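(* Let $c\in[1,23/22)$ and $h\in\mathcal{R}_c$. Let $(X,\mathcal{B},\mu)$ be a probability space and $T\colon X\to X$ a measure-preserving transformation. Then for every $f\in L^\infty_\mu(X)$, for $\mu$-a.e. $x\in X$ the limit $\lim_{N\to\infty}\frac1N\sum_{n=1}^N f(T^{\lfloor h(n)\rfloor^2}x)$ exists and \[ \lim_{N\to\infty}\frac{1}{N}\sum_{n=1}^N f(T^{\lfloor h(n)\rfloor^2}x)=\lim_{N\to\infty}\frac{1}{N}\sum_{n=1}^N f(T^{n^2}x). \]
   Context: Class $\mathcal{R}_c$ ($c$-regularly varying functions), for $c\in[1,2)$ and some $x_0\ge1$: the set of $h\in\mathcal{C}^3([x_0,\infty)\to[1,\infty))$ such that (i) $h'>0$ and $h''>0$; (ii) $h(x)=Cx^c\exp\big(\int_{x_0}^x\frac{\vartheta(t)}{t}dt\big)$ for a constant $C>0$ and some $\vartheta\in\mathcal{C}^3([x_0,\infty)\to\mathbb{R})$ with $\vartheta(x)\to0$, $x\vartheta'(x)\to0$, $x^2\vartheta''(x)\to0$, $x^3\vartheta'''(x)\to0$ as $x\to\infty$; (iii) if $c=1$, additionally $\vartheta$ is positive and decreasing, $\vartheta(x)^{-1}\lesssim_\varepsilon x^\varepsilon$ for every $\varepsilon>0$, $\lim_{x\to\infty}x/h(x)=0$, and $x\vartheta'(x)/\vartheta(x)\to0$, $x^2\vartheta''(x)/\vartheta(x)\to0$, $x^3\vartheta'''(x)/\vartheta(x)\to0$ as $x\to\infty$. For $x\in[1,x_0)$, $h(x)$ is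 given arbitrary values. The right-hand limit is known to exist $\mu$-a.e. (Bourgain). *)

(* Defs.v *)
From HB Require Import structures.
From mathcomp Require Import all_boot all_order all_algebra.
From mathcomp Require Import all_classical all_reals all_analysis.
Set Implicit Arguments. Unset Strict Implicit. Unset Printing Implicit Defensive.
Import Order.TTheory GRing.Theory Num.Theory.
Import numFieldNormedType.Exports.
Local Open Scope classical_set_scope.
Local Open Scope ring_scope.

Definition C3_from (R : realType) (a : R) (g : R -> R) : Prop :=
  {within `[a, +oo[, continuous g} /\
  forall x : R, a < x ->
    [/\ derivable g x 1, derivable (derive1n 1 g) x 1,
        derivable (derive1n 2 g) x 1 & {for x, continuous (derive1n 3 g)}].

Definition in_Rc (R : realType) (c : R) (h : R -> R) : Prop :=
  exists x0 : R, 1 <= x0 /\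
  exists C : R, 0 < C /\
  exists th : R -> R,
  [/\
    C3_from x0 h /\ (forall x, x0 <= x -> 1 <= h x),
    (forall x, x0 < x -> 0 < derive1n 1 h x /\ 0 < derive1n 2 h x),
    C3_from x0 th /\
    (forall x, x0 <= x ->
       h x = C * x `^ c * expR (Rintegral lebesgue_measure `[x0, x] (fun t => th t / t))) /\
    (th x @[x --> +oo] --> 0) /\
    ((x * derive1n 1 th x) @[x --> +oo] --> 0) /\
    ((x ^+ 2 * derive1n 2 th x) @[x --> +oo] --> 0) /\
    ((x ^+ 3 * derive1n 3 th x) @[x --> +oo] --> 0)
  &
    c = 1 ->
      (forall x, x0 <= x -> 0 < th x) /\
      (forall x y, x0 <= x -> x <= y -> th y <= th x) /\
      (forall eps : R, 0 < eps -> exists K : R, forall x, x0 <= x -> (th x)^-1 <= K * x `^ eps) /\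
      ((x / h x) @[x --> +oo] --> 0) /\
      ((x * derive1n 1 th x / th x) @[x --> +oo] --> 0) /\
      ((x ^+ 2 * derive1n 2 th x / th x) @[x --> +oo] --> 0) /\
      ((x ^+ 3 * derive1n 3 th x / th x) @[x --> +oo] --> 0)
  ].

Definition measure_preserving (d : measure_display) (X : measurableType d)
  (R : realType) (mu : set X -> \bar R) (T : X -> X) : Prop :=
  measurable_fun setT T /\
  forall A : set X, measurable A -> mu (T @^-1` A) = mu A.

Definition Linfty (d : measure_display) (X : measurableType d)
  (R : realType) (mu : {measure set X -> \bar R}) (f : X -> R) : Prop :=
  measurable_fun setT f /\ exists M : R, {ae mu, forall x, `|f x| <= M}.

Definition ergavg (X : Type) (R : realType) (f : X -> R) (T : X -> X)
  (a : nat -> nat) (x : X) (N : nat) : R :=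
  (N%:R)^-1 * \sum_(1 <= n < N.+1) f (iter (a n) T x).

Definition floor_sq (R : realType) (h : R -> R) (n : nat) : nat :=
  (`|Num.floor (h n%:R)| ^ 2)%N.

(* Main.v *)
(**
Averages along the squares are multipliers: [sum_i p_i T^i] acts on [L^2] with norm at most the supremum
of [|p|] on the unit circle, and the same holds for square functions (transference).

Pointwise convergence along [n^2] (Bourgain).  By Weyl's inequality the multiplier of the [N]-th average is
small off the rationals with small denominator.  Cut it with kernels concentrated at the rationals of
denominator [q <= 2^s]; the dyadic piece [2^s < q <= 2^(s+1)] has size [2^(-s/2)].  For [N = u 2^k] in a short
range of [k] its oscillation in [k] is controlled by the Rademacher-Menshov inequality, at the cost of a factor
polynomial in [s]; in the long range it is compared with ordinary ergodic averages of [T^Q], where [Q] clears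
all denominators [q <= 2^(s+1)], and the ergodic maximal inequality applies.  The pieces with bounded [s]
converge by Birkhoff's theorem, and convergence along all sequences [u 2^k] to a common limit gives
convergence of the full sequence.

Comparison with [floor (h n)].  Let [phi] be the inverse of [h] on a half-line.  The value [m] is taken
[ceil (phi (m+1)) - ceil (phi m)] times, that is [phi (m+1) - phi m] plus a difference of sawtooth values.  The
first weight is nonincreasing in [m], so by Abel summation it does not change the limit.  The second gives a
multiplier [N^-1 sum_m e(t m^2) (rho (phi (m+1)) - rho (phi m))]; a Fejer expansion of the sawtooth [rho], Weyl
differencing and van der Corput's second derivative test, applied with the third derivative of [phi],
bound it by [N^(22c/23 - 1)].  For [c < 23/22] this is summable in [L^2] along [N = u 2^s].
*)

Require Import Defs.
From HB Require Import structures.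
From mathcomp Require Import all_boot all_order all_algebra.
From mathcomp Require Import all_classical all_reals all_analysis.
From mathcomp Require Import measurable_realfun complex ring lra zify.
Import Order.TTheory GRing.Theory Num.Theory.
Import numFieldNormedType.Exports.
Local Open Scope classical_set_scope.
Local Open Scope ring_scope.

(** * Exponential sums and Weyl's inequality *)

Section ComplexExponential.
Context {R : realType}.
Implicit Types (z w : R[i]) (t s : R).

(** A piece of size [2^(-s/2)] leaves room only for losses polynomial in [s], and this fixes where
    the short range ends. A common multiple of the denominators up to [2^(s+1)] is roughly the
    factorial of [2^(s+1)], so its binary logarithm is below a constant times [4^s]. The short range
    thus holds [2^(O(s))] values of [k], and chaining over dyadic steps costs only powers of [s].
    The almost everywhere statements are read off from one weighted sum of square functions with
    finite expectation.

    The number [23/22] comes from writing the range of [m] as [w^46]. Weyl differencing removes the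
    quadratic phase, blocks of length [w^40] keep the phase increments within half a period, and the
    total saving is [w^2]. The sum is therefore [O((w^46)^(22/23))], at most a constant times
    [N^(22c/23)], and after division by [N] this is a negative power exactly when [c < 23/22]. For
    [c = 1] the third derivative of [phi] degenerates with [theta]; a lower bound losing [y^(-1/44)]
    survives, and the exponents are chosen so that this is enough. *)

Definition nm z : R := ComplexField.Normc.normc z.
Definition cexp t : R[i] := Complex (cos (2 * pi * t)) (sin (2 * pi * t)).

Lemma eq_imp_le (x y : R) : x = y -> x <= y.
Proof. by move=> ->. Qed.

Lemma nm_ge0 z : 0 <= nm z.
Proof. by case: z => a b; rewrite /nm /= sqrtr_ge0. Qed.

Lemma nmsqE z : nm z ^+ 2 = complex.Re z ^+ 2 + complex.Im z ^+ 2.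
Proof. by case: z => a b; rewrite /nm /= sqr_sqrtr // addr_ge0 ?sqr_ge0. Qed.

Lemma nm0 : nm 0 = 0. Proof. exact: ComplexField.Normc.normc0. Qed.
Lemma nm1 : nm 1 = 1. Proof. exact: ComplexField.Normc.normc1. Qed.
Lemma nmM z w : nm (z * w) = nm z * nm w.
Proof. exact: ComplexField.Normc.normcM. Qed.
Lemma nmD z w : nm (z + w) <= nm z + nm w. Proof. exact: le_normcD. Qed.
Lemma nmN z : nm (- z) = nm z. Proof. exact: normcN. Qed.
Lemma nmB z w : nm (z - w) <= nm z + nm w.
Proof. by rewrite -(nmN w) nmD. Qed.
Lemma nmBC z w : nm (z - w) = nm (w - z).
Proof. by rewrite -nmN opprB. Qed.
Lemma nmV z : nm z^-1 = (nm z)^-1. Proof. exact: ComplexField.Normc.normcV. Qed.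
Lemma nm_triangle z w u : nm (z - u) <= nm (z - w) + nm (w - u).
Proof. by apply: le_trans (nmD _ _); rewrite addrA subrK. Qed.

Lemma nm_sum (I : Type) (r : seq I) (P : pred I) (F : I -> R[i]) :
  nm (\sum_(i <- r | P i) F i) <= \sum_(i <- r | P i) nm (F i).
Proof.
elim/big_rec2: _ => [|i y x _ H]; first by rewrite nm0.
by apply: le_trans (nmD _ _) _; rewrite lerD2l.
Qed.

Lemma nmX z n : nm (z ^+ n) = nm z ^+ n.
Proof. by elim: n => [|n IH]; rewrite ?expr0 ?nm1 // !exprS nmM IH. Qed.

Lemma nm_real (a : R) : nm (real_complex R a) = `|a|.
Proof. by rewrite /nm /= expr0n /= addr0 sqrtr_sqr. Qed.

Lemma nm_conj z : nm (conjc z) = nm z.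
Proof. by case: z => a b; rewrite /nm /= sqrrN. Qed.

Lemma nm_Re z : `|complex.Re z| <= nm z.
Proof.
rewrite -(@ler_pXn2r _ 2) ?nnegrE ?nm_ge0 // nmsqE real_normK ?num_real //.
by rewrite lerDl sqr_ge0.
Qed.

Lemma mul_conj z : z * conjc z = real_complex R (nm z ^+ 2).
Proof.
rewrite nmsqE; case: z => a b; apply/eqP; rewrite eq_complex /=.
by apply/andP; split; apply/eqP; ring.
Qed.

Lemma nmD2 z w : nm (z + w) ^+ 2 <= 2 * nm z ^+ 2 + 2 * nm w ^+ 2.
Proof.
have := nmD z w; have := nm_ge0 (z + w); have := nm_ge0 z; have := nm_ge0 w.
move: (nm z) (nm w) (nm (z + w)) => a b c a0 b0 c0 h.
have := sqr_ge0 (a - b); nra.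
Qed.

Lemma cexpD t s : cexp (t + s) = cexp t * cexp s.
Proof.
rewrite /cexp mulrDr cosD sinD; apply/eqP; rewrite eq_complex /=.
by apply/andP; split; apply/eqP; ring.
Qed.

Lemma cexp0 : cexp 0 = 1.
Proof. by rewrite /cexp mulr0 cos0 sin0. Qed.

Lemma cexpN t : cexp (- t) = conjc (cexp t).
Proof. by rewrite /cexp mulrN cosN sinN. Qed.

Lemma nm_cexp t : nm (cexp t) = 1.
Proof. by rewrite /nm /= cos2Dsin2 sqrtr1. Qed.

Lemma cexp_nat n : cexp n%:R = 1.
Proof.
elim: n => [|n IH]; first exact: cexp0.
rewrite -natr1 cexpD IH mul1r /cexp mulr1.
rewrite -(addr0 (2 * pi)) (_ : 2 * pi = pi *+ 2); last by rewrite mulr_natl.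
by rewrite addr0 cos2pi sin2pi.
Qed.

Lemma cexp_int (n : int) : cexp n%:~R = 1.
Proof.
case: n => n; first exact: cexp_nat.
by rewrite NegzE mulrNz cexpN cexp_nat conjc1.
Qed.

Lemma cexpDn t n : cexp (t + n%:R) = cexp t.
Proof. by rewrite cexpD cexp_nat mulr1. Qed.

Lemma cexpX t n : cexp t ^+ n = cexp (t * n%:R).
Proof.
elim: n => [|n IH]; first by rewrite expr0 mulr0 cexp0.
by rewrite exprSr IH -cexpD -natr1 mulrDr mulr1.
Qed.

Lemma pi_le4 : pi <= 4 :> R.
Proof.
have /andP[_] := pihalf_02 R; lra.
Qed.

Lemma nm_1cexp_sin t : nm (1 - cexp t) = 2 * `|sin (pi * t)|.
Proof.
apply/eqP; rewrite -(@eqrXn2 _ 2) ?nm_ge0 ?mulr_ge0 //; apply/eqP.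
rewrite nmsqE exprMn real_normK ?num_real //=.
have -> : 2 * pi * t = pi * t + pi * t by ring.
rewrite cosD sinD.
have := cos2Dsin2 (pi * t); set c := cos _; set s := sin _ => h.
have -> : c * c = 1 - s * s by rewrite -h; ring.
have -> : (1 - (1 - s * s - s * s)) ^+ 2 + (0 - (s * c + c * s)) ^+ 2 =
  4 * s ^+ 2 * (c ^+ 2 + s ^+ 2) by ring.
by rewrite h; ring.
Qed.

Lemma norm_sin_le t : `|sin t| <= `|t|.
Proof.
wlog t0 : t / 0 <= t.
{ move=> H; case: (leP 0 t) => [|/ltW t0]; first exact: H.
  by rewrite -normrN -sinN -(normrN t) H // oppr_ge0. }
have [c _] := @MVT_segment _ sin cos 0 t t0 (fun x _ => is_derive_sin x)
  (continuous_subspaceT (@continuous_sin R)).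
rewrite sin0 !subr0 => ->; rewrite normrM ler_piMl //.
by rewrite ler_norml cos_geN1 cos_le1.
Qed.

Lemma nm_1cexp_le t : nm (1 - cexp t) <= 8 * `|t|.
Proof.
rewrite nm_1cexp_sin.
have := norm_sin_le (pi * t); rewrite normrM (ger0_norm (pi_ge0 R)).
have := pi_le4; have := normr_ge0 t; nra.
Qed.

Lemma nm_cexpB t s : nm (cexp t - cexp s) <= 8 * `|t - s|.
Proof.
have -> : cexp t - cexp s = - (cexp s * (1 - cexp (t - s))).
{ by rewrite mulrBr mulr1 -cexpD (addrC s) subrK opprB. }
by rewrite nmN nmM nm_cexp mul1r nm_1cexp_le.
Qed.

(** A crude Jordan inequality. While [cos t >= 1/3] the mean value theorem gives it, since the
    cosine decreases; afterwards [sin t >= 2/3], and [t <= 2]. *)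
Lemma sin_ge_third t : 0 <= t <= pi / 2 -> t / 3 <= sin t.
Proof.
move=> /andP[t0 t1]; have pi4 := pi_le4.
have s0 : 0 <= sin t by apply: sin_ge0_pi; rewrite t0 /=; lra.
have c0 : 0 <= cos t by apply: cos_ge0_pihalf; rewrite t1 andbT; lra.
case: (leP (1 / 3) (cos t)) => hc.
{ have [c /[!in_itv] /= /andP[c1 c2]] := @MVT_segment _ sin cos 0 t t0
    (fun x _ => is_derive_sin x) (continuous_subspaceT (@continuous_sin R)).
  rewrite sin0 !subr0 => ->.
  have : cos t <= cos c.
  { rewrite leNgt ltr_cos ?in_itv /= -?leNgt //; apply/andP; split; lra. }
  nra. }
have := cos2Dsin2 t; move: (cos t) (sin t) c0 s0 hc => c s c0 s0 hc h.
have : 2 / 3 <= s by rewrite leNgt; apply/negP => h'; nra.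
lra.
Qed.

Lemma nm_1cexp_ge t (delta : R) : (forall n : int, delta <= `|t - n%:~R|) ->
  delta <= nm (1 - cexp t).
Proof.
move=> H.
(* The nearest integer to [t], so that [u] lies in [[-1/2, 1/2]], where the sine has a linear lower
   bound. *)
pose n := Num.floor (t + 1 / 2).
have := floor_itv (t + 1 / 2); rewrite -/n => /andP[n1 n2].
have := H n; set u := t - n%:~R => Hu.
have hu : `|u| <= 1 / 2.
{ rewrite ler_norml /u; move: n2; rewrite intrD1 => n2; apply/andP; split; lra. }
have -> : cexp t = cexp u by rewrite /u cexpD -mulrNz cexp_int mulr1.
rewrite nm_1cexp_sin; apply: le_trans Hu _.
have Hs : `|sin (pi * u)| = sin (pi * `|u|).
{ have p0 := pi_ge0 R.
  have : 0 <= sin (pi * `|u|).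
  { apply: sin_ge0_pi; have := normr_ge0 u; nra. }
  case: (ger0P u) => hu0 hs; first by rewrite ger0_norm.
  by rewrite -normrN -sinN -mulrN ger0_norm. }
rewrite Hs; have p2 := pi_ge2 R; have u0 := normr_ge0 u.
have : (pi * `|u|) / 3 <= sin (pi * `|u|).
{ apply: sin_ge_third; apply/andP; split; nra. }
nra.
Qed.

Lemma geom_cexp t n : (1 - cexp t) * \sum_(0 <= i < n) cexp t ^+ i = 1 - cexp t ^+ n.
Proof.
elim: n => [|n IH]; first by rewrite big_geq // mulr0 expr0 subrr.
by rewrite big_nat_recr //= mulrDr IH mulrBl mul1r exprS; ring.
Qed.

Lemma nm_geom_le t (delta : R) n : 0 < delta ->
  (forall k : int, delta <= `|t - k%:~R|) ->
  nm (\sum_(0 <= i < n) cexp t ^+ i) <= 2 / delta.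
Proof.
move=> d0 H; have hd := nm_1cexp_ge t delta H.
have := congr1 nm (geom_cexp t n); rewrite nmM => h.
have : nm (1 - cexp t ^+ n) <= 2.
{ apply: le_trans (nmB _ _) _; rewrite nm1 nmX nm_cexp expr1n; lra. }
rewrite -h ler_pdivlMr // => h2; apply: le_trans h2.
by rewrite mulrC ler_wpM2r // nm_ge0.
Qed.

Lemma nm_geom_triv t n : nm (\sum_(0 <= i < n) cexp t ^+ i) <= n%:R.
Proof.
apply: le_trans (nm_sum _ _ _ _) _.
rewrite (eq_bigr (fun=> 1)) => [|i _]; last by rewrite nmX nm_cexp expr1n.
by rewrite big_const_nat subn0 iter_addr addr0.
Qed.

Lemma sum_diffs (V : zmodType) (F : nat -> nat -> V) N :
  \sum_(0 <= n < N) \sum_(0 <= k < n) F k n =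
  \sum_(1 <= r < N) \sum_(0 <= k < N - r) F k (k + r)%N.
Proof.
elim: N => [|N IH]; first by rewrite !big_geq.
case: N IH => [|N] IH; first by rewrite big_nat1 !big_geq.
rewrite big_nat_recr //= IH [in RHS]big_nat_recr //=.
rewrite subSnn big_nat1 add0n.
rewrite [X in _ + X = _]big_nat_recl //=.
rewrite [X in _ + X = _]addrC addrA; congr (_ + _).
have -> : \sum_(1 <= r < N.+1) \sum_(0 <= k < N.+2 - r) F k (k + r)%N =
  \sum_(1 <= r < N.+1) (\sum_(0 <= k < N.+1 - r) F k (k + r)%N + F (N.+1 - r)%N N.+1).
{ apply: eq_big_nat => r /andP[r1 r2]; rewrite subSn; last lia.
  by rewrite big_nat_recr //= subnK //; lia. }
rewrite big_split /=; congr (_ + _).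
rewrite big_add1 /= big_nat_rev /= add0n.
apply: eq_big_nat => i /andP[_ hi].
by congr (F _ _); lia.
Qed.

(** The off-diagonal terms come in conjugate pairs, so twice the real part of those with positive
    difference accounts for all of them. *)
Lemma nm_sum_sqr (z : nat -> R[i]) N :
  nm (\sum_(0 <= n < N) z n) ^+ 2 = \sum_(0 <= n < N) nm (z n) ^+ 2 +
  2 * complex.Re (\sum_(1 <= r < N) \sum_(0 <= k < N - r) z (k + r)%N * conjc (z k)).
Proof.
rewrite -(sum_diffs _ (fun k n => z n * conjc (z k))).
elim: N => [|N IH]; first by rewrite !big_geq // [nm _]nm0 /= mulr0 addr0 expr0n.
rewrite !big_nat_recr //=; set S := \sum_(0 <= n < N) z n in IH *.
set D := \sum_(0 <= n < N) \sum_(0 <= k < n) _ in IH *.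
have -> : \sum_(0 <= k < N) z N * conjc (z k) = z N * conjc S.
{ by rewrite -mulr_sumr /S raddf_sum. }
move: IH; rewrite !nmsqE.
move: S D (z N) => [a b] [c d'] [u v] /= IH.
have -> : (a + u) ^+ 2 + (b + v) ^+ 2 = (a ^+ 2 + b ^+ 2) + u ^+ 2 + v ^+ 2 + 2 * (u * a + v * b) by ring.
rewrite IH; ring.
Qed.

Lemma weyl_differencing (z : nat -> R[i]) N : (forall n, nm (z n) = 1) ->
  nm (\sum_(0 <= n < N) z n) ^+ 2 <=
  N%:R + 2 * \sum_(1 <= r < N) nm (\sum_(0 <= k < N - r) z (k + r)%N * conjc (z k)).
Proof.
move=> z1; rewrite nm_sum_sqr; apply: lerD.
{ rewrite (eq_bigr (fun=> 1)) => [|i _]; last by rewrite z1 expr1n.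
  by rewrite big_const_nat subn0 iter_addr addr0. }
rewrite ler_wpM2l //; apply: le_trans (nm_sum _ _ _ _).
exact: le_trans (ler_norm _) (nm_Re _).
Qed.

(** The symbol of the operator [pop T p]: on an eigenfunction of [T] with eigenvalue [e(t)] the
    operator is multiplication by this number. *)
Definition pev (p : {poly R}) t : R[i] := (map_poly (real_complex R) p).[cexp t].

Lemma pevD p q t : pev (p + q) t = pev p t + pev q t.
Proof. by rewrite /pev rmorphD hornerD. Qed.
Lemma pevN p t : pev (- p) t = - pev p t.
Proof. by rewrite /pev rmorphN hornerN. Qed.
Lemma pevB p q t : pev (p - q) t = pev p t - pev q t.
Proof. by rewrite pevD pevN. Qed.
Lemma pevM p q t : pev (p * q) t = pev p t * pev q t.
Proof. by rewrite /pev rmorphM hornerM. Qed.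
Lemma pevZ (a : R) p t : pev (a *: p) t = real_complex R a * pev p t.
Proof. by rewrite /pev map_polyZ hornerZ. Qed.
Lemma pevXn n t : pev 'X^n t = cexp (t * n%:R).
Proof. by rewrite /pev map_polyXn hornerXn cexpX. Qed.
Lemma pev1 t : pev 1 t = 1.
Proof. by rewrite /pev rmorph1 hornerE. Qed.
Lemma pev_sum (I : Type) (r : seq I) (P : pred I) (F : I -> {poly R}) t :
  pev (\sum_(i <- r | P i) F i) t = \sum_(i <- r | P i) pev (F i) t.
Proof. by rewrite /pev rmorph_sum horner_sum. Qed.

Lemma pevE (p : {poly R}) t n : (size p <= n)%N ->
  pev p t = \sum_(0 <= i < n) real_complex R p`_i * cexp (t * i%:R).
Proof.
move=> hn; rewrite -{1}(coefK p).
have -> : \poly_(i < size p) p`_i = \sum_(0 <= i < n) p`_i *: 'X^i.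
{ rewrite big_mkord -poly_def; apply/polyP => i; rewrite !coef_poly.
  case: ltnP => h1; case: ltnP => h2 //; first by lia.
  by rewrite nth_default. }
by rewrite pev_sum; apply: eq_bigr => i _; rewrite pevZ pevXn.
Qed.

End ComplexExponential.

(** * Weyl's inequality for the squares near a rational, and Dirichlet approximation *)

Section WeylSums.
Context {R : realType}.

Definition asq (N : nat) : {poly R} := (N%:R)^-1 *: \sum_(1 <= n < N.+1) 'X^(n ^ 2).

Lemma pev_asq N t : pev (asq N) t =
  real_complex R (N%:R)^-1 * \sum_(0 <= n < N) cexp (t * (n.+1 ^ 2)%:R).
Proof.
rewrite /asq pevZ pev_sum; congr (_ * _).
by rewrite big_add1 /=; apply: eq_bigr => i _; rewrite pevXn.
Qed.

Lemma sum_invsqrt n : \sum_(1 <= c < n.+1) (Num.sqrt c%:R)^-1 <= 2 * Num.sqrt n%:R :> R.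
Proof.
elim: n => [|n IH]; first by rewrite big_geq // sqrtr0 mulr0.
rewrite big_nat_recr //=; apply: le_trans (lerD IH (lexx _)) _.
have h1 : 0 < Num.sqrt n.+1%:R :> R by rewrite sqrtr_gt0 ltr0n.
have h0 : 0 <= Num.sqrt n%:R :> R by rewrite sqrtr_ge0.
have e1 : Num.sqrt n.+1%:R ^+ 2 = n.+1%:R :> R by rewrite sqr_sqrtr.
have e0 : Num.sqrt n%:R ^+ 2 = n%:R :> R by rewrite sqr_sqrtr.
have e2 : n.+1%:R = n%:R + 1 :> R by rewrite natr1.
rewrite -lerBrDl -(ler_pM2r h1) mulVf ?gt_eqF //.
move: e1 e0 e2 h1 h0; move: (Num.sqrt _) (Num.sqrt _) => u v *; nra.
Qed.

Lemma inv_le_invsqrt c : (c%:R)^-1 <= (Num.sqrt c%:R)^-1 :> R.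
Proof.
case: c => [|c]; first by rewrite sqrtr0.
rewrite lef_pV2 ?posrE ?sqrtr_gt0 ?ltr0n //.
have h1 : 0 < Num.sqrt c.+1%:R :> R by rewrite sqrtr_gt0 ltr0n.
have e1 : Num.sqrt c.+1%:R ^+ 2 = c.+1%:R :> R by rewrite sqr_sqrtr.
have e2 : 1 <= c.+1%:R :> R by rewrite ler1n.
rewrite leNgt; apply/negP => h; nra.
Qed.

(** A square root replaces the logarithm; every later use has a spare power to pay for it, and the
    bounds stay algebraic. *)
Lemma sum_inv_le n : \sum_(1 <= c < n.+1) (c%:R)^-1 <= 2 * Num.sqrt n%:R :> R.
Proof.
apply: le_trans (sum_invsqrt n); apply: ler_sum => i _; exact: inv_le_invsqrt.
Qed.

Lemma sum_nat_blocks (V : zmodType) (F : nat -> V) q n :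
  \sum_(0 <= i < q * n) F i = \sum_(0 <= t < n) \sum_(0 <= j < q) F (q * t + j)%N.
Proof.
elim: n => [|n IH]; first by rewrite muln0 !big_geq.
rewrite big_nat_recr //= -IH mulnS (addnC q).
rewrite (big_cat_nat _ (n := (q * n)%N)) //=; last by rewrite leq_addr.
congr (_ + _); rewrite -{1}(addn0 (q * n)%N) addnC big_addn addKn.
by apply: eq_bigr => i _; rewrite addnC.
Qed.

Lemma sum_perm_coprime (g : nat -> R) (a q : nat) : coprime a q ->
  \sum_(0 <= j < q) g ((j * a) %% q)%N = \sum_(0 <= j < q) g j.
Proof.
case: q => [|q] co; first by rewrite !big_geq.
rewrite !big_mkord.
pose f (j : 'I_q.+1) : 'I_q.+1 := inord ((j * a) %% q.+1)%N.
have vf j : f j = ((j * a) %% q.+1)%N :> nat by rewrite inordK // ltn_mod.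
have finj : injective f.
{ move=> i j /(congr1 val) /=; rewrite !vf => /eqP h; apply/val_inj => /=.
  have {h} : (i == j %[mod q.+1])%N.
  { wlog ij : i j h / (i <= j)%N.
    { move=> H; case: (leqP i j) => [/H|/ltnW ij]; first by apply.
      by rewrite eq_sym; apply: H => //; rewrite eq_sym. }
    rewrite eq_sym eqn_mod_dvd //; rewrite eq_sym eqn_mod_dvd ?leq_mul2r ?ij ?orbT // in h.
    by rewrite -mulnBl Gauss_dvdl // coprime_sym in h. }
  by rewrite !modn_small // => /eqP. }
rewrite [RHS](reindex_inj finj); apply: eq_bigr => j _; by rewrite vf.
Qed.

Lemma dist_frac (c q : nat) (k : int) : (0 < c < q)%N ->
  (minn c (q - c))%:R / q%:R <= `|c%:R / q%:R + k%:~R| :> R.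
Proof.
move=> /andP[c0 cq].
have q0 : 0 < q%:R :> R by rewrite ltr0n; lia.
have -> : `|c%:R / q%:R + k%:~R| = `|(c%:Z + k * q%:Z)%:~R| / q%:R :> R.
{ rewrite -{2}(ger0_norm (ltW q0)) -normf_div rmorphD rmorphM /= !pmulrn mulrDl mulfK // gt_eqF //. }
rewrite ler_pM2r ?invr_gt0 // -intr_norm pmulrn ler_int.
case: (leP 0 k) => hk; [|have : k <= -1 by lia]; nia.
Qed.

Lemma weyl_inner (alpha : R) N r : 
  nm (\sum_(0 <= k < N) cexp (alpha * ((k + r).+1 ^ 2)%:R) * conjc (cexp (alpha * (k.+1 ^ 2)%:R)))
  = nm (\sum_(0 <= k < N) cexp (alpha * (2 * r)%:R) ^+ k).
Proof.
have -> : \sum_(0 <= k < N) cexp (alpha * ((k + r).+1 ^ 2)%:R) * conjc (cexp (alpha * (k.+1 ^ 2)%:R))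
 = cexp (alpha * (r ^ 2 + 2 * r)%:R) * \sum_(0 <= k < N) cexp (alpha * (2 * r)%:R) ^+ k.
{ rewrite mulr_sumr; apply: eq_bigr => k _.
  rewrite -cexpN cexpX -!cexpD; congr cexp.
  rewrite -[(k + r).+1]addn1 -[k.+1]addn1 !(natrX, natrD, natrM); ring. }
by rewrite nmM nm_cexp mul1r.
Qed.

Section Bound.
Variables (N q a : nat) (beta : R).
Hypothesis (N0 : (0 < N)%N) (q0 : (0 < q)%N) (qN : (q <= 4 * N)%N) (co : coprime a q).
Hypothesis (hb : `|beta| <= (4 * q%:R * N%:R)^-1).
Let alpha : R := a%:R / q%:R + beta.

Let qr : 0 < q%:R :> R. Proof. by rewrite ltr0n. Qed.
Let Nr : 0 < N%:R :> R. Proof. by rewrite ltr0n. Qed.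

(** For [n < 2N] the perturbation [n beta] is at most [1/(2q)], half the least distance to the
    integers of a non-integral fraction with denominator [q]. So the residue of [na] modulo [q]
    decides the size; the reciprocals of [c] and [q - c] are added in place of taking the larger. *)
Lemma weyl_nonmult (n k : nat) : (n < 2 * N)%N -> ~~ (q %| n)%N ->
  nm (\sum_(0 <= i < k) cexp (alpha * n%:R) ^+ i) <=
  4 * q%:R * ((((n * a) %% q)%N%:R)^-1 + ((q - (n * a) %% q)%N%:R)^-1).
Proof.
move=> hn nd; set c := ((n * a) %% q)%N.
have cq : (0 < c < q)%N.
{ rewrite ltn_mod q0 andbT lt0n; apply: contra nd => h.
  by rewrite -(@Gauss_dvdl _ n a) ?(coprime_sym q) // /dvdn. }
have m0 : 0 < (minn c (q - c))%:R :> R by rewrite ltr0n; lia.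
have hd (l : int) : (minn c (q - c))%:R / (2 * q%:R) <= `|alpha * n%:R - l%:~R|.
{ have -> : alpha * n%:R - l%:~R = (c%:R / q%:R + (((n * a) %/ q)%N%:Z - l)%:~R) + beta * n%:R.
  { have := congr1 (fun x : nat => x%:R : R) (divn_eq (n * a) q); rewrite -/c /alpha.
    rewrite !natrD !natrM rmorphB /= -pmulrn => h.
    have -> : (a%:R / q%:R + beta) * n%:R = (n%:R * a%:R) / q%:R + beta * n%:R by ring.
    rewrite h mulrDl mulfK ?gt_eqF //; ring. }
  have := dist_frac c q (((n * a) %/ q)%N%:Z - l) cq.
  set X := c%:R / _ + _ => h1.
  have h2 : `|beta * n%:R| <= (2 * q%:R)^-1.
  { rewrite normrM normr_nat.
    have : n%:R <= 2 * N%:R :> R by rewrite -natrM ler_nat ltnW.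
    move=> h; apply: le_trans (ler_pM _ _ hb h) _ => //.
    apply: eq_imp_le; field.
    by rewrite !gt_eqF. }
  have h3 : (2 * q%:R)^-1 <= (minn c (q - c))%:R / (2 * q%:R) :> R.
  { rewrite -{1}(mul1r (2 * q%:R)^-1) ler_wpM2r ?invr_ge0 ?mulr_ge0 // ler1n; lia. }
  have h4 : (minn c (q - c))%:R / q%:R = (minn c (q - c))%:R / (2 * q%:R) + (minn c (q - c))%:R / (2 * q%:R) :> R.
  { by field; rewrite gt_eqF. }
  have := lerB_normD X (beta * n%:R); lra. }
have dp : 0 < (minn c (q - c))%:R / (2 * q%:R) :> R by rewrite divr_gt0 ?mulr_gt0.
apply: le_trans (nm_geom_le _ _ _ dp hd) _.
have -> : 2 / ((minn c (q - c))%:R / (2 * q%:R)) = 4 * q%:R * ((minn c (q - c))%:R)^-1 :> R.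
{ by field; rewrite !gt_eqF. }
rewrite ler_wpM2l ?mulr_ge0 //.
rewrite /minn; case: ifP => _; [rewrite lerDl | rewrite lerDr]; by rewrite invr_ge0.
Qed.

(** At multiples of [q] the fraction [a/q] contributes an integer and the phase is [beta q t], of
    modulus at most [1/2], so its distance to the integers is its own modulus. *)
Lemma weyl_mult (t k : nat) : (q * t < 2 * N)%N -> (0 < t)%N -> beta != 0 ->
  nm (\sum_(0 <= i < k) cexp (alpha * (q * t)%:R) ^+ i) <= 2 / (q%:R * t%:R * `|beta|).
Proof.
move=> ht t0 b0.
have tr : 0 < t%:R :> R by rewrite ltr0n.
have bp : 0 < `|beta| by rewrite normr_gt0.
apply: nm_geom_le; first by rewrite !mulr_gt0.
move=> l.
have -> : alpha * (q * t)%:R - l%:~R = ((t * a)%:Z - l)%:~R + beta * (q%:R * t%:R).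
{ rewrite /alpha rmorphB /= -pmulrn !natrM; field; by rewrite gt_eqF. }
set j := (t * a)%:Z - l.
have hq : `|beta * (q%:R * t%:R)| = q%:R * t%:R * `|beta|.
{ by rewrite normrM (ger0_norm (mulr_ge0 (ltW qr) (ltW tr))) mulrC. }
have hs : q%:R * t%:R * `|beta| <= 1 / 2.
{ have : q%:R * t%:R <= 2 * N%:R :> R by rewrite -!natrM ler_nat ltnW.
  move=> h; apply: le_trans (ler_pM _ _ h hb) _ => //.
  have q1 : 1 <= q%:R :> R by rewrite ler1n.
  have -> : 2 * N%:R * (4 * q%:R * N%:R)^-1 = (2 * q%:R)^-1 :> R by field; rewrite !gt_eqF.
  rewrite mul1r lef_pV2 ?posrE ?mulr_gt0 //; lra. }
case: (eqVneq j 0) => [->|j0]; first by rewrite add0r hq.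
have : 1 <= `|j%:~R| :> R.
{ by rewrite -intr_norm -[1]/(1%:~R) ler_int; move: j0; lia. }
have := lerB_normD (j%:~R) (beta * (q%:R * t%:R)); rewrite hq; lra.
Qed.

(** Frequencies prime to nothing in particular but not divisible by [q] run through complete residue
    systems, each costing [O(q^(3/2))] whatever [beta] is. The multiples of [q] are left to the
    parameter [Gm], so that the bounds with and without [beta] share one proof. *)
Lemma weyl_bound_gen (G : R) (Gm : nat -> R) : 
  (forall t, 0 <= Gm t) -> \sum_(1 <= t < ((2 * N) %/ q).+1) Gm t <= G ->
  (forall k t, (k <= N)%N -> (0 < t)%N -> (q * t < 2 * N)%N ->
     nm (\sum_(0 <= i < k) cexp (alpha * (q * t)%:R) ^+ i) <= Gm t) ->
  nm (pev (asq N) alpha) ^+ 2 <= 2 * G / N%:R ^+ 2 + 385 / Num.sqrt N%:R.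
Proof.
move=> Gm0 hG hGm.
rewrite pev_asq nmM nm_real exprMn real_normK ?num_real //.
have := @weyl_differencing R (fun n => cexp (alpha * (n.+1 ^ 2)%:R)) N (fun n => nm_cexp _).
set S := nm _ ^+ 2 => hS.
pose g c : R := if c == 0%N then 0 else 4 * q%:R * ((c%:R)^-1 + ((q - c)%:R)^-1).
have g0 c : 0 <= g c by rewrite /g; case: ifP => // _; rewrite !mulr_ge0 ?addr_ge0 ?invr_ge0.
(* The value 0 at [n = 0] matters: [Gm 0] is not covered by the bound on the sum of [Gm], and the
   frequencies [2r] are positive. *)
pose F n : R := (if (n %% q == 0)%N then (if (n %/ q == 0)%N then 0 else Gm (n %/ q)%N) else 0)
   + g ((n * a) %% q)%N.
have F0 n : 0 <= F n by rewrite /F addr_ge0 //; case: ifP => // _; case: ifP.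
pose M := ((2 * N) %/ q).+1.
have h1 : \sum_(1 <= r < N) nm (\sum_(0 <= k < N - r) cexp (alpha * ((k + r).+1 ^ 2)%:R) * conjc (cexp (alpha * (k.+1 ^ 2)%:R)))
  <= \sum_(1 <= r < N) F (2 * r)%N.
{ rewrite big_nat [X in _ <= X]big_nat; apply: ler_sum => r /andP[r1 rN].
  rewrite weyl_inner /F.
  have h2r : (2 * r < 2 * N)%N by lia.
  case: eqP => hd.
  { have e2 : (2 * r = q * (2 * r %/ q))%N by rewrite {1}(divn_eq (2 * r) q) hd addn0 mulnC.
    rewrite ifF; last by apply/eqP => h; rewrite h muln0 in e2; lia.
    rewrite -[X in X <= _]addr0; apply: lerD => //.
    rewrite {1}e2; apply: hGm; move: r1 rN e2 q0; clear; lia. }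
  rewrite add0r /g ifF; last first.
  { apply/eqP => /eqP h; apply: hd; apply/eqP.
    by rewrite -/(dvdn q (2 * r)) -(@Gauss_dvdl _ (2 * r) a) // coprime_sym. }
  apply: weyl_nonmult => //; by apply/negP => /eqP. }
(* Passing from the even numbers [2r] to all [n < 2N] only adds nonnegative terms. *)
have h2 : \sum_(1 <= r < N) F (2 * r)%N <= \sum_(0 <= n < 2 * N) F n.
{ rewrite sum_nat_blocks exchange_big /= big_nat_recl // -[X in X <= _]addr0; apply: lerD; last first.
  { by apply: sumr_ge0 => i _; apply: sumr_ge0. }
  rewrite [X in _ <= X](eq_bigr (fun r => F (2 * r)%N)); last by move=> i _; rewrite addn0.
  by rewrite [X in _ <= X]big_ltn // lerDr. }
have h3 : \sum_(0 <= n < 2 * N) F n <= \sum_(0 <= n < q * M) F n.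
{ rewrite [X in _ <= X](big_cat_nat _ (n := (2 * N)%N)) //=; last by rewrite /M; have := ltn_ceil (2 * N) q0; clear; lia.
  by rewrite lerDl sumr_ge0. }
have h4 : \sum_(0 <= n < q * M) F n <= G + M%:R * \sum_(0 <= j < q) g j.
{ rewrite sum_nat_blocks.
  have -> : \sum_(0 <= t < M) \sum_(0 <= j < q) F (q * t + j)%N =
    \sum_(0 <= t < M) ((if t == 0%N then 0 else Gm t) + \sum_(0 <= j < q) g j).
  { apply: eq_bigr => t _; rewrite big_split /=; congr (_ + _).
    { rewrite big_ltn // addn0 modnMr eqxx mulKn // big_nat big1 ?addr0 // => j /andP[j1 j2].
      by rewrite mulnC modnMDl modn_small // ifF //; move: j1; clear; lia. }
    rewrite -(sum_perm_coprime g a q co); apply: eq_bigr => j _.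
    by rewrite mulnDl -mulnA (mulnC q) modnMDl. }
  rewrite big_split /=; apply: lerD; last by rewrite sumr_const_nat subn0 mulr_natl.
  rewrite big_ltn //= add0r; apply: le_trans hG.
  by apply: eq_imp_le; apply: eq_big_nat => t /andP[t1 _]; rewrite ifF //; move: t1; clear; lia. }
have h5 : \sum_(0 <= j < q) g j <= 16 * q%:R * Num.sqrt q%:R.
{ rewrite big_ltn // /g /= add0r -/g.
  have -> : \sum_(1 <= i < q) g i = 4 * q%:R * (\sum_(1 <= i < q) (i%:R)^-1 + \sum_(1 <= i < q) (i%:R)^-1).
  { rewrite [X in _ + X]big_nat_rev /= -big_split /= mulr_sumr big_nat [RHS]big_nat.
    apply: eq_bigr => i /andP[i1 i2]; rewrite /g ifF; last by apply/eqP => h; rewrite h in i1.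
    congr (_ * (_ + _)); congr ((_%:R)^-1); lia. }
  have hh : \sum_(1 <= i < q) (i%:R)^-1 <= 2 * Num.sqrt q%:R :> R.
  { apply: le_trans (sum_inv_le q); rewrite [X in _ <= X]big_nat_recr // lerDl invr_ge0 //. }
  have -> : 16 * q%:R * Num.sqrt q%:R = 4 * q%:R * (2 * Num.sqrt q%:R + 2 * Num.sqrt q%:R) :> R by ring.
  by rewrite ler_wpM2l ?mulr_ge0 // lerD. }
set rN := Num.sqrt N%:R.
have rN0 : 0 < rN by rewrite sqrtr_gt0.
have rN2 : rN ^+ 2 = N%:R by rewrite sqr_sqrtr.
have h6 : Num.sqrt q%:R <= 2 * rN.
{ rewrite -(@ler_pXn2r _ 2) ?nnegrE ?mulr_ge0 ?sqrtr_ge0 // exprMn rN2 sqr_sqrtr //.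
  by rewrite -natrX -natrM ler_nat. }
have h7 : M%:R * q%:R <= 6 * N%:R :> R.
{ rewrite -!natrM ler_nat /M mulSn; move: (leq_trunc_div (2 * N) q) qN; clear; lia. }
have h8 : S <= N%:R + 2 * G + 384 * (N%:R * rN).
{ have h9 : M%:R * \sum_(0 <= j < q) g j <= 192 * (N%:R * rN).
  { apply: le_trans (ler_wpM2l _ h5) _ => //.
    have -> : M%:R * (16 * q%:R * Num.sqrt q%:R) = 16 * ((M%:R * q%:R) * Num.sqrt q%:R) :> R by ring.
    have -> : 192 * (N%:R * rN) = 16 * ((6 * N%:R) * (2 * rN)) by ring.
    rewrite ler_wpM2l // ler_pM ?mulr_ge0 ?sqrtr_ge0 //. }
  clear - hS h1 h2 h3 h4 h9; lra. }
have rN1 : 1 <= rN.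
{ rewrite leNgt; apply/negP => h; have : (1 : R) <= N%:R by rewrite ler1n. rewrite -rN2; nra. }
rewrite exprVn mulrC ler_pdivrMr ?exprn_gt0 //.
have -> : (2 * G / N%:R ^+ 2 + 385 / rN) * N%:R ^+ 2 = 2 * G + 385 * (N%:R * rN).
{ rewrite -rN2; field; by rewrite gt_eqF. }
have : N%:R <= N%:R * rN by rewrite ler_peMr // ltW.
lra.
Qed.

Lemma weyl_bound1 : nm (pev (asq N) alpha) ^+ 2 <= 4 / q%:R + 385 / Num.sqrt N%:R.
Proof.
apply: le_trans (weyl_bound_gen (2 * N%:R ^+ 2 / q%:R) (fun=> N%:R) _ _ _) _.
{ by []. }
{ rewrite sumr_const_nat subSS subn0 -[X in X <= _]mulr_natr.
  rewrite mulrC expr2 mulrA [X in _ <= X]mulrAC ler_wpM2r //.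
  by rewrite ler_pdivlMr // -!natrM ler_nat leq_trunc_div. }
{ move=> k t hk _ _; apply: le_trans (nm_geom_triv _ _) _; by rewrite ler_nat. }
rewrite lerD2r le_eqVlt; apply/orP; left; apply/eqP; field; by rewrite !gt_eqF.
Qed.

(** On the multiples [q t] the geometric mean of the trivial bound [N] and of [2/(q t |beta|)] is
    used: it decays like [t^(-1/2)], whose sum is again a square root. *)
Lemma weyl_bound2 : beta != 0 ->
  nm (pev (asq N) alpha) ^+ 2 <= 8 / (q%:R * (N%:R * Num.sqrt `|beta|)) + 385 / Num.sqrt N%:R.
Proof.
move=> b0; have bp : 0 < `|beta| by rewrite normr_gt0.
set sb := Num.sqrt `|beta|.
have sb0 : 0 < sb by rewrite sqrtr_gt0.
have sb2 : sb ^+ 2 = `|beta| by rewrite sqr_sqrtr ?ltW.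
pose K : R := Num.sqrt (2 * N%:R / q%:R) / sb.
have K0 : 0 <= K by rewrite divr_ge0 ?sqrtr_ge0.
apply: le_trans (weyl_bound_gen (4 * N%:R / (q%:R * sb)) (fun t => K * (Num.sqrt t%:R)^-1) _ _ _) _.
{ by move=> t; rewrite mulr_ge0 ?invr_ge0 ?sqrtr_ge0. }
{ rewrite -mulr_sumr; apply: le_trans (ler_wpM2l K0 (sum_invsqrt _)) _.
  have hs : Num.sqrt ((2 * N) %/ q)%:R <= Num.sqrt (2 * N%:R / q%:R) :> R.
  { rewrite ler_wsqrtr // ler_pdivlMr // -!natrM ler_nat leq_trunc_div //. }
  apply: (@le_trans _ _ (K * (2 * Num.sqrt (2 * N%:R / q%:R)))).
  { by rewrite ler_wpM2l // ler_wpM2l. }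
  have e : Num.sqrt (2 * N%:R / q%:R) ^+ 2 = 2 * N%:R / q%:R :> R by rewrite sqr_sqrtr // divr_ge0 ?mulr_ge0.
  rewrite /K.
  have -> : Num.sqrt (2 * N%:R / q%:R) / sb * (2 * Num.sqrt (2 * N%:R / q%:R)) =
     2 * Num.sqrt (2 * N%:R / q%:R) ^+ 2 / sb by ring.
  rewrite e le_eqVlt; apply/orP; left; apply/eqP; field; by rewrite !gt_eqF. }
{ move=> k t hk t0 ht.
  have h1 := weyl_mult t k ht t0 b0.
  have h2 : nm (\sum_(0 <= i < k) cexp (alpha * (q * t)%:R) ^+ i) <= N%:R.
  { apply: le_trans (nm_geom_triv _ _) _; by rewrite ler_nat. }
  have tr : 0 < t%:R :> R by rewrite ltr0n.
  rewrite -(@ler_pXn2r _ 2) ?nnegrE ?mulr_ge0 ?invr_ge0 ?sqrtr_ge0 ?nm_ge0 //.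
  rewrite expr2; apply: le_trans (ler_pM (nm_ge0 _) (nm_ge0 _) h1 h2) _.
  rewrite !exprMn !exprVn sb2 !sqr_sqrtr ?divr_ge0 ?mulr_ge0 ?ler0n //.
  apply: eq_imp_le; field; by rewrite !gt_eqF. }
rewrite lerD2r le_eqVlt; apply/orP; left; apply/eqP; field; by rewrite !gt_eqF.
Qed.

End Bound.

(** Pigeonhole on the fractional parts of [alpha i] gives [b/q]; reducing the fraction only lowers
    the denominator, which weakens the bound to be proved. *)
Lemma dirichlet_coprime (alpha : R) (n : nat) : 0 <= alpha -> (0 < n)%N ->
  exists a q : nat, [/\ (0 < q <= n)%N, coprime a q & `|alpha - a%:R / q%:R| <= (q%:R * n%:R)^-1].
Proof.
move=> al0 n0.
have nr : 0 < n%:R :> R by rewrite ltr0n.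
pose fl (i : nat) := Num.truncn (alpha * i%:R).
have flP i : (fl i)%:R <= alpha * i%:R < (fl i).+1%:R.
{ by apply: truncn_itv; rewrite mulr_ge0. }
pose g (i : nat) := Num.truncn (n%:R * (alpha * i%:R - (fl i)%:R)).
have gP i : (g i)%:R <= n%:R * (alpha * i%:R - (fl i)%:R) < (g i).+1%:R.
{ by apply: truncn_itv; have /andP[h _] := flP i; rewrite mulr_ge0 // subr_ge0. }
have gn i : (g i < n)%N.
{ have /andP[h _] := gP i; have /andP[_ h2] := flP i.
  rewrite -(ltr_nat R); apply: le_lt_trans h _.
  rewrite -natr1 in h2; nra. }
have [i [j [ij jn eg]]] : exists i j, [/\ (i < j)%N, (j <= n)%N & g i = g j].
{ have : ~ injective (fun i : 'I_n.+1 => Ordinal (gn i)).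
  { by move=> /leq_card; rewrite !card_ord ltnn. }
  move=> nI; apply: contrapT => H; apply: nI => i j /(congr1 val) /= e; apply/val_inj.
  case: (ltngtP i j) => // h; case: H; [exists i, j | exists j, i]; split => //;
    by rewrite -ltnS ltn_ord. }
pose q := (j - i)%N.
have q0 : (0 < q)%N by rewrite /q; lia.
have fij : (fl i <= fl j)%N.
{ rewrite /fl; apply: le_truncn; rewrite ler_wpM2l // ler_nat ltnW //. }
pose b := (fl j - fl i)%N.
have hq : `|alpha * q%:R - b%:R| <= n%:R^-1.
{ rewrite /q /b !natrB //; last exact: ltnW.
  have /andP[h1 h2] := gP i; have /andP[h3 h4] := gP j; rewrite eg in h1 h2.
  rewrite -natr1 in h2 h4; rewrite ler_norml.
  have -> : n%:R^-1 = 1 / n%:R :> R by rewrite mul1r.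
  rewrite lerNl ler_pdivlMr // ler_pdivlMr //; apply/andP; split; clear - h3 h1 h2 h4; lra. }
have gc0 : (0 < gcdn b q)%N by rewrite gcdn_gt0 q0 orbT.
have eb : b = (b %/ gcdn b q * gcdn b q)%N by rewrite divnK ?dvdn_gcdl.
have eq1 : q = (q %/ gcdn b q * gcdn b q)%N by rewrite divnK ?dvdn_gcdr.
have qg0 : (0 < q %/ gcdn b q)%N by rewrite divn_gt0 // dvdn_leq // dvdn_gcdr.
have qgq : (q %/ gcdn b q <= q)%N by rewrite leq_div.
exists (b %/ gcdn b q)%N, (q %/ gcdn b q)%N; split.
{ by rewrite qg0 /=; apply: leq_trans qgq _; rewrite /q; lia. }
{ rewrite /coprime -(@eqn_pmul2r (gcdn b q)) // mul1n muln_gcdl -eb -eq1 //. }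
have e : (b %/ gcdn b q)%:R / (q %/ gcdn b q)%:R = b%:R / q%:R :> R.
{ have eb' : b%:R = (b %/ gcdn b q)%:R * (gcdn b q)%:R :> R by rewrite -natrM -eb.
  have eq' : q%:R = (q %/ gcdn b q)%:R * (gcdn b q)%:R :> R by rewrite -natrM -eq1.
  by rewrite eb' eq' -mulf_div divff ?mulr1 // pnatr_eq0 -lt0n. }
have qr : 0 < q%:R :> R by rewrite ltr0n.
have qgr : 0 < (q %/ gcdn b q)%:R :> R by rewrite ltr0n.
rewrite e.
have -> : alpha - b%:R / q%:R = (alpha * q%:R - b%:R) / q%:R by field; rewrite gt_eqF.
rewrite normrM normfV normr_nat; apply: le_trans (ler_wpM2r _ hq) _; first by rewrite invr_ge0.
rewrite -invfM lef_pV2 ?posrE ?mulr_gt0 // [leLHS]mulrC ler_pM2l // ler_nat //.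
Qed.

End WeylSums.

(** * Multipliers of the square averages *)

Section Multipliers.
Context {R : realType}.

(** The normalised geometric kernel: equal to 1 at the integers and [O(1/(H delta))] at distance
    [delta] from them. *)
Definition kap (H : nat) (t : R) : R[i] :=
  real_complex R (H%:R)^-1 * \sum_(0 <= h < H) cexp t ^+ h.

Lemma kap_le1 H t : nm (kap H t) <= 1.
Proof.
rewrite nmM nm_real normfV normr_nat.
case: H => [|H]; first by rewrite invr0 mul0r.
by rewrite ler_pdivrMl ?ltr0n // mulr1 nm_geom_triv.
Qed.

Lemma kap_far H t (delta : R) : (0 < H)%N -> 0 < delta ->
  (forall k : int, delta <= `|t - k%:~R|) -> nm (kap H t) <= 2 / (H%:R * delta).
Proof.
move=> H0 d0 hd; rewrite nmM nm_real normfV normr_nat.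
have Hr : 0 < H%:R :> R by rewrite ltr0n.
apply: le_trans (ler_wpM2l _ (nm_geom_le _ _ H d0 hd)) _; first by rewrite invr_ge0.
by apply: eq_imp_le; field; rewrite !gt_eqF.
Qed.

Lemma kapDn H t n : kap H (t + n%:R) = kap H t.
Proof. by rewrite /kap cexpDn. Qed.

Lemma kap_lip H t s : (0 < H)%N -> nm (kap H t - kap H s) <= 8 * H%:R * `|t - s|.
Proof.
move=> H0; have Hr : 0 < H%:R :> R by rewrite ltr0n.
rewrite /kap -mulrBr -sumrB nmM nm_real normfV normr_nat ler_pdivrMl //.
apply: le_trans (nm_sum _ _ _ _) _.
apply: (@le_trans _ _ (\sum_(0 <= h < H) 8 * H%:R * `|t - s|)); last first.
{ by rewrite sumr_const_nat subn0 -[leLHS]mulr_natl. }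
rewrite big_nat [leRHS]big_nat; apply: ler_sum => h /andP[_ hh].
rewrite !cexpX; apply: le_trans (nm_cexpB _ _) _.
rewrite -mulrBl normrM normr_nat -mulrA ler_wpM2l // mulrC ler_wpM2r //.
by rewrite ler_nat ltnW.
Qed.

Lemma kap0 H : (0 < H)%N -> kap H 0 = 1.
Proof.
move=> H0; rewrite /kap cexp0 (eq_bigr (fun=> 1)); last by move=> i _; rewrite expr1n.
rewrite sumr_const_nat subn0 -[X in _ * X](rmorph_nat (real_complex R)) -rmorphM /=.
by rewrite mulVf ?pnatr_eq0 -?lt0n // rmorph1.
Qed.

Lemma kap_near H t : (0 < H)%N -> nm (1 - kap H t) <= 8 * H%:R * `|t|.
Proof. by move=> H0; rewrite -(kap0 H H0) nmBC -{2}(subr0 t) kap_lip. Qed.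

Lemma kap_root H t : cexp t ^+ H = 1 -> cexp t != 1 -> kap H t = 0.
Proof.
move=> h1 h2; have := geom_cexp t H; rewrite h1 subrr => /eqP.
rewrite mulf_eq0 subr_eq0 eq_sym (negbTE h2) /= => /eqP h.
by rewrite /kap h mulr0.
Qed.

(* Sum of the kernels [kap H] translated to the reduced fractions of denominator at most [D]; pairing [a/q] with
   [-a/q] turns the characters into cosines, so that the polynomial has real coefficients. *)
Definition upoly (D H : nat) : {poly R} :=
  \sum_(1 <= q < D.+1) \sum_(0 <= a < q | coprime a q)
     (H%:R)^-1 *: \sum_(0 <= h < H) cos (2 * pi * (a%:R / q%:R * h%:R)) *: 'X^h.

Lemma real_cos t : real_complex R (cos (2 * pi * t)) = (cexp t + cexp (- t)) / 2.
Proof.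
apply: (@mulIf _ 2); first by rewrite pnatr_eq0.
rewrite mulfVK ?pnatr_eq0 // cexpN /cexp.
rewrite -(rmorph_nat (real_complex R) 2) -rmorphM /=.
by apply/eqP; rewrite eq_complex /=; apply/andP; split; apply/eqP; ring.
Qed.

Lemma pev_upoly D H t : pev (upoly D H) t =
  \sum_(1 <= q < D.+1) \sum_(0 <= a < q | coprime a q) kap H (t - a%:R / q%:R).
Proof.
rewrite /upoly pev_sum; apply: eq_big_nat => q /andP[q1 _].
have qr : q%:R != 0 :> R by rewrite pnatr_eq0 -lt0n.
rewrite pev_sum.
have -> : \sum_(0 <= a < q | coprime a q) pev ((H%:R)^-1 *: \sum_(0 <= h < H) cos (2 * pi * (a%:R / q%:R * h%:R)) *: 'X^h) t
  = (\sum_(0 <= a < q | coprime a q) kap H (t + a%:R / q%:R) + \sum_(0 <= a < q | coprime a q) kap H (t - a%:R / q%:R)) / 2.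
{ rewrite -big_split mulr_suml /=; apply: eq_bigr => a _.
  rewrite pevZ pev_sum /kap -mulrDr -mulrA; congr (_ * _).
  rewrite -big_split /= mulr_suml; apply: eq_bigr => h _.
  rewrite pevZ pevXn real_cos !cexpX !mulrDl mulNr !cexpD; ring. }
have -> : \sum_(0 <= a < q | coprime a q) kap H (t + a%:R / q%:R) = \sum_(0 <= a < q | coprime a q) kap H (t - a%:R / q%:R).
{ rewrite !(big_mkcond (fun a => coprime a q)) /= !(big_ltn q1) mul0r addr0 subr0; congr (_ + _).
  rewrite big_nat_rev /=; apply: eq_big_nat => a /andP[a1 aq].
  have -> : (1 + q - a.+1 = q - a)%N by lia.
  have -> : coprime (q - a) q = coprime a q.
  { have [b qb] : exists b, q = (b + a)%N by exists (q - a)%N; rewrite subnK // ltnW.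
    by rewrite qb addnK /coprime gcdnDl gcdnDr gcdnC. }
  case: ifP => // _; rewrite natrB ?(ltnW aq) // mulrBl divff //.
  by rewrite -[RHS](kapDn _ _ 1); congr (kap _ _); ring. }
by rewrite -mulr2n -[X in X / _]mulr_natr mulfK ?pnatr_eq0.
Qed.

Lemma eq_reduced (a q a' q' : nat) (k : int) : (0 < q)%N -> (0 < q')%N ->
  coprime a q -> coprime a' q' ->
  a%:R / q%:R - a'%:R / q'%:R = k%:~R :> R -> q' = q /\ (a' %% q = a %% q)%N.
Proof.
move=> q0 q0' co co' h.
have qr : q%:R != 0 :> R by rewrite pnatr_eq0 -lt0n.
have qr' : q'%:R != 0 :> R by rewrite pnatr_eq0 -lt0n.
have {h} h : a%:Z * q'%:Z = (a'%:Z + k * q'%:Z) * q%:Z.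
{ apply/eqP; rewrite -(eqr_int R) !(rmorphM, rmorphD) /= -!pmulrn -h; apply/eqP; field.
  by rewrite qr qr'. }
have d1 : (q %| q')%N.
{ rewrite -(@Gauss_dvdr _ a) // 1?coprime_sym //.
  have : (q%:Z %| a%:Z * q'%:Z)%Z by rewrite h dvdz_mull.
  by rewrite dvdzE abszM. }
have d2 : (q' %| q)%N.
{ rewrite -(@Gauss_dvdr _ a') // 1?coprime_sym //.
  have : (q'%:Z %| a'%:Z * q%:Z)%Z.
  { have -> : a'%:Z * q%:Z = (a%:Z - k * q%:Z) * q'%:Z by rewrite mulrBl h; ring.
    by rewrite dvdz_mull. }
  by rewrite dvdzE abszM. }
have e : q' = q by apply/eqP; rewrite eqn_dvd d1 d2.
split => //; subst q'.
have {}h : a%:Z = a'%:Z + k * q%:Z.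
{ apply: (@mulIf _ q%:Z) => //; by rewrite eqz_nat -lt0n. }
by apply/eqP; rewrite -eqz_nat -!modz_nat h addrC modzMDl.
Qed.

(** Fractions with denominators [q] and [q' <= D] that differ modulo 1 are at least [1/(qD)] apart,
    and [beta] uses up at most half of this. *)
Lemma far_reduced (a q a' q' : nat) (beta : R) (D : nat) (k : int) :
  (0 < q)%N -> (0 < q' <= D)%N ->
  coprime a q -> coprime a' q' -> ~~ ((q' == q) && (a' %% q == a %% q)%N) ->
  `|beta| <= (2 * q%:R * D%:R)^-1 ->
  (2 * q%:R * D%:R)^-1 <= `|a%:R / q%:R + beta - a'%:R / q'%:R - k%:~R| :> R.
Proof.
move=> q0 /andP[q0' qD] co co' ne hb.
have qr : 0 < q%:R :> R by rewrite ltr0n.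
have qr' : 0 < q'%:R :> R by rewrite ltr0n.
have Dr : 0 < D%:R :> R by rewrite ltr0n; lia.
set X := a%:R / q%:R - a'%:R / q'%:R - k%:~R : R.
have X0 : X != 0.
{ apply/eqP => /eqP; rewrite /X subr_eq0 => /eqP h.
  have [e1 e2] := eq_reduced _ _ _ _ _ q0 q0' co co' h.
  by move: ne; rewrite e1 e2 !eqxx. }
have hX : (q%:R * D%:R)^-1 <= `|X|.
{ have eX : X = (a%:Z * q'%:Z - a'%:Z * q%:Z - k * (q%:Z * q'%:Z))%:~R / (q%:R * q'%:R).
  { rewrite /X !(rmorphB, rmorphM) /= -!pmulrn; field; by rewrite !gt_eqF. }
  move: X0; rewrite eX; set n : int := _ - _ - _ => X0.
  have n0 : n != 0 by apply/eqP => n0; move: X0; rewrite n0 mul0r eqxx.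
  rewrite normrM normfV (ger0_norm (mulr_ge0 (ltW qr) (ltW qr'))).
  apply: (@le_trans _ _ (q%:R * q'%:R)^-1).
  { by rewrite lef_pV2 ?posrE ?mulr_gt0 // ler_pM2l // ler_nat. }
  rewrite -{1}(mul1r (_^-1)) ler_wpM2r ?invr_ge0 ?mulr_ge0 //.
  by rewrite -intr_norm -[1]/(1%:~R) ler_int; move: n0; lia. }
have -> : a%:R / q%:R + beta - a'%:R / q'%:R - k%:~R = X + beta by rewrite /X; ring.
have e : (q%:R * D%:R)^-1 = (2 * q%:R * D%:R)^-1 + (2 * q%:R * D%:R)^-1 :> R.
{ by field; rewrite !gt_eqF. }
have := lerB_normD X beta; lra.
Qed.

Lemma sum_indicator (a q D : nat) (z : R[i]) : (0 < q)%N -> coprime a q ->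
  \sum_(1 <= q' < D.+1) \sum_(0 <= a' < q' | coprime a' q')
    (if (q' == q) && (a' %% q == a %% q)%N then z else 0) = if (q <= D)%N then z else 0.
Proof.
move=> q0 co.
rewrite (eq_big_nat _ _ (F2 := fun q' => if q' == q then z else 0)); last first.
{ move=> q' /andP[q1 _]; case: eqP => [->|_] /=; last by rewrite big1.
  rewrite big_mkcond /= (eq_big_nat _ _ (F2 := fun a' => if a' == (a %% q)%N then z else 0)).
  { by rewrite -big_mkcond /= big_nat1_eq /= ltn_mod q0. }
  move=> a' /andP[_ ha]; rewrite (modn_small ha); case: eqP => [->|_]; last by rewrite if_same.
  by rewrite coprime_modl co. }
by rewrite -big_mkcond /= big_nat1_eq ltnS q0.
Qed.

Lemma upoly_diff D H (a q : nat) (beta : R) : (0 < q)%N -> coprime a q ->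
  pev (upoly D H) (a%:R / q%:R + beta) - (if (q <= D)%N then kap H beta else 0) =
  \sum_(1 <= q' < D.+1) \sum_(0 <= a' < q' | coprime a' q')
    (if (q' == q) && (a' %% q == a %% q)%N then 0 else kap H (a%:R / q%:R + beta - a'%:R / q'%:R)).
Proof.
move=> q0 co; rewrite -(sum_indicator a q D _ q0 co) pev_upoly -sumrB.
apply: eq_bigr => q' _; rewrite -sumrB; apply: eq_bigr => a' _.
case: ifP => [/andP[/eqP -> /eqP h]|_]; last by rewrite subr0.
apply/eqP; rewrite subr_eq0; apply/eqP.
have qr : q%:R != 0 :> R by rewrite pnatr_eq0 -lt0n.
rewrite -[LHS](kapDn _ _ (a' %/ q)%N) -[RHS](kapDn _ _ (a %/ q)%N); congr (kap _ _).
rewrite {1}(divn_eq a q) {1}(divn_eq a' q) h !natrD !natrM; field; exact: qr.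
Qed.

Lemma card_coprime_pairs (D : nat) (x : R) (F : nat -> nat -> R) : 0 <= x ->
  (forall q a, (0 < q <= D)%N -> coprime a q -> F q a <= x) ->
  \sum_(1 <= q' < D.+1) \sum_(0 <= a' < q' | coprime a' q') F q' a' <= D%:R ^+ 2 * x.
Proof.
move=> x0 hF.
apply: (@le_trans _ _ (\sum_(1 <= q' < D.+1) D%:R * x)).
{ rewrite big_nat [leRHS]big_nat; apply: ler_sum => q' /andP[q1 q2].
  apply: (@le_trans _ _ (\sum_(0 <= a' < q' | coprime a' q') x)).
  { by apply: ler_sum => a' co; apply: hF => //; rewrite q1. }
  rewrite big_mkcond /=; apply: (@le_trans _ _ (\sum_(0 <= a' < q') x)).
  { by apply: ler_sum => i _; case: ifP. }
  by rewrite sumr_const_nat subn0 -[leLHS]mulr_natl ler_wpM2r // ler_nat. }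
by rewrite sumr_const_nat subSS subn0 -[leLHS]mulr_natl mulrA expr2.
Qed.

(** At most [D^2] kernels are centred elsewhere and each is small by [kap_far]; only the kernel at
    [a/q], if there is one, survives. *)
Lemma upoly_near D H (a q : nat) (beta : R) : (0 < q)%N -> (0 < D)%N -> (0 < H)%N -> coprime a q ->
  `|beta| <= (2 * q%:R * D%:R)^-1 ->
  nm (pev (upoly D H) (a%:R / q%:R + beta) - (if (q <= D)%N then kap H beta else 0)) <=
  4 * q%:R * D%:R ^+ 3 / H%:R.
Proof.
move=> q0 D0 H0 co hb.
have qr : 0 < q%:R :> R by rewrite ltr0n.
have Dr : 0 < D%:R :> R by rewrite ltr0n.
have Hr : 0 < H%:R :> R by rewrite ltr0n.
rewrite upoly_diff //; apply: le_trans (nm_sum _ _ _ _) _.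
apply: (@le_trans _ _ (\sum_(1 <= q' < D.+1) \sum_(0 <= a' < q' | coprime a' q')
   nm (if (q' == q) && (a' %% q == a %% q)%N then 0 else kap H (a%:R / q%:R + beta - a'%:R / q'%:R)))).
{ by apply: ler_sum => q' _; exact: nm_sum. }
have -> : 4 * q%:R * D%:R ^+ 3 / H%:R = D%:R ^+ 2 * (4 * q%:R * D%:R / H%:R) :> R by ring.
apply: card_coprime_pairs => [|q' a' hq' co'].
{ by rewrite divr_ge0 ?mulr_ge0. }
case: ifP => [_|ne]; first by rewrite nm0 divr_ge0 ?mulr_ge0.
apply: le_trans (kap_far _ _ (2 * q%:R * D%:R)^-1 H0 _ _) _.
{ by rewrite invr_gt0 !mulr_gt0. }
{ by move=> k; apply: far_reduced => //; rewrite ne. }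
by apply: eq_imp_le; field; rewrite !gt_eqF.
Qed.

(** When every denominator divides [H], the kernel centred at [a'/q'] vanishes at every other [a/q]:
    it is a complete sum over a nontrivial [H]-th root of unity. *)
Lemma upoly_exact D H (a q Q : nat) : (0 < q)%N -> coprime a q -> (0 < H)%N ->
  (q %| H)%N -> (forall q', (0 < q' <= D)%N -> (q' %| H)%N) ->
  pev (upoly D H) (a%:R / q%:R) = if (q <= D)%N then 1 else 0.
Proof.
move=> q0 co H0 dq dD.
have := @upoly_diff D H a q 0 q0 co; rewrite addr0 kap0 // => h.
apply/eqP; rewrite -subr_eq0 h; apply/eqP.
rewrite big_nat big1 // => q' /andP[q1 q2]; rewrite big1 // => a' co'.
case: ifP => // ne; apply: kap_root.
{ have dv (x y : nat) : (0 < y)%N -> (y %| H)%N -> cexp (x%:R / y%:R * H%:R : R) = 1.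
  { move=> y0 /dvdnP[j ->].
    have -> : x%:R / y%:R * (j * y)%:R = (x * j)%:R :> R.
    { by rewrite !natrM; field; rewrite pnatr_eq0 -lt0n. }
    exact: cexp_nat. }
  rewrite cexpX mulrBl cexpD -mulNr mulNr cexpN !dv //; first by rewrite conjc1 mulr1.
  by apply: dD; rewrite q1. }
apply/eqP => h1.
have Dr : (0 < D)%N by lia.
have := @nm_1cexp_ge R (a%:R / q%:R - a'%:R / q'%:R) (2 * q%:R * D%:R)^-1.
rewrite h1 subrr nm0 leNgt => /(_ _)/negP; apply.
{ move=> k; have := @far_reduced a q a' q' 0 D k q0; rewrite addr0; apply => //; first by rewrite q1.
  { by rewrite ne. }
  by rewrite normr0 invr_ge0 !mulr_ge0. }
by rewrite invr_gt0 !mulr_gt0 // ltr0n.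
Qed.

Lemma upoly_le D H t : nm (pev (upoly D H) t) <= D%:R ^+ 2.
Proof.
rewrite pev_upoly; apply: le_trans (nm_sum _ _ _ _) _; rewrite -[leRHS]mulr1.
apply: le_trans (card_coprime_pairs D 1 (fun q a => nm (kap H (t - a%:R / q%:R))) _ _) => //.
{ by apply: ler_sum => q _; exact: nm_sum. }
by move=> q a _ _; exact: kap_le1.
Qed.

Lemma upoly_lip D H t s : (0 < H)%N ->
  nm (pev (upoly D H) t - pev (upoly D H) s) <= 8 * D%:R ^+ 2 * H%:R * `|t - s|.
Proof.
move=> H0; rewrite !pev_upoly -sumrB; apply: le_trans (nm_sum _ _ _ _) _.
have -> : 8 * D%:R ^+ 2 * H%:R * `|t - s| = D%:R ^+ 2 * (8 * H%:R * `|t - s|) by ring.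
apply: le_trans (card_coprime_pairs D (8 * H%:R * `|t - s|) (fun q a => nm (kap H (t - a%:R / q%:R) - kap H (s - a%:R / q%:R))) _ _).
{ by apply: ler_sum => q _; rewrite -sumrB; exact: nm_sum. }
{ by rewrite !mulr_ge0. }
move=> q a _ _; apply: le_trans (kap_lip _ _ _ H0) _.
by apply: eq_imp_le; congr (_ * `|_|); ring.
Qed.

Lemma asq_le1 N t : nm (pev (asq N) t) <= 1 :> R.
Proof.
rewrite pev_asq nmM nm_real normfV normr_nat.
case: N => [|N]; first by rewrite invr0 mul0r.
rewrite ler_pdivrMl ?ltr0n // mulr1; apply: le_trans (nm_sum _ _ _ _) _.
rewrite (eq_bigr (fun=> 1)); last by move=> i _; rewrite nm_cexp.
by rewrite sumr_const_nat subn0.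
Qed.

Lemma asq_lip N t s : nm (pev (asq N) t - pev (asq N) s) <= 8 * N%:R ^+ 2 * `|t - s| :> R.
Proof.
rewrite !pev_asq -mulrBr -sumrB nmM nm_real normfV normr_nat.
case: N => [|N]; first by rewrite invr0 mul0r !mulr_ge0.
rewrite ler_pdivrMl ?ltr0n //; apply: le_trans (nm_sum _ _ _ _) _.
apply: (@le_trans _ _ (\sum_(0 <= h < N.+1) 8 * N.+1%:R ^+ 2 * `|t - s|)); last first.
{ by rewrite sumr_const_nat subn0 -[leLHS]mulr_natl. }
rewrite big_nat [leRHS]big_nat; apply: ler_sum => h /andP[_ hh].
apply: le_trans (nm_cexpB _ _) _.
rewrite -mulrBl normrM normr_nat -mulrA ler_wpM2l // mulrC ler_wpM2r //.
by rewrite -natrX ler_nat leq_exp2r.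
Qed.

Lemma asq_period N (a q : nat) : (0 < q)%N -> (0 < N)%N ->
  nm (pev (asq N) (a%:R / q%:R) - pev (asq q) (a%:R / q%:R)) <= 2 * q%:R / N%:R :> R.
Proof.
move=> q0 N0.
have qr : 0 < q%:R :> R by rewrite ltr0n.
have Nr : 0 < N%:R :> R by rewrite ltr0n.
pose z n : R[i] := cexp (a%:R / q%:R * (n.+1 ^ 2)%:R).
have zp n t : z (q * t + n)%N = z n.
{ rewrite /z; have -> : ((q * t + n).+1 ^ 2 = q * (q * t ^ 2 + 2 * t * n.+1) + n.+1 ^ 2)%N by lia.
  rewrite natrD mulrDr addrC.
  have -> : a%:R / q%:R * (q * (q * t ^ 2 + 2 * t * n.+1))%:R = (a * (q * t ^ 2 + 2 * t * n.+1))%:R :> R.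
  { rewrite natrM (natrM _ a); field; by rewrite gt_eqF. }
  exact: cexpDn. }
pose S := \sum_(0 <= n < q) z n.
have hS : nm S <= q%:R.
{ apply: le_trans (nm_sum _ _ _ _) _; rewrite (eq_bigr (fun=> 1)); last by move=> i _; rewrite nm_cexp.
  by rewrite sumr_const_nat subn0. }
pose T := \sum_(0 <= n < N %% q) z n.
have hT : nm T <= (N %% q)%:R.
{ apply: le_trans (nm_sum _ _ _ _) _; rewrite (eq_bigr (fun=> 1)); last by move=> i _; rewrite nm_cexp.
  by rewrite sumr_const_nat subn0. }
have eN : \sum_(0 <= n < N) z n = (N %/ q)%:R * S + T.
{ rewrite {1}(divn_eq N q) mulnC (big_cat_nat _ (n := (q * (N %/ q))%N)) //=; last by rewrite leq_addr.
  congr (_ + _).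
  { rewrite sum_nat_blocks (eq_bigr (fun=> S)); first by rewrite sumr_const_nat subn0 mulr_natl.
    by move=> t _; apply: eq_bigr => j _; rewrite zp. }
  rewrite -{1}(addn0 (q * _)%N) addnC big_addn addKn; apply: eq_bigr => i _.
  by rewrite addnC zp. }
rewrite !pev_asq -/S eN.
have -> : real_complex R (N%:R)^-1 * ((N %/ q)%:R * S + T) - real_complex R (q%:R)^-1 * S =
  real_complex R ((N %/ q)%:R / N%:R - (q%:R)^-1) * S + real_complex R (N%:R)^-1 * T.
{ rewrite rmorphB rmorphM /= (rmorph_nat (real_complex R)); ring. }
apply: le_trans (nmD _ _) _; rewrite !nmM !nm_real normfV normr_nat.
have e : (N %/ q)%:R / N%:R - (q%:R)^-1 = - ((N %% q)%:R / (N%:R * q%:R)) :> R.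
{ have := congr1 (fun n : nat => n%:R : R) (divn_eq N q); rewrite natrD natrM => e.
  have -> : (N %% q)%:R = N%:R - (N %/ q)%:R * q%:R :> R by rewrite {1}e; ring.
  by field; rewrite !gt_eqF. }
rewrite e normrN normf_div normr_nat normrM !normr_nat.
have hm : (N %% q)%:R <= q%:R :> R by rewrite ler_nat ltnW // ltn_mod.
have -> : 2 * q%:R / N%:R = q%:R / (N%:R * q%:R) * q%:R + N%:R^-1 * q%:R :> R.
{ by field; rewrite !gt_eqF. }
apply: lerD.
{ apply: ler_pM => //; rewrite ?nm_ge0 ?divr_ge0 ?mulr_ge0 //.
  by rewrite ler_wpM2r // invr_ge0 mulr_ge0. }
by rewrite ler_wpM2l ?invr_ge0 //; apply: le_trans hT hm.
Qed.

Lemma asq_period_exact (a q j : nat) : (0 < q)%N -> (0 < j)%N ->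
  pev (asq (q * j)) (a%:R / q%:R) = pev (asq q) (a%:R / q%:R) :> R[i].
Proof.
move=> q0 j0; have qr : q%:R != 0 :> R by rewrite pnatr_eq0 -lt0n.
have jr : j%:R != 0 :> R by rewrite pnatr_eq0 -lt0n.
rewrite !pev_asq sum_nat_blocks (eq_bigr (fun=> \sum_(0 <= n < q) cexp (a%:R / q%:R * (n.+1 ^ 2)%:R))).
{ rewrite sumr_const_nat subn0 -[X in _ * X]mulr_natl mulrA; congr (_ * _).
  rewrite -[X in _ * X](rmorph_nat (real_complex R)) -rmorphM natrM /=; congr (real_complex R _).
  by field; rewrite qr jr. }
move=> t _; apply: eq_bigr => n _.
have -> : ((q * t + n).+1 ^ 2 = q * (q * t ^ 2 + 2 * t * n.+1) + n.+1 ^ 2)%N by lia.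
rewrite natrD mulrDr addrC.
have -> : a%:R / q%:R * (q * (q * t ^ 2 + 2 * t * n.+1))%:R = (a * (q * t ^ 2 + 2 * t * n.+1))%:R :> R.
{ rewrite natrM (natrM _ a); field; exact: qr. }
exact: cexpDn.
Qed.

(** Weyl's inequality at [N = q^2] and [beta = 0]: by periodicity the average over [q^2] terms is
    the complete Gauss sum, and the error [385/sqrt(q^2)] is itself [O(1/q)]. *)
Lemma gauss_bound (a q : nat) : (0 < q)%N -> coprime a q ->
  nm (pev (asq q) (a%:R / q%:R)) ^+ 2 <= 389 / q%:R :> R.
Proof.
move=> q0 co; have qr : 0 < q%:R :> R by rewrite ltr0n.
rewrite -(asq_period_exact a q q) //.
have := @weyl_bound1 R (q * q) q a 0 _ q0 _ co.
rewrite addr0 natrM -expr2 sqrtr_sqr normr0 (ger0_norm (ltW qr)) => h.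
apply: le_trans (h _ _ _) _.
{ by rewrite muln_gt0 q0. }
{ by rewrite mulnCA leq_pmulr // muln_gt0. }
{ by rewrite invr_ge0 !mulr_ge0 // exprn_ge0. }
by apply: eq_imp_le; field; rewrite gt_eqF.
Qed.

End Multipliers.

(** * Size of the dyadic pieces of the multiplier *)

Section MultiplierEstimates.
Context {R : realType}.

(** The threshold makes the error of [upoly_near] at most [1/sqrt N]: with [q <= 4N], [D = 2^s] and
    [H >= N^2/(2 * 16^s)] this error is at most [32 * 128^s / N], and [2^(14 s + 10)] is the square
    of [32 * 128^s]. *)
Definition large_enough (s N : nat) : Prop := (2 ^ (14 * s + 10) <= N)%N.
(** The kernels are wider than the natural scale [N^(-2)] by the factor [16^s]. They stay close to 1
    as long as [N sqrt |beta| <= 2^s], and beyond that point Weyl's inequality in [beta] already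
    gains [2^(-s)]. *)
Definition ulen (s N : nat) : nat := (N ^ 2 %/ 16 ^ s)%N.
Definition usmooth (s N : nat) : {poly R} := upoly (2 ^ s) (ulen s N).
(* The part of the average carried by the denominators [2^s < q <= 2^(s+1)]. *)
Definition msq (s N : nat) : {poly R} := asq N * (usmooth s.+1 N - usmooth s N).

Lemma large_enough_sqrt s N : large_enough s N ->
  32 * 128 ^+ s <= Num.sqrt N%:R :> R.
Proof.
move=> h; rewrite -(@ler_pXn2r _ 2) ?nnegrE ?sqrtr_ge0 ?mulr_ge0 ?exprn_ge0 //.
rewrite sqr_sqrtr //; apply: le_trans (_ : (2 ^ (14 * s + 10))%:R <= _); last by rewrite ler_nat.
have e5 : 32 = 2 ^+ 5 :> R by ring.
have e7 : 128 = 2 ^+ 7 :> R by ring.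
by apply: eq_imp_le; rewrite natrX e5 e7 -exprM -exprD -exprM; congr (_ ^+ _); lia.
Qed.

Lemma large_enoughW s N : large_enough s.+1 N -> large_enough s N.
Proof. by apply: leq_trans; rewrite leq_exp2l //; lia. Qed.

Lemma large_enough_gt0 s N : large_enough s N -> (0 < N)%N.
Proof. by apply: leq_trans; rewrite expn_gt0. Qed.

Lemma ulen_bounds s N : large_enough s N ->
  [/\ (0 < ulen s N)%N, (ulen s N)%:R * 16 ^+ s <= N%:R ^+ 2 :> R &
   N%:R ^+ 2 <= 2 * 16 ^+ s * (ulen s N)%:R :> R].
Proof.
move=> h; rewrite /ulen.
have P0 : (0 < 16 ^ s)%N by rewrite expn_gt0.
have PN : (16 ^ s <= N ^ 2)%N.
{ apply: leq_trans (_ : N <= N ^ 2)%N; last by have := large_enough_gt0 _ _ h; nia.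
  by apply: leq_trans h; rewrite -[16%N]/(2 ^ 4)%N -expnM leq_exp2l //; lia. }
have u0 : (0 < N ^ 2 %/ 16 ^ s)%N by rewrite divn_gt0.
have e1 : 16 ^+ s = (16 ^ s)%:R :> R by rewrite natrX.
split => //; rewrite e1 -!natrX -!natrM ler_nat; first exact: leq_trunc_div.
have := ltn_ceil (N ^ 2) P0; move: u0; set k := (N ^ 2 %/ _)%N; set P := (16 ^ s)%N; set M := (N ^ 2)%N.
by clear; nia.
Qed.

Lemma usmooth_near s N (a q : nat) (beta : R) : large_enough s N ->
  (0 < q)%N -> (q <= 4 * N)%N -> coprime a q -> `|beta| <= (4 * q%:R * N%:R)^-1 ->
  nm (pev (usmooth s N) (a%:R / q%:R + beta) -
      (if (q <= 2 ^ s)%N then kap (ulen s N) beta else 0)) <= (Num.sqrt N%:R)^-1.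
Proof.
move=> h q0 qN co hb.
have [u0 u1 u2] := ulen_bounds _ _ h.
have N0 := large_enough_gt0 _ _ h.
have qr : 0 < q%:R :> R by rewrite ltr0n.
have Nr : 0 < N%:R :> R by rewrite ltr0n.
have ur : 0 < (ulen s N)%:R :> R by rewrite ltr0n.
have D0 : (0 < 2 ^ s)%N by rewrite expn_gt0.
have sN : (2 ^ s <= N)%N by apply: leq_trans h; rewrite leq_exp2l //; lia.
apply: le_trans (upoly_near _ _ _ _ _ q0 D0 u0 co _) _.
{ apply: le_trans hb _; rewrite lef_pV2 ?posrE ?mulr_gt0 ?ltr0n //.
  have : (2 ^ s)%:R <= N%:R :> R by rewrite ler_nat.
  have : 0 <= (2 ^ s)%:R :> R by [].
  move: qr; move: (q%:R : R) ((2 ^ s)%:R : R) (N%:R : R) => x y z *; nra. }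
have hs := large_enough_sqrt _ _ h.
set rN := Num.sqrt N%:R in hs *.
have rN0 : 0 < rN by rewrite sqrtr_gt0.
have rN2 : rN ^+ 2 = N%:R by rewrite sqr_sqrtr.
have qN' : q%:R <= 4 * N%:R :> R by rewrite -natrM ler_nat.
have e8 : (2 ^ s)%:R ^+ 3 = 8 ^+ s :> R.
{ rewrite natrX -exprM mulnC exprM; congr (_ ^+ _); ring. }
rewrite e8 ler_pdivrMr // ler_pdivlMl // -rN2 in qN' u2 *.
have p0 : 0 <= 8 ^+ s :> R by rewrite exprn_ge0.
have p1 : 0 < 16 ^+ s :> R by rewrite exprn_gt0.
have e128 : 128 ^+ s = 8 ^+ s * 16 ^+ s :> R by rewrite -exprMn; congr (_ ^+ _); ring.
rewrite e128 in hs.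
have h1 : rN * (4 * q%:R * 8 ^+ s) <= rN * (4 * (4 * rN ^+ 2) * 8 ^+ s).
{ by rewrite ler_wpM2l ?(ltW rN0) // ler_wpM2r // ler_wpM2l. }
apply: le_trans h1 _.
have h2 : 32 * (8 ^+ s * 16 ^+ s) * (rN ^+ 3 * rN) <= rN * rN ^+ 3 * (rN ^+ 2 * rN ^+ 2) / (rN ^+ 3).
{ have -> : rN * rN ^+ 3 * (rN ^+ 2 * rN ^+ 2) / rN ^+ 3 = rN * (rN ^+ 3 * rN).
  { by field; rewrite gt_eqF. }
  by rewrite ler_wpM2r // mulr_ge0 ?exprn_ge0 // ltW. }
have h3 : 32 * (8 ^+ s * 16 ^+ s) * (rN ^+ 3) <= (rN ^+ 2) ^+ 2.
{ have -> : (rN ^+ 2) ^+ 2 = rN * rN ^+ 3 by ring.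
  by rewrite ler_wpM2r // exprn_ge0 // ltW. }
rewrite -(ler_pM2l p1); have -> : 16 ^+ s * (rN * (4 * (4 * rN ^+ 2) * 8 ^+ s)) = (32 * (8 ^+ s * 16 ^+ s) * rN ^+ 3) / 2 by field.
by move: h3 u2; clear; lra.
Qed.

Lemma mul_sqr_le (x y ep : R) : 0 <= x <= 1 -> 0 <= y <= 2 * ep ->
  2 * (x ^+ 2 * y ^+ 2) <= 8 * ep ^+ 2.
Proof.
move=> /andP[x0 x1] /andP[y0 y1].
have h1 : x ^+ 2 <= 1 by rewrite expr_le1.
have h2 : y ^+ 2 <= (2 * ep) ^+ 2 by rewrite ler_pXn2r ?nnegrE //; lra.
have -> : 8 * ep ^+ 2 = 2 * (1 * (2 * ep) ^+ 2) by ring.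
by rewrite ler_wpM2l // ler_pM ?exprn_ge0.
Qed.

(** [A] is the squared Weyl factor and [K] the squared factor of the kernels. Here [A] supplies the
    gain [y]; in the companion [msq_arith_near] it is [K]. *)
Lemma msq_arith_far (X A K et y : R) : X <= 2 * (A * K) + 8 * et ^+ 2 -> et ^+ 2 <= et ->
  0 <= et -> 0 <= y -> 0 <= A -> K <= 4 -> A <= 8 * y + 385 * et -> X <= 64 * 64 * (y + et).
Proof.
move=> h e2 e0 y0 A0 K4 hA.
have : A * K <= A * 4 by rewrite ler_wpM2l.
clear - h e2 y0 A0 hA; lra.
Qed.

Lemma msq_arith_near (X A K et y : R) : X <= 2 * (A * K) + 8 * et ^+ 2 -> et ^+ 2 <= et ->
  0 <= et -> 0 <= y -> A <= 1 -> 0 <= K -> K <= 256 * y -> X <= 64 * 64 * (y + et).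
Proof.
move=> h e2 e0 y0 A1 K0 hK.
have : A * K <= 1 * K by rewrite ler_wpM2r.
lra.
Qed.

Lemma prod_split (a u1 u0 c1 c0 : R[i]) (ep : R) : nm a <= 1 -> 0 <= ep ->
  nm (u1 - c1) <= ep -> nm (u0 - c0) <= ep ->
  nm (a * (u1 - u0)) ^+ 2 <= 2 * (nm a ^+ 2 * nm (c1 - c0) ^+ 2) + 8 * ep ^+ 2.
Proof.
move=> a1 e0 h1 h0.
have -> : a * (u1 - u0) = a * (c1 - c0) + a * ((u1 - c1) - (u0 - c0)) by ring.
apply: le_trans (nmD2 _ _) _; rewrite !nmM !exprMn; apply: lerD => //.
have h2 : nm (u1 - c1 - (u0 - c0)) <= 2 * ep by apply: le_trans (nmB _ _) _; lra.
by apply: mul_sqr_le; rewrite nm_ge0.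
Qed.

Lemma eta_props N : (0 < N)%N ->
  [/\ 0 < (Num.sqrt N%:R)^-1 :> R, ((Num.sqrt N%:R)^-1) ^+ 2 <= (Num.sqrt N%:R)^-1 :> R
    & (Num.sqrt N%:R)^-1 <= 1 :> R].
Proof.
move=> N0; have h : 1 <= Num.sqrt N%:R :> R.
{ by rewrite -[leLHS]sqrtr1 ler_wsqrtr // ?ler1n. }
have h2 : (Num.sqrt N%:R)^-1 <= 1 :> R by rewrite invf_le1 //; lra.
have h3 : 0 < (Num.sqrt N%:R)^-1 :> R by rewrite invr_gt0; lra.
by split => //; rewrite expr2 ler_piMl // ltW.
Qed.

Lemma pow2_props s : [/\ 0 < (2 ^+ s)^-1 :> R, (2 ^+ s)^-1 <= 1 :> R, (16 ^+ s)^-1 <= (2 ^+ s)^-1 :> R & (2 ^ s)%:R = 2 ^+ s :> R].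
Proof.
split; last by rewrite natrX.
{ by rewrite invr_gt0 exprn_gt0. }
{ by rewrite invf_le1 ?exprn_gt0 // exprn_ege1 // ler1n. }
by rewrite lef_pV2 ?posrE ?exprn_gt0 //; apply: lerXn2r; rewrite ?nnegrE //; lra.
Qed.

(** In this range both lengths times [|beta|] are at most [4^(-s)], so both kernels are still close
    to their value 1 at the origin. *)
Lemma kap_diff_small s N (beta : R) : large_enough s.+1 N ->
  N%:R * Num.sqrt `|beta| <= 2 ^+ s ->
  nm (kap (ulen s.+1 N) beta - kap (ulen s N) beta) ^+ 2 <= 256 / 2 ^+ s.
Proof.
move=> h hr.
have [v0 v1 _] := ulen_bounds _ _ h.
have [u0 u1 _] := ulen_bounds _ _ (large_enoughW _ _ h).
have vu : (ulen s.+1 N)%:R <= (ulen s N)%:R :> R.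
{ by rewrite ler_nat /ulen leq_div2l // ?expn_gt0 // leq_exp2l. }
have h1 : nm (kap (ulen s.+1 N) beta - kap (ulen s N) beta) <= 16 * (ulen s N)%:R * `|beta|.
{ apply: le_trans (nm_triangle _ 1 _) _; rewrite nmBC.
  apply: le_trans (lerD (kap_near _ _ v0) (kap_near _ _ u0)) _.
  have := normr_ge0 beta; move: vu; move: (_%:R : R) (_%:R : R) `|beta| => x y z; nra. }
have hx : N%:R ^+ 2 * `|beta| <= 4 ^+ s.
{ have : (N%:R * Num.sqrt `|beta|) ^+ 2 <= (2 ^+ s) ^+ 2 by rewrite ler_pXn2r ?nnegrE ?mulr_ge0 ?sqrtr_ge0 ?exprn_ge0.
  rewrite exprMn sqr_sqrtr // -exprM mulnC exprM => /le_trans; apply.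
  by apply: eq_imp_le; congr (_ ^+ _); ring. }
have p16 : 0 < 16 ^+ s :> R by rewrite exprn_gt0.
have p4 : 0 < 4 ^+ s :> R by rewrite exprn_gt0.
have p2 : 1 <= 2 ^+ s :> R by rewrite exprn_ege1 // ler1n.
have e16 : 16 ^+ s = 4 ^+ s * 4 ^+ s :> R by rewrite -exprMn; congr (_ ^+ _); ring.
have e4 : 4 ^+ s = 2 ^+ s * 2 ^+ s :> R by rewrite -exprMn; congr (_ ^+ _); ring.
have h2 : (ulen s N)%:R * `|beta| <= (4 ^+ s)^-1.
{ rewrite -(ler_pM2r p16) e16.
  have -> : (4 ^+ s)^-1 * (4 ^+ s * 4 ^+ s) = 4 ^+ s :> R by field; rewrite gt_eqF.
  apply: le_trans hx; rewrite mulrAC -e16; exact: ler_wpM2r u1. }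
have h3 : nm (kap (ulen s.+1 N) beta - kap (ulen s N) beta) <= 16 / 4 ^+ s.
{ apply: le_trans h1 _; rewrite -mulrA ler_wpM2l //. }
apply: le_trans (_ : (16 / 4 ^+ s) ^+ 2 <= _).
{ by rewrite ler_pXn2r ?nnegrE ?nm_ge0 ?divr_ge0 // ltW. }
have -> : 256 = 16 ^+ 2 :> R by ring.
rewrite expr_div_n ler_pM2l ?exprn_gt0 // lef_pV2 ?posrE ?exprn_gt0 // e4.
move: p2; move: (2 ^+ s) => x x1.
have h4 : x <= x * x by nra.
have h5 : x * x <= (x * x) ^+ 2 by nra.
exact: le_trans h4 h5.
Qed.

(** The cases follow the size of [q]. For [q <= 2^s] both kernels are present and nearly cancel,
    until [N sqrt |beta|] exceeds [2^s] and Weyl's bound in [beta] takes over. For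
    [2^s < q <= 2^(s+1)] one kernel is present and Weyl's bound gives [1/q]. For larger [q] only the
    error terms remain. *)
Lemma msq_est s N (a q : nat) (beta : R) : large_enough s.+1 N ->
  (0 < q)%N -> (q <= 4 * N)%N -> coprime a q -> `|beta| <= (4 * q%:R * N%:R)^-1 ->
  [/\ nm (pev (msq s N) (a%:R / q%:R + beta)) ^+ 2 <= 64 * 64 * ((2 ^+ s)^-1 + (Num.sqrt N%:R)^-1),
      (beta != 0 -> nm (pev (msq s N) (a%:R / q%:R + beta)) ^+ 2 <=
          64 * 64 * ((N%:R * Num.sqrt `|beta|)^-1 + (Num.sqrt N%:R)^-1)) &
      ((2 ^ s.+1 < q)%N -> nm (pev (msq s N) (a%:R / q%:R + beta)) ^+ 2 <= 64 * 64 * (Num.sqrt N%:R)^-1)].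
Proof.
move=> h q0 qN co hb; rewrite /msq pevM pevB.
have N0 := large_enough_gt0 _ _ h.
have h1 := usmooth_near _ _ _ _ _ h q0 qN co hb.
have h0 := usmooth_near _ _ _ _ _ (large_enoughW _ _ h) q0 qN co hb.
have W1 := weyl_bound1 _ _ _ _ N0 q0 qN co hb.
have W2 := weyl_bound2 _ _ _ _ N0 q0 qN co hb.
have [et0 et2 et1] := eta_props N N0.
have [ps0 ps1 _ psE] := pow2_props s.
set al := a%:R / q%:R + beta in h1 h0 W1 W2 *.
have A1 := asq_le1 N al.
have := prod_split _ _ _ _ _ _ A1 (ltW et0) h1 h0.
set X := nm (_ * _) ^+ 2; set et := (Num.sqrt N%:R)^-1 in et0 et2 et1 W1 W2 *.
set A := nm (pev (asq N) al) in A1 W1 W2 *.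
have A0 : 0 <= A ^+ 2 by rewrite sqr_ge0.
have A1' : A ^+ 2 <= 1 by rewrite expr_le1 // nm_ge0.
have q1 : 1 <= q%:R :> R by rewrite ler1n.
have W2' : beta != 0 -> A ^+ 2 <= 8 * (N%:R * Num.sqrt `|beta|)^-1 + 385 * et.
{ move=> b0; apply: le_trans (W2 b0) _; rewrite lerD2r ler_wpM2l //.
  have b1 : 0 < N%:R * Num.sqrt `|beta| by rewrite mulr_gt0 ?ltr0n // sqrtr_gt0 normr_gt0.
  by rewrite invfM ler_piMl ?invr_ge0 ?(ltW b1) // invf_le1 //; clear - q1 b0 b1; lra. }
have rp : beta != 0 -> 0 < (N%:R * Num.sqrt `|beta|)^-1.
{ by move=> b0; rewrite invr_gt0 mulr_gt0 ?ltr0n // sqrtr_gt0 normr_gt0. }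
case: (leqP q (2 ^ s)) => [qs|qs].
{ have qs1 : (q <= 2 ^ s.+1)%N by apply: leq_trans qs _; rewrite leq_exp2l.
  rewrite qs1; set K := nm (_ - _) => hX.
  have K2 : K ^+ 2 <= 4.
  { have : K <= 2 by apply: le_trans (nmB _ _) _; apply: le_trans (lerD (kap_le1 _ _) (kap_le1 _ _)) _; clear; lra.
    have := nm_ge0 (kap (ulen s.+1 N) beta - kap (ulen s N) beta); rewrite -/K; nra. }
  have K0 : 0 <= K ^+ 2 by rewrite sqr_ge0.
  have B2 : beta != 0 -> X <= 64 * 64 * ((N%:R * Num.sqrt `|beta|)^-1 + et).
  { by move=> b0; apply: (msq_arith_far X (A ^+ 2) (K ^+ 2)) => //; try exact: ltW; try exact: ltW (rp b0); exact: W2'. }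
  split => //; last by move=> h2; move: (leq_trans h2 qs1); rewrite ltnn.
  case: (leP (N%:R * Num.sqrt `|beta|) (2 ^+ s)) => hr.
  { by apply: (msq_arith_near X (A ^+ 2) (K ^+ 2)) => //; try exact: ltW; exact: kap_diff_small. }
  have b0 : beta != 0.
  { apply/eqP => b0; move: hr; rewrite b0 normr0 sqrtr0 mulr0 ltNge exprn_ge0 //. }
  apply: le_trans (B2 b0) _; rewrite ler_wpM2l // lerD2r lef_pV2 ?posrE ?exprn_gt0 //; first exact: ltW.
  by rewrite -invr_gt0 rp. }
case: (leqP q (2 ^ s.+1)) => [qs1|qs1].
{ rewrite subr0; set K := nm _ => hX.
  have K1 : K <= 1 by exact: kap_le1.
  have K0 : 0 <= K by exact: nm_ge0.
  have K2 : K ^+ 2 <= 1 by rewrite expr_le1.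
  have K4 : K ^+ 2 <= 4 by clear - K2; lra.
  split; last by [].
  { have hq : q%:R^-1 <= (2 ^+ s)^-1 :> R.
    { by rewrite lef_pV2 ?posrE ?exprn_gt0 // ?ltr0n // -psE ler_nat ltnW. }
    apply: (msq_arith_far X (A ^+ 2) (K ^+ 2)) => //; try exact: ltW.
    by apply: le_trans W1 _; move: hq ps0; clear; lra. }
  by move=> b0; apply: (msq_arith_far X (A ^+ 2) (K ^+ 2)) => //; try exact: ltW; try exact: ltW (rp b0); exact: W2'. }
rewrite subrr nm0 expr0n mulr0 mulr0 add0r => hX.
by split; [|move=> b0; have := rp b0|]; move: hX et2 et0 ps0; clear; lra.
Qed.

Lemma msq_bound s N (alpha : R) : large_enough s.+1 N -> 0 <= alpha ->
  nm (pev (msq s N) alpha) ^+ 2 <= 64 * 64 * ((2 ^+ s)^-1 + (Num.sqrt N%:R)^-1).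
Proof.
move=> h al0; have N0 := large_enough_gt0 _ _ h.
have [a [q [/andP[q0 qN] co hb]]] := dirichlet_coprime alpha (4 * N) al0 (ltac:(lia) : (0 < 4 * N)%N).
have hb' : `|alpha - a%:R / q%:R| <= (4 * q%:R * N%:R)^-1.
{ by apply: le_trans hb _; rewrite natrM mulrCA mulrA. }
have [+ _ _] := msq_est _ _ _ _ _ h q0 qN co hb'.
by rewrite addrC subrK.
Qed.

(** What the kernels up to [2^s] miss: either [q > 2^s] and Weyl's bound gives [1/q], or [q <= 2^s]
    and [1 - kap] plays the part of the difference of two kernels. *)
Lemma fin_est s N (alpha : R) : large_enough s N -> 0 <= alpha ->
  nm (pev (asq N * (1 - usmooth s N)) alpha) ^+ 2 <= 64 * 64 * ((2 ^+ s)^-1 + (Num.sqrt N%:R)^-1).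
Proof.
move=> h al0; have N0 := large_enough_gt0 _ _ h.
have [a [q [/andP[q0 qN] co hb]]] := dirichlet_coprime alpha (4 * N) al0 (ltac:(lia) : (0 < 4 * N)%N).
have hb' : `|alpha - a%:R / q%:R| <= (4 * q%:R * N%:R)^-1.
{ by apply: le_trans hb _; rewrite natrM mulrCA mulrA. }
have e : alpha = a%:R / q%:R + (alpha - a%:R / q%:R) by rewrite addrC subrK.
move: hb' e {hb}; set beta := alpha - _ => hb ->; clearbody beta.
rewrite pevM pevB pev1.
have h0 := usmooth_near _ _ _ _ _ h q0 qN co hb.
have W1 := weyl_bound1 _ _ _ _ N0 q0 qN co hb.
have W2 := weyl_bound2 _ _ _ _ N0 q0 qN co hb.
have [et0 et2 et1] := eta_props N N0.
have [ps0 ps1 ps16 psE] := pow2_props s.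
have [u0 u1 _] := ulen_bounds _ _ h.
set al := a%:R / q%:R + beta in h0 W1 W2 *.
have A1 := asq_le1 N al.
have h1 : nm (1 - 1 : R[i]) <= (Num.sqrt N%:R)^-1 by rewrite subrr nm0 ltW.
have := prod_split _ _ _ _ _ _ A1 (ltW et0) h1 h0.
set X := nm (_ * _) ^+ 2; set et := (Num.sqrt N%:R)^-1 in et0 et2 et1 W1 W2 *.
set A := nm (pev (asq N) al) in A1 W1 W2 *.
have A0 : 0 <= A ^+ 2 by rewrite sqr_ge0.
have A1' : A ^+ 2 <= 1 by rewrite expr_le1 // nm_ge0.
have q1 : 1 <= q%:R :> R by rewrite ler1n.
case: (leqP q (2 ^ s)) => [qs|qs]; last first.
{ rewrite subr0 nm1 expr1n mulr1 => hX.
  have : q%:R^-1 <= (2 ^+ s)^-1 :> R.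
  { by rewrite lef_pV2 ?posrE ?exprn_gt0 // ?ltr0n // -psE ler_nat ltnW. }
  move=> hq; apply: (msq_arith_far X (A ^+ 2) 1) => //; rewrite ?mulr1 ?(ltW et0) ?(ltW ps0) //; first lra.
  by apply: le_trans W1 _; move: hq ps0; clear; lra. }
set K := nm (1 - _) => hX.
have K0 : 0 <= K by exact: nm_ge0.
have K2 : K <= 2 by apply: le_trans (nmB _ _) _; rewrite nm1; have := kap_le1 (ulen s N) beta; clear; lra.
have K4 : K ^+ 2 <= 4 by nra.
set r := N%:R * Num.sqrt `|beta|.
have r0 : 0 <= r by rewrite mulr_ge0 ?sqrtr_ge0.
case: (leP r (2 ^+ s)) => hr.
{ have r2 : r ^+ 2 = N%:R ^+ 2 * `|beta| by rewrite exprMn sqr_sqrtr.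
  have hK : K <= 8 * (2 ^+ s)^-1.
  { apply: le_trans (kap_near _ _ u0) _; rewrite -mulrA ler_wpM2l //.
    have p16 : 0 < 16 ^+ s :> R by rewrite exprn_gt0.
    rewrite -(ler_pM2r p16) mulrAC; apply: le_trans (ler_wpM2r (normr_ge0 _) u1) _.
    rewrite -r2; have e16 : 16 ^+ s = 2 ^+ s * (2 ^+ s) ^+ 3 :> R.
    { by rewrite -exprS -exprM mulnC exprM; congr (_ ^+ _); ring. }
    have p2 : 1 <= 2 ^+ s :> R by rewrite exprn_ege1 // ler1n.
    rewrite e16 mulKf; last by rewrite gt_eqF //; lra.
    have : r ^+ 2 <= (2 ^+ s) ^+ 2 by rewrite ler_pXn2r ?nnegrE // exprn_ge0.
    move=> /le_trans; apply; rewrite [leRHS]exprS ler_peMl //. }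
  have K64 : K ^+ 2 <= 256 * (2 ^+ s)^-1.
  { apply: (@le_trans _ _ ((8 * (2 ^+ s)^-1) ^+ 2)); first by rewrite ler_pXn2r ?nnegrE // mulr_ge0 // ltW.
    by move: ps0 ps1; move: (_^-1) => x; clear; nra. }
  by apply: (msq_arith_near X (A ^+ 2) (K ^+ 2)) => //; rewrite ?sqr_ge0 ?(ltW et0) ?(ltW ps0). }
have b0 : beta != 0.
{ apply/eqP => b0; move: hr; rewrite /r b0 normr0 sqrtr0 mulr0 ltNge exprn_ge0 //. }
have r1 : 0 < r by rewrite mulr_gt0 ?ltr0n // sqrtr_gt0 normr_gt0.
have hA : A ^+ 2 <= 8 * (2 ^+ s)^-1 + 385 * et.
{ apply: le_trans (W2 b0) _; rewrite lerD2r ler_wpM2l // -/r.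
  apply: (@le_trans _ _ r^-1).
  { by rewrite invfM ler_piMl ?invr_ge0 // invf_le1 //; clear - q1; lra. }
  by rewrite lef_pV2 ?posrE ?exprn_gt0 // ltW. }
by apply: (msq_arith_far X (A ^+ 2) (K ^+ 2)) => //; rewrite ?(ltW et0) ?(ltW ps0).
Qed.

(** The decay profile of a squared piece in [r = N sqrt |beta|], beyond its size [2^(-s)]: Lipschitz
    continuity handles small [r], Weyl's inequality large [r]. Only the roughly [3s] dyadic values
    of [r] between [4^(-s)] and [2^s] give no decay. *)
Definition omega (s : nat) (r : R) : R := Num.min 1 (Num.min (4 ^+ s * r) (2 ^+ s / r)).

Lemma omega_bound s (C X r et : R) : 0 <= C -> 0 <= et -> 0 <= r ->
  X <= C * ((2 ^+ s)^-1 + et) -> (1 <= r -> X <= C * (r^-1 + et)) ->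
  (r < 1 -> X <= C * (16 ^+ s * r ^+ 4 + et)) ->
  X <= C * ((2 ^+ s)^-1 * omega s r + et).
Proof.
move=> C0 e0 r0 h1 h2 h3.
have [ps0 ps1 _ _] := pow2_props s.
have p4 : 1 <= 4 ^+ s :> R by rewrite exprn_ege1 // ler1n.
have p2 : 1 <= 2 ^+ s :> R by rewrite exprn_ege1 // ler1n.
have W x : (2 ^+ s)^-1 <= x -> X <= C * (x + et).
{ by move=> hx; apply: le_trans h1 _; rewrite ler_wpM2l // lerD2r. }
have b1 : X <= C * ((2 ^+ s)^-1 * 1 + et) by rewrite mulr1.
(* If [4^s r >= 1] the uniform bound suffices. Otherwise [4^s r] disposes of one factor, and
   [r^2 <= r <= 4^(-s) <= 2^(-s)] of another. *)
have b2 : X <= C * ((2 ^+ s)^-1 * (4 ^+ s * r) + et).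
{ case: (leP 1 (4 ^+ s * r)) => hr; first by apply: W; nra.
  have r1 : r < 1 by nra.
  apply: le_trans (h3 r1) _; rewrite ler_wpM2l // lerD2r.
  have -> : 16 ^+ s * r ^+ 4 = (4 ^+ s * r) * ((4 ^+ s * r) * (r ^+ 2)).
  { have -> : 16 ^+ s = 4 ^+ s * 4 ^+ s :> R by rewrite -exprMn; congr (_ ^+ _); ring.
    ring. }
  rewrite mulrC ler_wpM2r ?mulr_ge0 ?exprn_ge0 //.
  apply: le_trans (_ : r ^+ 2 <= _); first by rewrite ler_piMl ?exprn_ge0 // ltW.
  have : r <= (4 ^+ s)^-1 by rewrite -(ler_pM2l (lt_le_trans ltr01 p4)) divff ?ltW // gt_eqF; lra.
  have : (4 ^+ s)^-1 <= (2 ^+ s)^-1 :> R.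
  { rewrite lef_pV2 ?posrE ?exprn_gt0 //; apply: lerXn2r; rewrite ?nnegrE //; lra. }
  rewrite expr2; nra. }
have b3 : X <= C * ((2 ^+ s)^-1 * (2 ^+ s / r) + et).
{ rewrite mulrA mulVf ?mul1r; last by rewrite gt_eqF; clear - p2 W b1; lra.
  case: (leP 1 r) => hr; first exact: h2.
  move: r0; rewrite le_eqVlt => /orP[/eqP r0|r0].
  { by have := h3 hr; rewrite -r0 expr0n /= mulr0 invr0. }
  apply: W; apply: le_trans ps1 _; rewrite invf_ge1 //; exact: ltW. }
have mn x y : X <= C * ((2 ^+ s)^-1 * x + et) -> X <= C * ((2 ^+ s)^-1 * y + et) ->
  X <= C * ((2 ^+ s)^-1 * Num.min x y + et) by case: (leP x y).
by apply: (mn) => //; apply: (mn).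
Qed.

Lemma sum_geom2_ge1 (x : R) n : 1 <= x ->
  \sum_(0 <= k < n) Num.min (x * 2 ^+ k) (x * 2 ^+ k)^-1 <= 2 / x.
Proof.
elim: n x => [|m IH] x x1; first by rewrite big_geq // divr_ge0 //; lra.
rewrite big_nat_recl //= expr0 mulr1.
rewrite (eq_bigr (fun k => Num.min (x * 2 * 2 ^+ k) (x * 2 * 2 ^+ k)^-1)); last first.
{ by move=> i _; rewrite exprS mulrA. }
have := IH (x * 2) (ltac:(lra)).
have : Num.min x x^-1 <= x^-1 by rewrite ge_min lexx orbT.
have -> : 2 / (x * 2) = x^-1 by field; rewrite gt_eqF //; lra.
have -> : 2 / x = x^-1 + x^-1 by ring.
lra.
Qed.

Lemma sum_geom2 (rho : R) n : 0 < rho ->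
  \sum_(0 <= k < n) Num.min (rho * 2 ^+ k) (rho * 2 ^+ k)^-1 <= 4.
Proof.
move=> r0; case: (leP 1 rho) => r1.
{ by apply: le_trans (sum_geom2_ge1 _ _ r1) _; rewrite ler_pdivrMr //; lra. }
suff : \sum_(0 <= k < n) Num.min (rho * 2 ^+ k) (rho * 2 ^+ k)^-1 <= 4 - rho by lra.
elim: n rho r0 r1 => [|m IH] x x0 x1; first by rewrite big_geq //; lra.
rewrite big_nat_recl //= expr0 mulr1.
rewrite (eq_bigr (fun k => Num.min (x * 2 * 2 ^+ k) (x * 2 * 2 ^+ k)^-1)); last first.
{ by move=> i _; rewrite exprS mulrA. }
have hm : Num.min x x^-1 <= x by rewrite ge_min lexx.
case: (ltP (x * 2) 1) => x2.
{ have := IH (x * 2) (ltac:(lra)) x2; lra. }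
have := sum_geom2_ge1 (x * 2) m x2.
have -> : 2 / (x * 2) = x^-1 by field; rewrite gt_eqF.
have : x^-1 <= 4 - 2 * x by rewrite -(ler_pM2l x0) divff ?gt_eqF //; nra.
lra.
Qed.

Lemma pow2_locate (rho : R) n : 1 <= rho -> rho < 2 ^+ n ->
  exists2 j, (j < n)%N & 2 ^+ j <= rho < 2 ^+ j.+1.
Proof.
move=> r1; elim: n => [|n IH]; first by rewrite expr0 ltNge r1.
case: (ltP rho (2 ^+ n)) => h h2.
{ by have [j jn hj] := IH h; exists j => //; exact: ltnW. }
by exists n => //; rewrite h h2.
Qed.

(** The plateau of [omega] is covered by [3s + 1] tents [min(x, 1/x)], each with a bounded sum over
    dyadic scales; this is where the factor [s] arises. *)
Lemma omega_le_sum s (r : R) : 0 < r -> omega s r <=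
  2 * \sum_(0 <= j < (3 * s).+1) Num.min (4 ^+ s * r / 2 ^+ j) (4 ^+ s * r / 2 ^+ j)^-1.
Proof.
move=> r0; set rho := 4 ^+ s * r.
have p4 : 0 < 4 ^+ s :> R by rewrite exprn_gt0.
have rho0 : 0 < rho by rewrite mulr_gt0.
have t0 j : 0 <= Num.min (rho / 2 ^+ j) (rho / 2 ^+ j)^-1.
{ by rewrite le_min invr_ge0 !divr_ge0 ?ltW ?exprn_gt0. }
have one j : (j < (3 * s).+1)%N -> omega s r <= 2 * Num.min (rho / 2 ^+ j) (rho / 2 ^+ j)^-1 ->
  omega s r <= 2 * \sum_(0 <= j < (3 * s).+1) Num.min (rho / 2 ^+ j) (rho / 2 ^+ j)^-1.
{ move=> hj h; apply: le_trans h _; rewrite ler_wpM2l //.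
  rewrite big_mkord (bigD1 (Ordinal hj)) //= lerDl sumr_ge0 //. }
have o1 : omega s r <= 1 by rewrite /omega ge_min lexx.
have o2 : omega s r <= rho by rewrite /omega !ge_min lexx orbT.
have o3 : omega s r <= 8 ^+ s / rho.
{ have -> : 8 ^+ s / rho = 2 ^+ s / r.
  { have -> : 8 ^+ s = 2 ^+ s * 4 ^+ s :> R by rewrite -exprMn; congr (_ ^+ _); ring.
    by rewrite /rho; field; rewrite !gt_eqF. }
  by rewrite /omega !ge_min lexx !orbT. }
have e8 : 8 ^+ s = 2 ^+ (3 * s) :> R by rewrite exprM; congr (_ ^+ _); ring.
case: (leP rho 1) => h1.
{ apply: (one 0%N) => //; rewrite expr0 divr1.
  have -> : Num.min rho rho^-1 = rho by apply: min_l; apply: (le_trans h1); rewrite invf_ge1 //.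
  lra. }
case: (leP (8 ^+ s) rho) => h2.
{ apply: (one (3 * s)%N) => //; rewrite -e8.
  have p8 : 0 < 8 ^+ s :> R by rewrite exprn_gt0.
  have -> : Num.min (rho / 8 ^+ s) (rho / 8 ^+ s)^-1 = (rho / 8 ^+ s)^-1.
  { have h : 1 <= rho / 8 ^+ s by rewrite ler_pdivlMr // mul1r.
    apply: min_r; apply: (fun y => le_trans y h); rewrite invf_le1 //; exact: lt_le_trans ltr01 h. }
  rewrite invf_div; have : 0 <= 8 ^+ s / rho by rewrite divr_ge0 // ltW.
  lra. }
rewrite e8 in h2; have [j hj /andP[j1 j2]] := pow2_locate _ _ (ltW h1) h2.
apply: (one j); first exact: ltnW.
have pj : 0 < 2 ^+ j :> R by rewrite exprn_gt0.
have h : 1 <= rho / 2 ^+ j by rewrite ler_pdivlMr // mul1r.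
have h' : rho / 2 ^+ j <= 2 by rewrite ler_pdivrMr // -exprS ltW.
have -> : Num.min (rho / 2 ^+ j) (rho / 2 ^+ j)^-1 = (rho / 2 ^+ j)^-1.
{ apply: min_r; apply: (fun y => le_trans y h); rewrite invf_le1 //; exact: lt_le_trans ltr01 h. }
apply: le_trans o1 _; rewrite -(ler_pM2r (lt_le_trans ltr01 h)) mul1r mulfVK //.
by rewrite gt_eqF //; lra.
Qed.

Lemma omega_sum s (r : R) n : 0 <= r ->
  \sum_(0 <= k < n) omega s (r * 2 ^+ k) <= 8 * (3 * s + 1)%:R.
Proof.
rewrite le_eqVlt => /orP[/eqP <-|r0].
{ rewrite big1 // => i _; rewrite /omega mul0r mulr0 invr0 mulr0 minxx; apply: min_r; lra. }
apply: (@le_trans _ _ (\sum_(0 <= k < n) 2 * \sum_(0 <= j < (3 * s).+1)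
  Num.min (4 ^+ s * (r * 2 ^+ k) / 2 ^+ j) (4 ^+ s * (r * 2 ^+ k) / 2 ^+ j)^-1)).
{ by apply: ler_sum => k _; apply: omega_le_sum; rewrite mulr_gt0 // exprn_gt0. }
rewrite -mulr_sumr exchange_big /=.
have -> : 8 * (3 * s + 1)%:R = 2 * \sum_(0 <= j < (3 * s).+1) 4 :> R.
{ rewrite sumr_const_nat subn0 addn1 -[X in 2 * X]mulr_natr; ring. }
rewrite ler_wpM2l //; apply: ler_sum => j _.
rewrite (eq_bigr (fun k => Num.min ((4 ^+ s * r / 2 ^+ j) * 2 ^+ k) ((4 ^+ s * r / 2 ^+ j) * 2 ^+ k)^-1)).
{ by apply: sum_geom2; rewrite divr_gt0 ?mulr_gt0 ?exprn_gt0. }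
by move=> k _; congr (Num.min _ _^-1); ring.
Qed.

(** [3/4] is a rational number above [1/sqrt 2]. *)
Lemma eta_geom s u k1 k : (0 < u)%N -> (4 ^ s <= 2 ^ k1)%N ->
  (Num.sqrt (u * 2 ^ (k1 + k))%:R)^-1 <= (2 ^+ s)^-1 * (3 / 4) ^+ k :> R.
Proof.
move=> u0 hk.
have -> : (2 ^+ s)^-1 * (3 / 4) ^+ k = (2 ^+ s * (4 / 3) ^+ k)^-1 :> R.
{ by rewrite invfM; congr (_ * _); rewrite -exprVn invf_div. }
have p0 : 0 < 2 ^+ s * (4 / 3) ^+ k :> R by rewrite mulr_gt0 ?exprn_gt0 //; lra.
rewrite lef_pV2 ?posrE //; last by rewrite sqrtr_gt0 ltr0n muln_gt0 u0 expn_gt0.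
rewrite -(@ler_pXn2r _ 2) ?nnegrE ?sqrtr_ge0 ?(ltW p0) // sqr_sqrtr //.
rewrite exprMn -!exprM (mulnC s) (mulnC k) !exprM.
apply: (@le_trans _ _ ((4 ^ s)%:R * (2 ^ k)%:R)).
{ rewrite !natrX ler_pM ?exprn_ge0 //; last by apply: lerXn2r; rewrite ?nnegrE //; lra.
  by apply: eq_imp_le; congr (_ ^+ _); ring. }
rewrite -natrM ler_nat expnD mulnA leq_mul2r; apply/orP; right.
by apply: leq_trans hk _; rewrite leq_pmull.
Qed.

Lemma sum_geom34 n : \sum_(0 <= k < n) (3 / 4) ^+ k <= 4 :> R.
Proof.
suff : \sum_(0 <= k < n) (3 / 4) ^+ k <= 4 - 4 * (3 / 4) ^+ n :> R.
{ have : 0 <= (3 / 4) ^+ n :> R by rewrite exprn_ge0 //; lra. lra. }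
elim: n => [|n IH]; first by rewrite big_geq // expr0; lra.
by rewrite big_nat_recr //= exprS; lra.
Qed.

Lemma tau_sum s (C r : R) (X : nat -> R) n : 0 <= C -> 0 <= r ->
  (forall k, X k <= C * ((2 ^+ s)^-1 * omega s (r * 2 ^+ k) + (2 ^+ s)^-1 * (3 / 4) ^+ k)) ->
  \sum_(0 <= k < n) X k <= 36 * C * s.+1%:R * (2 ^+ s)^-1.
Proof.
move=> C0 r0 hX; apply: le_trans (ler_sum _ (fun k _ => hX k)) _.
rewrite -mulr_sumr big_split /= -!mulr_sumr -mulrDr.
have h1 := omega_sum s r n r0; have h2 := sum_geom34 n.
have [ps0 _ _ _] := pow2_props s.
have h3 : \sum_(0 <= i < n) omega s (r * 2 ^+ i) + \sum_(0 <= i < n) (3 / 4) ^+ i <= 36 * s.+1%:R :> R.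
{ apply: le_trans (lerD h1 h2) _; rewrite natrD natrM -natr1; have := ler0n R s; lra. }
have -> : 36 * C * s.+1%:R * (2 ^+ s)^-1 = C * ((2 ^+ s)^-1 * (36 * s.+1%:R)) by ring.
by rewrite ler_wpM2l // ler_wpM2l // ltW.
Qed.

End MultiplierEstimates.

(** * Oscillation of the pieces in the short range of scales *)

Section SquareFunctions.
Context {R : realType}.

Lemma eq_frac_coprime (a q a' q' : nat) : (0 < q)%N -> (0 < q')%N -> coprime a q -> coprime a' q' ->
  (a * q' = a' * q)%N -> a = a' /\ q = q'.
Proof.
move=> q0 q0' co co' h.
have d1 : (q %| q')%N by rewrite -(@Gauss_dvdr _ a) 1?coprime_sym // h dvdn_mull.
have d2 : (q' %| q)%N by rewrite -(@Gauss_dvdr _ a') 1?coprime_sym // -h dvdn_mull.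
have e : q = q' by apply/eqP; rewrite eqn_dvd d1 d2.
split => //; subst q'; apply/eqP; by rewrite -(eqn_pmul2r q0) h.
Qed.

Lemma near_unique (a q a' q' D : nat) (alpha : R) : (0 < q <= D)%N -> (0 < q' <= D)%N ->
  coprime a q -> coprime a' q' -> `|alpha - a%:R / q%:R| < (2 * D%:R ^+ 2)^-1 ->
  `|alpha - a'%:R / q'%:R| < (2 * D%:R ^+ 2)^-1 -> a = a' /\ q = q'.
Proof.
move=> /andP[q0 qD] /andP[q0' qD'] co co' h h'.
apply: eq_frac_coprime => //.
have qr : 0 < q%:R :> R by rewrite ltr0n.
have qr' : 0 < q'%:R :> R by rewrite ltr0n.
have Dr : 0 < D%:R :> R by rewrite ltr0n; lia.
have h1 : `|a%:R / q%:R - a'%:R / q'%:R| < (D%:R ^+ 2)^-1 :> R.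
{ have e : (D%:R ^+ 2)^-1 = (2 * D%:R ^+ 2)^-1 + (2 * D%:R ^+ 2)^-1 :> R by field; rewrite gt_eqF.
  have := ler_distD alpha (a%:R / q%:R) (a'%:R / q'%:R).
  rewrite (distrC (a%:R / q%:R) alpha) e; lra. }
have h2 : `|(a * q')%:Z - (a' * q)%:Z|%:~R < 1 :> R.
{ have -> : `|(a * q')%:Z - (a' * q)%:Z|%:~R = `|a%:R / q%:R - a'%:R / q'%:R| * (q%:R * q'%:R) :> R.
  { rewrite -[X in _ * X](@ger0_norm _ (q%:R * q'%:R)) ?mulr_ge0 // -normrM intr_norm; congr (`|_|).
    rewrite rmorphB /= -!pmulrn !natrM; field; by rewrite !gt_eqF. }
  apply: (@lt_le_trans _ _ ((D%:R ^+ 2)^-1 * (q%:R * q'%:R))).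
  { by rewrite ltr_pM2r // mulr_gt0. }
  rewrite mulrC ler_pdivrMr ?exprn_gt0 // mul1r expr2 ler_pM ?ler_nat // ltW //. }
move: h2; rewrite -[1]/(1%:~R) ltr_int; lia.
Qed.

Lemma pow16_sq s (r : R) : 16 ^+ s * r ^+ 4 = (4 ^+ s * r ^+ 2) ^+ 2.
Proof. by rewrite exprMn -!exprM mulnC exprM; congr (_ ^+ _ * _); ring. Qed.

(* The value of the multiplier [msq s N] near [a/q]: a normalised Gauss sum, independent of [N]. *)
Definition gauss_target (s a q : nat) : R[i] :=
  if (2 ^ s < q <= 2 ^ s.+1)%N then pev (asq q) (a%:R / q%:R : R) else 0.

Lemma gauss_target_le s a q : (0 < q)%N -> coprime a q ->
  nm (gauss_target s a q) ^+ 2 <= 20 * 20 * (2 ^+ s)^-1.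
Proof.
move=> q0 co; have [ps0 _ _ psE] := @pow2_props R s.
rewrite /gauss_target; case: ifP => [/andP[qs _]|_].
{ have h : 389 / q%:R <= 20 * 20 / q%:R :> R by rewrite ler_wpM2r ?invr_ge0 ?ler0n //; lra.
  apply: le_trans (gauss_bound _ _ q0 co) (le_trans h _); rewrite ler_pM2l ?mulr_gt0 //.
  by rewrite lef_pV2 ?posrE ?exprn_gt0 ?ltr0n // -psE ler_nat ltnW. }
by rewrite nm0 expr0n; apply: mulr_ge0; [rewrite mulr_ge0|exact: ltW].
Qed.

Lemma msq_lip s N (x y : R) : large_enough s.+1 N ->
  nm (pev (msq s N) x - pev (msq s N) y) <= 80 * 4 ^+ s * (N%:R ^+ 2 * `|x - y|).
Proof.
move=> h; have h' := large_enoughW _ _ h; rewrite /msq !pevM !pevB.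
have [v0 v1 _] := @ulen_bounds R _ _ h; have [u0 u1 _] := @ulen_bounds R _ _ h'.
have [_ _ _ psE] := @pow2_props R s; have [_ _ _ psE'] := @pow2_props R s.+1.
have A1 := @asq_le1 R N y; have AL := asq_lip N x y.
have L1 := upoly_lip (2 ^ s.+1) (ulen s.+1 N) x y v0.
have L0 := upoly_lip (2 ^ s) (ulen s N) x y u0.
have B1 := upoly_le (2 ^ s.+1) (ulen s.+1 N) x.
have B0 := upoly_le (2 ^ s) (ulen s N) x.
rewrite -/(usmooth _ _) in L1 L0 B1 B0.
set P := pev (asq N) x in AL *; set P' := pev (asq N) y in A1 AL *.
set U1 := pev (usmooth s.+1 N) x in L1 B1 *; set U1' := pev (usmooth s.+1 N) y in L1 *.
set U0 := pev (usmooth s N) x in L0 B0 *; set U0' := pev (usmooth s N) y in L0 *.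
have -> : P * (U1 - U0) - P' * (U1' - U0') = (P - P') * (U1 - U0) + P' * ((U1 - U1') - (U0 - U0')) by ring.
apply: le_trans (nmD _ _) _; rewrite !nmM.
have e4 : (2 ^ s)%:R ^+ 2 = 4 ^+ s :> R.
{ rewrite psE -exprM mulnC exprM; congr (_ ^+ _); ring. }
have e4' : (2 ^ s.+1)%:R ^+ 2 = 4 * 4 ^+ s :> R.
{ rewrite psE' -exprM mulnC exprM -exprS; congr (_ ^+ _); ring. }
rewrite e4 in L0 B0; rewrite e4' in L1 B1.
have p4 : 0 < 4 ^+ s :> R by rewrite exprn_gt0.
have hB : nm (U1 - U0) <= 5 * 4 ^+ s by apply: le_trans (nmB _ _) _; lra.
set D := `|x - y| in AL L1 L0 *; have D0 : 0 <= D by exact: normr_ge0.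
have n0 : 0 <= N%:R ^+ 2 :> R by rewrite exprn_ge0.
have hv : (ulen s.+1 N)%:R <= N%:R ^+ 2 :> R.
{ by apply: le_trans v1; rewrite ler_peMr // exprn_ege1 // ler1n. }
have hu : (ulen s N)%:R <= N%:R ^+ 2 :> R.
{ by apply: le_trans u1; rewrite ler_peMr // exprn_ege1 // ler1n. }
have hU : nm (U1 - U1' - (U0 - U0')) <= 40 * 4 ^+ s * (N%:R ^+ 2 * D).
{ apply: le_trans (nmB _ _) _.
  have h1 : (ulen s.+1 N)%:R * D <= N%:R ^+ 2 * D by rewrite ler_wpM2r.
  have h2 : (ulen s N)%:R * D <= N%:R ^+ 2 * D by rewrite ler_wpM2r.
  have h3 : 4 ^+ s * ((ulen s.+1 N)%:R * D) <= 4 ^+ s * (N%:R ^+ 2 * D) by rewrite ler_pM2l.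
  have h4 : 4 ^+ s * ((ulen s N)%:R * D) <= 4 ^+ s * (N%:R ^+ 2 * D) by rewrite ler_pM2l.
  move: L1 L0 h3 h4; clear; lra. }
have hA : nm (P - P') * nm (U1 - U0) <= (8 * N%:R ^+ 2 * D) * (5 * 4 ^+ s) by rewrite ler_pM ?nm_ge0.
have hC : nm P' * nm (U1 - U1' - (U0 - U0')) <= 1 * (40 * 4 ^+ s * (N%:R ^+ 2 * D)) by rewrite ler_pM ?nm_ge0.
move: hA hC; clear; lra.
Qed.

(** At [a/q] itself the kernels are close to 1 or to 0, and [asq N] is a Gauss sum up to an
    incomplete period; the Lipschitz bound carries this over to [a/q + beta]. *)
Lemma msq_near s N (a q : nat) (beta : R) : large_enough s.+1 N ->
  (0 < q)%N -> coprime a q -> (4 * q ^ 2 <= N)%N ->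
  nm (pev (msq s N) (a%:R / q%:R + beta) - gauss_target s a q) <=
  80 * 4 ^+ s * (N%:R ^+ 2 * `|beta|) + 3 * (Num.sqrt N%:R)^-1.
Proof.
move=> h q0 co qN; have h' := large_enoughW _ _ h.
have N0 := large_enough_gt0 _ _ h.
have Nr : 0 < N%:R :> R by rewrite ltr0n.
apply: le_trans (nm_triangle _ (pev (msq s N) (a%:R / q%:R)) _) _; apply: lerD.
{ apply: le_trans (msq_lip _ _ _ _ h) _; apply: eq_imp_le; congr (_ * (_ * `|_|)); ring. }
have q4 : (q <= 4 * N)%N by clear -q0 qN; nia.
have hb : `|0 : R| <= (4 * q%:R * N%:R)^-1 by rewrite normr0 invr_ge0 !mulr_ge0.
have := usmooth_near _ _ _ _ _ h q0 q4 co hb.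
have := usmooth_near _ _ _ _ _ h' q0 q4 co hb.
have [v0 _ _] := @ulen_bounds R _ _ h; have [u0 _ _] := @ulen_bounds R _ _ h'.
rewrite addr0 !kap0 //.
have A1 := @asq_le1 R N (a%:R / q%:R).
have hp : nm (pev (asq N) (a%:R / q%:R) - pev (asq q) (a%:R / q%:R)) <= (Num.sqrt N%:R)^-1 :> R.
{ apply: le_trans (asq_period _ _ _ q0 N0) _.
  have s0 : 0 < Num.sqrt N%:R :> R by rewrite sqrtr_gt0.
  have hs : 2 * q%:R <= Num.sqrt N%:R :> R.
  { rewrite -(@ler_pXn2r _ 2) ?nnegrE ?mulr_ge0 ?sqrtr_ge0 // sqr_sqrtr //.
    by rewrite exprMn -!natrX -natrM ler_nat. }
  have s2 : Num.sqrt N%:R ^+ 2 = N%:R :> R by rewrite sqr_sqrtr.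
  have -> : 2 * q%:R / N%:R = (2 * q%:R / Num.sqrt N%:R) / Num.sqrt N%:R :> R.
  { by rewrite -[in LHS]s2; field; rewrite gt_eqF. }
  by rewrite ler_piMl ?invr_ge0 ?(ltW s0) // ler_pdivrMr // mul1r. }
rewrite /msq pevM pevB.
set P := pev (asq N) _ in A1 hp *; set U1 := pev (usmooth s.+1 N) _; set U0 := pev (usmooth s N) _.
set et := (Num.sqrt N%:R)^-1 in hp *; move=> hU0 hU1.
rewrite /gauss_target; case: (leqP q (2 ^ s)) hU0 => qs hU0.
{ have q1 : (q <= 2 ^ s.+1)%N by apply: leq_trans qs _; rewrite leq_exp2l.
  rewrite q1 in hU1; rewrite /= subr0 nmM.
  have : nm (U1 - U0) <= et + et.
  { apply: le_trans (nm_triangle _ 1 _) _; apply: lerD => //; by rewrite nmBC. }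
  have := nm_ge0 (U1 - U0); have := nm_ge0 P.
  have := nm_ge0 (U1 - 1); move: hU1 A1; set x := nm P; set y := nm (U1 - U0); clear; nra. }
rewrite subr0 in hU0; case: (leqP q (2 ^ s.+1)) hU1 => q1 hU1 /=.
{ set S := pev (asq q) _ in hp *.
  have -> : P * (U1 - U0) - S = P * ((U1 - 1) - U0) + (P - S) by ring.
  apply: le_trans (nmD _ _) _; rewrite nmM.
  have : nm (U1 - 1 - U0) <= et + et by apply: le_trans (nmB _ _) _; exact: lerD.
  have := nm_ge0 (U1 - 1 - U0); have := nm_ge0 P.
  have := nm_ge0 (U1 - 1); move: hU1 A1 hp; set x := nm P; set y := nm (U1 - 1 - U0); clear; nra. }
rewrite subr0 in hU1; rewrite subr0 nmM.
have : nm (U1 - U0) <= et + et by apply: le_trans (nmB _ _) _; exact: lerD.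
have := nm_ge0 (U1 - U0); have := nm_ge0 P.
have := nm_ge0 U1; move: hU1 A1; set x := nm P; set y := nm (U1 - U0); clear; nra.
Qed.

(** The Dirichlet approximation of [alpha] depends on [N]. By the uniqueness hypothesis it either is
    [a/q] or has a denominator beyond [2^(s+1)], where no kernel is present. *)
Lemma msq_bounds_at s N (a q : nat) (alpha : R) : large_enough s.+1 N -> 0 <= alpha ->
  (forall a' q', (0 < q' <= 2 ^ s.+1)%N -> coprime a' q' ->
     `|alpha - a'%:R / q'%:R| <= (4 * q'%:R * N%:R)^-1 -> a' = a /\ q' = q) ->
  let r := N%:R * Num.sqrt `|alpha - a%:R / q%:R| in
  1 <= r -> nm (pev (msq s N) alpha) ^+ 2 <= 64 * 64 * (r^-1 + (Num.sqrt N%:R)^-1).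
Proof.
move=> h al0 uniq r r1; have N0 := large_enough_gt0 _ _ h.
have [a' [q' [/andP[q0 qN] co hb]]] := dirichlet_coprime alpha (4 * N) al0 (ltac:(lia) : (0 < 4 * N)%N).
have hb' : `|alpha - a'%:R / q'%:R| <= (4 * q'%:R * N%:R)^-1.
{ by apply: le_trans hb _; rewrite natrM mulrCA mulrA. }
have [_ B2 B3] := msq_est _ _ _ _ _ h q0 qN co hb'.
rewrite (addrC (a'%:R / q'%:R)) subrK in B2 B3.
have [et0 _ _] := @eta_props R N N0.
case: (leqP q' (2 ^ s.+1)) => q2; last first.
{ apply: le_trans (B3 q2) _; rewrite ler_wpM2l ?mulr_ge0 // lerDr invr_ge0; clear - r1; lra. }
have [e1 e2] : a' = a /\ q' = q by apply: uniq => //; rewrite q0.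
subst a' q'; apply: B2; apply/eqP => b0; move: r1; rewrite /r b0 normr0 sqrtr0 mulr0; lra.
Qed.

Lemma short_tau_core s N (a q : nat) (alpha : R) : large_enough s.+1 N -> 0 <= alpha ->
  (0 < q)%N -> coprime a q -> (4 * q ^ 2 <= N)%N ->
  (forall a' q', (0 < q' <= 2 ^ s.+1)%N -> coprime a' q' ->
     `|alpha - a'%:R / q'%:R| <= (4 * q'%:R * N%:R)^-1 -> a' = a /\ q' = q) ->
  forall r, r = N%:R * Num.sqrt `|alpha - a%:R / q%:R| ->
  nm (pev (msq s N) alpha - (if r < 1 then gauss_target s a q else 0)) ^+ 2 <=
  128 * 128 * ((2 ^+ s)^-1 * omega s r + (Num.sqrt N%:R)^-1).
Proof.
move=> h al0 q0 co qN uniq r rE.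
have N0 := large_enough_gt0 _ _ h.
have [et0 et2 _] := @eta_props R N N0; set et := (Num.sqrt N%:R)^-1 in et0 et2 *.
have [ps0 _ _ _] := @pow2_props R s.
have r0 : 0 <= r by rewrite rE mulr_ge0 ?sqrtr_ge0.
have hM := msq_bound _ _ _ h al0; rewrite -/et in hM.
have hT := gauss_target_le s a q q0 co.
apply: omega_bound => //; first by rewrite ltW.
{ case: ifP => _; last by rewrite subr0; move: hM et0 ps0; clear; lra.
  have := nmD2 (pev (msq s N) alpha) (- gauss_target s a q); rewrite nmN.
  move: hM hT et0 ps0; clear; lra. }
{ move=> r1; rewrite ltNge r1 /= subr0.
  have := msq_bounds_at _ _ _ _ _ h al0 uniq; rewrite -rE -/et => /(_ r1).
  have : 0 <= r^-1 by rewrite invr_ge0.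
  move: et0; clear; lra. }
move=> r1; rewrite r1.
have hL := msq_near s N a q (alpha - a%:R / q%:R) h q0 co qN.
rewrite (addrC (a%:R / q%:R)) subrK -/et in hL.
have r2 : N%:R ^+ 2 * `|alpha - a%:R / q%:R| = r ^+ 2 by rewrite rE exprMn sqr_sqrtr.
rewrite r2 in hL.
have e16 := pow16_sq s r.
rewrite e16; move: hL; set x := 4 ^+ s * r ^+ 2; rewrite -mulrA -/x.
have x0 : 0 <= x by rewrite mulr_ge0 ?exprn_ge0.
clearbody x; set y := nm _ => hL.
have y0 : 0 <= y by exact: nm_ge0.
have h1 : y ^+ 2 <= (80 * x + 3 * et) ^+ 2 by rewrite ler_pXn2r ?nnegrE // addr_ge0 ?mulr_ge0 // ltW.
apply: (le_trans h1).
have h2 : (80 * x + 3 * et) ^+ 2 <= 2 * (80 * x) ^+ 2 + 2 * (3 * et) ^+ 2.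
{ have := sqr_ge0 (80 * x - 3 * et); move: (80 * x) (3 * et) => u v; clear; nra. }
apply: (le_trans h2); rewrite !exprMn.
have := sqr_ge0 x; move: et2 et0; clear; move: (x ^+ 2) => z; lra.
Qed.

(** The pair [t], [r0] must serve all scales [k] at once. At most one fraction with denominator up
    to [2^(s+1)] lies within [1/(2 * 4^(s+1))] of [alpha], and it is used for every [k]; if there is
    none, all Dirichlet denominators are too large and the multiplier is [O(1/sqrt N)]. *)
Lemma short_tau s u k0 (alpha : R) : 0 <= alpha -> (0 < u)%N -> (14 * s.+1 + 10 <= k0)%N ->
  exists t r0, [/\ 0 <= r0, nm t ^+ 2 <= 20 * 20 * (2 ^+ s)^-1 & forall k,
    nm (pev (msq s (u * 2 ^ (k0 + k))) alpha - (if r0 * 2 ^+ k < 1 then t else 0)) ^+ 2 <=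
    128 * 128 * ((2 ^+ s)^-1 * omega s (r0 * 2 ^+ k) + (2 ^+ s)^-1 * (3 / 4) ^+ k)].
Proof.
move=> al0 u0 hk0.
have LE k : large_enough s.+1 (u * 2 ^ (k0 + k)).
{ rewrite /large_enough; apply: (@leq_trans (2 ^ (k0 + k))); first by rewrite leq_exp2l //; lia.
  by rewrite leq_pmull. }
have hs4 : (4 ^ s <= 2 ^ k0)%N by rewrite -[4%N]/(2 ^ 2)%N -expnM leq_exp2l //; lia.
have [ps0 _ _ psE] := @pow2_props R s.
have near_lt (q' : nat) N : large_enough s.+1 N -> (0 < q')%N ->
   (4 * q'%:R * N%:R)^-1 < (2 * ((2 ^ s.+1)%N%:R) ^+ 2)^-1 :> R.
{ move=> h q0; have N0 := large_enough_gt0 _ _ h.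
  rewrite ltf_pV2 ?posrE ?mulr_gt0 ?exprn_gt0 ?ltr0n ?expn_gt0 //.
  rewrite -natrX -!natrM ltr_nat -expnM.
  apply: (@leq_trans (4 * N)); last by rewrite -mulnA leq_mul2l /= leq_pmull.
  rewrite -(expnS 2) -[4%N]/(2 ^ 2)%N; apply: (@leq_trans (2 ^ 2 * 2 ^ (14 * s.+1 + 10))).
  { by rewrite -expnD ltn_exp2l //; lia. }
  by rewrite leq_pmul2l. }
have [[a [q [hq co hd]]]|nex] := pselect (exists a q, [/\ (0 < q <= 2 ^ s.+1)%N, coprime a q &
   `|alpha - a%:R / q%:R| < (2 * ((2 ^ s.+1)%N%:R) ^+ 2)^-1 :> R]); last first.
(* With [r0 = 0] the profile [omega] vanishes, the quotient [2^s / 0] being 0, so only the geometric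
   term has to carry the bound. *)
{ exists 0, 0; split; [by []|by rewrite nm0 expr0n; apply: mulr_ge0; [rewrite mulr_ge0|exact: ltW]|].
  move=> k; rewrite if_same subr0.
  set N := (u * 2 ^ (k0 + k))%N; have h : large_enough s.+1 N := LE k.
  have N0 := large_enough_gt0 _ _ h.
  have [a' [q' [/andP[q0 qN] co hb]]] := dirichlet_coprime alpha (4 * N) al0 (ltac:(lia) : (0 < 4 * N)%N).
  have hb' : `|alpha - a'%:R / q'%:R| <= (4 * q'%:R * N%:R)^-1.
  { by apply: le_trans hb _; rewrite natrM mulrCA mulrA. }
  have [_ _ B3] := msq_est _ _ _ _ _ h q0 qN co hb'.
  rewrite (addrC (a'%:R / q'%:R)) subrK in B3.
  have q2 : (2 ^ s.+1 < q')%N.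
  { rewrite ltnNge; apply/negP => q2; apply: nex; exists a', q'; split => //; first by rewrite q0.
    exact: le_lt_trans hb' (near_lt _ _ h q0). }
  apply: le_trans (B3 q2) _; have he := @eta_geom R s u k0 k u0 hs4; rewrite -/N in he.
  rewrite mul0r /omega mulr0 invr0 mulr0 minxx min_r // mulr0 add0r.
  have := (@eta_props R N N0); case=> et0 _ _; move: he et0; clear; lra. }
have q0 : (0 < q)%N by case/andP: hq.
exists (gauss_target s a q), ((u * 2 ^ k0)%:R * Num.sqrt `|alpha - a%:R / q%:R|); split.
{ by rewrite mulr_ge0 ?sqrtr_ge0. }
{ exact: gauss_target_le. }
move=> k; set N := (u * 2 ^ (k0 + k))%N; have h : large_enough s.+1 N := LE k.
have eN : (u * 2 ^ k0)%:R * Num.sqrt `|alpha - a%:R / q%:R| * 2 ^+ k = N%:R * Num.sqrt `|alpha - a%:R / q%:R|.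
{ rewrite /N expnD !natrM (natrX _ 2 k); ring. }
rewrite eN; apply: le_trans (short_tau_core _ _ _ _ _ h al0 q0 co _ _ _ (erefl _)) _.
{ apply: leq_trans h; case/andP: hq => _ hq.
  apply: (@leq_trans (4 * (2 ^ s.+1) ^ 2)); first by rewrite leq_pmul2l // leq_exp2r.
  rewrite -expnM -[4%N]/(2 ^ 2)%N -expnD leq_exp2l //; lia. }
{ move=> a' q' hq' co' hb; apply: (near_unique _ _ _ _ _ _ hq' hq co' co _ hd).
  by case/andP: hq' => q0' _; apply: le_lt_trans hb (near_lt _ _ h q0'). }
rewrite ler_wpM2l ?mulr_ge0 // lerD2l; exact: eta_geom.
Qed.

Lemma subsum_le (X : nat -> R) d n : (0 < d)%N -> (forall k, 0 <= X k) ->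
  \sum_(0 <= l < n) X (d * l)%N <= \sum_(0 <= k < d * n) X k.
Proof.
move=> d0 X0; rewrite sum_nat_blocks; apply: ler_sum => l _.
by rewrite big_ltn // addn0 lerDl sumr_ge0.
Qed.

Lemma nm_sqr_sum3 (x y z : R[i]) : nm (x - y + z) ^+ 2 <= 3 * (nm x ^+ 2 + nm y ^+ 2 + nm z ^+ 2).
Proof.
have h : nm (x - y + z) <= nm x + nm y + nm z.
{ by apply: le_trans (nmD _ _) _; rewrite lerD2r nmB. }
have x0 := nm_ge0 x; have y0 := nm_ge0 y; have z0 := nm_ge0 z; have := nm_ge0 (x - y + z).
move: (nm x) (nm y) (nm z) (nm _) h x0 y0 z0 => a b c w h a0 b0 c0 w0.
apply: (@le_trans _ _ ((a + b + c) ^+ 2)); first by rewrite ler_pXn2r ?nnegrE // !addr_ge0.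
have := sqr_ge0 (a - b); have := sqr_ge0 (a - c); have := sqr_ge0 (b - c); clear; nra.
Qed.

(** The model value [if r0 * 2^k < 1 then t else 0] jumps at most once in [k]. So consecutive
    differences cost two sums of deviations from the model plus a single [|t|^2], whatever the step
    [d]; the steps [d = 2^j] are those of the dyadic chaining. *)
Lemma short_square s u k0 (alpha : R) d n : 0 <= alpha -> (0 < u)%N -> (14 * s.+1 + 10 <= k0)%N -> (0 < d)%N ->
  \sum_(0 <= l < n) nm (pev (msq s (u * 2 ^ (k0 + d * l.+1))) alpha - pev (msq s (u * 2 ^ (k0 + d * l))) alpha) ^+ 2
  <= 2048 * 2048 * s.+1%:R * (2 ^+ s)^-1.
Proof.
move=> al0 u0 hk0 d0.
have [t [r0 [hr0 ht hX]]] := short_tau s u k0 alpha al0 u0 hk0.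
have [ps0 _ _ _] := @pow2_props R s.
pose m k := pev (msq s (u * 2 ^ (k0 + k))) alpha.
pose I k : R := if r0 * 2 ^+ k < 1 then 1 else 0.
pose X k := nm (m k - (if r0 * 2 ^+ k < 1 then t else 0)) ^+ 2.
have X0 k : 0 <= X k by rewrite /X sqr_ge0.
have Imono i j : (i <= j)%N -> I j <= I i.
{ move=> ij; rewrite /I; case: ifP => hj; case: ifP => hi //.
  move: hi; rewrite (le_lt_trans _ hj) // ler_wpM2l // ler_eXn2l //; lra. }
have I01 k : 0 <= I k <= 1 by rewrite /I; case: ifP => _; clear; lra.
have step l : nm (m (d * l.+1)%N - m (d * l)%N) ^+ 2 <=
   3 * (X (d * l.+1)%N + X (d * l)%N + (I (d * l)%N - I (d * l.+1)%N) * (20 * 20 * (2 ^+ s)^-1)).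
{ pose J k : R[i] := if r0 * 2 ^+ k < 1 then t else 0.
  have -> : m (d * l.+1)%N - m (d * l)%N = (m (d * l.+1)%N - J (d * l.+1)%N) - (m (d * l)%N - J (d * l)%N) + (J (d * l.+1)%N - J (d * l)%N) by ring.
  apply: le_trans (nm_sqr_sum3 _ _ _) _; rewrite ler_wpM2l // lerD2l.
  have := Imono (d * l)%N (d * l.+1)%N; rewrite leq_mul2l leqnSn orbT => /(_ isT).
  rewrite /J /I; case: ifP => _; case: ifP => _.
  { by rewrite !subrr nm0 expr0n mul0r. }
  { by rewrite ler10. }
  { by move=> _; rewrite sub0r nmN subr0 mul1r. }
  by rewrite !subrr nm0 expr0n mul0r. }
apply: le_trans (ler_sum _ (fun l _ => step l)) _.
rewrite -mulr_sumr !big_split /= -mulr_suml.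
have hsum n' : \sum_(0 <= k < n') X k <= 36 * (128 * 128) * s.+1%:R * (2 ^+ s)^-1.
{ apply: (tau_sum s (128 * 128) r0) => //; by rewrite mulr_ge0. }
have S1 : \sum_(0 <= l < n) X (d * l)%N <= 36 * (128 * 128) * s.+1%:R * (2 ^+ s)^-1.
{ apply: le_trans (subsum_le _ _ _ d0 X0) _; exact: hsum. }
have S2 : \sum_(0 <= l < n) X (d * l.+1)%N <= 36 * (128 * 128) * s.+1%:R * (2 ^+ s)^-1.
{ apply: le_trans (_ : \sum_(0 <= l < n.+1) X (d * l)%N <= _); first by rewrite [leRHS]big_nat_recl // lerDr.
  apply: le_trans (subsum_le _ _ _ d0 X0) _; exact: hsum. }
have S3 : \sum_(0 <= l < n) (I (d * l)%N - I (d * l.+1)%N) <= 1.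
{ have -> : \sum_(0 <= l < n) (I (d * l)%N - I (d * l.+1)%N) = - \sum_(0 <= l < n) (I (d * l.+1)%N - I (d * l)%N).
  { by rewrite -sumrN; apply: eq_bigr => l _; rewrite opprB. }
  rewrite (telescope_sumr (fun l => I (d * l)%N)) //.
  have := I01 (d * n)%N; have := I01 (d * 0)%N; clear; lra. }
have S3' : (\sum_(0 <= l < n) (I (d * l)%N - I (d * l.+1)%N)) * (20 * 20 * (2 ^+ s)^-1) <= 1 * (20 * 20 * (2 ^+ s)^-1).
{ by apply: ler_wpM2r. }
have s1 : (2 ^+ s)^-1 <= s.+1%:R * (2 ^+ s)^-1 :> R by rewrite ler_peMl ?(ltW ps0) // ler1n.
have E c : c * s.+1%:R * (2 ^+ s)^-1 = c * (s.+1%:R * (2 ^+ s)^-1) :> R by rewrite mulrA.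
rewrite !E in S1 S2 *; move: S1 S2 S3' s1 ps0; move: (s.+1%:R / 2 ^+ s) => w; clear; lra.
Qed.

End SquareFunctions.

(** * Comparison with averages of a power of the transformation in the long range *)

Section LongRange.
Context {R : realType}.

(* A common multiple of all denominators up to [2^(s+1)] that is also admissible as a scale for [msq s]. *)
Definition bigQ (s : nat) : nat := ((2 ^ s.+1)`! * 2 ^ (14 * s.+1 + 10))%N.

Lemma bigQ_large s : large_enough s.+1 (bigQ s).
Proof. by rewrite /large_enough /bigQ leq_pmull // fact_gt0. Qed.

Lemma bigQ_gt0 s : (0 < bigQ s)%N.
Proof. by rewrite muln_gt0 fact_gt0 expn_gt0. Qed.

Lemma dvdn_bigQ s q : (0 < q <= 2 ^ s.+1)%N -> (q %| bigQ s)%N.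
Proof. by move=> h; rewrite dvdn_mulr // dvdn_fact. Qed.

(** The power of 2 in [bigQ] contains [16^s'], so the kernel length at scale [bigQ] is an integer
    multiple of [bigQ], hence of all denominators, as [upoly_exact] requires. *)
Lemma bigQ_ulen s s' : (s' <= s.+1)%N -> (bigQ s %| ulen s' (bigQ s))%N.
Proof.
move=> hs; have d : (16 ^ s' %| bigQ s)%N.
{ rewrite dvdn_mull // -[16%N]/(2 ^ 4)%N -expnM dvdn_exp2l //; lia. }
by rewrite /ulen -mulnn -muln_divA // dvdn_mulr.
Qed.

Lemma msq_bigQ_exact s (a q : nat) : (0 < q)%N -> coprime a q -> (q %| bigQ s)%N ->
  pev (msq s (bigQ s)) (a%:R / q%:R : R) = gauss_target s a q.
Proof.
move=> q0 co dq; rewrite /msq pevM pevB /usmooth.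
have h := bigQ_large s; have h' := large_enoughW _ _ h.
have [v0 _ _] := @ulen_bounds R _ _ h; have [u0 _ _] := @ulen_bounds R _ _ h'.
have d1 : (bigQ s %| ulen s.+1 (bigQ s))%N by apply: bigQ_ulen.
have d0 : (bigQ s %| ulen s (bigQ s))%N by apply: bigQ_ulen.
rewrite !(@upoly_exact R _ _ a q 0) //; last first.
{ by move=> q' hq'; apply: dvdn_trans d1; exact: dvdn_bigQ. }
{ exact: dvdn_trans d1. }
{ move=> q' /andP[hq1 hq2]; apply: dvdn_trans d0; apply: dvdn_bigQ; rewrite hq1 /=.
  by apply: leq_trans hq2 _; rewrite leq_exp2l. }
{ exact: dvdn_trans d0. }
rewrite /gauss_target; case/dvdnP: dq => j ej.
have j0 : (0 < j)%N by move: (bigQ_gt0 s); rewrite ej; case: (j).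
rewrite ej mulnC asq_period_exact //.
case: (leqP q (2 ^ s)) => qs.
{ have -> : (q <= 2 ^ s.+1)%N by apply: leq_trans qs _; rewrite leq_exp2l.
  by rewrite subrr mulr0. }
by case: ifP => _; rewrite subr0 ?mulr1 ?mulr0.
Qed.

Definition kpoly (Q H : nat) : {poly R} := (H%:R)^-1 *: \sum_(0 <= h < H) 'X^(Q * h).

Lemma pev_kpoly Q H t : pev (kpoly Q H) t = kap H (Q%:R * t).
Proof.
rewrite /kpoly pevZ pev_sum /kap; congr (_ * _); apply: eq_bigr => h _.
by rewrite pevXn cexpX natrM mulrA (mulrC t).
Qed.

Lemma long_kap (Q H N : nat) (beta : R) : (0 < Q)%N -> (0 < H)%N ->
  `|Q%:R * beta| <= 1 / 2 -> (H * Q)%:R <= N%:R ^+ 2 :> R -> N%:R ^+ 2 <= 2 * (H * Q)%:R :> R ->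
  nm (1 - kap H (Q%:R * beta)) <= 8 * (N%:R ^+ 2 * `|beta|) /\
  (0 < N%:R ^+ 2 * `|beta| -> nm (kap H (Q%:R * beta)) <= 4 / (N%:R ^+ 2 * `|beta|)).
Proof.
move=> Q0 H0 hb h1 h2.
have Qr : 0 < Q%:R :> R by rewrite ltr0n.
have Hr : 0 < H%:R :> R by rewrite ltr0n.
rewrite normrM normr_nat in hb; split.
{ apply: le_trans (kap_near _ _ H0) _; rewrite normrM normr_nat -mulrA ler_wpM2l //.
  by rewrite mulrA -natrM ler_wpM2r. }
move=> x0; have b0 : 0 < `|beta|.
{ rewrite lt0r normr_ge0 andbT; apply/eqP => e; move: x0; rewrite e mulr0 ltxx //. }
apply: le_trans (kap_far _ _ (Q%:R * `|beta|) H0 _ _) _.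
{ by rewrite mulr_gt0. }
{ move=> k; case: (eqVneq k 0) => [->|k0]; first by rewrite subr0 normrM normr_nat.
  have k1 : 1 <= `|k%:~R| :> R by rewrite -intr_norm -[1]/(1%:~R) ler_int; move: k0; lia.
  rewrite distrC; have := lerB_dist (k%:~R) (Q%:R * beta); rewrite normrM normr_nat.
  move: hb k1; clear; lra. }
have y0 : 0 < (H * Q)%:R * `|beta| by rewrite mulr_gt0 // ltr0n muln_gt0 H0.
rewrite mulrA -natrM ler_pdivrMr // mulrAC ler_pdivlMr //.
have : N%:R ^+ 2 * `|beta| <= 2 * (H * Q)%:R * `|beta| by rewrite ler_wpM2r.
move: (N%:R ^+ 2 * `|beta|) => x; rewrite -mulrA; move: (_ * `|beta|) => y; clear; lra.
Qed.

(** Near [a/q] both sides are close to the same Gauss sum: [msq s Q] takes that value exactly at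
    fractions whose denominator divides [Q], and the kernel of [T^Q] is close to 1. Far from [a/q]
    both are small, since the length [N^2 / Q] puts the kernel of [T^Q] at the same scale
    [|beta| = N^(-2)] as the average itself. *)
Lemma long_tau s (alpha : R) : 0 <= alpha -> exists2 rho, 0 <= rho &
  forall N, (4 * bigQ s ^ 2 <= N)%N ->
  nm (pev (msq s N) alpha - pev (msq s (bigQ s)) alpha * pev (kpoly (bigQ s) (N ^ 2 %/ bigQ s)) alpha) ^+ 2 <=
  128 * 128 * 128 * ((2 ^+ s)^-1 * omega s (N%:R * rho) + (Num.sqrt N%:R)^-1).
Proof.
move=> al0; set Q := bigQ s.
have Q0 : (0 < Q)%N := bigQ_gt0 s.
have Qr : 0 < Q%:R :> R by rewrite ltr0n.
(* [b/Q] is the nearest fraction to [alpha] with denominator [Q], and [a/q] is its reduced form; it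
   does not depend on [N]. *)
pose b := Num.truncn (Q%:R * alpha + 1 / 2).
have := truncn_itv (_ : 0 <= Q%:R * alpha + 1 / 2); rewrite -/b => /(_ _) /andP[].
{ by rewrite addr_ge0 // ?mulr_ge0 //; lra. }
rewrite -[b.+1%:R]natr1 => b1 b2.
pose g := gcdn b Q.
have g0 : (0 < g)%N by rewrite gcdn_gt0 Q0 orbT.
pose a := (b %/ g)%N; pose q := (Q %/ g)%N.
have eb : b = (a * g)%N by rewrite divnK ?dvdn_gcdl.
have eQ : Q = (q * g)%N by rewrite divnK ?dvdn_gcdr.
have q0 : (0 < q)%N by rewrite divn_gt0 // dvdn_leq // dvdn_gcdr.
have co : coprime a q by rewrite /coprime -(@eqn_pmul2r g) // mul1n muln_gcdl -eb -eQ.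
have dq : (q %| Q)%N by rewrite eQ dvdn_mulr.
have qQ : (q <= Q)%N by apply: dvdn_leq.
pose beta := alpha - a%:R / q%:R.
have ab : a%:R / q%:R = b%:R / Q%:R :> R.
{ have gr : g%:R != 0 :> R by rewrite pnatr_eq0 -lt0n.
  by rewrite eb eQ !natrM -mulf_div divff // mulr1. }
have eal : alpha = a%:R / q%:R + beta by rewrite /beta addrC subrK.
have Qb : Q%:R * beta = Q%:R * alpha - b%:R by rewrite /beta ab; field; rewrite gt_eqF.
have hQb : `|Q%:R * beta| <= 1 / 2 by rewrite Qb ler_norml; apply/andP; split; clear - b1 b2; lra.
exists (Num.sqrt `|beta|); first exact: sqrtr_ge0.
move=> N hN.
have QN : (Q <= N)%N by clear -Q0 hN; nia.
have N0 : (0 < N)%N by exact: leq_trans QN.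
have h : large_enough s.+1 N by apply: leq_trans (bigQ_large s) QN.
have hQ := bigQ_large s; rewrite -/Q in hQ.
have [et0 et2 _] := @eta_props R N N0; set et := (Num.sqrt N%:R)^-1 in et0 et2 *.
have [ps0 ps1 _ _] := @pow2_props R s.
pose H := (N ^ 2 %/ Q)%N.
have QN2 : (Q <= N ^ 2)%N by clear -QN N0; nia.
have H0 : (0 < H)%N by rewrite divn_gt0.
have H1 : (H * Q)%:R <= N%:R ^+ 2 :> R by rewrite -natrX ler_nat leq_trunc_div.
have H2 : N%:R ^+ 2 <= 2 * (H * Q)%:R :> R.
{ rewrite -natrX -natrM ler_nat.
  have h3 : (N ^ 2 < H.+1 * Q)%N := ltn_ceil (N ^ 2) Q0.
  by clear -h3 H0; nia. }
have [K1 K2] := long_kap _ _ _ _ Q0 H0 hQb H1 H2.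
have eK : pev (kpoly Q H) alpha = kap H (Q%:R * beta).
{ by rewrite pev_kpoly -(kapDn _ (Q%:R * beta) b) Qb subrK. }
rewrite eK; set r := N%:R * Num.sqrt `|beta|.
have r0 : 0 <= r by rewrite mulr_ge0 ?sqrtr_ge0.
have r2 : N%:R ^+ 2 * `|beta| = r ^+ 2 by rewrite exprMn sqr_sqrtr.
rewrite r2 in K1 K2.
have hM := msq_bound _ _ _ h al0; rewrite -/et in hM.
have hMQ : nm (pev (msq s Q) alpha) ^+ 2 <= 64 * 128 * (2 ^+ s)^-1.
{ have := msq_bound _ _ _ hQ al0.
  have : (Num.sqrt Q%:R)^-1 <= (2 ^+ s)^-1 :> R.
  { rewrite lef_pV2 ?posrE ?exprn_gt0 ?sqrtr_gt0 //.
    apply: le_trans (large_enough_sqrt _ _ (large_enoughW _ _ hQ)).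
    apply: (@le_trans _ _ (128 ^+ s)); first by apply: lerXn2r; rewrite ?nnegrE //; clear; lra.
    by rewrite ler_peMl ?exprn_ge0 //; clear; lra. }
  clear; lra. }
(* Such a denominator divides [Q], so the fraction is [(a' j)/Q]; its numerator differs from [b] by
   at most [1/2 + 1/4], hence equals [b]. *)
have uniq a' q' : (0 < q' <= 2 ^ s.+1)%N -> coprime a' q' ->
     `|alpha - a'%:R / q'%:R| <= (4 * q'%:R * N%:R)^-1 -> a' = a /\ q' = q.
{ move=> hq' co' hd; have /dvdnP[j ej] := dvdn_bigQ s q' hq'; rewrite -/Q in ej.
  case/andP: hq' => q0' hq'; have qr' : 0 < q'%:R :> R by rewrite ltr0n.
  have Nr : 0 < N%:R :> R by rewrite ltr0n.
  have hb : b = (a' * j)%N.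
  { have h1 : `|b%:R - (a' * j)%:R| < 1 :> R.
    { have -> : b%:R - (a' * j)%:R = - (Q%:R * beta) + Q%:R * (alpha - a'%:R / q'%:R) :> R.
      { rewrite Qb ej !natrM; field; by rewrite gt_eqF. }
      apply: le_lt_trans (ler_normD _ _) _; rewrite normrN [X in _ + X]normrM normr_nat.
      have h2 : Q%:R * `|alpha - a'%:R / q'%:R| <= 1 / 4.
      { apply: le_trans (ler_wpM2l (ltW Qr) hd) _; rewrite ler_pdivrMr ?mulr_gt0 //.
        have q1 : 1 <= q'%:R :> R by rewrite ler1n.
        have : Q%:R <= N%:R :> R by rewrite ler_nat.
        move: Qr q1; clear; nra. }
      move: hQb h2; clear; lra. }
    have : `|b%:Z - (a' * j)%:Z|%:~R < 1%:~R :> R by rewrite intr_norm rmorphB /= -!pmulrn.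
    rewrite ltr_int; move: (b) => b'; clear; lia. }
  apply: eq_frac_coprime => //.
  apply/eqP; rewrite -(eqn_pmul2r g0) -mulnA -eQ ej mulnA mulnAC mulnAC.
  by rewrite -(mulnA a') -[X in _ == X]mulnAC -eb hb mulnA. }
set MM := pev (msq s N) alpha in hM *; set MQ := pev (msq s Q) alpha in hMQ *.
set ka := kap H _ in K1 K2 *.
have k1 : nm ka <= 1 by exact: kap_le1.
have nk0 := nm_ge0 ka.
have k2 : nm ka ^+ 2 <= 1 by rewrite expr_le1.
have MQ0 := sqr_ge0 (nm MQ).
apply: omega_bound => //; [by rewrite ltW| | |].
{ have := nmD2 MM (- (MQ * ka)); rewrite nmN nmM exprMn.
  have : nm MQ ^+ 2 * nm ka ^+ 2 <= nm MQ ^+ 2 * 1 by rewrite ler_wpM2l.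
  move: hM hMQ et0 ps0; clear; lra. }
{ move=> r1; have := msq_bounds_at _ _ _ _ _ h al0 uniq; rewrite -/beta -/r -/et => /(_ r1) hM1.
  have rp : 0 < r by clear - r1; lra.
  have ri : r^-1 <= 1 by rewrite invf_le1.
  have ri0 : 0 < r^-1 by rewrite invr_gt0.
  have hk : nm ka ^+ 2 <= 16 * r^-1.
  { have hk' : nm ka <= 4 * (r^-1 * r^-1).
    { by apply: le_trans (K2 _) _; rewrite ?exprn_gt0 // expr2 invfM. }
    have hk'' : nm ka <= 4 * r^-1 by move: hk' ri ri0; clear; nra.
    move: hk'' ri ri0 nk0; clear; nra. }
  have := nmD2 MM (- (MQ * ka)); rewrite nmN nmM exprMn.
  have : nm MQ ^+ 2 * nm ka ^+ 2 <= (64 * 128 * (2 ^+ s)^-1) * (16 * r^-1).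
  { by rewrite ler_pM ?sqr_ge0. }
  have : (2 ^+ s)^-1 * r^-1 <= 1 * r^-1 by rewrite ler_wpM2r // ltW.
  move: hM1 et0 ri0; move: (_^-1) => y; clear; lra. }
move=> r1.
have qN : (4 * q ^ 2 <= N)%N.
{ apply: leq_trans hN; rewrite leq_pmul2l // leq_exp2r //. }
have hL := msq_near s N a q beta h q0 co qN; rewrite -eal r2 -/et -/MM in hL.
have hL' := msq_lip s Q alpha (a%:R / q%:R) hQ.
rewrite msq_bigQ_exact // -/MQ -/beta in hL'.
set t := gauss_target s a q in hL hL'.
have p4 : 1 <= 4 ^+ s :> R by rewrite exprn_ege1 // ler1n.
have e16 := pow16_sq s r.
rewrite e16; move: hL hL'; set x := 4 ^+ s * r ^+ 2; rewrite -!(mulrA 80) -/x => hL hL'.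
have x0 : 0 <= x by rewrite mulr_ge0 ?exprn_ge0.
have hL2 : nm (MQ - t) <= 80 * x.
{ apply: le_trans hL' _; rewrite ler_wpM2l // /x ler_wpM2l ?exprn_ge0 // -r2 ler_wpM2r //.
  by rewrite ler_pXn2r ?nnegrE // ler_nat. }
have rx : r ^+ 2 <= x by rewrite /x ler_peMl ?exprn_ge0.
have hk1 : nm (1 - ka) <= 8 * x by apply: le_trans K1 _; rewrite ler_wpM2l.
clearbody x.
have -> : MM - MQ * ka = (MM - t) - (MQ - t) + MQ * (1 - ka) by ring.
apply: le_trans (nm_sqr_sum3 _ _ _) _; rewrite nmM exprMn.
have sq (u v : R) : 0 <= u -> u <= v -> u ^+ 2 <= v ^+ 2 by move=> u0 uv; rewrite ler_pXn2r ?nnegrE // (le_trans u0).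
have hA := sq _ _ (nm_ge0 _) hL; have hB := sq _ _ (nm_ge0 _) hL2; have hC := sq _ _ (nm_ge0 _) hk1.
have hD : nm MQ ^+ 2 * nm (1 - ka) ^+ 2 <= (64 * 128 * (2 ^+ s)^-1) * (8 * x) ^+ 2 by rewrite ler_pM ?sqr_ge0.
have hD' : (64 * 128 * (2 ^+ s)^-1) * (8 * x) ^+ 2 <= (64 * 128) * (8 * x) ^+ 2.
{ by rewrite ler_wpM2r ?sqr_ge0 // -[leRHS]mulr1 ler_wpM2l // mulr_ge0. }
have hE : (80 * x + 3 * et) ^+ 2 <= 2 * (80 * x) ^+ 2 + 2 * (3 * et) ^+ 2.
{ have := sqr_ge0 (80 * x - 3 * et); move: (80 * x) (3 * et) => u v; clear; nra. }
rewrite !exprMn in hE hD' hB.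
have := sqr_ge0 x; move: hA hB hD hD' hE et2 et0; rewrite !exprMn; move: (x ^+ 2) (_ * _ * _ * (_ * _)) => z w.
by clear; lra.
Qed.

Lemma long_square s u k1 (alpha : R) n : 0 <= alpha -> (0 < u)%N -> (4 * bigQ s ^ 2 <= 2 ^ k1)%N ->
  \sum_(0 <= k < n) nm (pev (msq s (u * 2 ^ (k1 + k)) -
     msq s (bigQ s) * kpoly (bigQ s) ((u * 2 ^ (k1 + k)) ^ 2 %/ bigQ s)) alpha) ^+ 2 <=
  36 * (128 * 128 * 128) * s.+1%:R * (2 ^+ s)^-1.
Proof.
move=> al0 u0 hk; have [rho r0 hr] := long_tau s alpha al0.
apply: (tau_sum s (128 * 128 * 128) ((u * 2 ^ k1)%:R * rho)); [by rewrite !mulr_ge0|by rewrite mulr_ge0|].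
move=> k; rewrite pevB pevM.
have hN : (4 * bigQ s ^ 2 <= u * 2 ^ (k1 + k))%N.
{ apply: leq_trans hk _; apply: (@leq_trans (2 ^ (k1 + k))); first by rewrite leq_exp2l // leq_addr.
  by rewrite leq_pmull. }
apply: le_trans (hr _ hN) _.
have -> : (u * 2 ^ (k1 + k))%:R * rho = (u * 2 ^ k1)%:R * rho * 2 ^+ k.
{ rewrite expnD !natrM (natrX _ 2 k); ring. }
rewrite ler_wpM2l ?mulr_ge0 // lerD2l; apply: eta_geom => //.
apply: leq_trans hk; apply: leq_trans (_ : bigQ s <= _)%N; last by have := bigQ_gt0 s; nia.
by apply: leq_trans (bigQ_large s); rewrite -[4%N]/(2 ^ 2)%N -expnM leq_exp2l //; lia.
Qed.

End LongRange.

(** * Transference and the pointwise ergodic theorem *)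

Section BoundedMeasurable.
Context {d : measure_display} {X : measurableType d} {R : realType}.
Implicit Types (f g : X -> R) (T : X -> X).

(** Bounded everywhere, not only almost everywhere: the class is then closed under composition with
    [T] and under pointwise operations, and its members are integrable. *)
Definition bm f : Prop := measurable_fun setT f /\ exists M : R, forall x, `|f x| <= M.
Lemma bm_cst (c : R) : bm (fun=> c).
Proof. by split; [exact: measurable_cst | exists `|c|]. Qed.

Lemma bmD f g : bm f -> bm g -> bm (fun x => f x + g x).
Proof.
move=> [mf [M hM]] [mg [N hN]]; split; first exact: measurable_funD.
by exists (M + N) => x; apply: le_trans (ler_normD _ _) (lerD _ _).
Qed.

Lemma bmM f g : bm f -> bm g -> bm (fun x => f x * g x).
Proof.
move=> [mf [M hM]] [mg [N hN]]; split; first exact: measurable_funM.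
by exists (M * N) => x; rewrite normrM ler_pM.
Qed.

Lemma bmZ (c : R) f : bm f -> bm (fun x => c * f x).
Proof. by move=> hf; apply: bmM => //; exact: bm_cst. Qed.

Lemma bmN f : bm f -> bm (fun x => - f x).
Proof.
move=> [mf [M hM]]; split; first exact: (measurable_funN mf).
by exists M => x; rewrite normrN.
Qed.

Lemma bmB f g : bm f -> bm g -> bm (fun x => f x - g x).
Proof. by move=> hf hg; apply: bmD => //; exact: bmN. Qed.

Lemma bmX f n : bm f -> bm (fun x => f x ^+ n).
Proof.
move=> hf; elim: n => [|n IH]; first exact: (bm_cst 1).
rewrite (_ : (fun x => f x ^+ n.+1) = (fun x => f x * f x ^+ n)); first exact: bmM.
by apply/funext => x; rewrite exprS.
Qed.

Lemma bm_norm f : bm f -> bm (fun x => `|f x|).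
Proof.
move=> [mf [M hM]]; split; first exact: (measurableT_comp (@normr_measurable R setT) mf).
by exists M => x; rewrite normr_id.
Qed.

Lemma bm_max f g : bm f -> bm g -> bm (fun x => Num.max (f x) (g x)).
Proof.
move=> [mf [M hM]] [mg [N hN]]; split; first exact: measurable_maxr.
exists (M + N) => x; have := hM x; have := hN x; have := normr_ge0 (f x); have := normr_ge0 (g x).
by case: (leP (f x) (g x)) => _; lra.
Qed.

Lemma bm_indic (A : set X) : measurable A -> bm (\1_A : X -> R).
Proof.
move=> mA; split; first exact: measurable_indic.
by exists 1 => x; rewrite indicE; case: (x \in A); rewrite ?normr1 ?normr0.
Qed.

Lemma bm_sum (I : Type) (r : seq I) (F : I -> X -> R) : (forall i, bm (F i)) ->
  bm (fun x => \sum_(i <- r) F i x).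
Proof.
move=> hF; elim: r => [|i r IH].
{ rewrite (_ : (fun x => _) = (fun=> 0)); first exact: bm_cst.
  by apply/funext => x; rewrite big_nil. }
rewrite (_ : (fun x => _) = (fun x => F i x + \sum_(i <- r) F i x)); first exact: bmD.
by apply/funext => x; rewrite big_cons.
Qed.

Lemma bm_comp f T : measurable_fun setT T -> bm f -> bm (fun x => f (T x)).
Proof.
move=> mT [mf [M hM]]; split; first exact: (measurableT_comp mf mT).
by exists M => x.
Qed.

Context (mu : probability X R).

Definition Ex f : R := Rintegral mu setT f.

Lemma bm_integrable f : bm f -> mu.-integrable setT (EFin \o f).
Proof.
move=> [mf [M hM]]; apply: measurable_bounded_integrable => //.
{ exact: le_lt_trans (probability_le1 mu measurableT) (ltry _). }
exists M; split; first exact: num_real.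
by move=> N MN x _ /=; apply: le_trans (hM x) (ltW MN).
Qed.

Lemma ExD f g : bm f -> bm g -> Ex (fun x => f x + g x) = Ex f + Ex g.
Proof. by move=> hf hg; rewrite /Ex RintegralD //; exact: bm_integrable. Qed.

Lemma ExZ (c : R) f : bm f -> Ex (fun x => c * f x) = c * Ex f.
Proof. by move=> hf; rewrite /Ex RintegralZl //; exact: bm_integrable. Qed.

Lemma ExN f : bm f -> Ex (fun x => - f x) = - Ex f.
Proof.
move=> hf; rewrite -mulN1r -(ExZ (-1) f hf); congr Ex; by apply/funext => x; rewrite mulN1r.
Qed.

Lemma ExB f g : bm f -> bm g -> Ex (fun x => f x - g x) = Ex f - Ex g.
Proof. by move=> hf hg; rewrite ExD ?ExN //; exact: bmN. Qed.

Lemma Ex_le f g : bm f -> bm g -> (forall x, f x <= g x) -> Ex f <= Ex g.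
Proof. by move=> hf hg h; apply: le_Rintegral => //; exact: bm_integrable. Qed.

Lemma Ex_cst (c : R) : Ex (fun=> c) = c.
Proof.
have h := congr1 (@fine R) (@probability_setT _ _ _ mu).
by rewrite /Ex Rintegral_cst // -[RHS]mulr1; congr (_ * _).
Qed.

Lemma Ex_ge0 f : (forall x, 0 <= f x) -> 0 <= Ex f.
Proof. by move=> h; apply: Rintegral_ge0. Qed.

Lemma Ex_sum (I : Type) (r : seq I) (F : I -> X -> R) : (forall i, bm (F i)) ->
  Ex (fun x => \sum_(i <- r) F i x) = \sum_(i <- r) Ex (F i).
Proof.
move=> hF; elim: r => [|i r IH].
{ rewrite big_nil -[RHS](Ex_cst 0); congr Ex; by apply/funext => x; rewrite big_nil. }
rewrite big_cons -IH -ExD //; last exact: bm_sum.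
by congr Ex; apply/funext => x; rewrite big_cons.
Qed.

Lemma Ex_indic (A : set X) : measurable A -> Ex (\1_A : X -> R) = fine (mu A).
Proof. by move=> mA; rewrite /Ex /Rintegral integral_indic // setIT. Qed.

Lemma Ex_comp f T : measure_preserving mu T -> bm f -> Ex (fun x => f (T x)) = Ex f.
Proof.
move=> [mT pT] hf; have hfT := bm_comp f T mT hf.
rewrite /Ex /Rintegral; congr fine.
have := @integral_pushforward _ _ _ _ R T mT mu setT (EFin \o f) _ _ measurableT.
rewrite preimage_setT => <-.
{ apply: eq_measure_integral => A mA _; exact: pT. }
{ by apply/measurable_EFinP; case: hf. }
exact: bm_integrable.
Qed.

Lemma mp_id : measure_preserving mu (@id X).
Proof. by split => // A mA; rewrite preimage_id. Qed.

Lemma mp_comp T S : measure_preserving mu T -> measure_preserving mu S -> measure_preserving mu (T \o S).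
Proof.
move=> [mT pT] [mS pS]; split; first exact: measurableT_comp.
move=> A mA; rewrite comp_preimage pS ?pT //.
by rewrite -[X in measurable X]setTI; exact: mT.
Qed.

Lemma mp_iter T n : measure_preserving mu T -> measure_preserving mu (iter n T).
Proof.
move=> hT; elim: n => [|n IH]; first exact: mp_id.
exact: (mp_comp T (iter n T) hT IH).
Qed.

Lemma bm_iter f T n : measure_preserving mu T -> bm f -> bm (fun x => f (iter n T x)).
Proof. by move=> /(mp_iter T n)[mT _] hf; apply: bm_comp. Qed.

Lemma Ex_iter f T n : measure_preserving mu T -> bm f -> Ex (fun x => f (iter n T x)) = Ex f.
Proof. by move=> hT hf; apply: Ex_comp => //; exact: mp_iter. Qed.

(** By monotone convergence the infinite sum is integrable, hence finite almost everywhere.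
    Pointwise decay is later read off from this boundedness. *)
Lemma ae_sum_bounded (g : nat -> X -> R) (C : R) : (forall k, bm (g k)) ->
  (forall k x, 0 <= g k x) -> (forall n, \sum_(0 <= k < n) Ex (g k) <= C) ->
  {ae mu, forall x, exists M : R, forall n, \sum_(0 <= k < n) g k x <= M}.
Proof.
move=> hg g0 hC.
pose F x : \bar R := (\sum_(0 <= k <oo) (g k x)%:E)%E.
have mE k : measurable_fun setT (EFin \o g k) by apply/measurable_EFinP; case: (hg k).
have F0 x : (0 <= F x)%E by apply: nneseries_ge0 => k _ _; rewrite lee_fin.
have mF : measurable_fun setT F.
{ have h := @ge0_emeasurable_sum _ _ R setT (fun k x => (g k x)%:E) xpredT.
  by apply: h => [k x _ _|k _]; [rewrite lee_fin|exact: mE]. }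
have iF : (\int[mu]_x F x <= C%:E)%E.
{ rewrite integral_nneseries //; last by move=> k x _; rewrite lee_fin.
  apply: lime_le.
  { by apply: is_cvg_nneseries => k _ _; apply: integral_ge0 => x _; rewrite lee_fin. }
  apply: nearW => n; have := hC n; rewrite -lee_fin -sumEFin; apply: le_trans.
  apply: lee_sum => k _; rewrite /Ex /Rintegral fineK //.
  by apply: integrable_fin_num => //; exact: bm_integrable. }
have iF' : mu.-integrable setT F.
{ apply/integrableP; split => //.
  rewrite (eq_integral F) => [|x _]; last by rewrite gee0_abs.
  exact: le_lt_trans iF (ltry _). }
have := integrable_ae measurableT iF'; apply: filterS => x /(_ I) hx.
exists (fine (F x)) => n; rewrite -lee_fin fineK // -sumEFin.
by apply: nneseries_lim_ge => k _ _; rewrite lee_fin.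
Qed.

End BoundedMeasurable.

(** * Polynomials in the Koopman operator *)

Section PolynomialOperators.
Context {d : measure_display} {X : measurableType d} {R : realType} (mu : probability X R).
Context (T : X -> X).
Implicit Types (f : X -> R) (p q : {poly R}).

Definition pop p f (x : X) : R := \sum_(0 <= i < size p) p`_i * f (iter i T x).

Lemma popE p f x n : (size p <= n)%N -> pop p f x = \sum_(0 <= i < n) p`_i * f (iter i T x).
Proof.
move=> hn; rewrite /pop [RHS](big_cat_nat _ (n := size p)) //=.
have -> : \sum_(size p <= i < n) p`_i * f (iter i T x) = 0; last by rewrite addr0.
by rewrite big_nat big1 // => i /andP[hi _]; rewrite nth_default // mul0r.
Qed.

Lemma popD p q f x : pop (p + q) f x = pop p f x + pop q f x.
Proof.
pose n := maxn (size p) (size q).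
rewrite (popE (p + q) _ _ n) ?size_polyD // (popE p _ _ n) ?leq_maxl // (popE q _ _ n) ?leq_maxr //.
by rewrite -big_split /=; apply: eq_bigr => i _; rewrite coefD mulrDl.
Qed.

Lemma popZ (a : R) p f x : pop (a *: p) f x = a * pop p f x.
Proof.
rewrite (popE (a *: p) _ _ (size p)) ?size_scale_leq // /pop mulr_sumr.
by apply: eq_bigr => i _; rewrite coefZ mulrA.
Qed.

Lemma pop0 f x : pop 0 f x = 0.
Proof. by rewrite /pop size_poly0 big_geq. Qed.

Lemma popN p f x : pop (- p) f x = - pop p f x.
Proof. by rewrite -scaleN1r popZ mulN1r. Qed.

Lemma popB p q f x : pop (p - q) f x = pop p f x - pop q f x.
Proof. by rewrite popD popN. Qed.

Lemma pop_sum (I : Type) (r : seq I) (P : pred I) (F : I -> {poly R}) f x :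
  pop (\sum_(i <- r | P i) F i) f x = \sum_(i <- r | P i) pop (F i) f x.
Proof.
elim/big_rec2: _ => [|i y q _ <-]; first exact: pop0.
by rewrite popD.
Qed.

Lemma popXn n f x : pop 'X^n f x = f (iter n T x).
Proof.
rewrite /pop size_polyXn big_nat_recr //= coefXn eqxx mul1r big_nat big1 ?add0r // => i /andP[_ hi].
by rewrite coefXn ltn_eqF // mul0r.
Qed.

Lemma poly_sumE p : p = \sum_(0 <= i < size p) p`_i *: 'X^i.
Proof. by rewrite big_mkord -poly_def coefK. Qed.

Lemma popM p q f x : pop (p * q) f x = pop p (pop q f) x.
Proof.
rewrite [in LHS](poly_sumE p) mulr_suml pop_sum /pop; apply: eq_bigr => i _.
rewrite -scalerAl -/(pop _ _ _) popZ; congr (_ * _).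
rewrite [in LHS](poly_sumE q) mulr_sumr pop_sum; apply: eq_bigr => j _.
by rewrite -scalerAr popZ -exprD popXn addnC iterD.
Qed.

Hypothesis hT : measure_preserving mu T.

Lemma bm_pop p f : bm f -> bm (pop p f).
Proof. by move=> hf; apply: bm_sum => i; apply: bmZ; exact: (bm_iter mu). Qed.

End PolynomialOperators.

(** * Transference of multiplier bounds to a measure-preserving system *)

Section Transference.
Context {R : realType}.

Lemma conjcM (z w : R[i]) : conjc (z * w) = conjc z * conjc w.
Proof. exact: rmorphM. Qed.

Lemma conjc_sum (I : Type) (r : seq I) (F : I -> R[i]) :
  conjc (\sum_(i <- r) F i) = \sum_(i <- r) conjc (F i).
Proof. exact: raddf_sum. Qed.

Lemma sum_rev_shift (g : nat -> R) L M : (L <= M)%N ->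
  \sum_(0 <= m < L) g (M.-1 - m)%N = \sum_(M - L <= l < M) g l.
Proof.
move=> LM; have [a ->] : exists a, M = (a + L)%N by exists (M - L)%N; rewrite subnK.
rewrite addnK.
have -> : \sum_(a <= l < a + L) g l = \sum_(0 <= l < L) g (l + a)%N.
{ by rewrite -{1}(add0n a) big_addn addKn. }
rewrite big_nat_rev /=; apply: eq_big_nat => m /andP[_ hm]; congr (g _).
by move: hm; clear; lia.
Qed.

(** Orthogonality of the characters of the cyclic group of order [K]. The identity is exact because
    the degree is below [K], so no two coefficients are aliased. *)
Lemma parseval (P : {poly R}) K : (0 < K)%N -> (size P <= K)%N ->
  \sum_(0 <= i < K) P`_i ^+ 2 = (K%:R)^-1 * \sum_(0 <= j < K) nm (pev P (j%:R / K%:R)) ^+ 2.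
Proof.
move=> K0 hP; have Kr : K%:R != 0 :> R by rewrite pnatr_eq0 -lt0n.
apply: (@complexI R); rewrite rmorphM !rmorph_sum /=.
have -> : \sum_(0 <= j < K) real_complex R (nm (pev P (j%:R / K%:R)) ^+ 2) =
  \sum_(0 <= j < K) \sum_(0 <= i < K) \sum_(0 <= l < K)
    real_complex R (P`_i * P`_l) * cexp ((i%:R - l%:R) / K%:R) ^+ j.
{ apply: eq_bigr => j _; rewrite -mul_conj !(pevE P _ K) // conjc_sum mulr_suml.
  apply: eq_bigr => i _; rewrite mulr_sumr; apply: eq_bigr => l _.
  rewrite conjcM conjc_real -cexpN cexpX (rmorphM (real_complex R)).
  have -> : (i%:R - l%:R) / K%:R * j%:R = j%:R / K%:R * i%:R + - (j%:R / K%:R * l%:R) :> R by ring.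
  rewrite cexpD; ring. }
rewrite exchange_big /= mulr_sumr; apply: eq_big_nat => i /andP[_ iK].
rewrite exchange_big /=.
have inner l : (l < K)%N -> \sum_(0 <= j < K) real_complex R (P`_i * P`_l) * cexp ((i%:R - l%:R) / K%:R) ^+ j
  = if l == i then real_complex R (K%:R * P`_i ^+ 2) else 0.
{ move=> lK; rewrite -mulr_sumr; case: eqP => [->|ne].
  { rewrite subrr mul0r cexp0 (eq_bigr (fun=> 1)); last by move=> j _; rewrite expr1n.
    by rewrite sumr_const_nat subn0 -(rmorph_nat (real_complex R)) -rmorphM; congr (real_complex R _); ring. }
  set t := (i%:R - l%:R) / K%:R.
  have tK : cexp t ^+ K = 1.
  { rewrite cexpX /t mulfVK // cexpD cexpN !cexp_nat conjc1 mulr1 //. }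
  have := geom_cexp t K; rewrite tK subrr => /eqP; rewrite mulf_eq0 => /orP[|/eqP ->]; last by rewrite mulr0.
  rewrite subr_eq0 eq_sym => /eqP t1.
  have := @nm_1cexp_ge R t (K%:R)^-1; rewrite t1 subrr nm0 leNgt => /(_ _) /negP [].
  { move=> k.
    have -> : t - k%:~R = (i%:Z - l%:Z - k * K%:Z)%:~R / K%:R.
    { rewrite /t !rmorphB rmorphM /= -!pmulrn; field; exact: Kr. }
    rewrite normrM normfV normr_nat -{1}(mul1r (K%:R)^-1) ler_wpM2r ?invr_ge0 //.
    rewrite -intr_norm -[1]/(1%:~R) ler_int.
    have : i%:Z - l%:Z - k * K%:Z != 0.
    { apply/eqP => h; apply: ne; have : (l = i %[mod K])%N; last by rewrite !modn_small.
      apply/eqP; rewrite -eqz_nat -!modz_nat.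
      have -> : i%:Z = k * K%:Z + l%:Z by move: h; clear; lia.
      by rewrite modzMDl. }
    by clear; lia. }
  by rewrite invr_gt0 ltr0n. }
rewrite (eq_big_nat _ _ (F2 := fun l => if l == i then real_complex R (K%:R * P`_i ^+ 2) else 0)); last first.
{ by move=> l /andP[_ lK]; exact: inner. }
rewrite -big_mkcond /= big_nat1_eq iK /= -rmorphM mulrA mulVf // mul1r //.
Qed.

Lemma fourier_ineq (n dg L : nat) (p : nat -> {poly R}) (B : R) (F : nat -> R) : 
  (forall i, (size (p i) <= dg)%N) ->
  (forall t : R, 0 <= t -> \sum_(0 <= i < n) nm (pev (p i) t) ^+ 2 <= B) ->
  \sum_(0 <= i < n) \sum_(0 <= m < L) (\sum_(0 <= j < dg) (p i)`_j * F (m + j)%N) ^+ 2 <=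
  B * \sum_(0 <= m < L + dg) F m ^+ 2.
Proof.
move=> hs hB; case: (posnP (L + dg)) => [|M0].
{ move=> /eqP; rewrite addn_eq0 => /andP[/eqP -> /eqP ->]; rewrite [X in _ <= _ * X]big_geq // mulr0.
  by rewrite big1 // => i _; rewrite big_geq. }
(* [F] is reversed so that the correlation with [p i] becomes a coefficient of the product
   [p i * G]; [K] is large enough to hold the whole product. *)
set M := (L + dg)%N in M0 *; pose G : {poly R} := \poly_(i < M) F (M.-1 - i)%N.
pose K := (dg + M)%N.
have K0 : (0 < K)%N by rewrite /K addn_gt0 M0 orbT.
have szG : (size G <= M)%N by rewrite size_poly.
have sz i : (size (p i * G)%R <= K)%N.
{ apply: leq_trans (size_polyMleq _ _) _; have := hs i; rewrite /K; move: szG; clear; lia. }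
have h1 i : \sum_(0 <= m < L) (\sum_(0 <= j < dg) (p i)`_j * F (m + j)%N) ^+ 2 <= \sum_(0 <= l < K) (p i * G)`_l ^+ 2.
{ have -> : \sum_(0 <= m < L) (\sum_(0 <= j < dg) (p i)`_j * F (m + j)%N) ^+ 2 = \sum_(0 <= m < L) (p i * G)`_(M.-1 - m) ^+ 2.
  { apply: eq_big_nat => m /andP[_ mL]; congr (_ ^+ 2); rewrite coefM.
    have hM : (dg <= M.-1 - m + 1)%N by rewrite /M; clear -mL; lia.
    rewrite -(big_mkord xpredT (fun j => (p i)`_j * G`_(M.-1 - m - j))).
    rewrite [RHS](big_cat_nat _ (n := dg)) //=; last by rewrite -addn1.
    rewrite [X in _ = _ + X]big_nat [X in _ = _ + X]big1 ?addr0; last first.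
    { by move=> j /andP[hj _]; rewrite nth_default ?mul0r //; exact: leq_trans (hs i) hj. }
    apply: eq_big_nat => j /andP[_ jd]; congr (_ * _); rewrite coef_poly ifT; last by move: M0; clear; lia.
    congr (F _); move: hM jd mL M0; rewrite /M; clear; lia. }
  rewrite (sum_rev_shift (fun l => (p i * G)`_l ^+ 2)); last by rewrite leq_addr.
  rewrite /K; rewrite [leRHS](big_cat_nat _ (n := M)) //=; last by rewrite leq_addl.
  rewrite [in leRHS](big_cat_nat _ (n := (M - L)%N)) //=; last by rewrite leq_subr.
  have g0 u v : 0 <= \sum_(u <= l < v) (p i * G)`_l ^+ 2 by apply: sumr_ge0 => l _; exact: sqr_ge0.
  have := g0 0%N (M - L)%N; have := g0 M (dg + M)%N; lra. }
apply: le_trans (ler_sum _ (fun i _ => h1 i)) _.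
have h2 : \sum_(0 <= m < M) F m ^+ 2 = \sum_(0 <= l < K) G`_l ^+ 2.
{ rewrite [RHS](big_cat_nat _ (n := M)) //=; last by rewrite leq_addl.
  rewrite [X in _ = _ + X]big_nat [X in _ = _ + X]big1 ?addr0; last first.
  { by move=> l /andP[hl _]; rewrite nth_default ?expr0n //; exact: leq_trans szG hl. }
  rewrite big_nat_rev /=; apply: eq_big_nat => l /andP[_ hl].
  by rewrite coef_poly hl; congr (F _ ^+ 2); move: hl; clear; lia. }
rewrite h2 (parseval G K) //; last by apply: leq_trans szG _; rewrite leq_addl.
under eq_bigr do rewrite parseval //.
rewrite -mulr_sumr mulrCA ler_pM2l ?invr_gt0 ?ltr0n // exchange_big mulr_sumr /=.
apply: ler_sum => j _.
rewrite (eq_bigr (fun i => nm (pev (p i) (j%:R / K%:R)) ^+ 2 * nm (pev G (j%:R / K%:R)) ^+ 2)); last first.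
{ by move=> i _; rewrite pevM nmM exprMn. }
by rewrite -mulr_suml ler_wpM2r ?sqr_ge0 // hB // divr_ge0.
Qed.

(** Calderon's argument: the inequality on the integers is applied to orbit segments of length
    [L + dg] and integrated. Invariance of the measure turns every shift into the same integral. *)
Lemma transference {d : measure_display} {X : measurableType d} (mu : probability X R) (T : X -> X)
  (f : X -> R) (n : nat) (p : nat -> {poly R}) (B : R) : measure_preserving mu T -> bm f ->
  (forall t : R, 0 <= t -> \sum_(0 <= i < n) nm (pev (p i) t) ^+ 2 <= B) ->
  \sum_(0 <= i < n) Ex mu (fun x => pop T (p i) f x ^+ 2) <= B * Ex mu (fun x => f x ^+ 2).
Proof.
move=> hT hf hB; pose dg := (\max_(i < n) size (p i))%N.
pose p' i := if (i < n)%N then p i else 0.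
have hs i : (size (p' i) <= dg)%N.
{ rewrite /p'; case: ltnP => hi; last by rewrite size_poly0.
  exact: (leq_bigmax (Ordinal hi)). }
have hB' t : 0 <= t -> \sum_(0 <= i < n) nm (pev (p' i) t) ^+ 2 <= B.
{ move=> t0; apply: le_trans (hB t t0); apply: eq_imp_le; apply: eq_big_nat => i /andP[_ hi].
  by rewrite /p' hi. }
have bf2 : bm (fun x => f x ^+ 2) by exact: bmX.
set S := \sum_(0 <= i < n) _; set E := Ex mu _.
have key L : L%:R * S <= B * ((L + dg)%:R * E).
{ have -> : L%:R * S = Ex mu (fun x => \sum_(0 <= i < n) \sum_(0 <= m < L) (\sum_(0 <= j < dg) (p' i)`_j * f (iter (m + j) T x)) ^+ 2).
  { rewrite Ex_sum; last first.
    { move=> i; apply: bm_sum => m; apply: bmX; apply: bm_sum => j; apply: bmZ; exact: (bm_iter mu). }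
    rewrite /S mulr_sumr; apply: eq_big_nat => i /andP[_ hi].
    rewrite Ex_sum; last by move=> m; apply: bmX; apply: bm_sum => j; apply: bmZ; exact: (bm_iter mu).
    have -> : L%:R * Ex mu (fun x => pop T (p i) f x ^+ 2) = \sum_(0 <= m < L) Ex mu (fun x => pop T (p i) f x ^+ 2).
    { by rewrite sumr_const_nat subn0 mulr_natl. }
    apply: eq_bigr => m _.
    rewrite -(Ex_iter mu (fun x => pop T (p i) f x ^+ 2) T m hT); last by apply: bmX; exact: (bm_pop mu).
    congr (Ex mu _); apply/funext => x; congr (_ ^+ 2).
    have -> : p i = p' i by rewrite /p' hi.
    rewrite (popE _ _ _ _ dg) //; apply: eq_bigr => j _; by rewrite addnC iterD. }
  have -> : (L + dg)%:R * E = Ex mu (fun x => \sum_(0 <= m < L + dg) f (iter m T x) ^+ 2).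
  { rewrite Ex_sum; last by move=> m; apply: bmX; exact: (bm_iter mu).
    rewrite (eq_bigr (fun=> E)); first by rewrite sumr_const_nat subn0 mulr_natl.
    by move=> m _; rewrite (Ex_iter mu (fun x => f x ^+ 2)). }
  rewrite -ExZ; last by apply: bm_sum => m; apply: bmX; exact: (bm_iter mu).
  apply: Ex_le.
  { apply: bm_sum => i; apply: bm_sum => m; apply: bmX; apply: bm_sum => j; apply: bmZ; exact: (bm_iter mu). }
  { apply: bmZ; apply: bm_sum => m; apply: bmX; exact: (bm_iter mu). }
  by move=> x; apply: (fourier_ineq n dg L p' B (fun m => f (iter m T x)) hs hB'). }
rewrite leNgt; apply/negP => hlt.
have E0 : 0 <= E by apply: Ex_ge0 => x; exact: sqr_ge0.
(* The boundary excess [dg] does not grow with [L], so if the claim failed, an [L] beyond this ratio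
   would contradict [key]. *)
pose L := (Num.truncn (B * (dg%:R * E) / (S - B * E))).+1.
have hL : B * (dg%:R * E) / (S - B * E) < L%:R by exact: truncnS_gt.
have hp : 0 < S - B * E by rewrite subr_gt0.
rewrite ltr_pdivrMr // in hL.
have := key L; rewrite natrD; move: hL; clear; lra.
Qed.

End Transference.

(** The limit is the upper limit [sup S]; values staying below it infinitely often would be
    separated from it by two rationals. The margins [e] correspond to those in [upset]. *)
Lemma no_gap_cvg {R : realType} (u : nat -> R) (M : R) : (forall n, `|u n| <= M) ->
  (forall a b : rat, a < b ->
     ~ ((exists2 e : R, 0 < e & forall m, exists2 n, (m <= n)%N & ratr b + e < u n) /\
        (exists2 e : R, 0 < e & forall m, exists2 n, (m <= n)%N & - ratr a + e < - u n))) ->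
  exists l : R, u n @[n --> \oo] --> l.
Proof.
move=> hM hgap; pose S := [set y : R | forall m, exists2 n, (m <= n)%N & y < u n].
have S0 : S (- M - 1).
{ move=> m; exists m => //; have := hM m; rewrite ler_norml => /andP[]; lra. }
have Sub : has_ubound S.
{ exists M => y hy; have [n _ hn] := hy 0%N; have := hM n; rewrite ler_norml => /andP[]; lra. }
have hS : has_sup S by split => //; exists (- M - 1).
exists (sup S); apply/cvgrPdist_le => e e0.
have [m1 h1] : exists m, forall n, (m <= n)%N -> u n <= sup S + e.
{ apply: contrapT => h; have : sup S + e <= sup S; last by lra.
  apply: ub_le_sup => // m; apply: contrapT => hm; apply: h; exists m => n mn.
  by rewrite leNgt; apply/negP => hn; apply: hm; exists n. }
have lt1 : sup S - e < sup S by lra.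
have [a] := rat_in_itvoo lt1; rewrite in_itv /= => /andP[a1 a2].
have [b] := rat_in_itvoo a2; rewrite in_itv /= => /andP[b1 b2].
have [m2 h2] : exists m, forall n, (m <= n)%N -> sup S - e <= u n.
{ apply: contrapT => h; apply: (hgap a b); first by rewrite -(ltr_rat R).
  split.
  { have [|y Sy hy] := @sup_adherent _ S (sup S - ratr b) _ hS; first by rewrite subr_gt0.
    exists (y - ratr b); first by move: hy; lra.
    by move=> m; have [n mn hn] := Sy m; exists n => //; lra. }
  exists (ratr a - (sup S - e)); first by lra.
  move=> m; apply: contrapT => hm; apply: h; exists m => n mn.
  by rewrite leNgt; apply/negP => hn; apply: hm; exists n => //; lra. }
near=> n; rewrite ler_distlC; apply/andP; split.
{ apply: h2; near: n; exact: nbhs_infty_ge. }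
apply: h1; near: n; exact: nbhs_infty_ge.
Unshelve. all: by end_near.
Qed.

(** * The maximal ergodic inequality and Birkhoff's theorem *)

Section MaximalErgodic.
Context {d : measure_display} {X : measurableType d} {R : realType} (mu : probability X R).
Context (T : X -> X) (hT : measure_preserving mu T).
Implicit Types (f g phi : X -> R).

(** The maximum of 0 and the first [n] partial sums along the orbit, in the recursive form on which
    Garsia's argument rests. *)
Fixpoint maxsum phi (n : nat) (x : X) : R :=
  if n is m.+1 then Num.max 0 (phi x + maxsum phi m (T x)) else 0.

Lemma bm_maxsum phi n : bm phi -> bm (maxsum phi n).
Proof.
move=> hp; elim: n => [|n IH] /=; first exact: bm_cst.
apply: bm_max; first exact: bm_cst.
by apply: bmD => //; apply: bm_comp => //; case: hT.
Qed.

Lemma maxsum_ge0 phi n x : 0 <= maxsum phi n x.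
Proof. by case: n => [|n] //=; rewrite le_max lexx. Qed.

Lemma maxsum_leS phi n x : maxsum phi n x <= maxsum phi n.+1 x.
Proof.
elim: n x => [|n IH] x; first exact: maxsum_ge0.
rewrite -[maxsum phi n.+1 x]/(Num.max 0 (phi x + maxsum phi n (T x))).
rewrite -[maxsum phi n.+2 x]/(Num.max 0 (phi x + maxsum phi n.+1 (T x))).
by rewrite ge_max le_max lexx /= le_max lerD2l IH orbT.
Qed.

Lemma maxsum_ge phi n j x : (j <= n)%N -> \sum_(0 <= i < j) phi (iter i T x) <= maxsum phi n x.
Proof.
elim: n j x => [|n IH] [|j] x // hj; [by rewrite big_geq|by rewrite big_geq ?maxsum_ge0|].
rewrite big_nat_recl //= le_max; apply/orP; right; rewrite lerD2l.
by apply: le_trans (IH j (T x) hj); apply: eq_imp_le; apply: eq_bigr => i _; rewrite -iterSr.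
Qed.

Lemma maxsum_gt0_ex phi n x : 0 < maxsum phi n x ->
  exists2 j, (0 < j <= n)%N & 0 < \sum_(0 <= i < j) phi (iter i T x).
Proof.
suff H : exists2 j, (j <= n)%N & maxsum phi n x = \sum_(0 <= i < j) phi (iter i T x).
{ case: H => j hj -> h; exists j => //; rewrite hj andbT.
  by case: j h {hj} => //; rewrite big_geq // ltxx. }
elim: n x => [|n IH] x; first by exists 0%N => //; rewrite big_geq.
have [j hj e] := IH (T x); rewrite /=; case: leP => _; last by exists 0%N => //; rewrite big_geq.
exists j.+1 => //; rewrite big_nat_recl //= e; congr (_ + _).
by apply: eq_bigr => i _; rewrite -iterSr.
Qed.

Definition maxset phi n : set X := [set x | 0 < maxsum phi n x].

Lemma measurable_maxset phi n : bm phi -> measurable (maxset phi n).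
Proof.
move=> hp; have [mm _] := bm_maxsum phi n hp.
have -> : maxset phi n = setT `&` (maxsum phi n) @^-1` `]0, +oo[%classic.
{ by apply/seteqP; split => x /=; rewrite in_itv /= andbT; [move=> h; split|case]. }
by apply: mm => //; exact: measurable_itv.
Qed.

(** Let [M] be the maximal sum. Where it is positive it equals [phi] plus a shorter maximum at
    [T x], so [phi] dominates [M - M o T]; elsewhere [M - M o T <= 0]. The integral of [M - M o T]
    vanishes by invariance. *)
Lemma garsia phi n : bm phi -> 0 <= Ex mu (fun x => phi x * \1_(maxset phi n) x).
Proof.
move=> hp; case: n => [|n].
{ rewrite (_ : (fun x => _) = (fun=> 0)) ?Ex_cst //; apply/funext => x.
  by rewrite indicE memNset ?mulr0 // /maxset /= ltxx. }
have hM := bm_maxsum phi n.+1 hp.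
have hMT : bm (fun x => maxsum phi n.+1 (T x)) by apply: bm_comp => //; case: hT.
have e : Ex mu (fun x => maxsum phi n.+1 x - maxsum phi n.+1 (T x)) = 0.
{ by rewrite ExB // (Ex_comp mu (maxsum phi n.+1)) // subrr. }
rewrite -e; apply: Ex_le.
{ exact: bmB. }
{ by apply: bmM => //; apply: bm_indic; exact: measurable_maxset. }
move=> x; rewrite indicE; case: (boolP (x \in maxset phi n.+1)) => hx.
{ rewrite mulr1; move: hx; rewrite inE /maxset => hx.
  have : maxsum phi n.+1 x <= phi x + maxsum phi n (T x).
  { move: hx; rewrite -[maxsum phi n.+1 x]/(Num.max 0 (phi x + maxsum phi n (T x))) /=.
    rewrite lt_max ltxx /= => h; by rewrite ge_max (ltW h) lexx. }
  have := maxsum_leS phi n (T x); move: (maxsum phi n.+1 x) (maxsum phi n.+1 (T x)) => u v.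
  lra. }
rewrite mulr0; have h1 : maxsum phi n.+1 x <= 0.
{ rewrite leNgt; apply/negP => h; move: hx; rewrite notin_setE; apply; exact: h. }
have := maxsum_ge0 phi n.+1 (T x); lra.
Qed.

Lemma mu_bigcup_le (A : nat -> set X) (c : R) : (forall n, measurable (A n)) ->
  (forall n, A n `<=` A n.+1) -> (forall n, fine (mu (A n)) <= c) -> (mu (\bigcup_n A n) <= c%:E)%E.
Proof.
move=> mA hA hc.
have mU : measurable (\bigcup_n A n) by exact: bigcupT_measurable.
have mono : {homo A : n m / (n <= m)%N >-> (n <= m)%O}.
{ by apply/nondecreasing_seqP => n; apply/subsetPset. }
have cv := @nondecreasing_cvg_mu _ _ _ mu A mA mU mono.
rewrite -(cvg_lim _ cv) //; apply: lime_le; first by apply/cvg_ex; eexists; exact: cv.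
apply: nearW => n /=; rewrite -(@fineK _ (mu (A n))) ?lee_fin //.
by apply: fin_num_measure.
Qed.

Lemma ergodic_maximal_inequality g (lam : R) : bm g -> 0 < lam ->
  exists2 E : set X, measurable E /\ (mu E <= (Ex mu (fun x => `|g x|) / lam)%:E)%E &
  forall x, ~ E x -> forall n, \sum_(0 <= i < n) `|g (iter i T x)| <= n%:R * lam.
Proof.
move=> hg l0; pose phi x := `|g x| - lam.
have hn : bm (fun x => `|g x|) by exact: bm_norm.
have hp : bm phi by apply: bmB => //; exact: bm_cst.
exists (\bigcup_n maxset phi n); first split.
{ by apply: bigcupT_measurable => n; exact: measurable_maxset. }
{ apply: mu_bigcup_le => n; first exact: measurable_maxset.
  { by move=> x /= hx; apply: lt_le_trans hx (maxsum_leS _ _ _). }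
  have mS := measurable_maxset phi n hp.
  have b1 := @bm_indic _ _ R _ mS.
  rewrite ler_pdivlMr // -Ex_indic // mulrC -ExZ //.
  have := garsia phi n hp.
  rewrite (_ : (fun x => phi x * _) = (fun x => `|g x| * \1_(maxset phi n) x - lam * \1_(maxset phi n) x)); last first.
  { by apply/funext => x; rewrite /phi mulrBl. }
  rewrite ExB; [|exact: bmM|exact: bmZ]; rewrite subr_ge0 => /le_trans; apply.
  apply: Ex_le; [exact: bmM|exact: bm_norm|] => x.
  by rewrite ler_piMr // indicE; case: (_ \in _). }
move=> x hx n; rewrite leNgt; apply/negP => h; apply: hx; exists n => //=.
apply: lt_le_trans (maxsum_ge phi n n x (leqnn n)).
rewrite sumrB sumr_const_nat subn0 -[X in _ - X]mulr_natl subr_gt0 //.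
Qed.

Definition birk f n x : R := (n%:R)^-1 * \sum_(0 <= i < n) f (iter i T x).

Lemma bm_birk f n : bm f -> bm (birk f n).
Proof. by move=> hf; apply: bmZ; apply: bm_sum => i; exact: (bm_iter mu). Qed.

(* The set where the upper limit of the averages exceeds [b], written so that it is visibly measurable
   and [T]-invariant. *)
Definition upset f (b : R) : set X :=
  \bigcup_i \bigcap_m \bigcup_(n in [set n | (m <= n)%N]) [set x | b + i.+1%:R^-1 < birk f n x].

Lemma measurable_gt f (c : R) : bm f -> measurable [set x | c < f x].
Proof.
move=> [mf _]; have -> : [set x | c < f x] = setT `&` f @^-1` `]c, +oo[%classic.
{ by apply/seteqP; split => x /=; rewrite in_itv /= andbT; [move=> h; split|case]. }
by apply: mf => //; exact: measurable_itv.
Qed.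

Lemma measurable_upset f b : bm f -> measurable (upset f b).
Proof.
move=> hf; apply: bigcupT_measurable => i; apply: bigcapT_measurable => m.
by apply: bigcup_measurable => n _; apply: measurable_gt; exact: bm_birk.
Qed.

Lemma upset_def f b x : upset f b x <-> exists2 e : R, 0 < e & forall m, exists2 n, (m <= n)%N & b + e < birk f n x.
Proof.
split.
{ move=> [i _ h]; exists (i.+1%:R^-1); first by rewrite invr_gt0.
  by move=> m; have [n /= mn hn] := h m I; exists n. }
move=> [e e0 h]; exists (Num.truncn e^-1) => // m _.
have [n mn hn] := h m; exists n => //=; apply: le_lt_trans hn; rewrite lerD2l.
rewrite invf_ple ?posrE //; exact: ltW (truncnS_gt _).
Qed.

Lemma birk_shift f x (M : R) n : (forall x, `|f x| <= M) -> (0 < n)%N ->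
  `|birk f n (T x) - birk f n x| <= 2 * M / n%:R.
Proof.
move=> hM n0; have nr : 0 < n%:R :> R by rewrite ltr0n.
have -> : birk f n (T x) - birk f n x = (n%:R)^-1 * (f (iter n T x) - f x).
{ rewrite /birk -mulrBr; congr (_ * _).
  rewrite (eq_bigr (fun i => f (iter i.+1 T x))); last by move=> i _; rewrite -iterSr.
  by rewrite -sumrB (telescope_sumr (fun i => f (iter i T x))). }
rewrite normrM normfV normr_nat mulrC ler_pM2r ?invr_gt0 //.
apply: le_trans (ler_normB _ _) _; have := hM (iter n T x); have := hM x; lra.
Qed.

Lemma upset_inv f b x : bm f -> upset f b (T x) <-> upset f b x.
Proof.
move=> [_ [M hM]].
have M0 : 0 <= M by apply: le_trans (hM x).
have gen y z : (forall n, (0 < n)%N -> `|birk f n y - birk f n z| <= 2 * M / n%:R) -> upset f b y -> upset f b z.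
{ move=> hyz /upset_def[e e0 h]; apply/upset_def; exists (e / 2); first by rewrite divr_gt0.
  move=> m; have [n mn hn] := h (maxn m (Num.truncn (4 * M / e)).+1).
  exists n; first by apply: leq_trans mn; rewrite leq_maxl.
  have n1 : ((Num.truncn (4 * M / e)).+1 <= n)%N by apply: leq_trans mn; rewrite leq_maxr.
  have n0 : (0 < n)%N by exact: leq_trans n1.
  have nr : 0 < n%:R :> R by rewrite ltr0n.
  have h1 : 4 * M / e < n%:R by apply: lt_le_trans (truncnS_gt _) _; rewrite ler_nat.
  have h2 : 2 * M / n%:R <= e / 2.
  { rewrite ler_pdivrMr //; move: h1; rewrite ltr_pdivrMr //; lra. }
  have := hyz n n0; rewrite ler_norml => /andP[]; move: hn h2; lra. }
split; apply: gen => n n0; [|rewrite distrC]; exact: birk_shift.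
Qed.

(** For [phi = (f - b) 1_E] the maximal sets lie in [E] by invariance and exhaust it because the
    averages exceed [b] somewhere along each orbit; the maximal inequality passes to their union. *)
Lemma upset_mean f b (E : set X) : bm f -> measurable E -> (forall x, E (T x) <-> E x) ->
  E `<=` upset f b -> 0 <= Ex mu (fun x => (f x - b) * \1_E x).
Proof.
move=> hf mE invE hE.
have bE := @bm_indic _ _ R _ mE.
pose phi x := (f x - b) * \1_E x.
have hp : bm phi by apply: bmM => //; apply: bmB => //; exact: bm_cst.
have [_ [C hC]] := hp.
have C0 : 0 <= C by apply: le_trans (hC point).
have iterE n x : E (iter n T x) <-> E x.
{ by elim: n => //= n IH; apply: iff_trans (invE _) IH. }
have indE n x : \1_E (iter n T x) = \1_E x :> R.
{ rewrite !indicE; suff -> : (iter n T x \in E) = (x \in E) by [].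
  by apply/idP/idP; rewrite !inE => /iterE. }
have sub n : maxset phi n `<=` E.
{ move=> x /maxsum_gt0_ex[j _]; apply: contraPP => nE; apply/negP; rewrite -leNgt big1 // => i _.
  by rewrite /phi indE indicE memNset // mulr0. }
have cover : E `<=` \bigcup_n maxset phi n.
{ move=> x Ex'; have /upset_def[e e0 h] := hE x Ex'.
  have [n n1 hn] := h 1%N; exists n => //=.
  apply: lt_le_trans (maxsum_ge phi n n x (leqnn n)).
  have nr : 0 < n%:R :> R by rewrite ltr0n.
  have hn' : b < birk f n x by lra.
  rewrite (eq_bigr (fun i => f (iter i T x) - b)); last first.
  { by move=> i _; rewrite /phi indE indicE mem_set // mulr1. }
  rewrite sumrB sumr_const_nat subn0 -[X in _ - X]mulr_natl subr_gt0.
  by move: hn'; rewrite /birk ltr_pdivlMl. }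
have eqU : \bigcup_n maxset phi n = E.
{ by apply/seteqP; split => // x [n _ /sub]. }
rewrite leNgt; apply/negP => hneg.
have mM n := measurable_maxset phi n hp.
(* A negative integral over [E] would keep the measure of all maximal sets below that of [E] by a
   fixed amount, as [|phi| < C + 1]. *)
have bnd n : fine (mu (maxset phi n)) <= fine (mu E) + Ex mu phi / (C + 1).
{ have b1 := @bm_indic _ _ R _ (mM n).
  have := garsia phi n hp => hG.
  have h1 : Ex mu (fun x => phi x * \1_(maxset phi n) x) <= Ex mu (fun x => phi x + (C + 1) * (\1_E x - \1_(maxset phi n) x)).
  { apply: Ex_le; [exact: bmM|apply: bmD => //; apply: bmZ; exact: bmB|] => x.
    rewrite !indicE; case: (boolP (x \in maxset phi n)) => hx.
    { have -> : x \in E by rewrite inE; apply: (sub n); move: hx; rewrite inE.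
      by rewrite subrr mulr0 addr0 mulr1. }
    rewrite mulr0; case: (boolP (x \in E)) => hxE.
    { have := hC x; rewrite ler_norml /= subr0 mulr1 => /andP[]; lra. }
    by rewrite /phi indicE (negbTE hxE) /= mulr0 subrr mulr0 addr0. }
  rewrite ExD // in h1; last by apply: bmZ; exact: bmB.
  rewrite ExZ ?ExB // in h1; last exact: bmB.
  rewrite !Ex_indic // in h1.
  have c1 : 0 < C + 1 by lra.
  have e1 : Ex mu phi / (C + 1) * (C + 1) = Ex mu phi by rewrite mulfVK // gt_eqF.
  rewrite -(ler_pM2r c1) mulrDl e1; move: hG h1; clear; lra. }
have := mu_bigcup_le _ _ mM (fun n x hx => lt_le_trans hx (maxsum_leS phi n x)) bnd.
rewrite eqU -(@fineK _ (mu E)) ?lee_fin; last by apply: fin_num_measure.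
have : Ex mu phi / (C + 1) < 0 by rewrite pmulr_llt0 // invr_gt0; lra.
lra.
Qed.

Lemma birkhoff_gap f (a b : R) : bm f -> a < b ->
  mu.-negligible (upset f b `&` upset (fun x => - f x) (- a)).
Proof.
move=> hf ab; set E := _ `&` _; have hnf := bmN _ hf.
have mE : measurable E by apply: measurableI; exact: measurable_upset.
have invE x : E (T x) <-> E x.
{ split=> -[h1 h2]; split; [apply/(upset_inv f b x hf)|apply/(upset_inv _ (- a) x hnf)|apply/(upset_inv f b x hf)|apply/(upset_inv _ (- a) x hnf)] => //. }
have bE := @bm_indic _ _ R _ mE.
have h1 := upset_mean f b E hf mE invE (@subIsetl _ _ _).
have h2 := upset_mean _ (- a) E hnf mE invE (@subIsetr _ _ _).
suff e0 : fine (mu E) = 0.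
{ have muE : mu E = 0%E by rewrite -[mu E]fineK ?e0 //; apply: fin_num_measure.
  by exists E; split. }
apply/eqP; rewrite eq_le fine_ge0 // andbT.
have h3 : Ex mu (fun x => (f x - b) * \1_E x) + Ex mu (fun x => (- f x - - a) * \1_E x) = (a - b) * fine (mu E).
{ rewrite -Ex_indic // -ExZ // -ExD.
  { by congr (Ex mu _); apply/funext => x; ring. }
  { by apply: bmM => //; apply: bmB => //; exact: bm_cst. }
  by apply: bmM => //; apply: bmB => //; exact: bm_cst. }
have : 0 <= (a - b) * fine (mu E) by rewrite -h3 addr_ge0.
by rewrite nmulr_rge0 // subr_lt0.
Qed.

Theorem birkhoff f : bm f -> {ae mu, forall x, exists l : R, birk f n x @[n --> \oo] --> l}.
Proof.
move=> hf.
pose G (ab : rat * rat) : set X :=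
  if ab.1 < ab.2 then upset f (ratr ab.2) `&` upset (fun x => - f x) (- ratr ab.1) else set0.
have nb (ab : rat * rat) : mu.-negligible (G ab).
{ rewrite /G; case: ifP => h; last exact: negligible_set0.
  by apply: birkhoff_gap => //; rewrite ltr_rat. }
have : mu.-negligible (\bigcup_i (if (unpickle i : option (rat * rat)%type) is Some ab then G ab else set0)).
{ by apply: negligible_bigcup => i; case: unpickle => [ab|]; [exact: nb|exact: negligible_set0]. }
apply: negligibleS => x /= nc; apply: contrapT => hN; apply: nc.
have [_ [M hM]] := hf.
have M0 : 0 <= M by apply: le_trans (hM x).
pose u n := birk f n x.
have ub n : `|u n| <= M.
{ rewrite /u /birk normrM normfV normr_nat.
  case: (posnP n) => [->|n0]; first by rewrite invr0 mul0r.
  rewrite ler_pdivrMl ?ltr0n //; apply: le_trans (ler_norm_sum _ _ _) _.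
  apply: le_trans (ler_sum _ (fun i _ => hM _)) _; by rewrite sumr_const_nat subn0 mulr_natl. }
apply: (no_gap_cvg u M ub) => a b ab [hb ha]; apply: hN.
exists (pickle (a, b)); first exact: I.
rewrite pickleK /G /= ab.
split; apply/upset_def => //.
case: ha => e e0 he; exists e => // m; have [n mn hn] := he m; exists n => //.
by rewrite /birk sumrN mulrN.
Qed.

End MaximalErgodic.

(** * Bourgain's theorem for the squares *)

Section Tends.
Context {R : realType}.
Implicit Types (u v : nat -> R).

Definition tends u (l : R) : Prop :=
  forall e : R, 0 < e -> exists n0, forall n, (n0 <= n)%N -> `|u n - l| <= e.

Lemma tendsP u l : tends u l <-> u n @[n --> \oo] --> l.
Proof.
split.
{ move=> h; apply/cvgrPdist_le => e e0; have [n0 hn] := h e e0.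
  near=> n; rewrite distrC; apply: hn; near: n; exact: nbhs_infty_ge. }
move=> /cvgrPdist_le h e e0; have [n0 _ hn] := h e e0.
by exists n0 => n nn; rewrite distrC; apply: hn.
Unshelve. all: by end_near.
Qed.

Lemma eq_tends u v l : (forall n, u n = v n) -> tends u l -> tends v l.
Proof. by move=> h hu e e0; have [n0 hn] := hu e e0; exists n0 => n nn; rewrite -h; exact: hn. Qed.

Lemma tendsD u v l m : tends u l -> tends v m -> tends (fun n => u n + v n) (l + m).
Proof.
move=> hu hv e e0; have e2 : 0 < e / 2 by rewrite divr_gt0.
have [n1 h1] := hu _ e2; have [n2 h2] := hv _ e2; exists (maxn n1 n2) => n; rewrite geq_max => /andP[a b].
have := h1 n a; have := h2 n b; have := ler_normD (u n - l) (v n - m).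
have -> : u n - l + (v n - m) = u n + v n - (l + m) by ring.
by lra.
Qed.

Lemma tends_sum (I : Type) (r : seq I) (P : pred I) (F : I -> nat -> R) (l : I -> R) :
  (forall i, P i -> tends (F i) (l i)) ->
  tends (fun n => \sum_(i <- r | P i) F i n) (\sum_(i <- r | P i) l i).
Proof.
move=> h; elim: r => [|i r IH].
{ rewrite big_nil => e e0; exists 0%N => n _; by rewrite big_nil subrr normr0 ltW. }
rewrite big_cons; have -> : (fun n => \sum_(j <- i :: r | P j) F j n) =
  (fun n => if P i then F i n + \sum_(j <- r | P j) F j n else \sum_(j <- r | P j) F j n).
{ by apply/funext => n; rewrite big_cons. }
by case: (boolP (P i)) => // Pi; apply: tendsD => //; exact: h.
Qed.

Lemma tends_near u v l : tends v l ->
  (forall e : R, 0 < e -> exists n0, forall n, (n0 <= n)%N -> `|u n - v n| <= e) -> tends u l.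
Proof.
move=> hv huv e e0; have e2 : 0 < e / 2 by rewrite divr_gt0.
have [n1 h1] := huv _ e2; have [n2 h2] := hv _ e2; exists (maxn n1 n2) => n; rewrite geq_max => /andP[a b].
have := h1 n a; have := h2 n b; have := ler_distD (v n) (u n) l; lra.
Qed.

Lemma eventually_uniform (q : nat) (P : nat -> nat -> Prop) :
  (forall r, (r < q)%N -> exists n0, forall n, (n0 <= n)%N -> P r n) ->
  exists n0, forall r, (r < q)%N -> forall n, (n0 <= n)%N -> P r n.
Proof.
elim: q => [|q IH] h; first by exists 0%N.
have [n1 h1] := IH (fun r hr => h r (ltnW hr)); have [n2 h2] := h q (ltnSn q).
exists (maxn n1 n2) => r; rewrite ltnS leq_eqVlt => hr n; rewrite geq_max => /andP[a b].
by case/orP: hr => [/eqP ->|hr]; [exact: h2|exact: h1].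
Qed.

Lemma archi_nat (x : R) : exists n : nat, x <= n%:R.
Proof. by exists (Num.truncn x).+1; exact: ltW (truncnS_gt _). Qed.

Lemma tends_subseq_sums (B : nat -> R) (q : nat) (c l : R) : (0 < q)%N ->
  (forall M, `|B M.+1 - B M| <= c) ->
  tends (fun K => (K%:R)^-1 * B (q * K)%N) l -> tends (fun M => (M%:R)^-1 * B M) (l / q%:R).
Proof.
move=> q0 hB hl; have c0 : 0 <= c by apply: le_trans (hB 0%N).
have qr : 0 < q%:R :> R by rewrite ltr0n.
have q1 : 1 <= q%:R :> R by rewrite ler1n.
have step M r : `|B (M + r)%N - B M| <= r%:R * c.
{ elim: r => [|r IH]; first by rewrite addn0 subrr normr0 mul0r.
  have := hB (M + r)%N; have := ler_distD (B (M + r)%N) (B (M + r).+1) (B M).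
  by rewrite addnS -[r.+1%:R]natr1 mulrDl mul1r; move: IH; lra. }
move=> e e0; have e2 : 0 < e / 2 by rewrite divr_gt0.
have [K0 hK] := hl _ e2.
have [N0 hN0] := archi_nat ((q%:R * c + `|l|) * 2 / e).
exists (maxn (q * K0.+1) N0.+1) => M; rewrite geq_max => /andP[M1 M2].
pose K := (M %/ q)%N; pose r := (M %% q)%N.
have MK : M = (q * K + r)%N by rewrite mulnC -divn_eq.
have rq : (r < q)%N by rewrite ltn_mod.
have K1 : (K0.+1 <= K)%N by rewrite leq_divRL // mulnC.
have Kr : 0 < K%:R :> R by rewrite ltr0n; exact: leq_trans K1.
have Mr : 0 < M%:R :> R by rewrite ltr0n; exact: leq_trans M2.
have h1 := hK K (ltnW K1).
have h1' : `|B (q * K)%N - K%:R * l| <= K%:R * (e / 2).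
{ have -> : B (q * K)%N - K%:R * l = K%:R * ((K%:R)^-1 * B (q * K)%N - l) by field; rewrite gt_eqF.
  by rewrite normrM (gtr0_norm Kr) ler_pM2l. }
have h2 := step (q * K)%N r; rewrite -MK in h2.
have -> : (M%:R)^-1 * B M - l / q%:R = (M%:R)^-1 * ((B M - B (q * K)%N) + (B (q * K)%N - K%:R * l) - r%:R * l / q%:R).
{ rewrite [in LHS]MK [in RHS]MK natrD natrM; field.
  by rewrite (gt_eqF qr) /= -natrM -natrD -MK gt_eqF. }
rewrite normrM normfV (gtr0_norm Mr) ler_pdivrMl //.
have h3 : `|r%:R * l / q%:R| <= `|l|.
{ rewrite !normrM normfV !normr_nat ler_pdivrMr // mulrC ler_wpM2l //.
  by rewrite ler_nat ltnW. }
have h4 : r%:R * c <= q%:R * c by rewrite ler_wpM2r // ler_nat ltnW.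
have h5 : K%:R * (e / 2) <= M%:R * (e / 2).
{ rewrite ler_pM2r // ler_nat MK; apply: leq_trans (leq_addr _ _); exact: leq_pmull. }
have h6 : q%:R * c + `|l| <= M%:R * (e / 2).
{ have : (q%:R * c + `|l|) * 2 / e <= M%:R by apply: le_trans hN0 _; rewrite ler_nat ltnW.
  rewrite ler_pdivrMr //; clear; lra. }
apply: le_trans (ler_normB _ _) _; have := ler_normD (B M - B (q * K)%N) (B (q * K)%N - K%:R * l).
move: h1' h2 h3 h4 h5 h6; clear; lra.
Qed.

Lemma periodic_mod (w : nat -> R) q : (forall n, w (n + q)%N = w n) -> forall n, w n = w (n %% q)%N.
Proof.
move=> h n; rewrite {1}(divn_eq n q); elim: (n %/ q)%N => [|k IH]; first by rewrite mul0n.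
have -> : (k.+1 * q + n %% q = k * q + n %% q + q)%N by rewrite mulSn; clear; lia.
by rewrite h.
Qed.

Lemma tends_periodic_mean (w : nat -> R) (q : nat) : (0 < q)%N -> (forall n, w (n + q)%N = w n) ->
  tends (fun N => (N%:R)^-1 * \sum_(0 <= n < N) w n) ((\sum_(0 <= n < q) w n) / q%:R).
Proof.
move=> q0 hw.
have wm := periodic_mod w q hw.
apply: (tends_subseq_sums _ q (\sum_(0 <= n < q) `|w n|)) => //.
{ move=> M; rewrite big_nat_recr //= [X in `|X|]addrC addKr wm.
  rewrite (bigD1_seq (M %% q)%N) /= ?mem_index_iota ?ltn_mod ?iota_uniq //.
  by rewrite lerDl sumr_ge0. }
move=> e e0; exists 1%N => K K0.
have Kr : K%:R != 0 :> R by rewrite pnatr_eq0 -lt0n.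
rewrite sum_nat_blocks.
have -> : \sum_(0 <= t < K) \sum_(0 <= r < q) w (q * t + r)%N = K%:R * \sum_(0 <= n < q) w n.
{ rewrite (eq_bigr (fun=> \sum_(0 <= n < q) w n)); first by rewrite sumr_const_nat subn0 mulr_natl.
  by move=> t _; apply: eq_big_nat => r /andP[_ hr]; rewrite wm mulnC modnMDl -wm. }
by rewrite mulrA mulVf // mul1r subrr normr0 ltW.
Qed.

Lemma sum_sqr_le (x : nat -> R) n : (\sum_(0 <= j < n) x j) ^+ 2 <= n%:R * \sum_(0 <= j < n) x j ^+ 2.
Proof.
elim: n => [|n IH]; first by rewrite !big_geq // expr0n mul0r.
rewrite !big_nat_recr //=; move: IH.
set S := \sum_(0 <= j < n) x j; set Q := \sum_(0 <= j < n) x j ^+ 2; set y := x n => IH.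
have Q0 : 0 <= Q by apply: sumr_ge0 => j _; exact: sqr_ge0.
case: (posnP n) => [n0|n0].
{ by rewrite /S /Q n0 !big_geq // !add0r mul1r. }
have nr : 0 < n%:R :> R by rewrite ltr0n.
rewrite -[n.+1%:R]natr1; suff : 2 * (S * y) <= Q + n%:R * y ^+ 2 by move: IH; nra.
rewrite -(ler_pM2l nr); have := sqr_ge0 (S - n%:R * y); move: IH; nra.
Qed.

(* Telescope along the binary truncations of [i]: consecutive truncations differ by one dyadic step. *)
Lemma rademacher_menshov (b : nat -> R) J i : (i <= 2 ^ J)%N ->
  (b i - b 0%N) ^+ 2 <= J.+1%:R * \sum_(0 <= j < J.+1) \sum_(0 <= l < 2 ^ (J - j))
     (b (2 ^ j * l.+1)%N - b (2 ^ j * l)%N) ^+ 2.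
Proof.
move=> hi; pose p j := (i %/ 2 ^ j * 2 ^ j)%N.
have -> : b i - b 0%N = \sum_(0 <= j < J.+1) (b (p j) - b (p j.+1)).
{ have -> : \sum_(0 <= j < J.+1) (b (p j) - b (p j.+1)) = - \sum_(0 <= j < J.+1) (b (p j.+1) - b (p j)).
  { by rewrite -sumrN; apply: eq_bigr => j _; rewrite opprB. }
  rewrite (telescope_sumr (fun j => b (p j))) // opprB /p expn0 divn1 muln1; congr (_ - b _).
  by rewrite divn_small // (leq_ltn_trans hi) // ltn_exp2l. }
apply: le_trans (sum_sqr_le _ _) _; rewrite ler_wpM2l //.
apply: ler_sum_nat => j /andP[_ hj].
have d0 : 0 <= \sum_(0 <= l < 2 ^ (J - j)) (b (2 ^ j * l.+1)%N - b (2 ^ j * l)%N) ^+ 2.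
{ by apply: sumr_ge0 => l _; exact: sqr_ge0. }
set v := (i %/ 2 ^ j)%N.
have vE : (i %/ 2 ^ j.+1 = v %/ 2)%N by rewrite expnSr divnMA.
have pj : p j.+1 = (2 ^ j * (v %/ 2 * 2))%N by rewrite /p vE expnSr; clear; lia.
have pj' : p j = (2 ^ j * v)%N by rewrite /p mulnC.
rewrite pj pj'; case: (boolP (odd v)) => ov; last first.
{ have -> : (v %/ 2 * 2 = v)%N by apply/eqP; rewrite -dvdn_eq dvdn2.
  by rewrite subrr expr0n. }
have e1 : (v %/ 2 * 2).+1 = v by rewrite {2}(divn_eq v 2) modn2 ov addn1.
rewrite -{1}e1.
have hv : (v %/ 2 * 2 < 2 ^ (J - j))%N.
{ rewrite e1 /v -(@leq_pmul2r (2 ^ j)) ?expn_gt0 //; apply: leq_trans (leq_trunc_div _ _) _.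
  by rewrite -expnD subnK. }
rewrite (bigD1_seq (v %/ 2 * 2)%N) /= ?mem_index_iota ?iota_uniq // lerDl.
by apply: sumr_ge0 => l _; exact: sqr_ge0.
Qed.

(** For large [N] choose [s] with [N/(c D^s)] between [U] and [U D]. Rounding down to a multiple
    [u c D^s] alters the average of a bounded sequence by at most [2K/U], and only finitely many [u]
    occur, so their convergence is uniform. *)
Lemma tends_sandwich (F : nat -> R) (K L : R) (c D : nat) : (0 < c)%N -> (1 < D)%N ->
  (forall n, `|F n| <= K) ->
  (forall u : nat, (0 < u)%N -> tends (fun s => ((u * (c * D ^ s))%:R)^-1 * \sum_(1 <= n < (u * (c * D ^ s)).+1) F n) L) ->
  tends (fun N => (N%:R)^-1 * \sum_(1 <= n < N.+1) F n) L.
Proof.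
move=> c0 D1 hF hu e e0; have K0 : 0 <= K by apply: le_trans (hF 0%N).
have e2 : 0 < e / 2 by rewrite divr_gt0.
have [U0 hU0] := archi_nat (4 * K / e); pose U := U0.+1.
pose A N := (N%:R)^-1 * \sum_(1 <= n < N.+1) F n.
have diff N' N : (0 < N')%N -> (N' <= N)%N -> `|A N - A N'| <= 2 * K * (N - N')%:R / N%:R.
{ move=> N0' NN; have N0 : (0 < N)%N by exact: leq_trans NN.
  have Nr : 0 < N%:R :> R by rewrite ltr0n.
  have Nr' : 0 < N'%:R :> R by rewrite ltr0n.
  have bnd m k : `|\sum_(m <= n < k) F n| <= (k - m)%:R * K.
  { apply: le_trans (ler_norm_sum _ _ _) _; apply: le_trans (ler_sum _ (fun i _ => hF i)) _.
    by rewrite sumr_const_nat mulr_natl. }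
  rewrite ler_pdivlMr // -[X in _ * X <= _](gtr0_norm Nr) -normrM.
  have -> : (A N - A N') * N%:R = \sum_(N'.+1 <= n < N.+1) F n - (N - N')%:R * ((N'%:R)^-1 * \sum_(1 <= n < N'.+1) F n).
  { rewrite /A (big_cat_nat _ (n := N'.+1)) //= natrB //; field; by rewrite !gt_eqF. }
  apply: le_trans (ler_normB _ _) _.
  have h1 := bnd N'.+1 N.+1; rewrite subSS in h1.
  have h2 : `|(N - N')%:R * ((N'%:R)^-1 * \sum_(1 <= n < N'.+1) F n)| <= (N - N')%:R * K.
  { rewrite normrM normr_nat ler_wpM2l // normrM normfV normr_nat ler_pdivrMl //.
    by have := bnd 1%N N'.+1; rewrite subn1. }
  move: h1 h2; clear; lra. }
(* The alternative [u = 0] only fills the index range; it is excluded below by [u >= U > 0]. *)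
have [s0 hs0] := eventually_uniform (U * D) (fun (u s : nat) => `|A (u * (c * D ^ s))%N - L| <= e / 2 \/ u = 0%N) (ltac:(
  move=> u _; case: (posnP u) => [->|u0]; [by exists 0%N => n _; right|];
  have [s0 hs] := hu u u0 _ e2; exists s0 => n hn; left; exact: hs)).
exists (U * c * D ^ s0)%N => N hN.
have Uc : (0 < U * c)%N by rewrite muln_gt0 c0.
pose s := trunc_log D (N %/ (U * c)).
have Nq : (0 < N %/ (U * c))%N.
{ rewrite divn_gt0 //; apply: leq_trans hN; rewrite leq_pmulr // expn_gt0; move: D1; clear; lia. }
have /andP[s1 s2] := trunc_log_bounds D1 Nq; rewrite -/s in s1 s2.
have hs : (s0 <= s)%N.
{ rewrite -ltnS -(ltn_exp2l _ _ D1); apply: leq_ltn_trans s2; by rewrite leq_divRL // mulnC. }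
pose v := (c * D ^ s)%N; have v0 : (0 < v)%N by rewrite muln_gt0 c0 expn_gt0 (ltnW D1).
pose u := (N %/ v)%N.
have uU : (U <= u)%N.
{ rewrite leq_divRL // /v mulnA mulnC; move: s1; rewrite leq_divRL // mulnC //; by rewrite (mulnC (D ^ s)%N). }
have uUD : (u < U * D)%N.
{ rewrite ltn_divLR // /v; move: s2; rewrite ltn_divLR // expnS; clear; lia. }
have [h|h] := hs0 u uUD s hs; last by move: uU; rewrite h.
have N' : (u * v <= N)%N by exact: leq_trunc_div.
have uv0 : (0 < u * v)%N by rewrite muln_gt0 v0 andbT; exact: leq_trans uU.
have Nr : 0 < N%:R :> R by rewrite ltr0n; exact: leq_trans N'.
have h1 := diff _ _ uv0 N'.
have h2 : 2 * K * (N - u * v)%:R / N%:R <= e / 2.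
{ rewrite ler_pdivrMr //.
  have a1 : (N - u * v)%:R <= v%:R :> R.
  { rewrite ler_nat /u {1}(divn_eq N v) addKn ltnW // ltn_mod //. }
  have a2 : U%:R * v%:R <= N%:R :> R.
  { by rewrite -natrM ler_nat; apply: leq_trans N'; rewrite leq_mul2r uU orbT. }
  have a3 : 4 * K <= e * U%:R.
  { have : 4 * K / e <= U%:R by apply: le_trans hU0 _; rewrite ler_nat.
    by rewrite ler_pdivrMr // [U%:R * _]mulrC. }
  have vr : 0 <= v%:R :> R by [].
  have b1 : 2 * K * (N - u * v)%:R <= 2 * K * v%:R by rewrite ler_wpM2l // mulr_ge0.
  have b2 : 4 * K * v%:R <= e * U%:R * v%:R by rewrite ler_wpM2r.
  have b3 : e * (U%:R * v%:R) <= e * N%:R by rewrite ler_pM2l.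
  rewrite mulrA in b3; move: b1 b2 b3; clear; lra. }
have := ler_distD (A (u * v)%N) (A N) L; rewrite /A in h h1 *.
move: h h1 h2; rewrite /v; clear; lra.
Qed.

Lemma cauchy_tends (l : nat -> R) :
  (forall e : R, 0 < e -> exists S0, forall S S', (S0 <= S)%N -> (S0 <= S')%N -> `|l S - l S'| <= e) ->
  exists L, tends l L.
Proof.
move=> cau; suff : cvgn l by move=> cv; exists (limn l); apply/tendsP.
apply/cauchy_cvgP; apply/cauchy_ballP => e e0; rewrite near_map2.
have [S0 h] := cau (e / 2) (ltac:(by rewrite divr_gt0)).
exists ([set n | (S0 <= n)%N], [set n | (S0 <= n)%N]).
{ by split; exact: nbhs_infty_ge. }
move=> [m n] /= [hm hn]; rewrite -ball_normE /=; apply: le_lt_trans (h _ _ hm hn) _; lra.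
Qed.

(** The approximants [l S] do not depend on [u], which forces the limits for different [u] to
    coincide. *)
Lemma common_limit (a : nat -> nat -> R) (l : nat -> R) (E : nat -> nat -> R) :
  (forall u : nat, (0 < u)%N -> tends (E u) 0) ->
  (forall u : nat, (0 < u)%N -> exists S0, forall S, (S0 <= S)%N ->
     exists k0, forall k, (k0 <= k)%N -> `|a u k - l S| <= E u S) ->
  exists L, forall u : nat, (0 < u)%N -> tends (a u) L.
Proof.
move=> hE ha.
have [S1 hS1] := ha 1%N isT.
have cau (e : R) : 0 < e -> exists S0, forall S S', (S0 <= S)%N -> (S0 <= S')%N -> `|l S - l S'| <= e.
{ move=> e0; have e2 : 0 < e / 2 by rewrite divr_gt0.
  have [S2 hS2] := hE 1%N isT _ e2; exists (maxn S1 S2) => S S'; rewrite !geq_max => /andP[a1 a2] /andP[b1 b2].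
  have [k1 h1] := hS1 S a1; have [k2 h2] := hS1 S' b1.
  have := h1 _ (leq_maxl k1 k2); have := h2 _ (leq_maxr k1 k2); move: (maxn k1 k2) => k.
  have := hS2 S a2; have := hS2 S' b2; rewrite !subr0.
  have := ler_norm (E 1%N S); have := ler_norm (E 1%N S').
  have := ler_distD (a 1%N k) (l S) (l S'); rewrite (distrC (l S) (a 1%N k)); clear; lra. }
have [L hL] := cauchy_tends l cau; exists L => u u0 e e0.
have e2 : 0 < e / 2 by rewrite divr_gt0.
have [S2 h2] := hE u u0 _ e2; have [S3 h3] := hL _ e2; have [S4 h4] := ha u u0.
have [k0 hk] := h4 _ (leq_trans (leq_maxr S3 S4) (leq_maxr S2 (maxn S3 S4))).
exists k0 => k kk; have := hk k kk.
have := h2 _ (leq_maxl S2 (maxn S3 S4)); have := h3 _ (leq_trans (leq_maxl S3 S4) (leq_maxr S2 (maxn S3 S4))).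
move: (maxn _ _) => S; rewrite subr0; have := ler_norm (E u S); have := ler_distD (l S) (a u k) L; lra.
Qed.

End Tends.

(** * Convergence of the pieces with bounded denominator *)

Section PeriodicWeights.
Context {R : realType}.

(** The inner sum runs over a window starting at [n^2], so it is a difference of two weighted
    Birkhoff sums. Its length is at least [N^2/(2 * 16^S)], comparable with the starting point, so
    the relative errors stay small. What remains depends on [n^2] modulo [q] and is periodic in
    [n]. *)
Lemma tends_window (F e : nat -> R) (K Ke : R) (q S : nat) (beta : nat -> R) : (0 < q)%N ->
  (forall m, `|F m| <= K) -> (forall m, `|e m| <= Ke) -> (forall m, e (m + q)%N = e m) ->
  (forall r, (r < q)%N -> tends (fun M => (M%:R)^-1 * \sum_(0 <= m < M) e (m + (q - r))%N * F m) (beta r)) ->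
  exists l, tends (fun N => (N%:R)^-1 * \sum_(1 <= n < N.+1) (((ulen S N)%:R)^-1 *
     \sum_(0 <= h < ulen S N) e h * F (h + n ^ 2)%N)) l.
Proof.
move=> q0 hF he per hb.
have K0 : 0 <= K by apply: le_trans (hF 0%N).
have Ke0 : 0 <= Ke by apply: le_trans (he 0%N).
(* The shift by [q - r] realigns the weight: at [m = h + n^2] with [n^2] congruent to [r], the
   weight is [e h]. *)
pose B r M := \sum_(0 <= m < M) e (m + (q - r))%N * F m.
have em := periodic_mod e q per.
pose w n := beta ((n ^ 2) %% q)%N.
have wper n : w (n + q)%N = w n.
{ by rewrite /w -modnXm modnDr modnXm. }
have hw := tends_periodic_mean w q q0 wper.
have hw1 : tends (fun N => (N%:R)^-1 * \sum_(1 <= n < N.+1) w n) ((\sum_(0 <= n < q) w n) / q%:R).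
{ have per1 n : w (n + q).+1 = w n.+1 by rewrite -addSn wper.
  have -> : \sum_(0 <= n < q) w n = \sum_(0 <= n < q) w n.+1.
  { rewrite -(prednK q0) big_nat_recl // [RHS]big_nat_recr //= prednK // addrC; congr (_ + _).
    by rewrite -(wper 0%N) add0n. }
  have := tends_periodic_mean (fun n => w n.+1) q q0 per1.
  by apply: eq_tends => N; congr (_ * _); rewrite big_add1. }
exists ((\sum_(0 <= n < q) w n) / q%:R); apply: tends_near hw1 _ => ep ep0.
have p16 : 0 < 16 ^+ S :> R by rewrite exprn_gt0.
(* [4 * 16^S + 1] bounds [(H + 2 n^2)/H] for [n <= N], the factor by which the errors at the two
   ends of the window are amplified. *)
pose ep1 := ep / 2 / (4 * 16 ^+ S + 1).
have ep1_0 : 0 < ep1 by rewrite !divr_gt0 //; lra.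
have [M0 hM0] := eventually_uniform q _ (fun r hr => hb r hr ep1 ep1_0).
pose bs := \sum_(0 <= r < q) `|beta r|.
have bs0 : 0 <= bs by exact: sumr_ge0.
have bsr r : (r < q)%N -> `|beta r| <= bs.
{ move=> hr; rewrite /bs (bigD1_seq r) /= ?mem_index_iota ?iota_uniq // lerDl; exact: sumr_ge0. }
pose K' := M0%:R * (Ke * K + bs).
have K0' : 0 <= K' by rewrite mulr_ge0 // addr_ge0 // mulr_ge0.
have main r M : (r < q)%N -> `|B r M - M%:R * beta r| <= ep1 * M%:R + K'.
{ move=> hr; case: (leqP M0 M) => hM.
  { case: (posnP M) => [->|M1].
    { by rewrite /B big_geq // mul0r subrr normr0 mulr0 add0r. }
    have Mr : 0 < M%:R :> R by rewrite ltr0n.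
    have -> : B r M - M%:R * beta r = M%:R * ((M%:R)^-1 * B r M - beta r) by field; rewrite gt_eqF.
    rewrite normrM normr_nat; have := hM0 r hr M hM; rewrite -(ler_pM2l Mr) /B => h.
    by apply: le_trans h _; rewrite mulrC lerDl. }
  have h1 : `|B r M| <= M%:R * (Ke * K).
  { apply: le_trans (ler_norm_sum _ _ _) _.
    apply: le_trans (_ : \sum_(0 <= m < M) Ke * K <= _); last by rewrite sumr_const_nat subn0 mulr_natl.
    by apply: ler_sum => m _; rewrite normrM ler_pM. }
  have h2 : `|M%:R * beta r| <= M%:R * bs by rewrite normrM normr_nat ler_wpM2l // bsr.
  have h3 : M%:R * (Ke * K + bs) <= K' by rewrite ler_wpM2r ?addr_ge0 ?mulr_ge0 // ler_nat ltnW.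
  have h4 : 0 <= ep1 * M%:R by rewrite mulr_ge0 // ltW.
  apply: le_trans (ler_normB _ _) _; move: h1 h2 h3 h4; rewrite mulrDr; clear; lra. }
have [H0 hH0] := archi_nat (2 * K' / (ep / 2)).
exists (2 ^ (14 * S + 10) * (H0.+1 * 2 * 16 ^ S))%N => N hN.
have lN : large_enough S N by apply: leq_trans hN; rewrite leq_pmulr // !muln_gt0 expn_gt0.
have [H1 _ H3] := @ulen_bounds R _ _ lN; set H := ulen S N in H1 H3 *.
have N0 := large_enough_gt0 _ _ lN.
have Nr : 0 < N%:R :> R by rewrite ltr0n.
have Hr : 0 < H%:R :> R by rewrite ltr0n.
have hH : H0.+1%:R <= H%:R :> R.
{ have a1 : (H0.+1 * 2 * 16 ^ S)%:R <= N%:R :> R.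
  { by rewrite ler_nat; apply: leq_trans hN; rewrite leq_pmull // expn_gt0. }
  have a2 : N%:R <= N%:R ^+ 2 :> R by rewrite expr2 ler_peMr // ler1n.
  rewrite !natrM natrX in a1.
  rewrite -(@ler_pM2r _ (2 * 16 ^+ S)) ?mulr_gt0 //.
  have := le_trans a1 (le_trans a2 H3); clear; lra. }
rewrite -mulrBr -sumrB normrM normfV normr_nat ler_pdivrMl //.
apply: le_trans (ler_norm_sum _ _ _) _.
apply: le_trans (_ : \sum_(1 <= n < N.+1) ep <= _); last by rewrite sumr_const_nat subn1 mulr_natl.
apply: ler_sum_nat => n /andP[n1 nN]; rewrite ltnS in nN.
set r := (n ^ 2 %% q)%N; have rq : (r < q)%N by rewrite ltn_mod.
have -> : \sum_(0 <= h < H) e h * F (h + n ^ 2)%N = B r (H + n ^ 2)%N - B r (n ^ 2)%N.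
{ rewrite /B [X in _ = X - _](big_cat_nat _ (n := (n ^ 2)%N)) //= ?leq_addl // [RHS]addrC addKr.
  rewrite -{2}(add0n (n ^ 2)%N) big_addn addnK; apply: eq_bigr => h _; congr (_ * _).
  rewrite em [in RHS]em; congr e.
  have -> : (h + n ^ 2 + (q - r) = h + (n ^ 2 %/ q).+1 * q)%N.
  { rewrite {1}(divn_eq (n ^ 2) q) -/r mulSn; move: rq; clear; lia. }
  by rewrite addnC modnMDl. }
have h1 := main r (H + n ^ 2)%N rq; have h2 := main r (n ^ 2)%N rq.
have -> : (H%:R)^-1 * (B r (H + n ^ 2)%N - B r (n ^ 2)%N) - w n =
  (H%:R)^-1 * ((B r (H + n ^ 2)%N - (H + n ^ 2)%:R * beta r) - (B r (n ^ 2)%N - (n ^ 2)%:R * beta r)).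
{ rewrite /w -/r natrD; field; by rewrite gt_eqF. }
rewrite normrM normfV normr_nat ler_pdivrMl //; apply: le_trans (ler_normB _ _) _.
have h3 : (n ^ 2)%:R <= 2 * 16 ^+ S * H%:R :> R.
{ by apply: le_trans H3; rewrite -natrX ler_nat leq_exp2r. }
have h4 : ep1 * ((4 * 16 ^+ S + 1) * H%:R) = H%:R * (ep / 2).
{ rewrite /ep1; field; have : 0 < 4 * 16 ^+ S + 1 :> R by clear - p16; lra. by move=> h; rewrite gt_eqF. }
have h5 : 2 * K' <= H%:R * (ep / 2).
{ have : 2 * K' / (ep / 2) <= H%:R by apply: le_trans hH0 _; apply: le_trans hH; rewrite ler_nat.
  by rewrite ler_pdivrMr // divr_gt0. }
have h6 : ep1 * (n ^ 2)%:R <= ep1 * (2 * 16 ^+ S * H%:R) by rewrite ler_pM2l.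
have h7 : ep1 * (H + n ^ 2)%:R = ep1 * H%:R + ep1 * (n ^ 2)%:R by rewrite natrD mulrDr.
have h8 : ep1 * ((4 * 16 ^+ S + 1) * H%:R) = 2 * (ep1 * (2 * 16 ^+ S * H%:R)) + ep1 * H%:R by ring.
move: h1 h2 h4 h5 h6 h7 h8; clear; lra.
Qed.

Context {d : measure_display} {X : measurableType d} (mu : probability X R).

(** Grouping the terms into periods of the weight gives an ergodic average of [T^q]; bounded
    increments fill the gaps between multiples of [q]. *)
Lemma weighted_birkhoff (T : X -> X) (f : X -> R) (e : nat -> R) (q : nat) :
  measure_preserving mu T -> bm f -> (0 < q)%N -> (forall m, e (m + q)%N = e m) ->
  {ae mu, forall x, exists l : R, tends (fun M => (M%:R)^-1 * \sum_(0 <= m < M) e m * f (iter m T x)) l}.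
Proof.
move=> hT hf q0 per.
have em := periodic_mod e q per.
pose g x := \sum_(0 <= j < q) e j * f (iter j T x).
have hg : bm g by apply: bm_sum => j; apply: bmZ; exact: (bm_iter mu).
have := birkhoff mu (iter q T) (mp_iter mu T q hT) g hg.
apply: filterS => x [l /tendsP hl]; exists (l / q%:R).
have [_ [K hK]] := hf.
apply: (tends_subseq_sums _ q ((\sum_(0 <= j < q) `|e j|) * K)) => //.
{ move=> M; rewrite big_nat_recr //= [X in `|X|]addrC addKr normrM; apply: ler_pM => //.
  rewrite em (bigD1_seq (M %% q)%N) /= ?mem_index_iota ?ltn_mod ?iota_uniq //.
  by rewrite lerDl sumr_ge0. }
apply: eq_tends hl => k; rewrite /birk; congr (_ * _).
rewrite sum_nat_blocks; apply: eq_bigr => t _; rewrite /g; apply: eq_big_nat => j /andP[_ hj].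
rewrite [in RHS]em [in RHS]mulnC modnMDl -em; congr (_ * f _).
by rewrite addnC iterD iterM.
Qed.

Lemma cos_periodic (a q m : nat) : (0 < q)%N ->
  cos (2 * pi * (a%:R / q%:R * (m + q)%:R)) = cos (2 * pi * (a%:R / q%:R * m%:R)) :> R.
Proof.
move=> q0; have := congr1 (@complex.Re R) (cexpDn (a%:R / q%:R * m%:R) a); rewrite /cexp /= => <-.
by congr cos; rewrite natrD; field; rewrite pnatr_eq0 -lt0n.
Qed.

(** The kernels have cosine coefficients, periodic modulo the denominator. Countably many triples
    [a], [q], [r] occur, so one null set serves every level [S]; [q.+1] keeps the denominators
    positive. *)
Lemma smooth_part_cvg (T : X -> X) (f : X -> R) : measure_preserving mu T -> bm f ->
  {ae mu, forall x, forall S, exists l : R, tends (fun N => pop T (asq N * usmooth S N) f x) l}.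
Proof.
move=> hT hf; have [_ [K hK]] := hf.
pose e (a q m : nat) : R := cos (2 * pi * (a%:R / q.+1%:R * m%:R)).
have per a q m : e a q (m + q.+1)%N = e a q m by exact: cos_periodic.
have : {ae mu, forall x, forall a q r, exists l : R,
   tends (fun M => (M%:R)^-1 * \sum_(0 <= m < M) e a q (m + r)%N * f (iter m T x)) l}.
{ apply: ae_foralln => a; apply: ae_foralln => q; apply: ae_foralln => r.
  apply: (weighted_birkhoff T f (fun m => e a q (m + r)%N) q.+1) => // m.
  by rewrite addnAC per. }
apply: filterS => x hx S.
have key a q : exists l, tends (fun N => (N%:R)^-1 * \sum_(1 <= n < N.+1) (((ulen S N)%:R)^-1 *
     \sum_(0 <= h < ulen S N) e a q h * f (iter (h + n ^ 2) T x))) l.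
{ have [beta hb] := choice (fun r => hx a q (q.+1 - r)%N).
  apply: (tends_window (fun m => f (iter m T x)) (e a q) K 1 q.+1 S beta) => //.
  by move=> m; rewrite /e ler_norml cos_geN1 cos_le1. }
have /choice[L hL] : forall aq : nat * nat, exists l, tends (fun N => (N%:R)^-1 * \sum_(1 <= n < N.+1) (((ulen S N)%:R)^-1 *
     \sum_(0 <= h < ulen S N) e aq.1 aq.2 h * f (iter (h + n ^ 2) T x))) l by move=> aq; exact: key.
exists (\sum_(1 <= q < (2 ^ S).+1) \sum_(0 <= a < q | coprime a q) L (a, q.-1)).
have := tends_sum _ (index_iota 1 (2 ^ S).+1) xpredT _ _ (fun q _ => tends_sum _ (index_iota 0 q) (fun a => coprime a q) _ _ (fun a _ => hL (a, q.-1))).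
apply: eq_tends => N; rewrite popM /asq popZ pop_sum.
have -> : \sum_(1 <= n < N.+1) pop T 'X^(n ^ 2) (pop T (usmooth S N) f) x =
  \sum_(1 <= q < (2 ^ S).+1) \sum_(0 <= a < q | coprime a q) \sum_(1 <= n < N.+1) (((ulen S N)%:R)^-1 *
     \sum_(0 <= h < ulen S N) e a q.-1 h * f (iter (h + n ^ 2) T x)).
{ under eq_bigr do rewrite popXn /usmooth /upoly pop_sum.
  rewrite exchange_big /=; apply: eq_big_nat => q /andP[q1 _].
  under eq_bigr do rewrite pop_sum.
  rewrite exchange_big /=; apply: eq_bigr => a _; apply: eq_bigr => n _.
  rewrite popZ pop_sum; congr (_ * _); apply: eq_bigr => h _.
  by rewrite popZ popXn /e prednK // iterD. }
by rewrite mulr_sumr; apply: eq_bigr => q _; rewrite mulr_sumr.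
Qed.

End PeriodicWeights.

(** * Almost everywhere decay of the dyadic pieces *)

Section Bourgain.
Context {R : realType}.

Lemma bernoulli_le (y : R) n : 0 <= y -> 1 + n%:R * y <= (1 + y) ^+ n.
Proof.
move=> y0; elim: n => [|n IH]; first by rewrite mul0r addr0 expr0.
rewrite exprS -[n.+1%:R]natr1; have n0 : 0 <= n%:R * y * y :> R by rewrite !mulr_ge0.
have : (1 + y) * (1 + n%:R * y) <= (1 + y) * (1 + y) ^+ n by rewrite ler_wpM2l //; lra.
move: n0; clear; lra.
Qed.

Lemma sum_geom_le (r : R) n : 0 <= r < 1 -> \sum_(0 <= s < n) r ^+ s <= (1 - r)^-1.
Proof.
move=> /andP[r0 r1]; have h : 0 < 1 - r by lra.
rewrite -[leRHS]mul1r ler_pdivlMr //.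
suff -> : (\sum_(0 <= s < n) r ^+ s) * (1 - r) = 1 - r ^+ n by have := exprn_ge0 n r0; lra.
elim: n => [|n IH]; first by rewrite big_geq // mul0r expr0 subrr.
by rewrite big_nat_recr //= mulrDl IH exprS; ring.
Qed.

Lemma pow_unbounded (r M : R) : 1 < r -> exists s0, forall s, (s0 <= s)%N -> M < r ^+ s.
Proof.
move=> r1; have [s0 hs0] := archi_nat (M / (r - 1)); exists s0 => s hs.
have r10 : 0 < r - 1 by lra.
have := bernoulli_le (r - 1) s (ltW r10); rewrite (_ : 1 + (r - 1) = r); last by ring.
have : M <= s%:R * (r - 1).
{ rewrite -ler_pdivrMr //; apply: le_trans hs0 _; by rewrite ler_nat. }
by lra.
Qed.

Lemma tends_geom (c r : R) : 0 < r < 1 -> tends (fun s => c * r ^+ s) 0.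
Proof.
move=> /andP[r0 r1] e e0; have [s0 hs0] := pow_unbounded r^-1 (`|c| / e) (ltac:(by rewrite invf_gt1)).
exists s0 => s hs; rewrite subr0 normrM (ger0_norm (exprn_ge0 _ (ltW r0))).
have := hs0 s hs; rewrite exprVn ltr_pdivrMr // mulrC ltr_pdivlMr ?exprn_gt0 //; exact: ltW.
Qed.

Lemma fact_pow2_le n : ((2 ^ n)`! <= 2 ^ (n * 2 ^ n))%N.
Proof.
rewrite expnM; have gen v m : (m <= v)%N -> (m`! <= v ^ m)%N.
{ elim: m => // m IH hv; rewrite factS expnS leq_mul //; exact: IH (ltnW hv). }
exact: gen.
Qed.

(** The long range starts at most [2^(2s+6)] dyadic scales after the first admissible one. The
    chaining over the short range therefore has [2s + 7] levels, a factor linear in [s]. *)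
Lemma bigQ_le s : (4 * bigQ s ^ 2 <= 2 ^ (14 * s.+1 + 10 + 2 ^ (2 * s + 6)))%N.
Proof.
have h : (bigQ s <= 2 ^ (s.+1 * 2 ^ s.+1 + (14 * s.+1 + 10)))%N by rewrite expnD leq_mul2r fact_pow2_le orbT.
apply: leq_trans (_ : 2 ^ 2 * (2 ^ (s.+1 * 2 ^ s.+1 + (14 * s.+1 + 10))) ^ 2 <= _)%N.
{ by rewrite leq_mul2l leq_exp2r // h orbT. }
rewrite -expnM -expnD leq_exp2l //.
have e1 : (2 ^ (2 * s + 6) = 16 * (2 ^ s.+1 * 2 ^ s.+1))%N.
{ by rewrite -expnD -[16%N]/(2 ^ 4)%N -expnD; congr (2 ^ _)%N; clear; lia. }
have h2 : (s.+1 < 2 ^ s.+1)%N by exact: ltn_expl.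
rewrite e1; move: h2; move: (2 ^ s.+1)%N => v h2.
have a1 : (s.+1 * v <= v * v)%N by rewrite leq_mul2r (ltnW h2) orbT.
have a2 : (s.+1 * 2 <= v * v)%N by apply: leq_mul; [exact: ltnW|move: h2; clear; lia].
move: a1 a2; clear; lia.
Qed.

Lemma energy_const_ge0 : 0 <= 7 * (2048 * 2048) + 36 * (128 * 128 * 128) + 64 * 64 * 4 :> R.
Proof. lra. Qed.

Lemma energy_arith (z sr j1 a1 a2 a3 a4 : R) : z <= sr * (sr * z) ->
  sr * z <= sr * (sr * z) -> j1 * (sr * z) <= 7 * (sr * (sr * z)) ->
  a4 <= 64 * (64 * (2 * z)) -> a3 <= 36 * (128 * (128 * (128 * (sr * z)))) ->
  a2 <= j1 * (2048 * (2048 * (sr * z))) -> a1 <= 64 * (64 * (2 * z)) ->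
  a1 + a2 + a3 + a4 <=
  (7 * (2048 * 2048) + 36 * (128 * (128 * 128)) + 64 * (64 * 4)) * (sr * (sr * z)).
Proof.
have -> : j1 * (2048 * (2048 * (sr * z))) = 2048 * 2048 * (j1 * (sr * z)) by ring.
lra.
Qed.

Lemma sqr_le_shift (y z : R) : z ^+ 2 <= 2 * y ^+ 2 + 2 * (z - y) ^+ 2.
Proof. by have := sqr_ge0 (2 * y - z); nra. Qed.

Lemma sqr_le_split (y z M A B K : R) : y ^+ 2 <= M * A -> z ^+ 2 <= A -> 0 <= M * B -> M * A <= M * B ->
  A <= B -> 112 * M + 2 = K -> (y + z) ^+ 2 <= K * B.
Proof. by move=> h1 h2 h3 h4 h5 <-; have := sqr_ge0 (y - z); nra. Qed.

(** [12/13] is a rational number slightly above the square root of [27/32]. *)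
Lemma norm_le_of_sqr (K y : R) s : 0 <= K -> y ^+ 2 <= K * (27 / 32) ^+ s ->
  `|y| <= (K + 1) * (12 / 13) ^+ s.
Proof.
move=> K0 h; have p0 : 0 <= (12 / 13) ^+ s :> R by rewrite exprn_ge0 //; lra.
rewrite -(@ler_pXn2r _ 2) ?nnegrE //; last by rewrite mulr_ge0 //; lra.
rewrite real_normK ?num_real //; apply: le_trans h _; rewrite [leRHS]exprMn.
apply: ler_pM => //; first by nra.
by rewrite -exprM mulnC exprM; apply: lerXn2r; rewrite ?nnegrE; lra.
Qed.

Context {d : measure_display} {X : measurableType d} (mu : probability X R).

Lemma ae_bounded_mono (F : nat -> X -> R) (C : R) : (forall n, bm (F n)) ->
  (forall x, F 0%N x = 0) -> (forall n x, F n x <= F n.+1 x) -> (forall n, Ex mu (F n) <= C) ->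
  {ae mu, forall x, exists M : R, forall n, F n x <= M}.
Proof.
move=> hF F0 mono hC.
have tel n x : \sum_(0 <= k < n) (F k.+1 x - F k x) = F n x by rewrite (telescope_sumr (F^~ x)) // F0 subr0.
have h : {ae mu, forall x, exists M : R, forall n, \sum_(0 <= k < n) (F k.+1 x - F k x) <= M}; last first.
{ by apply: filterS h => x [M hM]; exists M => n; rewrite -tel. }
apply: (ae_sum_bounded mu (fun k x => F k.+1 x - F k x) C).
{ by move=> k; exact: bmB. }
{ by move=> k x; rewrite subr_ge0. }
move=> n; rewrite -Ex_sum; last by move=> k; exact: bmB.
by apply: le_trans (hC n); apply: eq_imp_le; congr (Ex mu _); apply/funext => x; exact: tel.
Qed.

Context (T : X -> X) (hT : measure_preserving mu T) (f : X -> R) (hf : bm f).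

Lemma transference1 (p : {poly R}) (B : R) :
  (forall t : R, 0 <= t -> nm (pev p t) ^+ 2 <= B) ->
  Ex mu (fun x => pop T p f x ^+ 2) <= B * Ex mu (fun x => f x ^+ 2).
Proof.
move=> h; have := transference mu T f 1 (fun=> p) B hT hf; rewrite big_nat1; apply => t t0.
by rewrite big_nat1; exact: h.
Qed.

Section FixedScale.
Variables (u : nat) (u0 : (0 < u)%N).

Let k0 s := (14 * s.+1 + 10)%N.
Let J s := (2 * s + 6)%N.
Let b s k x : R := pop T (msq s (u * 2 ^ k)) f x.
Let dyad s x : R := \sum_(0 <= j < (J s).+1) \sum_(0 <= l < 2 ^ (J s - j))
  (b s (k0 s + 2 ^ j * l.+1)%N x - b s (k0 s + 2 ^ j * l)%N x) ^+ 2.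
Let k1 s := (k0 s + 2 ^ J s)%N.
Let err s k x : R := pop T (msq s (u * 2 ^ (k1 s + k)) -
  msq s (bigQ s) * kpoly (bigQ s) ((u * 2 ^ (k1 s + k)) ^ 2 %/ bigQ s)) f x.
Let fin s x : R := pop T (asq (u * 2 ^ (14 * s + 10)) * (1 - usmooth s (u * 2 ^ (14 * s + 10)))) f x.
Let e2 := Ex mu (fun x => f x ^+ 2).

Lemma e2_ge0 : 0 <= e2. Proof. by apply: Ex_ge0 => x; exact: sqr_ge0. Qed.

Let bm_pop2 p : bm (fun x => pop T p f x ^+ 2).
Proof. by apply: bmX; exact: (bm_pop mu). Qed.

Lemma large_scale s k : (k0 s <= k)%N -> large_enough s.+1 (u * 2 ^ k).
Proof. by move=> h; rewrite /large_enough; apply: leq_trans (leq_pmull _ u0); rewrite leq_exp2l. Qed.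

Lemma inv_sqrt_le s k : (2 * s <= k)%N -> (Num.sqrt (u * 2 ^ k)%:R)^-1 <= (2 ^+ s)^-1 :> R.
Proof.
move=> h; have := @eta_geom R s u k 0 u0; rewrite addn0 expr0 mulr1; apply.
by rewrite -[4%N]/(2 ^ 2)%N -expnM leq_exp2l.
Qed.

Lemma dyad_ge0 s x : 0 <= dyad s x.
Proof. by apply: sumr_ge0 => j _; apply: sumr_ge0 => l _; exact: sqr_ge0. Qed.

Lemma bm_dyad s : bm (dyad s).
Proof.
apply: bm_sum => j; apply: bm_sum => l; apply: bmX; apply: bmB; exact: (bm_pop mu).
Qed.

Lemma Ex_dyad s : Ex mu (dyad s) <= (J s).+1%:R * (2048 * 2048 * s.+1%:R * (2 ^+ s)^-1 * e2).
Proof.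
rewrite /dyad Ex_sum; last first.
{ by move=> j; apply: bm_sum => l; apply: bmX; apply: bmB; exact: (bm_pop mu). }
apply: le_trans (_ : \sum_(0 <= j < (J s).+1) (2048 * 2048 * s.+1%:R * (2 ^+ s)^-1 * e2) <= _); last first.
{ by rewrite sumr_const_nat subn0 [leRHS]mulr_natl. }
apply: ler_sum => j _; rewrite Ex_sum; last first.
{ by move=> l; apply: bmX; apply: bmB; exact: (bm_pop mu). }
have := transference mu T f (2 ^ (J s - j)) (fun l => msq s (u * 2 ^ (k0 s + 2 ^ j * l.+1)) - msq s (u * 2 ^ (k0 s + 2 ^ j * l)))
  (2048 * 2048 * s.+1%:R * (2 ^+ s)^-1) hT hf.
have h (t : R) : 0 <= t -> \sum_(0 <= i < 2 ^ (J s - j)) nm (pev (msq s (u * 2 ^ (k0 s + 2 ^ j * i.+1)) - msq s (u * 2 ^ (k0 s + 2 ^ j * i))) t) ^+ 2 <=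
  2048 * 2048 * s.+1%:R * (2 ^+ s)^-1.
{ move=> t0; under eq_bigr do rewrite pevB.
  by apply: short_square => //; rewrite expn_gt0. }
move=> /(_ h); apply: le_trans; apply: eq_imp_le; apply: eq_bigr => l _.
by congr (Ex mu _); apply/funext => x; rewrite popB.
Qed.

Lemma Ex_b s : Ex mu (fun x => b s (k0 s) x ^+ 2) <= 64 * 64 * 2 * (2 ^+ s)^-1 * e2.
Proof.
apply: transference1 => t t0; apply: le_trans (msq_bound s _ t (large_scale s (k0 s) (leqnn _)) t0) _.
have := inv_sqrt_le s (k0 s) (ltac:(by rewrite /k0; clear; lia)); lra.
Qed.

Lemma Ex_fin s : Ex mu (fun x => fin s x ^+ 2) <= 64 * 64 * 2 * (2 ^+ s)^-1 * e2.
Proof.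
have hl : large_enough s (u * 2 ^ (14 * s + 10)) by exact: leq_pmull.
apply: transference1 => t t0; apply: le_trans (fin_est s _ t hl t0) _.
have := inv_sqrt_le s (14 * s + 10)%N (ltac:(by clear; lia)); lra.
Qed.

Lemma Ex_err s n : Ex mu (fun x => \sum_(0 <= k < n) err s k x ^+ 2) <=
  36 * (128 * 128 * 128) * s.+1%:R * (2 ^+ s)^-1 * e2.
Proof.
rewrite Ex_sum; last by move=> k; exact: bm_pop2.
apply: (transference mu T f n (fun k => msq s (u * 2 ^ (k1 s + k)) -
  msq s (bigQ s) * kpoly (bigQ s) ((u * 2 ^ (k1 s + k)) ^ 2 %/ bigQ s))) => // t t0.
by apply: long_square => //; exact: bigQ_le.
Qed.

Let g s := pop T (msq s (bigQ s)) f.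

Lemma Ex_g s : Ex mu (fun x => g s x ^+ 2) <= 64 * 64 * 2 * (2 ^+ s)^-1 * e2.
Proof.
apply: transference1 => t t0; apply: le_trans (msq_bound s _ t (bigQ_large s) t0) _.
have : (Num.sqrt (bigQ s)%:R)^-1 <= (2 ^+ s)^-1 :> R.
{ have := @eta_geom R s (2 ^ s.+1)`! (14 * s.+1 + 10) 0 (fact_gt0 _); rewrite addn0 expr0 mulr1; apply.
  rewrite -[4%N]/(2 ^ 2)%N -expnM leq_exp2l //; clear; lia. }
lra.
Qed.

(** The maximal inequality for [T^Q], applied to [g^2] with threshold [(3/4)^s], leaves a set of
    measure [O((2/3)^s)]. One set serves all lengths [H], hence every scale of the long range. *)
Lemma exceptional s : exists2 E : set X, measurable E /\ fine (mu E) <= 64 * 64 * 2 * (2 ^+ s)^-1 * e2 * (4 / 3) ^+ s &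
  forall x, ~ E x -> forall H, ((H%:R)^-1 * \sum_(0 <= h < H) g s (iter (bigQ s * h) T x)) ^+ 2 <= (3 / 4) ^+ s.
Proof.
have l0 : 0 < (3 / 4) ^+ s :> R by rewrite exprn_gt0 //; lra.
have [E [mE hE] hx] := ergodic_maximal_inequality mu (iter (bigQ s) T) (mp_iter mu T _ hT) (fun x => g s x ^+ 2) ((3 / 4) ^+ s) (bm_pop2 _) l0.
exists E.
{ split => //; have fE : mu E \is a fin_num by apply: fin_num_measure.
  rewrite -(fineK fE) lee_fin in hE; apply: le_trans hE _.
  have -> : Ex mu (fun x => `|g s x ^+ 2|) = Ex mu (fun x => g s x ^+ 2).
  { by congr (Ex mu _); apply/funext => x; rewrite ger0_norm // sqr_ge0. }
  rewrite -exprVn invf_div; apply: ler_wpM2r; last exact: Ex_g.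
  by rewrite exprn_ge0 //; lra. }
move=> x nE H; case: (posnP H) => [->|H0]; first by rewrite invr0 mul0r expr0n ltW.
have Hr : 0 < H%:R :> R by rewrite ltr0n.
rewrite exprMn exprVn ler_pdivrMl ?exprn_gt0 //; apply: le_trans (sum_sqr_le _ _) _.
rewrite expr2 -mulrA ler_pM2l //; apply: le_trans (hx x nE H); apply: eq_imp_le.
by apply: eq_bigr => i _; rewrite ger0_norm ?sqr_ge0 // mulnC iterM.
Qed.

Lemma pop_long s H x : pop T (msq s (bigQ s) * kpoly (bigQ s) H) f x =
  (H%:R)^-1 * \sum_(0 <= h < H) g s (iter (bigQ s * h) T x).
Proof.
rewrite mulrC popM /kpoly popZ pop_sum; congr (_ * _); apply: eq_bigr => h _; exact: popXn.
Qed.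

Lemma succ_le s : s.+1%:R <= 8 * (9 / 8) ^+ s :> R.
Proof.
have := bernoulli_le (1 / 8) s (ltac:(lra)); have -> : 1 + 1 / 8 = 9 / 8 :> R by field.
by rewrite -[s.+1%:R]natr1; have : 0 <= s%:R :> R by []; lra.
Qed.

(** The square functions of level [s] enter with weight [(4/3)^s], the exceptional set with weight
    [(5/4)^s]. Factors [s^2] are absorbed by [(9/8)^(2s)], and [4/3 * 81/64 * 1/2 = 27/32]; for the
    exceptional sets [5/4 * 4/3 * 1/2 = 5/6]. Both rates are below 1, so the sum over [s] has
    bounded expectation. *)
Lemma energy_bound : exists2 W : nat -> nat -> X -> R,
  [/\ forall s n, bm (W s n), forall s n x, 0 <= W s n x, forall s n x, W s n x <= W s n.+1 x &
      exists C, forall s n, Ex mu (W s n) <= C * (27 / 32) ^+ s] &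
  exists E : nat -> set X, forall s x,
   (forall n, W s n x = (4 / 3) ^+ s * (b s (k0 s) x ^+ 2 + dyad s x + \sum_(0 <= k < n) err s k x ^+ 2 + fin s x ^+ 2) +
    (5 / 4) ^+ s * \1_(E s) x) /\
   (~ E s x -> forall H, ((H%:R)^-1 * \sum_(0 <= h < H) g s (iter (bigQ s * h) T x)) ^+ 2 <= (3 / 4) ^+ s).
Proof.
have /choice[E hE] : forall s, exists E : set X, (measurable E /\ fine (mu E) <= 64 * 64 * 2 * (2 ^+ s)^-1 * e2 * (4 / 3) ^+ s) /\
  forall x, ~ E x -> forall H, ((H%:R)^-1 * \sum_(0 <= h < H) g s (iter (bigQ s * h) T x)) ^+ 2 <= (3 / 4) ^+ s.
{ by move=> s; have [E h1 h2] := exceptional s; exists E. }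
have mE s : measurable (E s) by case: (hE s) => -[].
have bE s : bm (\1_(E s) : X -> R) by exact: bm_indic.
pose V s n x := b s (k0 s) x ^+ 2 + dyad s x + \sum_(0 <= k < n) err s k x ^+ 2 + fin s x ^+ 2.
have bV s n : bm (V s n).
{ apply: bmD; last exact: bm_pop2.
  apply: bmD; last by apply: bm_sum => k; exact: bm_pop2.
  by apply: bmD; [exact: bm_pop2|exact: bm_dyad]. }
have V0 s n x : 0 <= V s n x.
{ rewrite /V addr_ge0 ?sqr_ge0 // addr_ge0 //; last by apply: sumr_ge0 => k _; exact: sqr_ge0.
  by rewrite addr_ge0 ?sqr_ge0 // dyad_ge0. }
exists (fun s n x => (4 / 3) ^+ s * V s n x + (5 / 4) ^+ s * \1_(E s) x); last first.
{ by exists E => s x; split => //; case: (hE s) => _; exact. }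
have p43 s : 0 <= (4 / 3) ^+ s :> R by rewrite exprn_ge0 //; lra.
have p54 s : 0 <= (5 / 4) ^+ s :> R by rewrite exprn_ge0 //; lra.
split.
{ by move=> s n; apply: bmD; apply: bmZ. }
{ by move=> s n x; rewrite addr_ge0 // mulr_ge0 // indicE. }
{ move=> s n x; rewrite lerD2r ler_wpM2l // /V lerD2r lerD2l big_nat_recr //= lerDl; exact: sqr_ge0. }
exists (64 * (7 * (2048 * 2048) + 36 * (128 * 128 * 128) + 64 * 64 * 4) * e2 + 64 * 64 * 2 * e2) => s n.
rewrite ExD; [|exact: bmZ|exact: bmZ].
rewrite !ExZ // Ex_indic //.
have hV : Ex mu (V s n) <= (7 * (2048 * 2048) + 36 * (128 * 128 * 128) + 64 * 64 * 4) * (s.+1%:R * s.+1%:R) * (2 ^+ s)^-1 * e2.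
{ rewrite /V ExD; [|apply: bmD; [apply: bmD; [exact: bm_pop2|exact: bm_dyad]|apply: bm_sum => k; exact: bm_pop2]|exact: bm_pop2].
  rewrite ExD; [|apply: bmD; [exact: bm_pop2|exact: bm_dyad]|apply: bm_sum => k; exact: bm_pop2].
  rewrite ExD; [|exact: bm_pop2|exact: bm_dyad].
  have z0 : 0 <= (2 ^+ s)^-1 * e2 by rewrite mulr_ge0 ?e2_ge0 // invr_ge0 exprn_ge0.
  have s1 : 1 <= s.+1%:R :> R by rewrite ler1n.
  have J1 : (J s).+1%:R <= 7 * s.+1%:R :> R by rewrite -natrM ler_nat /J; clear; lia.
  have := Ex_b s; have := Ex_dyad s; have := Ex_err s n; have := Ex_fin s.
  have q1 : (2 ^+ s)^-1 * e2 <= s.+1%:R * s.+1%:R * ((2 ^+ s)^-1 * e2).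
  { by rewrite ler_peMl // -[leLHS]mulr1 ler_pM. }
  have q2 : s.+1%:R * ((2 ^+ s)^-1 * e2) <= s.+1%:R * s.+1%:R * ((2 ^+ s)^-1 * e2).
  { by rewrite ler_wpM2r // ler_peMr. }
  have q3 : (J s).+1%:R * (s.+1%:R * ((2 ^+ s)^-1 * e2)) <= 7 * s.+1%:R * (s.+1%:R * ((2 ^+ s)^-1 * e2)).
  { by rewrite ler_wpM2r // mulr_ge0. }
  move: q1 q2 q3; rewrite -!mulrA.
  exact: energy_arith. }
have hi : fine (mu (E s)) <= 64 * 64 * 2 * (2 ^+ s)^-1 * e2 * (4 / 3) ^+ s by case: (hE s) => -[].
have r1 : s.+1%:R * s.+1%:R <= 64 * (81 / 64) ^+ s :> R.
{ have -> : 64 * (81 / 64) ^+ s = (8 * (9 / 8) ^+ s) * (8 * (9 / 8) ^+ s) :> R.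
  { have -> : (81 / 64 : R) = 9 / 8 * (9 / 8) by field. rewrite [in LHS]exprMn; ring. }
  by apply: ler_pM => //; exact: succ_le. }
have i1 : (4 / 3) ^+ s * ((81 / 64) ^+ s * (2 ^+ s)^-1) = (27 / 32) ^+ s :> R.
{ by rewrite -exprVn -!exprMn; congr (_ ^+ s); field. }
have i2 : (5 / 4) ^+ s * ((2 ^+ s)^-1 * (4 / 3) ^+ s) = (5 / 6) ^+ s :> R.
{ by rewrite -exprVn -!exprMn; congr (_ ^+ s); field. }
have i3 : (5 / 6) ^+ s <= (27 / 32) ^+ s :> R.
{ by apply: lerXn2r; rewrite ?nnegrE ?divr_ge0 // ler_pdivrMr // mulrAC ler_pdivlMr // -!natrM ler_nat. }
set A : R := 7 * (2048 * 2048) + 36 * (128 * 128 * 128) + 64 * 64 * 4.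
have A0 : 0 <= A := energy_const_ge0.
apply: le_trans (_ : (4 / 3) ^+ s * (A * (64 * (81 / 64) ^+ s) * (2 ^+ s)^-1 * e2) + (5 / 4) ^+ s * (64 * 64 * 2 * (2 ^+ s)^-1 * e2 * (4 / 3) ^+ s) <= _).
{ apply: lerD; apply: ler_wpM2l => //; apply: le_trans hV _.
  apply: ler_wpM2r; first exact: e2_ge0.
  apply: ler_wpM2r; first by rewrite invr_ge0 exprn_ge0.
  exact: ler_wpM2l. }
have -> : (4 / 3) ^+ s * (A * (64 * (81 / 64) ^+ s) * (2 ^+ s)^-1 * e2) = 64 * A * e2 * ((4 / 3) ^+ s * ((81 / 64) ^+ s * (2 ^+ s)^-1)) by ring.
have -> : (5 / 4) ^+ s * (64 * 64 * 2 * (2 ^+ s)^-1 * e2 * (4 / 3) ^+ s) = 64 * 64 * 2 * e2 * ((5 / 4) ^+ s * ((2 ^+ s)^-1 * (4 / 3) ^+ s)) by ring.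
rewrite i1 i2 [leRHS]mulrDl; apply: lerD => //; apply: ler_wpM2l => //.
by rewrite mulr_ge0 ?e2_ge0 //; lra.
Qed.

Lemma oscillation_bound : {ae mu, forall x, exists C s0, 1 <= C /\ forall s, (s0 <= s)%N ->
  (forall k, (14 * s.+1 + 10 <= k)%N -> `|pop T (msq s (u * 2 ^ k)) f x| <= C * (12 / 13) ^+ s) /\
  `|pop T (asq (u * 2 ^ (14 * s + 10)) * (1 - usmooth s (u * 2 ^ (14 * s + 10)))) f x| <= C * (12 / 13) ^+ s}.
Proof.
have [W [bW W0 Wm [C hC]] [E hE]] := energy_bound.
have C0 : 0 <= C by have := hC 0%N 0%N; rewrite expr0 mulr1; apply: le_trans; apply: Ex_ge0 => x; exact: W0.
have bnd : {ae mu, forall x, exists M : R, forall n, \sum_(0 <= s < n) W s n x <= M}.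
(* The levels [s] and the long-range scales [k] are truncated by the same [n], so that one monotone
   limit covers both. *)
{ apply: (ae_bounded_mono (fun n x => \sum_(0 <= s < n) W s n x) (C * (1 - 27 / 32)^-1)).
{ by move=> n; apply: bm_sum. }
{ by move=> x; rewrite big_geq. }
{ move=> n x; rewrite big_nat_recr //= -[leLHS]addr0 lerD //; by apply: ler_sum. }
{ move=> n; rewrite Ex_sum // => /=; apply: le_trans (ler_sum _ (fun s _ => hC s n)) _.
  rewrite -mulr_sumr ler_wpM2l //; apply: sum_geom_le; lra. } }
apply: filterS bnd => x [M hM].
have WM s n : W s n x <= M.
{ apply: le_trans (_ : W s (maxn n s.+1) x <= _).
  { have /subnK <- := leq_maxl n s.+1; elim: (_ - n)%N => [|k IH]; first by [].
    by rewrite addSn; exact: le_trans IH (Wm _ _ _). }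
  apply: le_trans (hM (maxn n s.+1)); rewrite (bigD1_seq s) /= ?mem_index_iota ?iota_uniq //; last by rewrite leq_maxr.
  by rewrite lerDl sumr_ge0. }
have M0 : 0 <= M by exact: le_trans (W0 0%N 0%N x) (WM _ _).
have [s0 hs0] := pow_unbounded (5 / 4) M (ltac:(lra)).
(* In the short range the bound is [2 * 7 * 8 * M]: two from squaring a sum, seven from the number
   of chaining levels and eight from [succ_le]. The 2 pays for the maximal function in the long
   range. *)
pose K : R := 112 * M + 2.
exists (K + 1), s0; split; first by rewrite /K; lra.
have conv s (y : R) : y ^+ 2 <= K * (27 / 32) ^+ s -> `|y| <= (K + 1) * (12 / 13) ^+ s.
{ by apply: norm_le_of_sqr; rewrite /K; lra. }
move=> s hs; have [hW hx] := hE s x.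
have p43 : 0 < (4 / 3) ^+ s :> R by rewrite exprn_gt0 //; lra.
have p34 : 0 <= (3 / 4) ^+ s :> R by rewrite exprn_ge0 //; lra.
have p54 : 0 < (5 / 4) ^+ s :> R by rewrite exprn_gt0 //; lra.
have inv34 : (4 / 3) ^+ s * (3 / 4) ^+ s = 1 :> R.
{ by rewrite -exprMn (_ : 4 / 3 * (3 / 4) = 1) ?expr1n //; field. }
have ind0 : 0 <= \1_(E s) x :> R by rewrite indicE.
(* The weight [(5/4)^s] of the exceptional set exceeds the total [M] once [s >= s0]. *)
have nE : ~ E s x.
{ move=> h; have := WM s 0%N; have := hs0 s hs; rewrite hW indicE mem_set // mulr1 big_geq // addr0.
  have : 0 <= (4 / 3) ^+ s * (b s (k0 s) x ^+ 2 + dyad s x + fin s x ^+ 2).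
  { by rewrite mulr_ge0 ?(ltW p43) // !addr_ge0 ?sqr_ge0 // dyad_ge0. }
  lra. }
have en n : b s (k0 s) x ^+ 2 + dyad s x + \sum_(0 <= k < n) err s k x ^+ 2 + fin s x ^+ 2 <= M * (3 / 4) ^+ s.
{ rewrite -(ler_pM2l p43) mulrCA inv34 mulr1; apply: le_trans (WM s n); rewrite hW lerDl mulr_ge0 // ltW //. }
have se n : 0 <= \sum_(0 <= k < n) err s k x ^+ 2 by apply: sumr_ge0 => k _; exact: sqr_ge0.
have r1 : (3 / 4) ^+ s <= (27 / 32) ^+ s :> R.
  { by apply: lerXn2r; rewrite ?nnegrE ?divr_ge0 // ler_pdivrMr // mulrAC ler_pdivlMr // -!natrM ler_nat. }
have d0 := dyad_ge0 s x; have b0 := sqr_ge0 (b s (k0 s) x); have f0 := sqr_ge0 (fin s x).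
have Mr : M * (3 / 4) ^+ s <= M * (27 / 32) ^+ s by rewrite ler_wpM2l.
have p27 : 0 <= (27 / 32) ^+ s :> R by exact: le_trans r1.
split; last first.
{ apply: conv; rewrite -/(fin s x); have := en 0%N; rewrite big_geq // /K.
  have : 0 <= M * (27 / 32) ^+ s by rewrite mulr_ge0.
  lra. }
move=> k hk; apply: conv; rewrite -/(b s k x).
(* Up to [k1 s] the value is reached from scale [k0 s] by dyadic chaining; beyond, it is compared
   with an average of [g s] along [T^Q]. *)
case: (leqP k (k1 s)) => hk1.
{ have hi : (k - k0 s <= 2 ^ J s)%N by rewrite leq_subLR.
  have := rademacher_menshov (fun i => b s (k0 s + i)%N x) (J s) (k - k0 s) hi.
  rewrite /= addn0 subnKC // -/(dyad s x) => h.
  have J1 : (J s).+1%:R <= 7 * s.+1%:R :> R by rewrite -natrM ler_nat /J; clear; lia.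
  have s1 : 1 <= s.+1%:R :> R by rewrite ler1n.
  have h1 : (J s).+1%:R * dyad s x <= 7 * s.+1%:R * dyad s x by rewrite ler_wpM2r.
  have h2 : b s (k0 s) x ^+ 2 <= s.+1%:R * b s (k0 s) x ^+ 2 by rewrite ler_peMl.
  have h3 : s.+1%:R * (b s (k0 s) x ^+ 2 + dyad s x) <= 8 * (9 / 8) ^+ s * (M * (3 / 4) ^+ s).
  { apply: ler_pM => //; [by rewrite addr_ge0|exact: succ_le|].
    have := en 0%N; rewrite big_geq //; lra. }
  have h4 : 8 * (9 / 8) ^+ s * (M * (3 / 4) ^+ s) = 8 * M * (27 / 32) ^+ s :> R.
  { have -> : (27 / 32 : R) = 9 / 8 * (3 / 4) by field. rewrite [in RHS]exprMn; ring. }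
  have h5 : 0 <= s.+1%:R * b s (k0 s) x ^+ 2 by rewrite mulr_ge0.
  have h6 : b s k x ^+ 2 <= 2 * b s (k0 s) x ^+ 2 + 2 * (b s k x - b s (k0 s) x) ^+ 2.
  { exact: sqr_le_shift. }
  rewrite /K mulrDl; move: h h1 h2 h3 h4 h5 h6 p27; rewrite mulrDr; lra. }
have [i ki] : exists i, k = (k1 s + i)%N by exists (k - k1 s)%N; rewrite subnKC // ltnW.
have hb : b s k x = err s i x + pop T (msq s (bigQ s) * kpoly (bigQ s) ((u * 2 ^ (k1 s + i)) ^ 2 %/ bigQ s)) f x.
{ by rewrite /err popB subrK /b ki. }
have h1 : err s i x ^+ 2 <= M * (3 / 4) ^+ s.
{ have := en i.+1; rewrite big_nat_recr //=; have := se i; clear - d0 b0 f0; lra. }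
have h2 := hx nE ((u * 2 ^ (k1 s + i)) ^ 2 %/ bigQ s)%N; rewrite -pop_long in h2.
have h3 : 0 <= M * (27 / 32) ^+ s by rewrite mulr_ge0.
by rewrite hb; apply: sqr_le_split h1 h2 h3 Mr r1 _.
Qed.

End FixedScale.

Lemma asq_decomp S sg N : (S <= sg)%N ->
  asq N = asq N * usmooth S N + \sum_(S <= s < sg) msq s N + asq N * (1 - usmooth sg N) :> {poly R}.
Proof.
move=> h; rewrite /msq -mulr_sumr (telescope_sumr (fun s => usmooth s N)) //; ring.
Qed.

Theorem bourgain_squares :
  {ae mu, forall x, exists l : R, tends (fun N => (N%:R)^-1 * \sum_(1 <= n < N.+1) f (iter (n ^ 2) T x)) l}.
Proof.
have osc : {ae mu, forall x, forall u, exists C s0, 1 <= C /\ forall s, (s0 <= s)%N ->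
  (forall k, (14 * s.+1 + 10 <= k)%N -> `|pop T (msq s (u.+1 * 2 ^ k)) f x| <= C * (12 / 13) ^+ s) /\
  `|pop T (asq (u.+1 * 2 ^ (14 * s + 10)) * (1 - usmooth s (u.+1 * 2 ^ (14 * s + 10)))) f x| <= C * (12 / 13) ^+ s}.
{ by apply: ae_foralln => u; exact: oscillation_bound. }
have sm := smooth_part_cvg mu T f hT hf.
have [_ [K hK]] := hf.
apply: filterS2 osc sm => x /choice[C hC] /choice[l hl].
(* At [N = u * 2^(14 k + 10)] the level [k] is just admissible for [large_enough], so the
   decomposition can run up to level [k] with a controlled remainder. *)
pose a u k := (((u * (2 ^ 10 * (2 ^ 14) ^ k))%N)%:R)^-1 * \sum_(1 <= n < (u * (2 ^ 10 * (2 ^ 14) ^ k)).+1) f (iter (n ^ 2) T x).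
have [L hL] : exists L, forall u : nat, (0 < u)%N -> tends (a u) L.
(* [15 = 13 + 1 + 1]: the geometric series of ratio [12/13], the approximation of [l S], and the
   remainder. *)
{ apply: (common_limit a l (fun u S => 15 * C u.-1 * (12 / 13) ^+ S)).
  { by move=> u _; apply: tends_geom; lra. }
  move=> u u0; have [s0 [C1 hs]] := hC u.-1; rewrite prednK // in hs.
  exists s0 => S hS.
  have p S' : 0 < C u.-1 * (12 / 13) ^+ S' by rewrite mulr_gt0 ?exprn_gt0 //; lra.
  have [N0 hN0] := hl S _ (p S).
  exists (maxn S N0) => k; rewrite geq_max => /andP[Sk N0k].
  have e1 : (2 ^ 10 * (2 ^ 14) ^ k = 2 ^ (14 * k + 10))%N by rewrite -expnM -expnD addnC.
  have kN : (N0 <= u * 2 ^ (14 * k + 10))%N.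
  { apply: leq_trans N0k _; apply: leq_trans (leq_pmull _ u0).
    apply: ltnW; apply: leq_trans (ltn_expl k (ltnSn 1)) _; rewrite leq_exp2l //; clear; lia. }
  have -> : a u k = pop T (asq (u * 2 ^ (14 * k + 10))) f x.
  { rewrite /a e1 /asq popZ pop_sum; congr (_ * _); apply: eq_bigr => n _; by rewrite popXn. }
  set N := (u * 2 ^ (14 * k + 10))%N in kN *.
  rewrite {1}(asq_decomp S k N Sk) !popD pop_sum.
  have h1 := hN0 N kN.
  have h2 : `|\sum_(S <= s < k) pop T (msq s N) f x| <= 13 * (C u.-1 * (12 / 13) ^+ S).
  { apply: le_trans (ler_norm_sum _ _ _) _.
    apply: le_trans (_ : \sum_(S <= s < k) C u.-1 * (12 / 13) ^+ s <= _).
    { apply: ler_sum_nat => s /andP[Ss sk]; have [+ _] := hs s (leq_trans hS Ss); apply.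
      move: sk; clear; lia. }
    rewrite -mulr_sumr -{1}(add0n S) big_addn.
    have -> : \sum_(0 <= i < k - S) (12 / 13) ^+ (i + S) = (12 / 13) ^+ S * \sum_(0 <= i < k - S) (12 / 13) ^+ i :> R.
    { by rewrite mulr_sumr; apply: eq_bigr => i _; rewrite exprD mulrC. }
    rewrite [leLHS]mulrA [leRHS]mulrC; apply: ler_wpM2l; first exact: ltW (p S).
     apply: le_trans (sum_geom_le _ _ _) _; first by clear - h1; lra.
    by rewrite (_ : 1 - 12 / 13 = 13^-1) ?invrK //; field. }
  have [_ h3] := hs k (leq_trans hS Sk); rewrite -/N in h3.
  have h4 : C u.-1 * (12 / 13) ^+ k <= C u.-1 * (12 / 13) ^+ S.
  { rewrite ler_wpM2l //; first by lra.
    by rewrite ler_wiXn2l //; lra. }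
  have -> : pop T (asq N * usmooth S N) f x + \sum_(S <= s < k) pop T (msq s N) f x + pop T (asq N * (1 - usmooth k N)) f x - l S
    = (pop T (asq N * usmooth S N) f x - l S) + \sum_(S <= s < k) pop T (msq s N) f x + pop T (asq N * (1 - usmooth k N)) f x by ring.
  apply: le_trans (ler_normD _ _) _; apply: le_trans (lerD (ler_normD _ _) (lexx _)) _.
  move: h1 h2 h3 h4; clear; lra. }
exists L; apply: (tends_sandwich (fun n => f (iter (n ^ 2) T x)) K L (2 ^ 10) (2 ^ 14)) => //.
Qed.

End Bourgain.

(** * Sums against the sawtooth function *)

Section VanDerCorput.
Context {R : realType}.
Implicit Types (E : nat -> R[i]) (t psi : nat -> R).

Lemma nm_1cexp_ge_third (x : R) : `|x| <= 3 / 4 -> `|x| / 3 <= nm (1 - cexp x).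
Proof.
move=> hx; apply: nm_1cexp_ge => n.
have x0 := normr_ge0 x.
case: (eqVneq n 0) => [->|n0]; first by rewrite mulr0z subr0; lra.
have h1 : 1 <= `|n%:~R| :> R by rewrite -intr_norm -[1]/(1%:~R) ler_int; move: n0; clear; lia.
have := lerB_dist n%:~R x; rewrite distrC; lra.
Qed.

Lemma nm_invB (z w : R[i]) : z != 0 -> w != 0 -> nm (z^-1 - w^-1) = nm (z - w) / (nm z * nm w).
Proof.
move=> z0 w0; have -> : z^-1 - w^-1 = (w - z) * (z * w)^-1 by field; rewrite z0 w0.
by rewrite nmM nmV nmM nmBC.
Qed.

(** Partial summation from [E m = (E m.+1 - E m)/(e(t m) - 1)]. The variation of [1/(e(t) - 1)]
    telescopes since [t] is monotone and keeps its sign; [72] is the Lipschitz constant 8 times two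
    factors 3 from the lower bound for [1 - e(t)]. *)
Lemma kusmin_landau_step E t (delta : R) n : (forall m, nm (E m) = 1) -> 0 < delta ->
  (forall m, (m <= n)%N -> E m.+1 = E m * cexp (t m)) ->
  (forall m, (m <= n)%N -> delta <= `|t m| <= 3 / 4) ->
  (forall m, (m < n)%N -> t m <= t m.+1 /\ 0 < t m * t m.+1) ->
  nm (\sum_(0 <= m < n.+1) E m - (cexp (t n) - 1)^-1 * E n.+1) <= 3 / delta + 72 * ((t 0%N)^-1 - (t n)^-1).
Proof.
move=> hE d0; elim: n => [|n IH] hrec hd hmon.
{ rewrite big_nat1 subrr mulr0 addr0 hrec //.
  have [h1 h2] := andP (hd 0%N (leqnn _)).
  have hc := nm_1cexp_ge_third _ h2.
  have c0 : 0 < nm (1 - cexp (t 0%N)) by apply: lt_le_trans hc; lra.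
  have nz : cexp (t 0%N) - 1 != 0.
  { by apply/eqP => h; move: c0; rewrite nmBC h nm0 ltxx. }
  have -> : E 0%N - (cexp (t 0%N) - 1)^-1 * (E 0%N * cexp (t 0%N)) = - (E 0%N * (cexp (t 0%N) - 1)^-1) by field.
  rewrite nmN nmM hE mul1r nmV nmBC.
  rewrite -[leRHS]invrK invf_div lef_pV2 ?posrE ?divr_gt0 //; lra. }
have IH' := IH (fun m hm => hrec m (leqW hm)) (fun m hm => hd m (leqW hm)) (fun m hm => hmon m (ltnW hm)).
have [a1 a2] := andP (hd n (leqnSn _)); have [b1 b2] := andP (hd n.+1 (leqnn _)).
have ha := nm_1cexp_ge_third _ a2; have hb := nm_1cexp_ge_third _ b2.
have ca : 0 < nm (1 - cexp (t n)) by apply: lt_le_trans ha; lra.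
have cb : 0 < nm (1 - cexp (t n.+1)) by apply: lt_le_trans hb; lra.
have nza : cexp (t n) - 1 != 0 by apply/eqP => h; move: ca; rewrite nmBC h nm0 ltxx.
have nzb : cexp (t n.+1) - 1 != 0 by apply/eqP => h; move: cb; rewrite nmBC h nm0 ltxx.
have e1 : \sum_(0 <= m < n.+2) E m - (cexp (t n.+1) - 1)^-1 * E n.+2 =
  (\sum_(0 <= m < n.+1) E m - (cexp (t n) - 1)^-1 * E n.+1) +
  ((cexp (t n) - 1)^-1 - (cexp (t n.+1) - 1)^-1) * E n.+1.
{ rewrite big_nat_recr //= (hrec n.+1) //.
  have : E n.+1 = (cexp (t n.+1) - 1)^-1 * (E n.+1 * cexp (t n.+1)) - (cexp (t n.+1) - 1)^-1 * E n.+1 by field.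
  move: (\sum_(0 <= m < n.+1) E m) => S h; rewrite {1}h; ring. }
rewrite e1; apply: le_trans (nmD _ _) _; rewrite nmM hE mulr1.
have [m1 m2] := hmon n (ltnSn n).
have key : nm ((cexp (t n) - 1)^-1 - (cexp (t n.+1) - 1)^-1) <= 72 * ((t n)^-1 - (t n.+1)^-1).
{ rewrite nm_invB //.
  have -> : cexp (t n) - 1 - (cexp (t n.+1) - 1) = cexp (t n) - cexp (t n.+1) by ring.
  have n1 := nm_cexpB (t n) (t n.+1); rewrite distrC ger0_norm ?subr_ge0 // in n1.
  have tn0 : t n != 0 by apply/eqP => h; move: m2; rewrite h mul0r ltxx.
  have tn1 : t n.+1 != 0 by apply/eqP => h; move: m2; rewrite h mulr0 ltxx.
  have -> : (t n)^-1 - (t n.+1)^-1 = (t n.+1 - t n) / (t n * t n.+1) by field; rewrite tn0 tn1.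
  rewrite (nmBC (cexp (t n)) 1) (nmBC (cexp (t n.+1)) 1).
  rewrite mulrA ler_pdivlMr // mulrAC ler_pdivrMr ?mulr_gt0 //.
  have p1 : t n * t n.+1 <= 9 * (nm (1 - cexp (t n)) * nm (1 - cexp (t n.+1))).
  { have : `|t n| * `|t n.+1| <= (3 * nm (1 - cexp (t n))) * (3 * nm (1 - cexp (t n.+1))).
    { by apply: ler_pM => //; clear - ha hb; lra. }
    rewrite -normrM (gtr0_norm m2); move: (nm _) (nm _) => x y; clear; lra. }
  apply: le_trans (_ : 8 * (t n.+1 - t n) * (9 * (nm (1 - cexp (t n)) * nm (1 - cexp (t n.+1)))) <= _).
  { by apply: ler_pM => //; [exact: nm_ge0|exact: ltW]. }
  by apply: eq_imp_le; ring. }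
move: IH' key; clear; lra.
Qed.

Lemma kusmin_landau E t (delta : R) n : (forall m, nm (E m) = 1) -> 0 < delta ->
  (forall m, (m < n)%N -> E m.+1 = E m * cexp (t m)) ->
  (forall m, (m < n)%N -> delta <= `|t m| <= 3 / 4) ->
  (forall m, (m.+1 < n)%N -> t m <= t m.+1 /\ 0 < t m * t m.+1) ->
  nm (\sum_(0 <= m < n) E m) <= 150 / delta.
Proof.
case: n => [|n] hE d0 hrec hd hmon; first by rewrite big_geq // nm0 divr_ge0 // ltW.
have h := kusmin_landau_step E t delta n hE d0 hrec hd hmon.
have inv m : (m <= n)%N -> `|(t m)^-1| <= delta^-1.
{ move=> hm; have [h1 _] := andP (hd m hm); rewrite normfV lef_pV2 ?posrE //; lra. }
have := inv 0%N (leq0n _); have := inv n (leqnn _).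
have [h1 h2] := andP (hd n (leqnn _)); have h3 := nm_1cexp_ge_third _ h2.
have h4 : nm ((cexp (t n) - 1)^-1 * E n.+1) <= 3 / delta.
{ rewrite nmM hE mulr1 nmV nmBC -[leRHS]invrK invf_div lef_pV2 ?posrE ?divr_gt0 //; lra. }
have h5 : nm (\sum_(0 <= m < n.+1) E m) <= nm (\sum_(0 <= m < n.+1) E m - (cexp (t n) - 1)^-1 * E n.+1) + nm ((cexp (t n) - 1)^-1 * E n.+1).
{ by rewrite -{1}(subrK ((cexp (t n) - 1)^-1 * E n.+1) (\sum_(0 <= m < n.+1) E m)) nmD. }
rewrite !ler_norml => /andP[i1 i2] /andP[i3 i4].
move: h h4 h5 i1 i2 i3 i4; clear; lra.
Qed.

Lemma monotone_split (P : nat -> bool) n : (forall m, (m.+1 < n)%N -> P m -> P m.+1) ->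
  exists2 p, (p <= n)%N & (forall m, (m < p)%N -> ~~ P m) /\ (forall m, (p <= m < n)%N -> P m).
Proof.
elim: n => [|n IH] h; first by exists 0%N => //; split => // m; lia.
have [p pn [h1 h2]] := IH (fun m hm => h m (ltnW hm)).
case: (boolP (P n)) => Pn.
{ exists p; first exact: ltnW.
  split => // m /andP[pm]; rewrite ltnS leq_eqVlt => /orP[/eqP -> //|mn]; apply: h2; by rewrite pm mn. }
exists n.+1 => //; split; last by move=> m; lia.
move=> m; rewrite ltnS leq_eqVlt => /orP[/eqP -> //|mn].
case: (ltnP m p) => mp; first exact: h1.
apply/negP => Pm; case/negP: Pn.
have : forall k, (m <= k <= n)%N -> P k.
{ elim => [|k IHk]; first by rewrite leqn0 => /andP[/eqP <- _].
  move=> /andP[mk kn]; case: (ltngtP m k.+1) mk => // [mk|<-] _ //.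
  apply: h => //; apply: IHk; by rewrite -ltnS mk ltnW. }
by apply; rewrite (ltnW mn) leqnn.
Qed.

(** The increments grow by at least [lam] per step. Those at least [sqrt lam] away from 0 form an
    initial and a final stretch, handled by [kusmin_landau]; at most [2/sqrt lam + 1] terms lie
    between. *)
Lemma second_derivative_test psi (lam : R) n : 0 < lam ->
  (forall m, (m.+1 < n)%N -> lam <= (psi m.+2 - psi m.+1) - (psi m.+1 - psi m)) ->
  (forall m, (m < n)%N -> (psi m.+1 - psi m) - (psi 1%N - psi 0%N) <= 1 / 2) ->
  nm (\sum_(0 <= m < n) cexp (psi m)) <= 302 / Num.sqrt lam + 1.
Proof.
move=> l0 hl hv; set delta : R := Num.sqrt lam.
have d0 : 0 < delta by rewrite sqrtr_gt0.
have d2 : delta ^+ 2 = lam by rewrite sqr_sqrtr // ltW.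
(* With this integer removed the first increment lies in [[-3/4, 1/4)]; a total growth of at most
   [1/2] then keeps all increments in [[-3/4, 3/4]], where 0 is the only integer. *)
pose k := Num.floor (psi 1%N - psi 0%N + 3 / 4).
pose t m := psi m.+1 - psi m - k%:~R.
have rec m : cexp (psi m.+1) = cexp (psi m) * cexp (t m).
{ rewrite -cexpD /t -[RHS]mulr1 -(cexp_int k) -cexpD; congr cexp; ring. }
have tinc m : (m.+1 < n)%N -> lam <= t m.+1 - t m by move=> hm; have := hl m hm; rewrite /t; lra.
have tmono m i : (m + i < n)%N -> i%:R * lam <= t (m + i)%N - t m.
{ elim: i => [|i IH] hi; first by rewrite addn0 subrr mul0r.
  rewrite addnS in hi *; have := IH (ltnW hi); have := tinc _ hi; rewrite -[i.+1%:R]natr1; lra. }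
have t0b : - (3 / 4) <= t 0%N < 1 / 4.
{ have := floor_itv (psi 1%N - psi 0%N + 3 / 4); rewrite -/k /t => /andP[k1 k2].
  rewrite intrD in k2; apply/andP; split; move: k1 k2; rewrite ?mulr1z; lra. }
have tb m : (m < n)%N -> `|t m| <= 3 / 4.
{ move=> hm; have := hv m hm => h; have := tmono 0%N m hm; rewrite add0n.
  have : 0 <= m%:R * lam by rewrite mulr_ge0 // ltW.
  have [a b] := andP t0b; rewrite ler_norml => c e; apply/andP; split; move: a b c e h; rewrite /t; lra. }
have tle m : (m.+1 < n)%N -> t m <= t m.+1 by move=> hm; have := tinc m hm; move: l0; clear; lra.
have nmE m : nm (cexp (psi m)) = 1 by exact: nm_cexp.
have [p pn [p1 p2]] := monotone_split (fun m => - delta < t m) n (fun m hm h => lt_le_trans h (tle m hm)).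
have [q qn [q1 q2]] := monotone_split (fun m => delta <= t m) n (fun m hm h => le_trans h (tle m hm)).
have pq : (p <= q)%N.
{ rewrite leqNgt; apply/negP => qp; have := p1 q qp; have := q2 q; rewrite leqnn /= => h.
  have := h (leq_trans qp pn); rewrite -leNgt; lra. }
have KL a b : (a <= b)%N -> (b <= n)%N -> (forall m, (a <= m < b)%N -> delta <= `|t m|) ->
   (forall m, (a <= m)%N -> (m.+1 < b)%N -> 0 < t m * t m.+1) -> nm (\sum_(a <= m < b) cexp (psi m)) <= 150 / delta.
{ move=> ab bn hd hs; rewrite -{1}(add0n a) big_addn.
  apply: (kusmin_landau (fun m => cexp (psi (m + a)%N)) (fun m => t (m + a)%N)) => //.
  { by move=> m hm; rewrite addSn rec. }
  { move=> m hm; rewrite hd ?tb //; first by apply: leq_trans bn; move: hm ab; clear; lia.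
    move: hm ab; clear; lia. }
  move=> m hm; have mb : ((m + a).+1 < b)%N by move: hm ab; clear; lia.
  rewrite addSn; split; last by apply: hs => //; rewrite leq_addl.
  by have := tinc _ (leq_trans mb bn); lra. }
rewrite (big_cat_nat _ (n := p)) //= (big_cat_nat _ (m := p) (n := q)) //=.
have s1 : nm (\sum_(0 <= m < p) cexp (psi m)) <= 150 / delta.
{ apply: KL => // m; first by move=> hm; have := p1 m hm; rewrite -leNgt => h; rewrite ler0_norm; lra.
  move=> _ hm; have := p1 m (ltnW hm); have := p1 _ hm; rewrite -!leNgt; nra. }
have s3 : nm (\sum_(q <= m < n) cexp (psi m)) <= 150 / delta.
{ apply: KL => // m; first by move=> hm; have := q2 m hm => h; rewrite ger0_norm; lra.
  move=> qm hm; have := q2 m; have := q2 m.+1; rewrite qm (ltnW hm) hm (leqW qm) => /(_ isT) a /(_ isT) b; nra. }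
have s2 : nm (\sum_(p <= m < q) cexp (psi m)) <= 2 / delta + 1.
{ apply: le_trans (nm_sum _ _ _ _) _.
  rewrite (eq_bigr (fun=> 1)); last by move=> m _; exact: nm_cexp.
  rewrite sumr_const_nat.
  case: (ltnP p q) => pq'; last by rewrite (eqP pq') mulr0n addr_ge0 // divr_ge0 // ltW.
  have e : (q - p = (q.-1 - p).+1)%N by move: pq'; clear; lia.
  have hq : (p + (q.-1 - p) < n)%N by move: pq' qn; clear; lia.
  have hq1 : (p + (q.-1 - p) = q.-1)%N by move: pq'; clear; lia.
  rewrite e -[leLHS]natr1 lerD2r; have := tmono p (q.-1 - p)%N hq; rewrite hq1.
  have := p2 p; rewrite leqnn (leq_trans pq' qn) => /(_ isT) a.
  have qq : (q.-1 < q)%N by move: pq'; clear; lia.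
  have := q1 _ qq; rewrite -ltNge => b h.
  rewrite ler_pdivlMr //; move: h; rewrite -d2; nra. }
apply: le_trans (nmD _ _) _; apply: le_trans (lerD (lexx _) (nmD _ _)) _.
move: s1 s2 s3; clear; lra.
Qed.

Definition diff3 (P : nat -> R) (m : nat) : R := P m.+3 - 3 * P m.+2 + 3 * P m.+1 - P m.

Lemma diff3_sum (P : nat -> R) m r :
  (P (m + r).+2 - 2 * P (m + r).+1 + P (m + r)%N) - (P m.+2 - 2 * P m.+1 + P m) = \sum_(0 <= i < r) diff3 P (m + i)%N.
Proof.
elim: r => [|r IH]; first by rewrite addn0 subrr big_geq.
by rewrite big_nat_recr //= -IH /diff3 addnS; ring.
Qed.

Definition qphase (al be : R) (P : nat -> R) (m : nat) : R := al * m%:R ^+ 2 + be * m%:R + P m.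

(** Differencing by [r] makes the quadratic phase linear, hence invisible to second differences.
    What is left has second differences between [r lam] and [r Lam], and [L^2 Lam <= 1/2] keeps its
    increments within half a period. *)
Lemma cubic_block (al be lam Lam : R) (P : nat -> R) (a L : nat) : 0 < lam ->
  (forall m, (a <= m < a + L)%N -> lam <= diff3 P m <= Lam) -> L%:R ^+ 2 * Lam <= 1 / 2 ->
  nm (\sum_(0 <= m < L) cexp (qphase al be P (a + m)%N)) ^+ 2 <=
  3 * L%:R + 8 * 151 * Num.sqrt L%:R / Num.sqrt lam.
Proof.
move=> l0 hd hL.
have sl : 0 < Num.sqrt lam by rewrite sqrtr_gt0.
apply: le_trans (weyl_differencing (fun m => cexp (qphase al be P (a + m)%N)) L (fun m => nm_cexp _)) _.
have Lam0 : (0 < L)%N -> 0 <= Lam.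
{ by move=> L0; have := hd a; rewrite leqnn -{1}(addn0 a) ltn_add2l L0 => /(_ isT)/andP[]; lra. }
have key r : (1 <= r < L)%N -> nm (\sum_(0 <= k < L - r) cexp (qphase al be P (a + (k + r))%N) * conjc (cexp (qphase al be P (a + k)%N)))
   <= 302 / Num.sqrt lam * (Num.sqrt r%:R)^-1 + 1.
{ move=> /andP[r1 rL]; have L0 : (0 < L)%N by exact: leq_trans rL.
  have rr : 0 < r%:R :> R by rewrite ltr0n.
  pose psi k := qphase al be P (a + (k + r))%N - qphase al be P (a + k)%N.
  have -> : \sum_(0 <= k < L - r) cexp (qphase al be P (a + (k + r))%N) * conjc (cexp (qphase al be P (a + k)%N)) = \sum_(0 <= k < L - r) cexp (psi k).
  { by apply: eq_bigr => k _; rewrite -cexpN -cexpD. }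
  have d2 m : (psi m.+2 - psi m.+1) - (psi m.+1 - psi m) = \sum_(0 <= i < r) diff3 P (a + m + i)%N.
  { rewrite -(diff3_sum P (a + m) r) /psi /qphase.
    have -> : (a + (m.+2 + r) = (a + m + r).+2)%N by clear; lia.
    have -> : (a + (m.+1 + r) = (a + m + r).+1)%N by clear; lia.
    have -> : (a + (m + r) = a + m + r)%N by clear; lia.
    rewrite !addnS.
    have n2 k : k.+2%:R = k%:R + 2 :> R by rewrite -addn2 natrD.
    have n1 k : k.+1%:R = k%:R + 1 :> R by rewrite -addn1 natrD.
    rewrite !(n2 (a + m)%N) !(n2 (a + m + r)%N) !(n1 (a + m)%N) !(n1 (a + m + r)%N) (natrD _ (a + m)%N r).
    move: (P _) (P _) (P _) (P _) (P _) (P _) ((a + m)%:R) (r%:R) => p1 p2 p3 p4 p5 p6 x y; ring. }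
  have bounds m : (m + r < L)%N -> r%:R * lam <= \sum_(0 <= i < r) diff3 P (a + m + i)%N <= r%:R * Lam.
  { move=> hm; have hh i : (i < r)%N -> lam <= diff3 P (a + m + i)%N <= Lam.
    { move=> hi; apply: hd; move: hm hi; clear; lia. }
    apply/andP; split.
    { apply: le_trans (_ : \sum_(0 <= i < r) lam <= _); first by rewrite sumr_const_nat subn0 mulr_natl.
      by apply: ler_sum_nat => i /andP[_ /hh/andP[]]. }
    apply: le_trans (_ : \sum_(0 <= i < r) Lam <= _); last by rewrite sumr_const_nat subn0 mulr_natl.
    by apply: ler_sum_nat => i /andP[_ /hh/andP[]]. }
  have := second_derivative_test psi (r%:R * lam) (L - r) (mulr_gt0 rr l0).
  rewrite (sqrtrM lam (ltW rr)) invfM mulrA => h; apply: le_trans (h _ _) _; last by rewrite mulrAC.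
  { move=> m hm; rewrite d2; have /andP[] := bounds m (ltac:(move: hm; clear; lia)); lra. }
  have tel m : (m < L - r)%N -> (psi m.+1 - psi m) - (psi 1%N - psi 0%N) <= m%:R * (r%:R * Lam).
  { elim: m => [|m IH] hm; first by rewrite subrr mul0r.
    have := IH (ltnW hm); have := d2 m; have /andP[_] := bounds m (ltac:(move: hm; clear; lia)).
    rewrite -[m.+1%:R]natr1; lra. }
  move=> m hm; apply: le_trans (tel m hm) _; apply: le_trans hL; rewrite mulrA expr2 ler_wpM2r ?Lam0 //.
  apply: ler_pM => //; rewrite ler_nat; move: hm rL; clear; lia. }
have h1 : \sum_(1 <= r < L) nm (\sum_(0 <= k < L - r) cexp (qphase al be P (a + (k + r))%N) * conjc (cexp (qphase al be P (a + k)%N))) <=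
  302 / Num.sqrt lam * (2 * Num.sqrt L%:R) + L%:R.
{ apply: le_trans (_ : \sum_(1 <= r < L) (302 / Num.sqrt lam * (Num.sqrt r%:R)^-1 + 1) <= _).
  { by apply: ler_sum_nat => r hr; exact: key. }
  rewrite big_split /= -mulr_sumr; apply: lerD.
  { apply: ler_wpM2l; first by rewrite divr_ge0 ?ler0n ?(ltW sl).
    case: L hd hL Lam0 key => [|L] _ _ _ _; first by rewrite big_geq // sqrtr0 mulr0.
    apply: le_trans (sum_invsqrt L) _; by rewrite ler_pM2l // ler_wsqrtr // ler_nat. }
  by rewrite sumr_const_nat ler_nat leq_subr. }
have -> : 3 * L%:R + 8 * 151 * Num.sqrt L%:R / Num.sqrt lam = L%:R + 2 * (302 / Num.sqrt lam * (2 * Num.sqrt L%:R) + L%:R) by field; rewrite gt_eqF.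
by rewrite lerD2l ler_pM2l.
Qed.

End VanDerCorput.

(** * Fejer approximation of the sawtooth *)

Section Sawtooth.
Context {R : realType}.

Lemma mean_value (f df : R -> R) (a b : R) : a <= b -> (forall x, a <= x <= b -> is_derive x 1 f (df x)) ->
  exists2 c, a <= c <= b & f b - f a = df c * (b - a).
Proof.
move=> ab hd.
have cont : {within `[a, b], continuous f}.
{ apply: derivable_within_continuous => x; rewrite in_itv /= => hx; exact: (@ex_derive _ _ _ _ _ _ _ (hd x hx)). }
have [||c] := @MVT_segment _ f df a b ab; last by rewrite in_itv /= => hc e; exists c.
{ by move=> x; rewrite in_itv /= => /andP[x1 x2]; apply: hd; rewrite !ltW. }
exact: cont.
Qed.

Definition fejer (K : nat) (t : R) : R :=
  1 + 2 * \sum_(1 <= j < K) (1 - j%:R / K%:R) * cos (2 * pi * (t * j%:R)).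

(** The Fejer mean of the Fourier series of [1/2 - t] on [(0, 1)]. *)
Definition saw (J : nat) (t : R) : R :=
  \sum_(1 <= j < J) (1 - j%:R / J%:R) / (pi * j%:R) * sin (2 * pi * (t * j%:R)).

(** The sawtooth normalised by [ceil t = t + 1/2 + rho t], because the fibres of [floor (h n)] are
    counted by ceilings; at integers it is [-1/2]. *)
Definition rho (t : R) : R := (Num.ceil t)%:~R - t - 1 / 2.

Lemma fejerE K t : (0 < K)%N -> fejer K t = (K%:R)^-1 * nm (\sum_(0 <= k < K) cexp t ^+ k) ^+ 2.
Proof.
move=> K0; have Kr : K%:R != 0 :> R by rewrite pnatr_eq0 -lt0n.
rewrite nm_sum_sqr (eq_bigr (fun=> 1)) => [|i _]; last by rewrite nmX nm_cexp !expr1n.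
rewrite sumr_const_nat subn0 -[1 *+ K]/(K%:R).
have -> : \sum_(1 <= r < K) \sum_(0 <= k < K - r) cexp t ^+ (k + r) * conjc (cexp t ^+ k) =
   \sum_(1 <= r < K) (K - r)%:R * cexp (t * r%:R).
{ apply: eq_bigr => r _; rewrite (eq_bigr (fun=> cexp (t * r%:R))); first by rewrite sumr_const_nat subn0 mulr_natl.
  move=> k _; rewrite exprD mulrC mulrA [conjc _ * _]mulrC mul_conj nmX nm_cexp !expr1n rmorph1 mul1r.
  exact: cexpX. }
have reS (s : seq nat) (F : nat -> R[i]) : complex.Re (\sum_(r <- s) F r) = \sum_(r <- s) complex.Re (F r).
{ by elim/big_rec2: _ => [//|r x y _ <-]; rewrite raddfD. }
rewrite reS mulrDr mulVf // /fejer; congr (_ + _); rewrite mulrCA; congr (_ * _); rewrite mulr_sumr.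
apply: eq_big_nat => r /andP[r1 rK]; rewrite -(rmorph_nat (real_complex R)) /cexp /= mul0r subr0 mulrA natrB ?(ltnW rK) //.
by field.
Qed.

Lemma fejer_ge0 K t : (0 < K)%N -> 0 <= fejer K t.
Proof. by move=> K0; rewrite fejerE // mulr_ge0 ?invr_ge0 ?sqr_ge0. Qed.

Lemma fejer_far K (t delta : R) : (0 < K)%N -> 0 < delta -> delta <= t <= 1 - delta ->
  fejer K t <= 4 / (K%:R * delta ^+ 2).
Proof.
move=> K0 d0 /andP[t1 t2]; have Kr : 0 < K%:R :> R by rewrite ltr0n.
rewrite fejerE //; have -> : 4 / (K%:R * delta ^+ 2) = (K%:R)^-1 * (4 / delta ^+ 2) by field; rewrite !gt_eqF.
rewrite ler_pM2l ?invr_gt0 //.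
have h : nm (\sum_(0 <= k < K) cexp t ^+ k) <= 2 / delta.
{ apply: nm_geom_le => // k; have [k1|k1] := leP 1 k.
  { have : 1 <= k%:~R :> R by rewrite -[1]/(1%:~R) ler_int.
    by move=> h; rewrite ler0_norm; lra. }
  have : k%:~R <= 0 :> R by rewrite -[0]/(0%:~R) ler_int; move: k1; clear; lia.
  by move=> h; rewrite ger0_norm; lra. }
have n0 := nm_ge0 (\sum_(0 <= k < K) cexp t ^+ k).
have -> : 4 / delta ^+ 2 = (2 / delta) ^+ 2 by field; rewrite gt_eqF.
by rewrite lerXn2r // nnegrE divr_ge0 // ltW.
Qed.

Lemma fejer_near K (t : R) (n : int) : (0 < K)%N -> `|t - n%:~R| <= (8 * K%:R)^-1 -> K%:R / 4 <= fejer K t.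
Proof.
move=> K0 ht; have Kr : 0 < K%:R :> R by rewrite ltr0n.
rewrite fejerE // ler_pdivlMl //.
have e k : cexp t ^+ k = cexp ((t - n%:~R) * k%:R).
{ by rewrite -cexpX; congr (_ ^+ _); rewrite cexpD cexpN cexp_int conjc1 mulr1. }
have h1 : nm (K%:R - \sum_(0 <= k < K) cexp t ^+ k) <= K%:R / 2.
{ have -> : K%:R - \sum_(0 <= k < K) cexp t ^+ k = \sum_(0 <= k < K) (1 - cexp t ^+ k).
  { by rewrite sumrB sumr_const_nat subn0. }
  apply: le_trans (nm_sum _ _ _ _) _.
  apply: le_trans (_ : \sum_(0 <= k < K) (K%:R)^-1 * k%:R <= _).
  { apply: ler_sum => k _; rewrite e; apply: le_trans (nm_1cexp_le _) _.
    rewrite normrM normr_nat mulrA ler_wpM2r //.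
    have := ler_wpM2l (ler0n R 8) ht; rewrite invfM mulrA divff ?mul1r // pnatr_eq0 //. }
  rewrite -mulr_sumr ler_pdivrMl //.
  elim: (K) => [|m IH]; first by rewrite big_geq // mul0r.
  by rewrite big_nat_recr //= -[m.+1%:R]natr1; move: IH; nra. }
have h2 : K%:R <= nm (K%:R - \sum_(0 <= k < K) cexp t ^+ k) + nm (\sum_(0 <= k < K) cexp t ^+ k).
{ have := nmD (K%:R - \sum_(0 <= k < K) cexp t ^+ k) (\sum_(0 <= k < K) cexp t ^+ k).
  by rewrite subrK -(rmorph_nat (real_complex R)) nm_real normr_nat. }
have h3 : K%:R / 2 <= nm (\sum_(0 <= k < K) cexp t ^+ k) by move: h1 h2; lra.
have : (K%:R / 2) ^+ 2 <= nm (\sum_(0 <= k < K) cexp t ^+ k) ^+ 2 by rewrite lerXn2r // nnegrE ?divr_ge0 ?nm_ge0.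
by apply: le_trans; apply: eq_imp_le; field.
Qed.

(** Its derivative is minus a Fejer kernel, so on [[0, 1]] it decreases from [1/2] to [-1/2]. It
    vanishes at [1/2] and varies little where the kernel is small. *)
Definition sawerr (J : nat) (t : R) : R := 1 / 2 - t - saw J t.

Lemma is_derive_sinlin (a : R) (t : R) : is_derive t 1 (fun x => sin (a * x)) (a * cos (a * t)).
Proof.
have h : is_derive t 1 (fun x : R => a * x) a.
{ have := @is_deriveZ _ _ _ (@id R) a t 1 1 (is_derive_id _ _); by rewrite /GRing.scale /= mulr1. }
have := @is_derive1_comp _ sin (fun x : R => a * x) t (cos (a * t)) a (is_derive_sin _) h.
by rewrite mulrC.
Qed.

Lemma saw_coef (q p j c : R) : p != 0 -> j != 0 -> q / (p * j) * (2 * p * j * c) = 2 * (q * c).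
Proof. by move=> p0 j0; field; rewrite p0 j0. Qed.

Lemma is_derive_sawerr (J : nat) (t : R) : is_derive t 1 (sawerr J) (- fejer J t).
Proof.
have hs : is_derive t 1 (saw J) (2 * \sum_(1 <= j < J) (1 - j%:R / J%:R) * cos (2 * pi * (t * j%:R))).
{ rewrite mulr_sumr.
  have -> : saw J = \sum_(1 <= j < J) (fun t : R => (1 - j%:R / J%:R) / (pi * j%:R) * sin (2 * pi * j%:R * t)).
  { apply/funext => x; rewrite fct_sumE /saw; apply: eq_bigr => j _; congr (_ * sin _); ring. }
  rewrite big_nat [X in is_derive _ _ _ X]big_nat.
  elim/big_rec2: _ => [|j f df /andP[j1 _] IH]; first exact: is_derive_cst.
  apply: is_deriveD => //.
  have j0 : j%:R != 0 :> R by rewrite pnatr_eq0 -lt0n.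
  have pi0 : pi != 0 :> R by rewrite gt_eqF // pi_gt0.
  have := @is_deriveZ _ _ _ _ ((1 - j%:R / J%:R) / (pi * j%:R)) t 1 _ (is_derive_sinlin (2 * pi * j%:R) t).
  rewrite /GRing.scale /=; move: (1 - j%:R / J%:R) => q.
  have -> : q / (pi * j%:R) * (2 * pi * j%:R * cos (2 * pi * j%:R * t)) = 2 * (q * cos (2 * pi * (t * j%:R))).
  { have -> : 2 * pi * j%:R * t = 2 * pi * (t * j%:R) by ring.
    exact: saw_coef. }
  by []. }
have -> : sawerr J = (fun t => 1 / 2 - t) - saw J by [].
have -> : - fejer J t = - 1 - 2 * \sum_(1 <= j < J) (1 - j%:R / J%:R) * cos (2 * pi * (t * j%:R)) by rewrite /fejer opprD.
apply: is_deriveB; have := @is_deriveB _ _ _ (cst (1 / 2 : R)) (@id R) t 1 0 1 (is_derive_cst _ _ _) (is_derive_id _ _).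
by rewrite sub0r.
Qed.

Lemma sawerr_mono J (s t : R) : (0 < J)%N -> s <= t -> sawerr J t <= sawerr J s.
Proof.
move=> J0 st.
have [c _ e] := mean_value (sawerr J) (fun x => - fejer J x) s t st (fun x _ => is_derive_sawerr J x).
have := fejer_ge0 J c J0 => h; rewrite -subr_le0 e mulNr oppr_le0 mulr_ge0 // subr_ge0 //.
Qed.

Lemma saw_int J (n : int) : saw J n%:~R = 0.
Proof.
rewrite /saw big1 // => j _; have -> : sin (2 * pi * (n%:~R * j%:R)) = 0 :> R; last by rewrite mulr0.
by have := congr1 (@complex.Im R) (cexp_int (n * j%:Z)); rewrite intrM /cexp /=.
Qed.

Lemma sawDint J (t : R) (n : int) : saw J (t + n%:~R) = saw J t.
Proof.
apply: eq_bigr => j _; congr (_ * _).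
have := congr1 (@complex.Im R) (cexpD (t * j%:R) (n * j%:Z)%:~R).
by rewrite cexp_int mulr1 intrM -mulrDl /cexp /=.
Qed.

Lemma saw_half J : saw J (1 / 2) = 0.
Proof.
rewrite /saw big1 // => j _.
have -> : 2 * pi * (1 / 2 * j%:R) = pi *+ j :> R by rewrite -mulr_natr; field.
have -> : sin (pi *+ j) = 0 :> R; last by rewrite mulr0.
by elim: j => [|j IH]; rewrite ?mulr0n ?sin0 // mulrSr sinDpi IH oppr0.
Qed.

Lemma sawerr_le_half J (t : R) : (0 < J)%N -> 0 <= t <= 1 -> `|sawerr J t| <= 1 / 2.
Proof.
move=> J0 /andP[t0 t1].
have := sawerr_mono J 0 t J0 t0; have := sawerr_mono J t 1 J0 t1.
have e0 : sawerr J 0 = 1 / 2 by rewrite /sawerr -[0]/(0%:~R) saw_int; lra.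
have e1 : sawerr J 1 = - (1 / 2) by rewrite /sawerr -[X in saw _ X]/(1%:~R) saw_int; lra.
by rewrite e0 e1 ler_norml => h1 h2; apply/andP; split.
Qed.

Lemma sawerr_far J (t delta : R) : (0 < J)%N -> 0 < delta -> delta <= t <= 1 - delta ->
  `|sawerr J t| <= 4 / (J%:R * delta ^+ 2).
Proof.
move=> J0 d0 /andP[t1 t2].
have half : sawerr J (1 / 2) = 0 by rewrite /sawerr saw_half; lra.
have bnd (a b : R) : delta <= a -> a <= b -> b <= 1 - delta -> `|sawerr J b - sawerr J a| <= 4 / (J%:R * delta ^+ 2) * (b - a).
{ move=> da ab bd.
  have [c /andP[c1 c2] ->] := mean_value (sawerr J) (fun x => - fejer J x) a b ab (fun x _ => is_derive_sawerr J x).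
  rewrite normrM normrN (ger0_norm (fejer_ge0 J c J0)) [`|b - a|]ger0_norm ?subr_ge0 //.
  apply: ler_wpM2r; first by rewrite subr_ge0.
  apply: fejer_far => //; apply/andP; split; lra. }
have c0 : 0 <= 4 / (J%:R * delta ^+ 2) by rewrite divr_ge0 // mulr_ge0 // sqr_ge0.
have [th|th] := leP t (1 / 2).
{ have := bnd t (1 / 2) t1 th (ltac:(lra)); rewrite half sub0r normrN => /le_trans; apply.
  by rewrite ler_piMr //; lra. }
have := bnd (1 / 2) t (ltac:(lra)) (ltW th) t2; rewrite half subr0 => /le_trans; apply.
by rewrite ler_piMr //; lra.
Qed.

(** Within [1/(8K)] of an integer the approximation fails, but the difference is at most [1/2] there
    while [4/K * fejer K] is at least 1. A second Fejer kernel thus majorises the bad set, in a form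
    that exponential sums can handle. *)
Lemma rho_approx (J K : nat) (t : R) : (0 < J)%N -> (0 < K)%N ->
  `|rho t - saw J t| <= 256 * (K%:R ^+ 2 / J%:R) + 4 / K%:R * fejer K t.
Proof.
move=> J0 K0; have Jr : 0 < J%:R :> R by rewrite ltr0n.
have Kr : 0 < K%:R :> R by rewrite ltr0n.
have K1 : 1 <= K%:R :> R by rewrite ler1n.
pose n := Num.floor t; pose s := t - n%:~R.
have /andP[n1 n2] := floor_itv t; rewrite -/n in n1 n2.
rewrite intrD mulr1z in n2.
have ts : t = s + n%:~R by rewrite /s subrK.
have sJ : saw J t = saw J s by rewrite ts sawDint.
(* The radius of [fejer_near]; it turns [4/(J delta^2)] into [256 K^2/J]. *)
pose delta : R := (8 * K%:R)^-1.
have d0 : 0 < delta by rewrite invr_gt0 mulr_gt0.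
have f0 : 0 <= 4 / K%:R * fejer K t by rewrite mulr_ge0 ?fejer_ge0 // divr_ge0 // ltW.
have q0 : 0 <= 256 * (K%:R ^+ 2 / J%:R) :> R by rewrite mulr_ge0 ?ler0n // divr_ge0 ?sqr_ge0 // ltW.
have big (k : int) : `|t - k%:~R| <= delta -> 1 <= 4 / K%:R * fejer K t.
{ move=> h; have := fejer_near K t k K0 h; rewrite -(@ler_pM2l _ (4 / K%:R)) ?divr_gt0 //.
  by move=> h2; apply: le_trans h2; apply: eq_imp_le; field; rewrite gt_eqF. }
have le1 : 1 / 2 <= 1 :> R by lra.
have [s0|s0] := eqVneq s 0.
{ have tn : t = n%:~R by rewrite ts s0 add0r.
  have -> : rho t - saw J t = - (1 / 2) by rewrite /rho tn intrKceil saw_int; lra.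
  have := big n; rewrite tn subrr normr0 normrN (ger0_norm (ltW _ : 0 <= 1 / 2 :> R)); last by lra.
  by move=> /(_ (ltW d0)); rewrite -tn; move: q0 le1; lra. }
have sp : 0 < s < 1 by rewrite lt_def s0 /s /=; apply/andP; split; move: n1 n2; clear; lra.
have [s1 s2] := andP sp.
have -> : rho t - saw J t = sawerr J s.
{ have ct : Num.ceil t = n + 1.
  { apply: ceil_def; rewrite addrK intrD mulr1z; apply/andP; split; move: s1 n2; rewrite /s; clear; lra. }
  rewrite /rho ct sJ /sawerr intrD mulr1z; move: (saw J s) => y; rewrite /s; clear; lra. }
have [sd|sd] := leP s delta.
{ have := sawerr_le_half J s J0 (ltac:(by rewrite !ltW)); have := big n; rewrite -/s ger0_norm ?(ltW s1) // => /(_ sd).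
  move: q0 le1; lra. }
have [sd2|sd2] := leP (1 - delta) s.
{ have := sawerr_le_half J s J0 (ltac:(by rewrite !ltW)); have := big (n + 1); rewrite intrD mulr1z.
  have -> : t - (n%:~R + 1) = - (1 - s) by rewrite /s; ring.
  rewrite normrN ger0_norm; last by move: s2; clear; lra.
  move=> /(_ (ltac:(move: sd2; (clear; lra)))); move: q0 le1; clear; lra. }
have := sawerr_far J s delta J0 d0 (ltac:(by rewrite !ltW)).
have -> : 4 / (J%:R * delta ^+ 2) = 256 * (K%:R ^+ 2 / J%:R) by rewrite /delta; field; rewrite !gt_eqF.
by move: f0; clear; lra.
Qed.

Lemma rho_le (t : R) : `|rho t| <= 1 / 2.
Proof.
have /andP[h1 h2] := ceil_itv t; rewrite intrB mulr1z in h1.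
by rewrite /rho ler_norml; apply/andP; split; lra.
Qed.

Lemma frac_weight (j J : nat) : (j < J)%N -> 0 <= 1 - j%:R / J%:R :> R /\ 1 - j%:R / J%:R <= 1 :> R.
Proof.
move=> jJ; have Jr : 0 < J%:R :> R by rewrite ltr0n (leq_trans _ jJ).
have h1 : 0 <= j%:R / J%:R :> R by rewrite divr_ge0.
have h2 : j%:R / J%:R <= 1 :> R by rewrite ler_pdivrMr // mul1r ler_nat ltnW.
by split; lra.
Qed.

Lemma sum_fejer_le (P : nat -> R) (K a b : nat) (B : R) : (0 < K)%N -> 0 <= B ->
  (forall j, (1 <= j < K)%N -> nm (\sum_(a <= m < b) cexp (P m * j%:R)) <= B) ->
  \sum_(a <= m < b) fejer K (P m) <= (b - a)%:R + 2 * K%:R * B.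
Proof.
move=> K0 B0 hB; rewrite /fejer big_split /= sumr_const_nat lerD2l.
rewrite -mulr_sumr -mulrA ler_pM2l // exchange_big /=.
have Kr : 0 < K%:R :> R by rewrite ltr0n.
have reS (s : seq nat) (F : nat -> R[i]) : complex.Re (\sum_(r <- s) F r) = \sum_(r <- s) complex.Re (F r).
{ by elim/big_rec2: _ => [//|r x y _ <-]; rewrite raddfD. }
apply: le_trans (_ : \sum_(1 <= j < K) B <= _); last first.
{ by rewrite sumr_const_nat -[leLHS]mulr_natl ler_wpM2r // ler_nat leq_subr. }
apply: ler_sum_nat => j hj; rewrite -mulr_sumr.
have h1 : `|\sum_(a <= m < b) cos (2 * pi * (P m * j%:R))| <= B.
{ apply: le_trans (hB j hj); have -> : \sum_(a <= m < b) cos (2 * pi * (P m * j%:R)) = complex.Re (\sum_(a <= m < b) cexp (P m * j%:R)) by rewrite reS.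
  exact: nm_Re. }
have [j1 jK] := andP hj.
have [h3 h4] := frac_weight j K jK; apply: le_trans (ler_norm _) _; rewrite normrM (ger0_norm h3).
by apply: le_trans h1; rewrite ler_piMl.
Qed.

Lemma nm_sum_saw_le (u : nat -> R[i]) (P : nat -> R) (J a b : nat) (B : R) : (0 < J)%N ->
  (forall j, (1 <= j < J)%N -> nm (\sum_(a <= m < b) u m * cexp (P m * j%:R)) <= B /\
     nm (\sum_(a <= m < b) u m * cexp (- (P m * j%:R))) <= B) -> 0 <= B ->
  nm (\sum_(a <= m < b) u m * real_complex R (saw J (P m))) <= 2 * Num.sqrt J%:R * B.
Proof.
move=> J0 hB B0; have Jr : 0 < J%:R :> R by rewrite ltr0n.
have -> : \sum_(a <= m < b) u m * real_complex R (saw J (P m)) =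
  \sum_(1 <= j < J) real_complex R ((1 - j%:R / J%:R) / (pi * j%:R)) * \sum_(a <= m < b) u m * real_complex R (sin (2 * pi * (P m * j%:R))).
{ rewrite (eq_bigr (fun m => \sum_(1 <= j < J) real_complex R ((1 - j%:R / J%:R) / (pi * j%:R)) * (u m * real_complex R (sin (2 * pi * (P m * j%:R)))))).
  { by rewrite exchange_big /=; apply: eq_bigr => j _; rewrite mulr_sumr. }
  move=> m _; rewrite /saw rmorph_sum mulr_sumr; apply: eq_bigr => j _; rewrite rmorphM /=; ring. }
apply: le_trans (nm_sum _ _ _ _) _.
apply: le_trans (_ : \sum_(1 <= j < J) (j%:R)^-1 * B <= _); last first.
{ rewrite -mulr_suml ler_wpM2r //; case: (J) J0 => // J' _; apply: le_trans (sum_inv_le J') _.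
  by rewrite ler_pM2l // ler_wsqrtr // ler_nat. }
apply: ler_sum_nat => j hj; have [j1 jJ] := andP hj; have [b1 b2] := hB j hj.
have jr : 0 < j%:R :> R by rewrite ltr0n.
have pi1 : 1 <= pi :> R by have := pi_ge2 R; lra.
rewrite nmM nm_real; apply: ler_pM => //; first exact: nm_ge0.
{ have [h3 h4] := frac_weight j J jJ; have pj : 0 < pi * j%:R :> R by rewrite mulr_gt0 // pi_gt0.
  rewrite ger0_norm ?divr_ge0 ?(ltW pj) // ler_pdivrMr //.
  apply: le_trans h4 _; rewrite mulrC mulfK ?gt_eqF //. }
set S := \sum_(a <= m < b) u m * real_complex R _.
have e : Complex 0 2 * S = \sum_(a <= m < b) u m * cexp (P m * j%:R) - \sum_(a <= m < b) u m * cexp (- (P m * j%:R)).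
{ rewrite /S mulr_sumr -sumrB; apply: eq_bigr => m _; rewrite -mulrBr mulrCA; congr (_ * _).
  by rewrite cexpN /cexp; apply/eqP; rewrite eq_complex /=; apply/andP; split; apply/eqP; ring. }
have n2 : nm (Complex 0 2 : R[i]) = 2.
{ apply/eqP; rewrite -(@eqrXn2 _ 2) ?nm_ge0 //; apply/eqP; rewrite nmsqE /=; ring. }
have := congr1 nm e; rewrite nmM n2 => h; have := nmB (\sum_(a <= m < b) u m * cexp (P m * j%:R)) (\sum_(a <= m < b) u m * cexp (- (P m * j%:R))).
by rewrite -h; move: b1 b2; lra.
Qed.

Lemma cubic_sum (al lam Lam : R) (P : nat -> R) (a b L : nat) (S : R) : 0 < lam -> (0 < L)%N -> (a <= b)%N ->
  (forall m, (a <= m < b)%N -> lam <= diff3 P m <= Lam) -> L%:R ^+ 2 * Lam <= 1 / 2 ->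
  0 <= S -> 3 * L%:R + 8 * 151 * Num.sqrt L%:R / Num.sqrt lam <= S ^+ 2 ->
  nm (\sum_(a <= m < b) cexp (qphase al 0 P m)) <= (b - a)%:R / L%:R * S + L%:R.
Proof.
move=> l0 L0 ab hd hL S0 hS; have Lr : 0 < L%:R :> R by rewrite ltr0n.
pose n := ((b - a) %/ L)%N; pose r := ((b - a) %% L)%N.
have e : (b - a = L * n + r)%N by rewrite mulnC -divn_eq.
have rL : (r < L)%N by rewrite ltn_mod.
rewrite -{1}(add0n a) big_addn e (big_cat_nat _ (n := (L * n)%N)) ?leq_addr //=.
apply: le_trans (nmD _ _) _; apply: lerD; last first.
{ apply: le_trans (nm_sum _ _ _ _) _; rewrite (eq_bigr (fun=> 1)); last by move=> i _; exact: nm_cexp.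
  by rewrite sumr_const_nat addKn ler_nat ltnW. }
rewrite sum_nat_blocks; apply: le_trans (nm_sum _ _ _ _) _.
apply: le_trans (_ : \sum_(0 <= t < n) S <= _); last first.
{ rewrite sumr_const_nat subn0 -[leLHS]mulr_natl ler_wpM2r // ler_pdivlMr // -natrM ler_nat mulnC leq_addr //. }
apply: ler_sum_nat => t /andP[_ tn].
have hb : (a + L * t + L <= b)%N.
{ have : (L * t.+1 <= L * n)%N by rewrite leq_mul2l tn orbT.
  rewrite mulnS; move: e ab; clear; lia. }
have := cubic_block al 0 lam Lam P (a + L * t) L l0 _ hL; move=> /(_ _) h.
rewrite -(@ler_pXn2r _ 2) ?nnegrE ?nm_ge0 //; apply: le_trans hS; apply: le_trans (h _).
{ by apply: eq_imp_le; congr (nm _ ^+ 2); apply: eq_bigr => i _; congr (cexp (qphase _ _ _ _)); clear; lia. }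
by move=> m /andP[m1 m2]; apply: hd; move: m1 m2 hb; clear; lia.
Qed.

Lemma diff3Z (P : nat -> R) (c : R) m : diff3 (fun m => P m * c) m = diff3 P m * c.
Proof. by rewrite /diff3; ring. Qed.

Lemma rho_arith (T y a b B : R) : a <= T * y -> b <= (35 * T + 1) * y -> B <= (35 * T + 1) * y ->
  0 <= T * y -> 0 <= y -> 2 * b + (256 * a + (4 * a + 8 * B)) <= (8 * 80 * T + 16) * y.
Proof. by move=> h1 h2 h3 h4 h5; lra. Qed.

(** The parameters are powers of [w] for a range of length about [w^46]. Blocks of length [L = w^40]
    and frequencies up to [J = w^6] meet the constraint [L^2 J Lam <= 1/2]; a block sum is
    [O(w^34)], so each frequency costs [O(w^40)]. The sawtooth series loses [sqrt J = w^3], and the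
    truncation errors [w^46 K^2/J] and [w^46/K], balanced by [K = w^2], give [w^44]. *)
Lemma rho_sum_bound (al Lam : R) (P : nat -> R) (w M : nat) : (0 < w)%N -> (M <= 2 ^ 46 * w ^ 46)%N ->
  (forall m, (w ^ 44 <= m < M)%N -> (w%:R ^+ 96)^-1 <= diff3 P m <= Lam) -> w%:R ^+ 86 * Lam <= 1 / 2 ->
  nm (\sum_(w ^ 44 <= m < M) cexp (al * m%:R ^+ 2) * real_complex R (rho (P m))) <= (8 * 80 * 2 ^+ 46 + 16) * w%:R ^+ 44.
Proof.
move=> w0 hM hd hL; have wr : 0 < w%:R :> R by rewrite ltr0n.
have w1 : 1 <= w%:R :> R by rewrite ler1n.
case: (leqP (w ^ 44) M) => hwM; last first.
{ by rewrite big_geq ?(ltnW hwM) // nm0 mulr_ge0 ?addr_ge0 ?mulr_ge0 ?exprn_ge0 ?ler0n. }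
pose L := (w ^ 40)%N; pose J := (w ^ 6)%N; pose K := (w ^ 2)%N.
have L0 : (0 < L)%N by rewrite expn_gt0 w0.
have J0 : (0 < J)%N by rewrite expn_gt0 w0.
have K0 : (0 < K)%N by rewrite expn_gt0 w0.
have LE : L%:R = w%:R ^+ 40 :> R by rewrite natrX.
have JE : J%:R = w%:R ^+ 6 :> R by rewrite natrX.
have KE : K%:R = w%:R ^+ 2 :> R by rewrite natrX.
have Lr : 0 < L%:R :> R by rewrite ltr0n.
have Mr : (M - w ^ 44)%:R <= 2 ^+ 46 * w%:R ^+ 46 :> R.
{ by rewrite -!natrX -natrM ler_nat; apply: leq_trans hM; rewrite leq_subr. }
have l0 : 0 < (w%:R ^+ 96)^-1 :> R by rewrite invr_gt0 exprn_gt0.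
have sqX (k : nat) : Num.sqrt (w%:R ^+ (2 * k)) = w%:R ^+ k :> R.
{ by rewrite mulnC exprM sqrtr_sqr ger0_norm // exprn_ge0. }
pose S : R := 35 * w%:R ^+ 34.
have S0 : 0 <= S by rewrite mulr_ge0 ?ler0n // exprn_ge0.
have hS : 3 * L%:R + 8 * 151 * Num.sqrt L%:R / Num.sqrt (w%:R ^+ 96)^-1 <= S ^+ 2.
{ rewrite LE sqrtrV ?exprn_ge0 // (sqX 20%N) (sqX 48%N) invrK -mulrA -exprD /S exprMn -exprM /=.
  have : w%:R ^+ 40 <= w%:R ^+ 68 :> R by rewrite ler_weXn2l.
  have : 0 <= w%:R ^+ 68 :> R by rewrite exprn_ge0.
  have -> : (34 * 2 = 68)%N by [].
  rewrite (expr2 (35 : R)).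
  move: (w%:R ^+ 40) (w%:R ^+ 68) => x y; clear; lra. }
pose B : R := (35 * 2 ^+ 46 + 1) * w%:R ^+ 40.
have p46 : 0 <= 2 ^+ 46 :> R by rewrite exprn_ge0.
have B0 : 0 <= B by rewrite mulr_ge0 ?exprn_ge0 // addr_ge0 // mulr_ge0.
have main (al' : R) j : (1 <= j < J)%N -> nm (\sum_(w ^ 44 <= m < M) cexp (qphase al' 0 (fun m => P m * j%:R) m)) <= B.
{ move=> /andP[j1 jJ]; have jr : 1 <= j%:R :> R by rewrite ler1n.
  have jJr : j%:R <= J%:R :> R by rewrite ler_nat ltnW.
  have hcs := cubic_sum al' (w%:R ^+ 96)^-1 (Lam * J%:R) (fun m => P m * j%:R) (w ^ 44) M L S l0 L0 hwM.
  apply: le_trans (hcs _ _ S0 hS) _.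
  { move=> m hm; have /andP[d1 d2] := hd m hm; rewrite diff3Z.
    have d0 : 0 <= diff3 P m by exact: le_trans (ltW l0) d1.
    apply/andP; split; first by apply: le_trans d1 _; rewrite ler_peMr.
    by apply: ler_pM => //; lra. }
  { apply: le_trans hL; rewrite LE JE -exprM mulrCA mulrC -exprD; apply: eq_imp_le; ring. }
  rewrite LE /S /B [leRHS]mulrDl mul1r lerD2r.
  have -> : (M - w ^ 44)%:R / w%:R ^+ 40 * (35 * w%:R ^+ 34) = (M - w ^ 44)%:R * (35 * (w%:R ^+ 34 / w%:R ^+ 40)) :> R by ring.
  have -> : w%:R ^+ 34 / w%:R ^+ 40 = (w%:R ^+ 6)^-1 :> R.
  { rewrite -[40%N]/(34 + 6)%N exprD invfM mulrA divff ?mul1r // gt_eqF // exprn_gt0 //. }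
  rewrite mulrA ler_pdivrMr ?exprn_gt0 //; apply: le_trans (ler_wpM2r (ler0n R 35) Mr) _.
  have -> : w%:R ^+ 46 = w%:R ^+ 40 * w%:R ^+ 6 :> R by rewrite -exprD.
  by apply: eq_imp_le; ring. }
have main2 j : (1 <= j < J)%N -> nm (\sum_(w ^ 44 <= m < M) cexp (al * m%:R ^+ 2) * cexp (P m * j%:R)) <= B /\
     nm (\sum_(w ^ 44 <= m < M) cexp (al * m%:R ^+ 2) * cexp (- (P m * j%:R))) <= B.
{ move=> hj; split.
  { apply: le_trans (main al j hj); apply: eq_imp_le; congr nm; apply: eq_bigr => m _.
    by rewrite -cexpD /qphase mul0r addr0. }
  apply: le_trans (main (- al) j hj); rewrite -[leRHS]nm_conj; apply: eq_imp_le; congr nm.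
  rewrite [RHS]raddf_sum; apply: eq_bigr => m _.
  by rewrite -[RHS]/(conjc _) -cexpN -cexpD /qphase mul0r addr0 mulNr opprD opprK. }
have main3 j : (1 <= j < K)%N -> nm (\sum_(w ^ 44 <= m < M) cexp (P m * j%:R)) <= B.
{ move=> /andP[j1 jK]; have hj : (1 <= j < J)%N.
  { by rewrite j1 /=; apply: leq_trans jK _; rewrite leq_pexp2l. }
  apply: le_trans (main 0 j hj); apply: eq_imp_le; congr nm; apply: eq_bigr => m _.
  by rewrite /qphase !mul0r !add0r. }
have h1 := nm_sum_saw_le (fun m => cexp (al * m%:R ^+ 2)) P J (w ^ 44) M B J0 main2 B0.
have h2 := sum_fejer_le P K (w ^ 44) M B K0 B0 main3.
have e : \sum_(w ^ 44 <= m < M) cexp (al * m%:R ^+ 2) * real_complex R (rho (P m)) =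
  \sum_(w ^ 44 <= m < M) cexp (al * m%:R ^+ 2) * real_complex R (saw J (P m)) +
  \sum_(w ^ 44 <= m < M) cexp (al * m%:R ^+ 2) * real_complex R (rho (P m) - saw J (P m)).
{ by rewrite -big_split /=; apply: eq_bigr => m _; rewrite -mulrDr -rmorphD /= addrC subrK. }
have h3 : nm (\sum_(w ^ 44 <= m < M) cexp (al * m%:R ^+ 2) * real_complex R (rho (P m) - saw J (P m))) <=
  (M - w ^ 44)%:R * (256 * (K%:R ^+ 2 / J%:R)) + 4 / K%:R * ((M - w ^ 44)%:R + 2 * K%:R * B).
{ apply: le_trans (nm_sum _ _ _ _) _.
  apply: le_trans (_ : \sum_(w ^ 44 <= m < M) (256 * (K%:R ^+ 2 / J%:R) + 4 / K%:R * fejer K (P m)) <= _).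
  { by apply: ler_sum => m _; rewrite nmM nm_cexp mul1r nm_real; exact: rho_approx. }
  rewrite big_split /= sumr_const_nat -[X in X + _ <= _]mulr_natl lerD2l -mulr_sumr ler_wpM2l //. }
rewrite e; apply: le_trans (nmD _ _) _; apply: le_trans (lerD h1 h3) _.
have sJ : Num.sqrt J%:R = w%:R ^+ 3 :> R by rewrite JE (sqX 3%N).
rewrite sJ JE KE.
have e1 : (w%:R ^+ 2) ^+ 2 / w%:R ^+ 6 = (w%:R ^+ 2)^-1 :> R.
{ rewrite -exprM -[6%N]/(4 + 2)%N exprD invfM mulrA divff ?mul1r // gt_eqF // exprn_gt0 //. }
rewrite e1.
have e2 : (M - w ^ 44)%:R * (w%:R ^+ 2)^-1 <= 2 ^+ 46 * w%:R ^+ 44 :> R.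
{ rewrite ler_pdivrMr ?exprn_gt0 //; apply: le_trans Mr _; apply: eq_imp_le.
  have -> : w%:R ^+ 46 = w%:R ^+ 44 * w%:R ^+ 2 :> R by rewrite -exprD.
  by rewrite mulrA. }
have e3 : w%:R ^+ 3 * B <= (35 * 2 ^+ 46 + 1) * w%:R ^+ 44.
{ rewrite /B mulrCA -exprD ler_wpM2l ?ler_weXn2l //; by rewrite addr_ge0 // mulr_ge0. }
have e4 : B <= (35 * 2 ^+ 46 + 1) * w%:R ^+ 44.
{ rewrite /B ler_wpM2l ?ler_weXn2l //; by rewrite addr_ge0 // mulr_ge0. }
have e5 : 4 / w%:R ^+ 2 * ((M - w ^ 44)%:R + 2 * w%:R ^+ 2 * B) = 4 * ((M - w ^ 44)%:R * (w%:R ^+ 2)^-1) + 8 * B.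
{ by field; rewrite gt_eqF. }
rewrite e5; have e6 : (M - w ^ 44)%:R * (256 * (w%:R ^+ 2)^-1) = 256 * ((M - w ^ 44)%:R * (w%:R ^+ 2)^-1) :> R by ring.
rewrite e6; have e7 : 2 * w%:R ^+ 3 * B = 2 * (w%:R ^+ 3 * B) by ring.
rewrite e7; have w44 : 0 <= 2 ^+ 46 * w%:R ^+ 44 :> R by rewrite mulr_ge0 ?exprn_ge0.
have w44' : 0 <= w%:R ^+ 44 :> R by rewrite exprn_ge0.
exact: rho_arith.
Qed.

End Sawtooth.

(** * Regularly varying functions and their inverses *)

Section DerivativeRules.
Context {R : realType}.
Implicit Types (f g : R -> R) (x : R).

Lemma der_eq f x (a b : R) : is_derive x 1 f a -> a = b -> is_derive x 1 f b.
Proof. by move=> h <-. Qed.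

Lemma derM f g x (a b : R) : is_derive x 1 f a -> is_derive x 1 g b ->
  is_derive x 1 (fun y => f y * g y) (a * g x + f x * b).
Proof.
move=> hf hg; apply: der_eq (@is_deriveM _ _ f g x 1 a b hf hg) _.
by rewrite /GRing.scale /=; ring.
Qed.

Lemma derD f g x (a b : R) : is_derive x 1 f a -> is_derive x 1 g b ->
  is_derive x 1 (fun y => f y + g y) (a + b).
Proof. by move=> hf hg; exact: (@is_deriveD _ _ _ f g x 1 a b hf hg). Qed.

Lemma derN f x (a : R) : is_derive x 1 f a -> is_derive x 1 (fun y => - f y) (- a).
Proof. by move=> hf; exact: (@is_deriveN _ _ _ f x 1 a hf). Qed.

Lemma derB f g x (a b : R) : is_derive x 1 f a -> is_derive x 1 g b ->
  is_derive x 1 (fun y => f y - g y) (a - b).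
Proof. by move=> hf hg; apply: derD => //; exact: derN. Qed.

Lemma derC (c : R) x : is_derive x 1 (fun=> c) 0.
Proof. exact: is_derive_cst. Qed.

Lemma derI x : is_derive x 1 (fun y : R => y) 1.
Proof. exact: is_derive_id. Qed.

Lemma derZ (c : R) f x (a : R) : is_derive x 1 f a -> is_derive x 1 (fun y => c * f y) (c * a).
Proof. by move=> hf; apply: der_eq (derM (fun=> c) f x 0 a (derC c x) hf) _; rewrite mul0r add0r. Qed.

Lemma derV f x (a : R) : is_derive x 1 f a -> f x != 0 ->
  is_derive x 1 (fun y => (f y)^-1) (- a / f x ^+ 2).
Proof.
move=> hf nz; apply: der_eq (@is_deriveV _ f x a 1 nz hf) _.
by rewrite /GRing.scale /=; field.
Qed.

Lemma der_comp f g x (a b : R) : is_derive (g x) 1 f a -> is_derive x 1 g b ->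
  is_derive x 1 (fun y => f (g y)) (a * b).
Proof. by move=> hf hg; exact: (@is_derive1_comp R f g x a b hf hg). Qed.

Lemma der_continuous f x (a : R) : is_derive x 1 f a -> {for x, continuous f}.
Proof. by move=> h; apply/differentiable_continuous/derivable1_diffP; exact: (@ex_derive _ _ _ _ _ _ _ h). Qed.

Lemma der_shift f (s x a : R) : is_derive (x + s) 1 f a -> is_derive x 1 (fun y => f (y + s)) a.
Proof.
move=> hf; apply: der_eq (der_comp f (fun y => y + s) x a 1 hf _) _; last by rewrite mulr1.
by apply: der_eq (derD _ _ x 1 0 (derI x) (derC s x)) _; rewrite addr0.
Qed.

Lemma diff3_mean (f f1 f2 f3 : R -> R) (a : R) :
  (forall x, a <= x <= a + 3 -> [/\ is_derive x 1 f (f1 x), is_derive x 1 f1 (f2 x) & is_derive x 1 f2 (f3 x)]) ->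
  exists2 xi, a <= xi <= a + 3 & f (a + 3) - 3 * f (a + 2) + 3 * f (a + 1) - f a = f3 xi.
Proof.
move=> hd; pose u y := f (y + 1) - f y; pose v y := u (y + 1) - u y.
pose u1 y := f1 (y + 1) - f1 y; pose u2 y := f2 (y + 1) - f2 y.
have hu y : a <= y -> y <= a + 2 -> is_derive y 1 u (u1 y) /\ is_derive y 1 u1 (u2 y).
{ move=> y1 y2; have [p1 p2 _] := hd y (ltac:(lra)); have [q1 q2 _] := hd (y + 1) (ltac:(lra)).
  by split; apply: derB => //; exact: der_shift. }
have hv y : a <= y <= a + 1 -> is_derive y 1 v (u1 (y + 1) - u1 y).
{ move=> hy; have [p1 _] := hu y (ltac:(lra)) (ltac:(lra)); have [q1 _] := hu (y + 1) (ltac:(lra)) (ltac:(lra)).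
  by apply: derB => //; exact: der_shift. }
have a1 : a <= a + 1 by lra.
have [x1 h1 e1] := mean_value v _ a (a + 1) a1 hv.
have x11 : x1 <= x1 + 1 by lra.
have [x2 h2 e2] := mean_value u1 u2 x1 (x1 + 1) x11 (fun y hy => (hu y (ltac:(lra)) (ltac:(lra))).2).
have x22 : x2 <= x2 + 1 by lra.
have hf2 y : x2 <= y <= x2 + 1 -> is_derive y 1 f2 (f3 y) by move=> hy; have [_ _] := hd y (ltac:(lra)).
have [x3 h3 e3] := mean_value f2 f3 x2 (x2 + 1) x22 hf2.
exists x3; first by lra.
have o (z : R) : z + 1 - z = 1 by ring.
rewrite !o !mulr1 in e1 e2 e3.
rewrite -e3 -/(u2 x2) -e2 -e1 /v /u.
have -> : a + 1 + 1 + 1 = a + 3 by ring.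
have -> : a + 1 + 1 = a + 2 by ring.
by ring.
Qed.

End DerivativeRules.

(** * Logarithmic derivative of a regularly varying function *)

Section RegularGrowth.
Context {R : realType}.

(** Differentiation of the integral representation; the fundamental theorem is applied on
    [[x0, x + 1]] so that [x] is an interior point. *)
Lemma log_derivative (c C x0 : R) (th h : R -> R) : 1 <= x0 -> 0 < C ->
  {within `[x0, +oo[, continuous th} -> (forall x, x0 < x -> derivable th x 1) ->
  (forall x, x0 <= x -> h x = C * x `^ c * expR (Rintegral lebesgue_measure `[x0, x] (fun t => th t / t))) ->
  forall x, x0 < x -> 0 < h x /\ is_derive x 1 h (h x * (c + th x) / x).
Proof.
move=> x01 C0 cth dth hh x x0x.
have xp : 0 < x by lra.
split; first by rewrite hh ?ltW // !mulr_gt0 ?powR_gt0 ?expR_gt0.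
pose g t := th t / t.
have cg (y : R) : x0 < y -> {for y, continuous g}.
{ move=> hy; have /derivable1_diffP/differentiable_continuous c1 := dth y hy.
  have y0 : y != 0 by rewrite gt_eqF //; lra.
  by apply: cvgM; [exact: c1|exact: inv_continuous]. }
have ig : lebesgue_measure.-integrable `[x0, x + 1] (EFin \o g).
{ apply: continuous_compact_integrable; first exact: segment_compact.
  have c1 : {within `[x0, x + 1], continuous th}.
  { apply: continuous_subspaceW cth => y /=; rewrite !in_itv /= => /andP[-> //]. }
  have c2 : {within `[x0, x + 1], continuous (fun t : R => t^-1)}.
  { apply: derivable_within_continuous => y; rewrite in_itv /= => /andP[y1 _].
    have y0 : y != 0 by rewrite gt_eqF //; lra.
    exact: (@ex_derive _ _ _ _ _ _ _ (derV _ y 1 (derI y) y0)). }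
  by move=> y; exact: cvgM (c1 y) (c2 y). }
have [dF eF] := @continuous_FTC1_closed R g x0 x (x + 1) (ltac:(lra)) ig x0x (cg x x0x).
have hF : is_derive x 1 (fun y => Rintegral lebesgue_measure `[x0, y] g) (th x / x).
{ apply: (@DeriveDef _ _ _ _ _ _ _ dF); rewrite -derive1E; exact: eF. }
have hg := derM _ _ x _ _ (derZ C _ x _ (@is_derive1_powR R c x xp)) (der_comp expR _ x _ _ (is_derive_expR _) hF).
apply: (@near_eq_is_derive _ _ _ (fun y => C * y `^ c * expR (Rintegral lebesgue_measure `[x0, y] g))).
{ near=> y; rewrite hh //; near: y; exists (x - x0) => /=; first by rewrite subr_gt0.
  move=> y /=; rewrite ltr_distlC => /andP[]; lra. }
apply: der_eq hg _; rewrite hh ?ltW // -/g.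
have -> : x `^ c = x * x `^ (c - 1).
{ rewrite -{2}(powRr1 (ltW xp)) -powRD; last by rewrite (gt_eqF xp) implybT.
  by congr powR; ring. }
by field; rewrite gt_eqF.
Unshelve. all: by end_near.
Qed.

End RegularGrowth.

(** * The inverse function and its first three derivatives *)

Section InverseFunction.
Context {R : realType}.
Implicit Types (h A phi : R -> R).

(* With [A = y h'/h], [A1 = A'], [A2 = A'']: [h'' = h curv / y^2], and [curv3] is the numerator that appears in the third derivative of the inverse of [h]. *)
Definition curv A (A1 : R -> R) (y : R) : R := A y ^+ 2 - A y + y * A1 y.

Definition curv3 A (A1 A2 : R -> R) (y : R) : R :=
  3 * curv A A1 y ^+ 2 - A y ^+ 2 * curv A A1 y + 2 * (A y * curv A A1 y)
  - A y * (2 * A y * (y * A1 y) + y ^+ 2 * A2 y).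

(* The exponent [1/44] is what the exponent [22/23] leaves. *)
Definition regular h A (A1 A2 : R -> R) (y1 c K0 ka : R) : Prop :=
  [/\ [/\ 1 <= y1, c < 23 / 22 & 0 < ka],
      forall y, y1 <= y -> 0 < h y /\ is_derive y 1 h (h y * A y / y),
      forall y, y1 <= y -> is_derive y 1 A (A1 y) /\ is_derive y 1 A1 (A2 y) &
      forall y, y1 <= y -> [/\ 1 <= A y <= c, 0 <= curv A A1 y & ka * y `^ (- (1 / 44)) <= curv3 A A1 A2 y <= K0]].

Section Fixed.
Variables (h A A1 A2 : R -> R) (y1 c K0 ka : R).
Context (reg : regular h A A1 A2 y1 c K0 ka).

Lemma reg_pos y : y1 <= y -> 1 <= y /\ 0 < y.
Proof. by case: reg => -[h1 _ _] _ _ _ hy; split; lra. Qed.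

Lemma growth_lt a b : y1 <= a -> a < b -> h a < h b.
Proof.
move=> ya ab; case: (reg) => _ dh _ bA.
have [e he] := mean_value h _ a b (ltW ab) (fun x hx => (dh x (le_trans ya (proj1 (andP hx)))).2).
have ye : y1 <= e by apply: le_trans ya _; case/andP: he.
have [h0 _] := dh e ye; have [e1 e0] := reg_pos e ye; have [/andP[A1' _] _ _] := bA e ye.
move=> E; rewrite -subr_gt0 E mulr_gt0 ?subr_gt0 // divr_gt0 // mulr_gt0 //; lra.
Qed.

(** [h y / y] is nondecreasing because [A >= 1]. *)
Lemma growth_ge y : y1 <= y -> h y1 / y1 * y <= h y.
Proof.
move=> hy; case: (reg) => _ dh _ bA.
have [_ y0] := reg_pos y hy.
pose df e := h e * (A e - 1) / e ^+ 2.
have [e he E] := mean_value (fun y => h y / y) df y1 y hy (ltac:(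
  move=> e /andP[ye _]; have [_ e0] := reg_pos e ye; have [_ de] := dh e ye;
  apply: der_eq (derM _ _ e _ _ de (derV _ e 1 (derI e) (lt0r_neq0 e0))) _;
  rewrite /df; field; exact: lt0r_neq0)).
have ye : y1 <= e by case/andP: he.
have [h0 _] := dh e ye; have [e1 e0] := reg_pos e ye; have [/andP[A1' _] _ _] := bA e ye.
rewrite -ler_pdivlMr // -subr_ge0 E mulr_ge0 ?subr_ge0 // /df divr_ge0 ?sqr_ge0 // mulr_ge0 //; lra.
Qed.

(** [ln h - c ln y] is nonincreasing because [A <= c]; the factor [y1^c >= 1] in the denominator is
    discarded. *)
Lemma growth_le y : y1 <= y -> h y <= h y1 * y `^ c.
Proof.
move=> hy; case: (reg) => -[y11 _ _] dh _ bA.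
have [_ y0] := reg_pos y hy; have [_ y10] := reg_pos y1 (lexx _).
pose df e := (A e - c) / e.
have [e he E] := mean_value (fun y => ln (h y) - c * ln y) df y1 y hy (ltac:(
  move=> e /andP[ye _]; have [_ e0] := reg_pos e ye; have [he0 de] := dh e ye;
  apply: der_eq (derB _ _ e _ _ (der_comp _ _ e _ _ (@is_derive1_ln R (h e) he0) de) (derZ c _ e _ (@is_derive1_ln R e e0))) _;
  rewrite /df; field; by rewrite !lt0r_neq0)).
have ye : y1 <= e by case/andP: he.
have [e1 e0] := reg_pos e ye; have [/andP[_ Ac] _ _] := bA e ye.
have [hy0 _] := dh y hy; have [hy10 _] := dh y1 (lexx _).
have p0 : 0 < y `^ c by exact: powR_gt0.
rewrite -ler_ln ?posrE ?mulr_gt0 // lnM ?posrE // ln_powR.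
have c0 : 0 <= c * ln y1.
{ rewrite mulr_ge0 ?ln_ge0 //; have [/andP[a b] _ _] := bA y1 (lexx _); lra. }
have : df e * (y - y1) <= 0.
{ apply: mulr_le0_ge0; last by rewrite subr_ge0.
  by rewrite /df; apply: mulr_le0_ge0; [lra|rewrite invr_ge0 ltW]. }
by rewrite -E; move: c0; lra.
Qed.

Lemma inverse_exists : exists phi, forall z, h y1 <= z -> y1 <= phi z /\ h (phi z) = z.
Proof.
case: (reg) => -[y11 _ _] dh _ bA; have [_ y10] := reg_pos y1 (lexx _); have [h10 _] := dh y1 (lexx _).
have ex z : exists y, h y1 <= z -> y1 <= y /\ h y = z.
{ case: (leP (h y1) z) => hz; last by exists 0.
  pose b := y1 * z / h y1.
  have yb : y1 <= b by rewrite /b ler_pdivlMr // ler_pM2l.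
  have hb : z <= h b.
  { apply: le_trans (growth_ge b yb); apply: eq_imp_le; rewrite /b; field; by rewrite !lt0r_neq0. }
  have cont : {within `[y1, b], continuous h}.
  { apply: derivable_within_continuous => x; rewrite in_itv /= => /andP[hx _].
    exact: (@ex_derive _ _ _ _ _ _ _ (dh x hx).2). }
  have [y] := IVT yb cont (ltac:(by rewrite ge_min hz /= le_max hb orbT) : Num.min (h y1) (h b) <= z <= Num.max (h y1) (h b)).
  by rewrite in_itv /= => /andP[yy _] e; exists y. }
by have [phi hphi] := choice ex; exists phi.
Qed.

Variables (phi : R -> R).
Context (hphi : forall z, h y1 <= z -> y1 <= phi z /\ h (phi z) = z).

Lemma phiK y : y1 <= y -> phi (h y) = y.
Proof.
move=> hy; have h1 : h y1 <= h y by rewrite le_eqVlt; case: (ltgtP y1 y) hy => // [lt|->] _; rewrite ?eqxx // growth_lt ?orbT.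
have [a b] := hphi _ h1; case: (ltgtP (phi (h y)) y) => // lt.
{ by have := growth_lt _ _ a lt; rewrite b ltxx. }
by have := growth_lt _ _ hy lt; rewrite b ltxx.
Qed.

Lemma phi_gt z : h y1 < z -> y1 < phi z.
Proof.
move=> hz; have [a b] := hphi _ (ltW hz); rewrite lt_neqAle a andbT; apply/eqP => e.
by move: hz; rewrite -b -e ltxx.
Qed.

Lemma phi_le z z' : h y1 <= z -> z <= z' -> phi z <= phi z'.
Proof.
move=> hz zz; have [a b] := hphi _ hz; have [a' b'] := hphi _ (le_trans hz zz).
by rewrite leNgt; apply/negP => lt; have := growth_lt _ _ a' lt; rewrite b b' ltNge zz.
Qed.

(** Obtained from [h (phi z) = z] and [h' = h A / y]: the derivatives of [phi] in terms of [phi z],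
    [z] and [A], [A1], [A2] at [phi z]. *)
Definition phi1 z := phi z / (z * A (phi z)).
Definition phi2 z := - (phi z * curv A A1 (phi z)) / (z ^+ 2 * A (phi z) ^+ 3).
Definition phi3 z := phi z * curv3 A A1 A2 (phi z) / (z ^+ 3 * A (phi z) ^+ 5).

Lemma phi_facts z : h y1 <= z -> [/\ 0 < z, y1 <= phi z, 0 < phi z, 1 <= A (phi z) & A (phi z) <= c].
Proof.
move=> hz; case: (reg) => _ dh _ bA; have [a b] := hphi _ hz; have [h10 _] := dh y1 (lexx _).
have [_ p0] := reg_pos _ a; have [/andP[A1' A2'] _ _] := bA _ a; split => //; lra.
Qed.

Lemma der_phi z : h y1 < z -> is_derive z 1 phi (phi1 z).
Proof.
move=> hz; have [z0 a p0 Ag _] := phi_facts z (ltW hz); have [_ b] := hphi _ (ltW hz).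
case: (reg) => _ dh _ _; have [_ d] := dh _ a; have lt := phi_gt _ hz.
have nearP : \forall y \near phi z, y1 < y.
{ exists (phi z - y1) => /=; first by rewrite subr_gt0.
  move=> y /=; rewrite ltr_distlC => /andP[]; lra. }
have nz : h (phi z) * A (phi z) / phi z != 0 by rewrite b lt0r_neq0 // divr_gt0 // mulr_gt0 //; lra.
have := @is_derive_inverse R h phi _ (phi z) _ _ d nz; rewrite b => H; apply: der_eq (H _ _) _.
{ by apply: filterS nearP => y hy; apply: phiK; exact: ltW. }
{ by apply: filterS nearP => y hy; exact: der_continuous (dh y (ltW hy)).2. }
by rewrite /phi1 invf_div.
Qed.

Lemma der_Aphi z : h y1 < z -> is_derive z 1 (fun z => A (phi z)) (A1 (phi z) * phi1 z).
Proof.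
move=> hz; have [_ a _ _ _] := phi_facts z (ltW hz); case: (reg) => _ _ dA _.
exact: der_comp (dA _ a).1 (der_phi z hz).
Qed.

Lemma der_phi1 z : h y1 < z -> is_derive z 1 phi1 (phi2 z).
Proof.
move=> hz; have [z0 a p0 Ag _] := phi_facts z (ltW hz); have zn := lt0r_neq0 z0.
have An : A (phi z) != 0 by rewrite lt0r_neq0 //; lra.
apply: der_eq (derM _ _ z _ _ (der_phi z hz) (derV _ z _ (derM _ _ z _ _ (derI z) (der_Aphi z hz)) (mulf_neq0 zn An))) _.
by rewrite /phi2 /phi1 /curv; field; rewrite An zn.
Qed.

Lemma der_curv y : y1 <= y -> is_derive y 1 (curv A A1) (2 * A y * A1 y + y * A2 y).
Proof.
move=> hy; case: (reg) => _ _ dA _; have [d1 d2] := dA y hy.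
apply: der_eq (derD _ _ y _ _ (derB _ _ y _ _ (derM _ _ y _ _ d1 d1) d1) (derM _ _ y _ _ (derI y) d2)) _.
by ring.
Qed.

Lemma der_phi2 z : h y1 < z -> is_derive z 1 phi2 (phi3 z).
Proof.
move=> hz; have [z0 a p0 Ag _] := phi_facts z (ltW hz); have zn := lt0r_neq0 z0.
have An : A (phi z) != 0 by rewrite lt0r_neq0 //; lra.
have dA := der_Aphi z hz.
have d1 := derN _ z _ (derM _ _ z _ _ (der_phi z hz) (der_comp _ _ z _ _ (der_curv _ a) (der_phi z hz))).
have d2 := derM _ _ z _ _ (derM _ _ z _ _ (derI z) (derI z)) (derM _ _ z _ _ dA (derM _ _ z _ _ dA dA)).
have nz : z * z * (A (phi z) * (A (phi z) * A (phi z))) != 0 by rewrite !mulf_neq0.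
apply: der_eq (derM _ _ z _ _ d1 (derV _ z _ d2 nz)) _.
by rewrite /phi3 /phi1 /curv3 /curv; field; rewrite An zn.
Qed.

Let slope := y1 / h y1.

Lemma slope_gt0 : 0 < slope.
Proof. by case: (reg) => _ dh _ _; have [h10 _] := dh y1 (lexx _); rewrite divr_gt0 //; case: (reg_pos y1 (lexx _)). Qed.

Lemma phi_le_slope z : h y1 <= z -> phi z <= slope * z.
Proof.
move=> hz; have [a b] := hphi _ hz; have := growth_ge _ a; rewrite b.
case: (reg) => _ dh _ _; have [h10 _] := dh y1 (lexx _); have [_ y10] := reg_pos y1 (lexx _).
by rewrite -ler_pdivlMl ?divr_gt0 // invf_div.
Qed.

Lemma phi1_bounds z : h y1 <= z -> 0 <= phi1 z <= slope.
Proof.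
move=> hz; have [z0 a p0 Ag _] := phi_facts z hz; have zA : 0 < z * A (phi z) by rewrite mulr_gt0 //; lra.
have s0 := slope_gt0; rewrite /phi1 divr_ge0 ?(ltW p0) ?(ltW zA) //= ler_pdivrMr //.
apply: le_trans (phi_le_slope z hz) _; by rewrite mulrA ler_peMr // mulr_ge0 ?(ltW s0) ?(ltW z0).
Qed.

Lemma phi2_le0 z : h y1 <= z -> phi2 z <= 0.
Proof.
move=> hz; have [z0 a p0 Ag _] := phi_facts z hz; case: (reg) => _ _ _ bA; have [_ B0 _] := bA _ a.
have zA : 0 <= z ^+ 2 * A (phi z) ^+ 3 by rewrite mulr_ge0 ?sqr_ge0 // exprn_ge0 //; lra.
by rewrite /phi2 mulNr oppr_le0 divr_ge0 // mulr_ge0 // ltW.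
Qed.

Lemma phi3_le z : h y1 <= z -> phi3 z <= K0 * slope / z ^+ 2.
Proof.
move=> hz; have [z0 a p0 Ag _] := phi_facts z hz; case: (reg) => -[_ _ ka0] _ _ bA; have [_ _ /andP[Y1 Y2]] := bA _ a.
have Y0 : 0 <= curv3 A A1 A2 (phi z) by apply: le_trans Y1; rewrite mulr_ge0 ?powR_ge0 // ltW.
have A5 : 1 <= A (phi z) ^+ 5 by rewrite exprn_ege1.
have z3 : 0 < z ^+ 3 by rewrite exprn_gt0.
rewrite /phi3 ler_pdivrMr; last by rewrite mulr_gt0 //; lra.
have -> : K0 * slope / z ^+ 2 * (z ^+ 3 * A (phi z) ^+ 5) = slope * z * K0 * A (phi z) ^+ 5 by field; exact: lt0r_neq0.
apply: le_trans (_ : slope * z * K0 <= _).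
{ by apply: ler_pM => //; [exact: ltW|exact: phi_le_slope]. }
have s0 := slope_gt0; have K00 := le_trans Y0 Y2.
by rewrite ler_peMr // mulr_ge0 // mulr_ge0 ?(ltW s0) ?(ltW z0).
Qed.

(** As [h] grows at most like [y^(23/22)], [phi z] is at least a multiple of [z^(22/23)]. The loss
    [y^(-1/44)] leaves [phi^(43/44)], that is [z^(43/46)], and division by [z^3] gives the exponent
    [-95/46]. *)
Lemma phi3_ge : exists2 k, 0 < k & forall z, h y1 <= z -> k * z `^ (- (95 / 46)) <= phi3 z.
Proof.
case: (reg) => -[y11 c23 ka0] dh _ bA; have [h10 _] := dh y1 (lexx _).
pose k := ka / (2 * h y1 `^ (43 / 46)).
have hp : 0 < h y1 `^ (43 / 46) by exact: powR_gt0.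
exists k; first by rewrite divr_gt0 // mulr_gt0.
move=> z hz; have [z0 a p0 Ag Ac] := phi_facts z hz; have [_ b] := hphi _ hz.
have [_ _ /andP[Y1 Y2]] := bA _ a; have [y1' _] := reg_pos _ a.
set y := phi z in a b p0 Ag Ac Y1 Y2 y1' *.
have zy : z <= h y1 * y `^ (23 / 22).
{ rewrite -{1}b; apply: le_trans (growth_le _ a) _; rewrite ler_pM2l // ler_powR // ltW //. }
have zp : z `^ (43 / 46) <= h y1 `^ (43 / 46) * y `^ (43 / 44).
{ have -> : y `^ (43 / 44) = (y `^ (23 / 22)) `^ (43 / 46) by rewrite -powRrM; congr powR; field.
  rewrite -powRM ?powR_ge0 ?(ltW h10) //; apply: ge0_ler_powR => //; rewrite ?nnegrE ?mulr_ge0 ?powR_ge0 ?(ltW h10) ?(ltW z0) //. }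
have yY : ka * y `^ (43 / 44) <= y * curv3 A A1 A2 y.
{ have -> : y `^ (43 / 44) = y * y `^ (- (1 / 44)).
  { rewrite -{2}(powRr1 (ltW p0)) -powRD; last by rewrite (gt_eqF p0) implybT.
    by congr powR; field. }
  by rewrite mulrCA ler_pM2l. }
have A5 : A y ^+ 5 <= 2.
{ apply: le_trans (_ : (23 / 22) ^+ 5 <= _); last by rewrite !exprS expr0; lra.
  by apply: lerXn2r; rewrite ?nnegrE ?divr_ge0 ?(le_trans ler01 Ag) // (le_trans Ac (ltW c23)). }
have A50 : 0 < A y ^+ 5 by rewrite exprn_gt0 // (lt_le_trans ltr01 Ag).
have z3 : 0 < z ^+ 3 by rewrite exprn_gt0.
have -> : z `^ (- (95 / 46)) = z `^ (43 / 46) / z ^+ 3.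
{ rewrite -(powR_mulrn 3 (ltW z0)) -powRN -powRD; last by rewrite (gt_eqF z0) implybT.
  by congr powR; field. }
rewrite /phi3 -/y ler_pdivlMr; last exact: mulr_gt0.
have -> : k * (z `^ (43 / 46) / z ^+ 3) * (z ^+ 3 * A y ^+ 5) = k * z `^ (43 / 46) * A y ^+ 5 by field; exact: lt0r_neq0.
apply: le_trans yY; apply: le_trans (_ : k * (h y1 `^ (43 / 46) * y `^ (43 / 44)) * 2 <= _).
{ have k0 : 0 <= k by rewrite divr_ge0 ?ltW // mulr_gt0.
  by apply: ler_pM => //; [rewrite mulr_ge0 ?powR_ge0|exact: ltW|rewrite ler_wpM2l]. }
apply: eq_imp_le; rewrite /k; field; exact: lt0r_neq0.
Qed.

(** Two mean value steps reduce the last inequality to [phi2 <= 0], the concavity of [phi]. *)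
Lemma phi_steps z : h y1 < z -> [/\ 0 <= phi (z + 1) - phi z, phi (z + 1) - phi z <= slope
   & phi (z + 2) - phi (z + 1) <= phi (z + 1) - phi z].
Proof.
move=> hz; have z1 : z <= z + 1 by lra.
have [e he E] := mean_value phi phi1 z (z + 1) z1 (fun x hx => der_phi x (lt_le_trans hz (proj1 (andP hx)))).
have e1 : h y1 <= e by apply: le_trans (ltW hz) _; case/andP: he.
have /andP[p1 p2] := phi1_bounds e e1.
have o (x : R) : x + 1 - x = 1 by ring.
rewrite o mulr1 in E; rewrite E; split => //.
have hu x : z <= x <= z + 1 -> is_derive x 1 (fun x => phi (x + 1) - phi x) (phi1 (x + 1) - phi1 x).
{ move=> /andP[x1 _]; apply: derB; [apply: der_shift|]; apply: der_phi; lra. }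
have [f hf F] := mean_value _ _ z (z + 1) z1 hu.
have hz2 x : f <= x <= f + 1 -> is_derive x 1 phi1 (phi2 x) by move=> /andP[x1 _]; apply: der_phi1; move: hf; lra.
have [g hg G] := mean_value phi1 phi2 f (f + 1) (ltac:(lra)) hz2.
have := phi2_le0 g (ltac:(move: hg hf; lra)).
rewrite o mulr1 in F; rewrite o mulr1 in G; rewrite -G -F E.
have -> : z + 1 + 1 = z + 2 by ring.
by lra.
Qed.

Lemma phi_diff3 (m : nat) : h y1 < m%:R -> exists2 xi, m%:R <= xi <= m%:R + 3 &
  diff3 (fun m => phi m%:R) m = phi3 xi.
Proof.
move=> hm; have [xi hxi E] := diff3_mean phi phi1 phi2 phi3 m%:R (ltac:(
  move=> x /andP[x1 _]; have hx : h y1 < x by [lra];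
  split; [exact: der_phi|exact: der_phi1|exact: der_phi2])).
exists xi => //; rewrite -E /diff3 -[m.+3%:R]/((3 + m)%:R) -[m.+2%:R]/((2 + m)%:R) -[m.+1%:R]/((1 + m)%:R).
by rewrite !natrD !(addrC _ m%:R).
Qed.

End Fixed.
End InverseFunction.

(** * Membership in the class implies the regularity conditions *)

Section RegularlyVarying.
Context {R : realType}.

Lemma cvg_pinfty_ev (f : R -> R) (l e : R) : f x @[x --> +oo] --> l -> 0 < e ->
  exists M : R, forall x, M <= x -> `|f x - l| <= e.
Proof.
move=> /cvgrPdist_le /(_ e) h e0; have [M [_ hM]] := h e0.
by exists (M + 1) => x hx; rewrite distrC; apply: hM; lra.
Qed.

Lemma common_bound (a b d e x : R) (y := `|a| + `|b| + `|d| + `|e| + x + 1) : 0 <= x ->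
  [/\ a <= y, b <= y, d <= y, e <= y & x < y].
Proof.
move=> x0; rewrite /y; have := ler_norm a; have := ler_norm b; have := ler_norm d; have := ler_norm e.
have := normr_ge0 a; have := normr_ge0 b; have := normr_ge0 d; have := normr_ge0 e.
by move: `|a| `|b| `|d| `|e| => a' b' d' e' *; split; lra.
Qed.

(** The case [c = 1], with [t = theta]. To first order [B] is [t], and so is the whole expression
    because [2A - A^2 = 1 - t^2]; the terms with [e1] and [e2] amount to a few hundredths of [t]. *)
Lemma curv3_small (t e1 e2 : R) : 0 < t -> t <= 1 / 100 -> `|e1| <= 1 / 100 * t -> `|e2| <= 1 / 100 * t ->
  forall A B : R, A = 1 + t -> B = A ^+ 2 - A + e1 ->
  0 <= B /\ t / 2 <= 3 * B ^+ 2 - A ^+ 2 * B + 2 * (A * B) - A * (2 * A * e1 + e2) <= 1.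
Proof.
move=> t0 t1; rewrite !ler_norml => /andP[a1 a2] /andP[b1 b2] A B hA hB.
have tt : 0 <= t * t by rewrite mulr_ge0 // ltW.
have tt1 : t * t <= 1 / 100 * t by rewrite ler_wpM2r // ltW.
have B1 : 99 / 100 * t <= B by rewrite hB hA; lra.
have B2 : B <= 102 / 100 * t by rewrite hB hA; lra.
have -> : 3 * B ^+ 2 - A ^+ 2 * B + 2 * (A * B) - A * (2 * A * e1 + e2) =
  3 * (B * B) + B - B * (t * t) - (2 * (e1 + 2 * (t * e1) + t * t * e1) + e2 + t * e2) by rewrite hA; ring.
have B0 : 0 <= B by clear - tt1 B1 B2; lra.
have q1 : 0 <= B * B by rewrite mulr_ge0.
have q2 : B * B <= 102 / 100 * t * (2 / 100).
{ by apply: ler_pM => //; clear - B2 t1; lra. }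
have q3 : 0 <= B * (t * t) by rewrite mulr_ge0.
have q4 : B * (t * t) <= 2 / 100 * (1 / 100 * t) by apply: ler_pM => //; clear - B2 t1; lra.
have m1 (e : R) : - (1 / 100 * t) <= e -> e <= 1 / 100 * t -> - (1 / 100 * t) <= t * e /\ t * e <= 1 / 100 * t.
{ move=> x1 x2; have u : t * e <= t * (1 / 100 * t) by rewrite ler_pM2l.
  have v : t * - (1 / 100 * t) <= t * e by rewrite ler_pM2l.
  by split; move: u v tt1; clear; lra. }
have [c1 c2] := m1 e1 a1 a2; have [d1 d2] := m1 e2 b1 b2; have [f1 f2] := m1 _ c1 c2; rewrite mulrA in f1 f2.
split => //; apply/andP; split; [clear - q1 B1 q4 a2 c2 f2 b2 d2 t0|clear - q2 B2 q3 a1 c1 f1 b1 d1 t1]; lra.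
Qed.

Lemma in_Rc_regular (c : R) (h : R -> R) : 1 <= c < 23 / 22 -> in_Rc c h ->
  exists A A1 A2 : R -> R, exists y1 c' K0 ka : R, regular h A A1 A2 y1 c' K0 ka.
Proof.
move=> /andP[c1 c23] [x0 [x01 [C [C0 [th [[_ _] _ [[cth C3th] [hh [l0 [l1 [l2 _]]]]] hc1]]]]]].
pose A y := c + th y; pose A1 := derive1n 1 th; pose A2 := derive1n 2 th.
exists A, A1, A2.
have dth x : x0 < x -> derivable th x 1 by move=> /C3th[].
have dh := log_derivative c C x0 th h x01 C0 cth dth hh.
have dA y : x0 < y -> is_derive y 1 A (A1 y) /\ is_derive y 1 A1 (A2 y).
{ move=> /C3th[d1 d2 _ _]; split.
  { apply: der_eq (derD _ _ y 0 (A1 y) (derC c y) _) _; last by rewrite add0r.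
    by apply: (@DeriveDef _ _ _ _ _ _ _ d1); rewrite -derive1E. }
  by apply: (@DeriveDef _ _ _ _ _ _ _ d2); rewrite -derive1E. }
(* [A = c + theta] may exceed [c], so the upper bound is taken strictly between [c] and [23/22]. *)
pose c' := (c + 23 / 22) / 2.
have cA : A y @[y --> +oo] --> c by rewrite -[X in _ --> X]addr0; apply: cvgD => //; exact: cvg_cst.
suff [y1 [K0 [ka [y1x ka0 H]]]] : exists y1 K0 ka : R, [/\ x0 < y1, 0 < ka & forall y, y1 <= y ->
   [/\ 1 <= A y <= c', 0 <= curv A A1 y & ka * y `^ (- (1 / 44)) <= curv3 A A1 A2 y <= K0]].
{ exists y1, c', K0, ka; split; [split| | |exact: H].
  { by apply: le_trans x01 (ltW _). }
  { by rewrite /c'; move: c23; clear; lra. }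
  { exact: ka0. }
  { by move=> y hy; apply: dh; exact: lt_le_trans y1x hy. }
  by move=> y hy; apply: dA; exact: lt_le_trans y1x hy. }
have e1 : 0 < c' - c by rewrite /c'; move: c23; clear; lra.
have [M1 hM1] := cvg_pinfty_ev _ _ _ cA e1.
have pw1 (y : R) : 1 <= y -> y `^ (- (1 / 44)) <= 1.
{ move=> hy; have := ler_powR hy (ltac:(clear; lra) : - (1 / 44) <= 0 :> R); by rewrite powRr0. }
move: c1; rewrite le_eqVlt => /orP[/eqP ce|c1].
(* For [c = 1] all quantities are compared with [theta], and [1/theta <= K y^(1/44)] supplies the
   lower bound. *)
{ have [tp [_ [tinv [_ [r1 [r2 _]]]]]] := hc1 (esym ce).
  have h100 : 0 < 1 / 100 :> R by clear; lra.
  have [M2 hM2] := cvg_pinfty_ev _ _ _ l0 h100.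
  have [M3 hM3] := cvg_pinfty_ev _ _ _ r1 h100.
  have [M4 hM4] := cvg_pinfty_ev _ _ _ r2 h100.
  have [K hK] := tinv (1 / 44) (ltac:(clear; lra)).
  pose y1 := `|M1| + `|M2| + `|M3| + `|M4| + x0 + 1.
  have y1b : [/\ M1 <= y1, M2 <= y1, M3 <= y1, M4 <= y1 & x0 < y1].
  { by apply: common_bound; move: x01; clear; lra. }
  case: y1b => b1 b2 b3 b4 b5.
  have K0 : 0 < K.
  { have := hK y1 (ltW b5); have : 0 < (th y1)^-1 by rewrite invr_gt0 tp // ltW.
    have p0 : 0 < y1 `^ (1 / 44) by rewrite powR_gt0 //; move: x01 b5; clear; lra.
    by move=> a b; rewrite -(pmulr_lgt0 _ p0); exact: lt_le_trans a b. }
  exists y1, 1, (1 / 2 / K); split => //; first by rewrite divr_gt0 //; clear; lra.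
  move=> y hy; have tpos : 0 < th y by apply: tp; exact: le_trans (ltW b5) hy.
  have ypos : 0 < y by move: x01 b5 hy; clear; lra.
  have t1 : th y <= 1 / 100 by have := hM2 y (le_trans b2 hy); rewrite subr0 ler_norml => /andP[].
  have q1 : `|y * A1 y| <= 1 / 100 * th y.
  { have := hM3 y (le_trans b3 hy); rewrite subr0 normrM normfV (gtr0_norm tpos) ler_pdivrMr //. }
  have q2 : `|y ^+ 2 * A2 y| <= 1 / 100 * th y.
  { have := hM4 y (le_trans b4 hy); rewrite subr0 normrM normfV (gtr0_norm tpos) ler_pdivrMr //. }
  have AE : A y = 1 + th y by rewrite /A -ce.
  have [B0 /andP[Y1 Y2]] := curv3_small (th y) (y * A1 y) (y ^+ 2 * A2 y) tpos t1 q1 q2 (A y) (curv A A1 y) AE erefl.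
  split => //.
  { have := hM1 y (le_trans b1 hy); rewrite ler_norml => /andP[_ u]; apply/andP; split; [move: AE tpos|move: u]; clear; lra. }
  rewrite /curv3 Y2 andbT; apply: le_trans Y1.
  have p0 : 0 < y `^ (1 / 44) by exact: powR_gt0.
  rewrite powRN; have := hK y (le_trans (ltW b5) hy).
  rewrite -lef_pV2 ?posrE ?invr_gt0 ?mulr_gt0 // invrK invfM => u.
  by move: u; rewrite -(@ler_pM2l _ (1 / 2)) //; clear; lra. }
have cB : curv A A1 y @[y --> +oo] --> c * c - c + 0 by exact: cvgD (cvgB (cvgM cA cA) cA) l1.
(* The limit of [curv3] as [A] tends to [c] and the derivative terms to 0; it is positive since
   [c > 1]. *)
pose L := c ^+ 2 * (c - 1) * (2 * c - 1).
have cY : curv3 A A1 A2 y @[y --> +oo] --> L.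
{ have -> : L = 3 * ((c * c - c + 0) * (c * c - c + 0)) - c * c * (c * c - c + 0) + 2 * (c * (c * c - c + 0)) - c * (2 * c * 0 + 0).
  { by rewrite /L; ring. }
  apply: cvgB; first apply: cvgD; first apply: cvgB.
  { apply: cvgM; [exact: cvg_cst|exact: (cvgM cB cB)]. }
  { exact: (cvgM (cvgM cA cA) cB). }
  { apply: cvgM; [exact: cvg_cst|exact: (cvgM cA cB)]. }
  apply: cvgM => //; apply: cvgD => //; apply: cvgM => //; apply: cvgM => //; exact: cvg_cst. }
have L0 : 0 < L by rewrite /L !mulr_gt0 ?exprn_gt0 //; move: c1; clear; lra.
have [M2 hM2] := cvg_pinfty_ev _ _ _ cY (ltac:(move: L0; clear; lra) : 0 < L / 2).
have [M3 hM3] := cvg_pinfty_ev _ _ _ cB (ltac:(move: c1; clear; nra) : 0 < c * c - c).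
have [M4 hM4] := cvg_pinfty_ev _ _ _ cA (ltac:(move: c1; clear; lra) : 0 < c - 1).
pose y1 := `|M1| + `|M2| + `|M3| + `|M4| + x0 + 1.
have y1b : [/\ M1 <= y1, M2 <= y1, M3 <= y1, M4 <= y1 & x0 < y1].
{ by apply: common_bound; move: x01; clear; lra. }
case: y1b => b1 b2 b3 b4 b5; exists y1, (3 / 2 * L), (L / 2); split => //; first by move: L0; clear; lra.
move=> y hy.
have := hM1 y (le_trans b1 hy); have := hM2 y (le_trans b2 hy); have := hM3 y (le_trans b3 hy); have := hM4 y (le_trans b4 hy).
rewrite !ler_norml => /andP[a1 a2] /andP[p1 p2] /andP[q1 q2] /andP[s1 s2].
split; [|by move: p1; clear; lra|].
{ by apply/andP; split; [move: a1; clear; lra|move: s2; clear; lra]. }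
apply/andP; split; last by move: q2; clear; lra.
have := pw1 y (ltac:(move: x01 b5 hy; clear; lra)); rewrite -(@ler_pM2l _ (L / 2)); last by move: L0; clear; lra.
by move: q1; clear; lra.
Qed.

End RegularlyVarying.

(** * Comparison of the two averages *)

Section Toeplitz.
Context {R : realType}.

Lemma abel_sum (G om : nat -> R) m0 n :
  \sum_(0 <= i < n) G (m0 + i)%N * om (m0 + i)%N = om (m0 + n)%N * \sum_(0 <= i < n) G (m0 + i)%N +
  \sum_(0 <= i < n) (om (m0 + i)%N - om (m0 + i).+1) * \sum_(0 <= j < i.+1) G (m0 + j)%N.
Proof.
elim: n => [|n IH]; first by rewrite !big_geq // mulr0 addr0.
rewrite big_nat_recr //= IH [in RHS]big_nat_recr //= [in X in _ = _ + X]big_nat_recr //= big_nat_recr //= addnS.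
ring.
Qed.

Lemma abel_bound (G om : nat -> R) m0 n (e K : R) : 0 <= e -> 0 <= K ->
  (forall m, (m0 <= m)%N -> 0 <= om m /\ om m.+1 <= om m) ->
  (forall n, `|\sum_(0 <= i < n) G (m0 + i)%N| <= e * n%:R + K) ->
  `|\sum_(0 <= i < n) G (m0 + i)%N * om (m0 + i)%N| <= e * \sum_(0 <= i < n) om (m0 + i)%N + K * om m0.
Proof.
move=> e0 K0 hom hG; rewrite abel_sum.
have h0 i : 0 <= om (m0 + i)%N by case: (hom (m0 + i)%N (leq_addr _ _)).
have h1 i : 0 <= om (m0 + i)%N - om (m0 + i).+1 by rewrite subr_ge0; case: (hom (m0 + i)%N (leq_addr _ _)).
have -> : e * \sum_(0 <= i < n) om (m0 + i)%N + K * om m0 = om (m0 + n)%N * (e * n%:R + K) +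
  \sum_(0 <= i < n) (om (m0 + i)%N - om (m0 + i).+1) * (e * i.+1%:R + K).
{ elim: n => [|n IH]; first by rewrite !big_geq // addn0; ring.
  rewrite big_nat_recr //= [in RHS]big_nat_recr //= mulrDr addrAC IH addnS -[n.+1%:R]natr1; ring. }
apply: le_trans (ler_normD _ _) _; apply: lerD.
{ by rewrite normrM ger0_norm // ler_wpM2l. }
apply: le_trans (ler_norm_sum _ _ _) _; apply: ler_sum => i _.
by rewrite normrM ger0_norm // ler_wpM2l.
Qed.

Lemma sum_shift (V : zmodType) (F : nat -> V) a b : (a <= b)%N ->
  \sum_(a <= m < b) F m = \sum_(0 <= i < b - a) F (a + i)%N.
Proof.
by move=> _; rewrite -{1}(add0n a) big_addn; apply: eq_bigr => i _; rewrite addnC.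
Qed.

(** Monotone weights inherit the [e]-closeness of the unweighted partial sums. The terms before the
    limit is felt, and those below [m0], enter only through [C], which does not depend on [M]. *)
Lemma toeplitz (F om : nat -> R) (Kf L : R) m0 : (forall m, `|F m| <= Kf) ->
  (forall m, (m0 <= m)%N -> 0 <= om m /\ om m.+1 <= om m) ->
  tends (fun N => (N%:R)^-1 * \sum_(1 <= n < N.+1) F n) L ->
  forall e : R, 0 < e -> exists C : R, 0 <= C /\ forall M, (m0 <= M)%N ->
    `|\sum_(m0 <= m < M) F m * om m - L * \sum_(m0 <= m < M) om m| <= e * \sum_(m0 <= m < M) om m + C.
Proof.
move=> hF hom hL e e0; have [N0 hN0] := hL e e0.
have Kf0 : 0 <= Kf by apply: le_trans (hF 0%N).
pose K := Kf + `|L|; have K0 : 0 <= K by rewrite addr_ge0.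
have hG m : `|F m - L| <= K by apply: le_trans (ler_normB _ _) _; rewrite lerD2r.
have triv a b : `|\sum_(a <= m < b) (F m - L)| <= (b - a)%:R * K.
{ apply: le_trans (ler_norm_sum _ _ _) _; apply: le_trans (ler_sum _ (fun i _ => hG i)) _.
  by rewrite sumr_const_nat mulr_natl. }
have part N : `|\sum_(1 <= n < N.+1) (F n - L)| <= e * N%:R + N0%:R * K.
{ case: (leqP N0 N) => hN; last first.
  { have := triv 1%N N.+1; rewrite subn1 /= => h; apply: le_trans h _.
    have : N%:R * K <= N0%:R * K by rewrite ler_wpM2r // ler_nat ltnW.
    have : 0 <= e * N%:R by rewrite mulr_ge0 // ltW.
    by lra. }
  case: (posnP N) => [->|Np]; first by rewrite big_geq // normr0 mulr0 add0r mulr_ge0.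
  have Nr : 0 < N%:R :> R by rewrite ltr0n.
  have -> : \sum_(1 <= n < N.+1) (F n - L) = N%:R * ((N%:R)^-1 * \sum_(1 <= n < N.+1) F n - L).
  { rewrite sumrB sumr_const_nat subn1 /= -[L *+ N]mulr_natl; field; exact: lt0r_neq0. }
  rewrite normrM (gtr0_norm Nr); have := hN0 N hN; rewrite -(ler_pM2l Nr) => h.
  apply: le_trans h _; rewrite mulrC lerDl mulr_ge0 //. }
pose K2 := N0%:R * K + (m0 + 1)%:R * K + e * (m0 + 1)%:R.
have K20 : 0 <= K2 by rewrite !addr_ge0 // ?mulr_ge0 // ltW.
exists (K2 * om m0); split; first by rewrite mulr_ge0 //; case: (hom m0 (leqnn _)).
move=> M hM; have -> : \sum_(m0 <= m < M) F m * om m - L * \sum_(m0 <= m < M) om m = \sum_(m0 <= m < M) (F m - L) * om m.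
{ by rewrite mulr_sumr -sumrB; apply: eq_bigr => m _; rewrite mulrBl. }
rewrite !(sum_shift _ _ _ _ hM); apply: (abel_bound (fun m => F m - L)) => //; first exact: ltW.
move=> n; have -> : \sum_(0 <= i < n) (F (m0 + i)%N - L) = \sum_(m0 <= m < m0 + n) (F m - L).
{ by rewrite (sum_shift _ (fun m => F m - L)) ?leq_addr // addKn. }
case: (posnP m0) => [z|mp].
{ case: (posnP n) => [->|n1]; first by rewrite addn0 big_geq // normr0 mulr0 add0r.
  have -> : \sum_(m0 <= m < m0 + n) (F m - L) = (F 0%N - L) + \sum_(1 <= m < n) (F m - L).
  { by rewrite z add0n big_ltn. }
  have := part n.-1; rewrite prednK // => h; apply: le_trans (ler_normD _ _) _.
  have := hG 0%N; have a : e * n.-1%:R <= e * n%:R by rewrite ler_pM2l // ler_nat leq_pred.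
  rewrite /K2 z add0n mul1r mulr1; move: h a K0 e0; lra. }
have -> : \sum_(m0 <= m < m0 + n) (F m - L) = \sum_(1 <= m < m0 + n) (F m - L) - \sum_(1 <= m < m0) (F m - L).
{ by rewrite [X in _ = X - _](big_cat_nat _ (n := m0)) //= ?leq_addr // [RHS]addrC addKr. }
apply: le_trans (ler_normB _ _) _.
have := part (m0 + n).-1; rewrite prednK ?addn_gt0 ?mp // => h.
have t := triv 1%N m0.
have a : e * (m0 + n).-1%:R <= e * (m0 + n)%:R by rewrite ler_pM2l // ler_nat leq_pred.
have b : (m0 - 1)%:R * K <= (m0 + 1)%:R * K.
{ by rewrite ler_wpM2r // ler_nat; apply: leq_trans (leq_subr _ _) (leq_addr _ _). }
have a2 : e * (m0 + n)%:R = e * m0%:R + e * n%:R by rewrite natrD mulrDr.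
have k2 : K2 = N0%:R * K + (m0 + 1)%:R * K + e * m0%:R + e by rewrite /K2 [e * (m0 + 1)%:R](_ : _ = e * m0%:R + e) ?addrA // natrD mulrDr mulr1.
by rewrite k2; move: h t a b e0 a2; clear; lra.
Qed.

Lemma root_nat (M k : nat) : (0 < k)%N -> exists w, (w ^ k <= M < w.+1 ^ k)%N.
Proof.
move=> k0; elim: M => [|M [w /andP[h1 h2]]]; first by exists 0%N; rewrite exp0n // exp1n.
case: (leqP (w.+1 ^ k) M.+1) => h; last by exists w; rewrite h (leq_trans h1).
by exists w.+1; rewrite h /=; apply: leq_trans (_ : w.+1 ^ k < _)%N; rewrite ?ltnS // ltn_exp2r.
Qed.

Lemma sum_bounded_tends0 (g : nat -> R) (M : R) : (forall k, 0 <= g k) ->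
  (forall n, \sum_(0 <= k < n) g k <= M) -> tends g 0.
Proof.
move=> g0 hM; apply/tendsP; apply: cvg_series_cvg_0; apply: nondecreasing_is_cvgn.
{ by apply/nondecreasing_seqP => n; rewrite /series /= big_nat_recr //= lerDl. }
by exists M => _ [n _ <-]; exact: hM.
Qed.

End Toeplitz.

(** * Fibres of the integer part of the function *)

Section Counting.
Context {R : realType}.
Variables (h A A1 A2 : R -> R) (y1 c K0 ka : R).
Context (reg : regular h A A1 A2 y1 c K0 ka).
Variables (phi : R -> R).
Context (hphi : forall z, h y1 <= z -> y1 <= phi z /\ h (phi z) = z).
Variable (m0 : nat).
Context (hm0 : h y1 < m0%:R).

Definition cphi (m : nat) : nat := `|Num.ceil (phi m%:R)|%N.
(* The absolute value only matters where [h n < 0], i.e. for finitely many [n]. *)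
Definition ifloor (n : nat) : nat := `|Num.floor (h n%:R)|%N.

Lemma m0_le m : (m0 <= m)%N -> h y1 < m%:R.
Proof. by move=> hm; apply: lt_le_trans hm0 _; rewrite ler_nat. Qed.

Lemma cphiE m : (m0 <= m)%N -> (cphi m)%:R = (Num.ceil (phi m%:R))%:~R :> R.
Proof.
move=> hm; have [_ _ p0 _ _] := phi_facts _ _ _ _ _ _ _ _ reg phi hphi _ (ltW (m0_le m hm)).
have : 0 <= Num.ceil (phi m%:R) by rewrite ltW // ceil_gt0.
by rewrite /cphi; case: (Num.ceil _).
Qed.

Lemma cphi_le m n : (m0 <= m)%N -> (cphi m <= n)%N = (phi m%:R <= n%:R).
Proof. by move=> hm; rewrite -(ler_nat R) cphiE // -[n%:R]/((n%:Z)%:~R) ler_int ceil_le_int. Qed.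

Lemma phi_le_nat m n : (m0 <= m)%N -> y1 <= n%:R -> (phi m%:R <= n%:R) = (m%:R <= h n%:R).
Proof.
move=> hm hn; have hz := ltW (m0_le m hm); have [a b] := hphi _ hz.
apply/idP/idP => H.
{ move: H; rewrite le_eqVlt => /orP[/eqP <-|H]; first by rewrite b.
  by rewrite -{1}b ltW // (growth_lt _ _ _ _ _ _ _ _ reg). }
rewrite leNgt; apply/negP => lt.
by have := growth_lt _ _ _ _ _ _ _ _ reg _ _ hn lt; rewrite b ltNge H.
Qed.

Lemma cphi_ge_y1 m n : (m0 <= m)%N -> (cphi m <= n)%N -> y1 <= n%:R.
Proof.
move=> hm; rewrite cphi_le // => H; apply: le_trans H.
by have [] := hphi _ (ltW (m0_le m hm)).
Qed.

Lemma ifloor_bounds n : y1 <= n%:R -> (ifloor n)%:R <= h n%:R < (ifloor n)%:R + 1.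
Proof.
move=> hn; case: (reg) => _ dh _ _; have [h0 _] := dh _ hn.
have /andP[f1 f2] := floor_itv (h n%:R); rewrite intrD mulr1z in f2.
have f0 : 0 <= Num.floor (h n%:R) by rewrite floor_ge0 ltW.
have e : (ifloor n)%:R = (Num.floor (h n%:R))%:~R :> R by rewrite /ifloor; move: f0; case: (Num.floor _).
by rewrite e f1.
Qed.

Lemma ifloor_ge m n : (m0 <= m)%N -> (cphi m <= n)%N -> (m <= ifloor n)%N.
Proof.
move=> hm H; have hn := cphi_ge_y1 m n hm H.
move: H; rewrite cphi_le // phi_le_nat // => H.
have /andP[_ f2] := ifloor_bounds n hn.
by rewrite -ltnS -(ltr_nat R) -[(ifloor n).+1%:R]natr1; exact: le_lt_trans H f2.
Qed.

Lemma ifloor_lt m n : (m0 <= m)%N -> y1 <= n%:R -> (n < cphi m)%N -> (ifloor n < m)%N.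
Proof.
move=> hm hn; rewrite ltnNge cphi_le // phi_le_nat // -ltNge => H.
have /andP[f1 _] := ifloor_bounds n hn.
by rewrite -(ltr_nat R); exact: le_lt_trans f1 H.
Qed.

Lemma ifloorE m n : (m0 <= m)%N -> (cphi m <= n < cphi m.+1)%N -> ifloor n = m.
Proof.
move=> hm /andP[n1 n2]; have hn := cphi_ge_y1 m n hm n1.
apply/eqP; rewrite eqn_leq (ifloor_ge m n) // andbT -ltnS; apply: ifloor_lt => //; exact: leqW.
Qed.

Lemma cphi_mono m : (m0 <= m)%N -> (cphi m <= cphi m.+1)%N.
Proof.
move=> hm; rewrite cphi_le //; apply: le_trans (_ : phi m.+1%:R <= _).
{ apply: (phi_le _ _ _ _ _ _ _ _ reg phi hphi); first exact: ltW (m0_le m hm).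
  by rewrite ler_nat. }
by rewrite -(cphi_le m.+1) // leqW.
Qed.

Lemma cphi_homo m n : (m0 <= m)%N -> (m <= n)%N -> (cphi m <= cphi n)%N.
Proof.
move=> hm /subnK <-; elim: (n - m)%N => // k IH; apply: leq_trans IH _; rewrite addSn.
by apply: cphi_mono; apply: leq_trans hm (leq_addl _ _).
Qed.

Lemma sum_ifloor (G : nat -> R) M : (m0 <= M)%N ->
  \sum_(cphi m0 <= n < cphi M) G (ifloor n) = \sum_(m0 <= m < M) G m * (cphi m.+1 - cphi m)%:R.
Proof.
move=> /subnK <-; elim: (M - m0)%N => [|k IH]; first by rewrite !add0n !big_geq.
rewrite addSn big_nat_recr ?leq_addl //= -IH (big_cat_nat _ (n := cphi (k + m0))) //=; last 2 first.
{ by apply: cphi_homo => //; rewrite leq_addl. }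
{ by apply: cphi_mono; rewrite leq_addl. }
congr (_ + _); rewrite (eq_big_nat _ _ (F2 := fun=> G (k + m0)%N)); first by rewrite sumr_const_nat mulr_natr.
by move=> n hn; rewrite (ifloorE (k + m0)) // leq_addl.
Qed.

Definition omphi (m : nat) : R := phi m.+1%:R - phi m%:R.
Definition dphi (m : nat) : R := rho (phi m.+1%:R) - rho (phi m%:R).

(** From [ceil x = x + 1/2 + rho x]; the constants [1/2] cancel in the difference. *)
Lemma cphi_split m : (m0 <= m)%N -> (cphi m.+1 - cphi m)%:R = omphi m + dphi m.
Proof.
move=> hm; rewrite natrB; last exact: cphi_mono.
by rewrite !cphiE // ?leqW // /omphi /dphi /rho; ring.
Qed.

Lemma omphi_props m : (m0 <= m)%N -> [/\ 0 <= omphi m, omphi m.+1 <= omphi m & omphi m <= y1 / h y1].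
Proof.
move=> hm; have [] := phi_steps _ _ _ _ _ _ _ _ reg phi hphi m%:R (m0_le m hm).
have n1 k : k%:R + 1 = k.+1%:R :> R by rewrite natr1.
have n2 : m%:R + 2 = m.+2%:R :> R by rewrite -[m.+2]addn2 natrD.
by rewrite /omphi n2 n1.
Qed.

Lemma sum_omphi M : (m0 <= M)%N -> \sum_(m0 <= m < M) omphi m = phi M%:R - phi m0%:R.
Proof. by move=> hM; rewrite (telescope_sumr (fun m => phi m%:R)). Qed.

(* Both the initial segment and the last, incomplete fibre of [ifloor] contribute a bounded amount. *)
Lemma counting_split : exists C : R, 0 <= C /\ forall (F : nat -> R) (Kf : R) N, (forall m, `|F m| <= Kf) ->
  (cphi m0 <= N)%N ->
  [/\ (m0 <= ifloor N)%N,
   `|\sum_(1 <= n < N.+1) F (ifloor n) - \sum_(m0 <= m < ifloor N) F m * omphi m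
     - \sum_(m0 <= m < ifloor N) F m * dphi m| <= Kf * C & 0 <= N%:R - phi (ifloor N)%:R <= C].
Proof.
pose D := y1 / h y1 + 1; exists ((cphi m0)%:R + D + 1).
have D0 : 0 <= D by rewrite /D; have := slope_gt0 _ _ _ _ _ _ _ _ reg; lra.
have c00 : 0 <= (cphi m0)%:R :> R by [].
split; first by rewrite addr_ge0 // addr_ge0.
move=> F Kf N hF hN; have hn := cphi_ge_y1 m0 N (leqnn _) hN; set M := ifloor N.
have hM : (m0 <= M)%N by exact: ifloor_ge.
have Kf0 : 0 <= Kf by apply: le_trans (hF 0%N).
have cM : (cphi M <= N)%N.
{ by rewrite cphi_le // phi_le_nat //; have /andP[] := ifloor_bounds N hn. }
have cM1 : (N < cphi M.+1)%N.
{ rewrite ltnNge; apply/negP => H; have := ifloor_ge M.+1 N (leqW hM) H; by rewrite ltnn. }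
have [k1 k2 k3] := omphi_props M hM.
have cd : (cphi M.+1 - cphi M)%:R <= D.
{ rewrite cphi_split // /D; apply: lerD => //; rewrite /dphi.
  have := rho_le (phi M.+1%:R); have := rho_le (phi M%:R); rewrite !ler_norml => /andP[a b] /andP[a' b']; lra. }
have c1 : (1 <= cphi m0)%N.
{ rewrite ltnNge; apply/negP => H; have := cphi_ge_y1 m0 0 (leqnn _) H; case: (reg) => -[y11 _ _] _ _ _; lra. }
have bnd a b : `|\sum_(a <= n < b) F (ifloor n)| <= (b - a)%:R * Kf.
{ apply: le_trans (ler_norm_sum _ _ _) _; apply: le_trans (ler_sum _ (fun i _ => hF (ifloor i))) _.
  by rewrite sumr_const_nat mulr_natl. }
split => //.
{ have -> : \sum_(1 <= n < N.+1) F (ifloor n) = \sum_(1 <= n < cphi m0) F (ifloor n) + \sum_(cphi m0 <= n < cphi M) F (ifloor n) + \sum_(cphi M <= n < N.+1) F (ifloor n).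
  { rewrite (big_cat_nat _ (n := cphi m0)) //= ?leqW // -addrA; congr (_ + _).
    by rewrite (big_cat_nat _ (n := cphi M)) //= ?leqW // cphi_homo. }
  rewrite sum_ifloor //.
  have -> : \sum_(m0 <= m < M) F m * (cphi m.+1 - cphi m)%:R = \sum_(m0 <= m < M) F m * omphi m + \sum_(m0 <= m < M) F m * dphi m.
  { rewrite -big_split /=; apply: eq_big_nat => m /andP[mm _]; by rewrite cphi_split // mulrDr. }
  set a := \sum_(1 <= n < cphi m0) _; set b := \sum_(m0 <= m < M) _; set e := \sum_(m0 <= m < M) _; set g := \sum_(cphi M <= n < N.+1) _.
  have -> : a + (b + e) + g - b - e = a + g by ring.
  have ha := bnd 1%N (cphi m0); have hg := bnd (cphi M) N.+1; rewrite -/a -/g in ha hg.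
  apply: le_trans (ler_normD _ _) _.
  have u1 : (cphi m0 - 1)%:R * Kf <= (cphi m0)%:R * Kf by rewrite ler_wpM2r // ler_nat leq_subr.
  have u2 : (N.+1 - cphi M)%:R * Kf <= D * Kf.
  { by rewrite ler_wpM2r //; apply: le_trans cd; rewrite ler_nat leq_sub2r. }
  have -> : Kf * ((cphi m0)%:R + D + 1) = (cphi m0)%:R * Kf + D * Kf + Kf by ring.
  by move: ha hg u1 u2 Kf0; lra. }
apply/andP; split; first by rewrite subr_ge0 -(cphi_le M).
have : N%:R < phi M.+1%:R by rewrite ltNge -(cphi_le M.+1) ?leqW // -ltnNge.
have c0 : 0 <= (cphi m0)%:R :> R by [].
by move: k3 c0; rewrite /omphi /D; lra.
Qed.

End Counting.

(** * The sawtooth error term and the transfer of the limit *)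

Section ErrorTerm.
Context {R : realType}.

Lemma le_of_scale (xi u v : R) : xi <= u + 3 -> 4 <= u -> 2 <= v -> xi <= v * u.
Proof. by move=> h1 h2 h3; nra. Qed.

Lemma half_of_double (q w w2 : R) : 2 * q <= w -> w <= w2 -> q <= 1 / 2 * w2.
Proof. by move=> h1 h2; lra. Qed.

Lemma dphi_le (phi : R -> R) m : `|dphi phi m| <= 1.
Proof.
rewrite /dphi; apply: le_trans (ler_normB _ _) _.
by have := rho_le (phi m.+1%:R); have := rho_le (phi m%:R); lra.
Qed.

Variables (h A A1 A2 : R -> R) (y1 c K0 ka : R).
Context (reg : regular h A A1 A2 y1 c K0 ka).
Variables (phi : R -> R).
Context (hphi : forall z, h y1 <= z -> y1 <= phi z /\ h (phi z) = z).
Variable (m0 : nat).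
Context (hm0 : h y1 < m0%:R).

Lemma powR_root (w : R) (a b : nat) : 0 <= w -> (0 < b)%N -> (w ^+ b) `^ (a%:R / b%:R) = w ^+ a.
Proof.
move=> w0 b0; rewrite -powR_mulrn // -powRrM mulrCA divff ?mulr1 ?powR_mulrn // pnatr_eq0 -lt0n //.
Qed.

(** On [m <= 2^46 w^46] the lower bound [m^(-95/46)] is a multiple of [w^(-95)]; on [m >= w^44] the
    upper bound [m^(-2)] is at most [w^(-88)]. *)
Lemma diff3_phi_bounds : exists W0 : nat, forall w m : nat, (W0 <= w)%N -> (w ^ 44 <= m)%N -> (m <= 2 ^ 46 * w ^ 46)%N ->
  (w%:R ^+ 96)^-1 <= diff3 (fun m => phi m%:R) m <= K0 * (y1 / h y1) / w%:R ^+ 88.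
Proof.
have [k k0 hk] := phi3_ge _ _ _ _ _ _ _ _ reg phi hphi.
have [W1 hW1] := archi_nat (4 ^+ 95 / k); exists (maxn m0.+1 W1.+1) => w m; rewrite geq_max => /andP[wm wW] m1 m2.
have w0 : (0 < w)%N by exact: leq_trans wm.
have wr : 0 < w%:R :> R by rewrite ltr0n.
have wp : (w <= w ^ 44)%N by rewrite -{1}(expn1 w) leq_pexp2l.
have hm : h y1 < m%:R.
{ apply: lt_le_trans hm0 _; rewrite ler_nat; apply: leq_trans m1; apply: leq_trans wp; exact: ltnW wm. }
have [xi /andP[x1 x2] ->] := phi_diff3 _ _ _ _ _ _ _ _ reg phi hphi m hm.
have hx : h y1 <= xi by exact: le_trans (ltW hm) x1.
have x0 : 0 < xi by apply: lt_le_trans x1; rewrite ltr0n; apply: leq_trans m1; rewrite expn_gt0 w0.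
have wx : w%:R ^+ 44 <= xi by apply: le_trans x1; rewrite -natrX ler_nat.
have w44 : 0 < w%:R ^+ 44 :> R by rewrite exprn_gt0.
apply/andP; split; last first.
{ apply: le_trans (phi3_le _ _ _ _ _ _ _ _ reg phi hphi xi hx) _.
  have S0 := slope_gt0 _ _ _ _ _ _ _ _ reg.
  have K00 : 0 <= K0.
  { case: (reg) => -[_ _ ka0] _ _ bA; have [_ _ /andP[a b]] := bA y1 (lexx _).
    by apply: le_trans b; apply: le_trans a; rewrite mulr_ge0 ?powR_ge0 // ltW. }
  apply: ler_wpM2l; first by rewrite mulr_ge0 // ltW.
  rewrite lef_pV2 ?posrE ?exprn_gt0 //.
  have -> : w%:R ^+ 88 = (w%:R ^+ 44) ^+ 2 :> R by rewrite -exprM.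
  by rewrite lerXn2r // nnegrE ltW. }
apply: le_trans (hk xi hx).
have xw : xi <= (4 * w%:R) ^+ 46.
{ have a1 : xi <= (2 ^ 46 * w ^ 46)%:R + 3 by apply: le_trans x2 _; rewrite lerD2r ler_nat.
  have a2 : 4 <= (2 ^ 46 * w ^ 46)%:R :> R.
  { rewrite ler_nat -expnMn; apply: leq_trans (_ : (2 * w) ^ 2 <= _)%N.
    { by rewrite -[4%N]/(2 ^ 2)%N leq_exp2r // leq_pmulr. }
    by rewrite leq_pexp2l // muln_gt0. }
  have -> : (4 * w%:R) ^+ 46 = 2 ^+ 46 * (2 ^ 46 * w ^ 46)%:R :> R.
  { by rewrite natrM !natrX mulrA -!exprMn; congr (_ ^+ _); ring. }
  have a3 : 2 <= 2 ^+ 46 :> R by rewrite -{1}(expr1 2) ler_weXn2l // ler1n.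
  exact: le_of_scale a1 a2 a3. }
have e1 : ((4 * w%:R) ^+ 46) `^ (- (95 / 46)) = ((4 * w%:R) ^+ 95)^-1 :> R.
{ by rewrite powRN (powR_root _ 95 46) // mulr_ge0 // ltW. }
have e2 : ((4 * w%:R) ^+ 95)^-1 <= xi `^ (- (95 / 46)).
{ rewrite -e1 !powRN lef_pV2 ?posrE ?powR_gt0 //; last by rewrite exprn_gt0 // mulr_gt0.
  apply: ge0_ler_powR => //; rewrite ?nnegrE ?(ltW x0) //; by rewrite exprn_ge0 // mulr_ge0 // ltW. }
apply: le_trans (_ : k * ((4 * w%:R) ^+ 95)^-1 <= _); last by rewrite ler_pM2l.
(* The spare power between [w^(-95)] and [w^(-96)] absorbs all constants once [w] is large. *)
have wk : 4 ^+ 95 <= k * w%:R.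
{ have : 4 ^+ 95 / k <= w%:R by apply: le_trans hW1 _; rewrite ler_nat ltnW.
  by rewrite ler_pdivrMr // mulrC. }
have p95 : 0 < w%:R ^+ 95 :> R by rewrite exprn_gt0.
have p4 : 0 < 4 ^+ 95 :> R by rewrite exprn_gt0.
rewrite exprMn ler_pdivlMr ?mulr_gt0 //.
have -> : (w%:R ^+ 96)^-1 * (4 ^+ 95 * w%:R ^+ 95) = 4 ^+ 95 / w%:R :> R.
{ rewrite -[96%N]/(95.+1)%N exprS; move: (w%:R ^+ 95) p95 (4 ^+ 95) => p pp q.
  by field; rewrite !lt0r_neq0. }
by rewrite ler_pdivrMr.
Qed.

Lemma powR_sqr_swap (e : R) (k : nat) : (2 `^ (- (2 * e))) ^+ k = ((2 ^+ k) `^ (- e)) ^+ 2 :> R.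
Proof.
rewrite -(powR_mulrn k (powR_ge0 _ _)) -(powR_mulrn 2 (powR_ge0 _ _)).
rewrite -(powR_mulrn k (ler0n R 2)) -!powRrM; congr powR; ring.
Qed.

Definition errconst : R := 2 * (8 * 80 * 2 ^+ 46 + 16) + 1.

(** [rho_sum_bound] is used for [phi] and for its shift by one. Below [w^44] the third differences
    are too large for it, but there the trivial bound has the desired size. *)
Lemma err_sum_bound : exists W0 : nat, forall (w M : nat) (t : R), (W0 <= w)%N -> (M < 2 ^ 46 * w ^ 46)%N ->
  nm (\sum_(m0 <= m < M) cexp (t * m%:R ^+ 2) * real_complex R (dphi phi m)) <= errconst * w%:R ^+ 44.
Proof.
have [W0 hW0] := diff3_phi_bounds.
have [W1 hW1] := archi_nat (2 * (K0 * (y1 / h y1))).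
exists (maxn W0 (maxn m0.+1 W1.+1)) => w M t; rewrite !geq_max => /and3P[w1 w2 w3] hM.
have w0 : (0 < w)%N by exact: leq_trans w2.
have wr : 0 < w%:R :> R by rewrite ltr0n.
have wr1 : 1 <= w%:R :> R by rewrite ler1n.
have wp : (w <= w ^ 44)%N by rewrite -{1}(expn1 w) leq_pexp2l.
have mw : (m0 <= w ^ 44)%N by apply: leq_trans wp; exact: ltnW w2.
have w44 : 0 <= w%:R ^+ 44 :> R by rewrite exprn_ge0.
pose B : R := (8 * 80 * 2 ^+ 46 + 16) * w%:R ^+ 44.
have hL : w%:R ^+ 86 * (K0 * (y1 / h y1) / w%:R ^+ 88) <= 1 / 2.
{ have -> : w%:R ^+ 88 = w%:R ^+ 86 * w%:R ^+ 2 :> R by rewrite -exprD.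
  have p86 : 0 < w%:R ^+ 86 :> R by rewrite exprn_gt0.
  have -> : w%:R ^+ 86 * (K0 * (y1 / h y1) / (w%:R ^+ 86 * w%:R ^+ 2)) = K0 * (y1 / h y1) / w%:R ^+ 2.
  { move: (w%:R ^+ 86) p86 (K0 * (y1 / h y1)) => p pp q; by field; rewrite !lt0r_neq0. }
  rewrite ler_pdivrMr ?exprn_gt0 //.
  have a : 2 * (K0 * (y1 / h y1)) <= w%:R by apply: le_trans hW1 _; rewrite ler_nat ltnW.
  have b : w%:R <= w%:R ^+ 2 :> R by rewrite expr2 ler_peMr // ltW.
  exact: half_of_double a b. }
have b1 := rho_sum_bound t _ (fun m => phi m%:R) w M w0 (ltnW hM) (fun m hm => hW0 w m w1 (proj1 (andP hm)) (ltnW (ltn_trans (proj2 (andP hm)) hM))) hL.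
have b2 := rho_sum_bound t _ (fun m => phi m.+1%:R) w M w0 (ltnW hM) (fun m hm => hW0 w m.+1 w1 (leqW (proj1 (andP hm))) (leq_trans (proj2 (andP hm)) (ltnW hM))) hL.
have triv b : (b <= w ^ 44)%N -> nm (\sum_(m0 <= m < b) cexp (t * m%:R ^+ 2) * real_complex R (dphi phi m)) <= w%:R ^+ 44.
{ move=> hb; apply: le_trans (nm_sum _ _ _ _) _.
  apply: le_trans (_ : \sum_(m0 <= m < b) 1 <= _).
  { apply: ler_sum => m _; rewrite nmM nm_cexp mul1r nm_real; exact: dphi_le. }
  by rewrite sumr_const_nat -natrX ler_nat; apply: leq_trans hb; rewrite leq_subr. }
have B0 : 0 <= B by rewrite /B mulr_ge0 // addr_ge0 // ?mulr_ge0 ?exprn_ge0 ?ler0n.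
have fin : 2 * B + w%:R ^+ 44 = errconst * w%:R ^+ 44 by rewrite /B /errconst; move: (2 ^+ 46) (w%:R ^+ 44) => u v; ring.
rewrite -fin; case: (leqP M (w ^ 44)) => hMw.
{ by apply: le_trans (triv M hMw) _; rewrite lerDr mulr_ge0. }
rewrite (big_cat_nat _ (n := (w ^ 44)%N)) //= ?(ltnW hMw) //.
have e : \sum_(w ^ 44 <= m < M) cexp (t * m%:R ^+ 2) * real_complex R (dphi phi m) =
  \sum_(w ^ 44 <= m < M) cexp (t * m%:R ^+ 2) * real_complex R (rho (phi m.+1%:R)) -
  \sum_(w ^ 44 <= m < M) cexp (t * m%:R ^+ 2) * real_complex R (rho (phi m%:R)).
{ by rewrite -sumrB; apply: eq_bigr => m _; rewrite -mulrBr -rmorphB. }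
rewrite e; apply: le_trans (nmD _ _) _; rewrite addrC; apply: lerD; last exact: triv.
by apply: le_trans (nmB _ _) _; rewrite mulr_natl mulr2n; exact: lerD.
Qed.

Definition errpoly (N : nat) : {poly R} :=
  (N%:R)^-1 *: \sum_(m0 <= m < ifloor h N) dphi phi m *: 'X^(m ^ 2).

(** Here [w] is the integer 46th root of [floor (h N)], so [w^46] is at most a multiple of [N^c] and
    [w^44] at most one of [N^(22c/23)]. *)
Lemma pev_errpoly_bound : exists (N0 : nat) (C : R), forall N t, (N0 <= N)%N ->
  nm (pev (errpoly N) t) <= C * N%:R `^ (22 / 23 * c - 1).
Proof.
have [W0 hW0] := err_sum_bound.
pose Mx := maxn m0 (W0.+1 ^ 46)%N.
exists (maxn 1 (cphi phi Mx)), (errconst * h y1 `^ (22 / 23)) => N t; rewrite geq_max => /andP[N1 hN].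
have Nr : 0 < N%:R :> R by rewrite ltr0n.
have mMx : (m0 <= Mx)%N by rewrite leq_maxl.
have hM := ifloor_ge _ _ _ _ _ _ _ _ reg phi hphi m0 hm0 Mx N mMx hN.
have hy := cphi_ge_y1 _ _ _ _ _ _ _ _ reg phi hphi m0 hm0 Mx N mMx hN.
set M := ifloor h N in hM *.
have [w /andP[r1 r2]] := root_nat M 46 isT.
have wW : (W0 < w)%N.
{ rewrite ltnNge; apply/negP => H; have : (W0.+1 ^ 46 < w.+1 ^ 46)%N.
  { by apply: leq_ltn_trans r2; apply: leq_trans hM; rewrite leq_maxr. }
  by rewrite ltn_exp2r // ltnS ltnNge H. }
have w0 : (0 < w)%N by exact: leq_ltn_trans wW.
have wr : 0 < w%:R :> R by rewrite ltr0n.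
have M2 : (M < 2 ^ 46 * w ^ 46)%N.
{ apply: leq_trans r2 _; rewrite -expnMn leq_exp2r // mul2n -addnn -addn1 leq_add2l //. }
have b := hW0 w M t (ltnW wW) M2.
rewrite /errpoly pevZ nmM nm_real normfV normr_nat pev_sum.
have -> : \sum_(m0 <= m < M) pev (dphi phi m *: 'X^(m ^ 2)) t = \sum_(m0 <= m < M) cexp (t * m%:R ^+ 2) * real_complex R (dphi phi m).
{ by apply: eq_bigr => m _; rewrite pevZ pevXn natrX mulrC. }
have /andP[f1 _] := ifloor_bounds _ _ _ _ _ _ _ _ reg N hy; rewrite -/M in f1.
have g := growth_le _ _ _ _ _ _ _ _ reg _ hy.
have h10 : 0 < h y1 by case: (reg) => _ dh _ _; case: (dh y1 (lexx _)).
have w46 : w%:R ^+ 46 <= h y1 * N%:R `^ c.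
{ by apply: le_trans g; apply: le_trans f1; rewrite -natrX ler_nat. }
have w44 : w%:R ^+ 44 <= h y1 `^ (22 / 23) * N%:R `^ (22 / 23 * c).
{ have -> : w%:R ^+ 44 = (w%:R ^+ 46) `^ (22 / 23) :> R.
  { have -> : 22 / 23 = 44%:R / 46%:R :> R by field. by rewrite powR_root // ltW. }
  have -> : N%:R `^ (22 / 23 * c) = (N%:R `^ c) `^ (22 / 23) :> R by rewrite -powRrM (mulrC c).
  rewrite -powRM ?powR_ge0 ?(ltW h10) //.
  apply: ge0_ler_powR => //; rewrite ?nnegrE ?exprn_ge0 ?(ltW wr) //; by rewrite mulr_ge0 ?powR_ge0 // ltW. }
have E0 : 0 <= errconst by rewrite /errconst addr_ge0 // mulr_ge0 // addr_ge0 // mulr_ge0 ?exprn_ge0 // mulr_ge0.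
rewrite ler_pdivrMl //; apply: le_trans b _.
have -> : N%:R * (errconst * h y1 `^ (22 / 23) * N%:R `^ (22 / 23 * c - 1)) = errconst * (h y1 `^ (22 / 23) * N%:R `^ (22 / 23 * c)).
{ have -> : N%:R `^ (22 / 23 * c) = N%:R * N%:R `^ (22 / 23 * c - 1) :> R.
  { rewrite -{2}(powRr1 (ltW Nr)) -powRD; last by rewrite (gt_eqF Nr) implybT.
    by congr powR; ring. }
  by ring. }
by rewrite ler_wpM2l.
Qed.

Context {d : measure_display} {X : measurableType d} (mu : probability X R).
Context (T : X -> X) (hT : measure_preserving mu T) (f : X -> R) (hf : bm f).

Lemma errpoly_ae : {ae mu, forall x, forall u : nat, (0 < u)%N ->
  tends (fun s => pop T (errpoly (u * 2 ^ s)) f x) 0}.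
Proof.
have [N0 [C hC]] := pev_errpoly_bound.
case: (reg) => -[_ c23 _] _ _ _.
pose de := 1 - 22 / 23 * c; have de0 : 0 < de by rewrite /de; lra.
apply: ae_foralln => u; case: (posnP u) => [->|u0].
{ by apply: aeW => x. }
(* The shift by [N0] puts every term of the series in the range of the multiplier bound; the limit
   is insensitive to it. *)
pose g s x := pop T (errpoly (u * 2 ^ (s + N0))) f x ^+ 2.
pose q : R := 2 `^ (- (2 * de)).
have q01 : 0 <= q < 1.
{ rewrite powR_ge0 /= /q powRN invf_lt1 ?powR_gt0 //.
  have d2 : 0 < 2 * de by rewrite mulr_gt0.
  have := @gt0_ltr_powR R _ d2 1 2 (ltac:(by rewrite nnegrE)) (ltac:(by rewrite nnegrE)); rewrite powR1; apply.
  by rewrite ltr1n. }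
have bnd : {ae mu, forall x, exists M : R, forall n, \sum_(0 <= k < n) g k x <= M}.
{ apply: (ae_sum_bounded mu g (C ^+ 2 * Ex mu (fun x => f x ^+ 2) * (1 - q)^-1)).
  { by move=> k; apply: bmX; exact: (bm_pop mu). }
  { by move=> k x; exact: sqr_ge0. }
  move=> n; apply: le_trans (_ : \sum_(0 <= k < n) C ^+ 2 * Ex mu (fun x => f x ^+ 2) * q ^+ k <= _); last first.
  { rewrite -mulr_sumr ler_wpM2l //; last exact: sum_geom_le.
    by rewrite mulr_ge0 ?sqr_ge0 // Ex_ge0 // => x; exact: sqr_ge0. }
  apply: ler_sum => k _; rewrite mulrAC; apply: (transference1 mu T hT f hf) => t _.
  have NN : (N0 <= u * 2 ^ (k + N0))%N.
  { apply: leq_trans (leq_pmull _ u0); apply: leq_trans (ltnW (ltn_expl N0 (ltnSn 1))) _; by rewrite leq_exp2l // leq_addl. }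
  have b := hC _ t NN; have n0 := nm_ge0 (pev (errpoly (u * 2 ^ (k + N0))) t).
  have NN2 : 2 ^+ k <= (u * 2 ^ (k + N0))%:R :> R.
  { rewrite -natrX ler_nat; apply: leq_trans (leq_pmull _ u0); by rewrite leq_exp2l // leq_addr. }
  have e : 22 / 23 * c - 1 = - de by rewrite /de; ring.
  rewrite e in b.
  set N := (u * 2 ^ (k + N0))%N in b NN NN2 n0 *.
  have p : N%:R `^ (- de) ^+ 2 <= q ^+ k.
  { have -> : q ^+ k = (2 ^+ k) `^ (- de) ^+ 2.
    { exact: powR_sqr_swap. }
    apply: lerXn2r; rewrite ?nnegrE ?powR_ge0 // !powRN lef_pV2 ?posrE ?powR_gt0 ?exprn_gt0 //; last first.
    { by apply: lt_le_trans NN2; rewrite exprn_gt0. }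
    apply: ge0_ler_powR => //; rewrite ?nnegrE ?exprn_ge0 //; exact: ltW. }
  apply: le_trans (_ : (C * N%:R `^ (- de)) ^+ 2 <= _).
  { by apply: lerXn2r; rewrite ?nnegrE //; exact: le_trans b. }
  by rewrite exprMn ler_wpM2l // sqr_ge0. }
apply: filterS bnd => x [M hM] _.
have := sum_bounded_tends0 (fun k => g k x) M (fun k => sqr_ge0 _) hM => hg e e0.
have e20 : 0 < e ^+ 2 by rewrite exprn_gt0.
have [n0 hn0] := hg _ e20; exists (n0 + N0)%N => s hs; rewrite subr0.
have hsn : (n0 <= s - N0)%N by rewrite leq_subRL 1?addnC //; apply: leq_trans hs; rewrite leq_addl.
have := hn0 _ hsn.
rewrite subr0 /g subnK; last by apply: leq_trans hs; rewrite leq_addl.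
rewrite ger0_norm ?sqr_ge0 // => H.
by rewrite -(@ler_pXn2r _ 2) ?nnegrE ?(ltW e0) // real_normK ?num_real.
Qed.

(** The weights [omphi] sum to [phi M - phi m0], which differs from [N] by a bounded amount when
    [M = floor (h N)], so the weighted average has the limit [L]. The sawtooth part is supposed to
    vanish only along [u * 2^s], which suffices by [tends_sandwich]. *)
Lemma weighted_tends (F : nat -> R) (Kf L : R) : (forall m, `|F m| <= Kf) ->
  tends (fun N => (N%:R)^-1 * \sum_(1 <= n < N.+1) F n) L ->
  (forall u : nat, (0 < u)%N -> tends (fun s => ((u * 2 ^ s)%:R)^-1 * \sum_(m0 <= m < ifloor h (u * 2 ^ s)) F m * dphi phi m) 0) ->
  tends (fun N => (N%:R)^-1 * \sum_(1 <= n < N.+1) F (ifloor h n)) L.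
Proof.
move=> hF hL herr; apply: (tends_sandwich (fun n => F (ifloor h n)) Kf L 1 2) => // u u0.
have [C [C0 hsplit]] := counting_split _ _ _ _ _ _ _ _ reg phi hphi m0 hm0.
have Kf0 : 0 <= Kf by apply: le_trans (hF 0%N).
have om m : (m0 <= m)%N -> 0 <= omphi phi m /\ omphi phi m.+1 <= omphi phi m.
{ by move=> hm; have [] := omphi_props _ _ _ _ _ _ _ _ reg phi hphi m0 hm0 m hm. }
have ht := toeplitz F (omphi phi) Kf L m0 hF om hL.
move=> e e0; have e4 : 0 < e / 4 by rewrite divr_gt0.
have [D [D0 hD]] := ht _ e4; have [s1 hs1] := herr u u0 _ e4.
pose K := Kf * C + D + `|L| * (C + `|phi m0%:R|).
have K00 : 0 <= K by rewrite !addr_ge0 // mulr_ge0 // addr_ge0.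
have [N1 hN1] := archi_nat (K / (e / 4)).
exists (maxn s1 (maxn (cphi phi m0) N1.+1)) => s; rewrite !geq_max => /and3P[a1 a2 a3]; rewrite mul1n.
have sN : (s < u * 2 ^ s)%N by apply: leq_trans (ltn_expl s (ltnSn 1)) _; rewrite leq_pmull.
have er := hs1 s a1; rewrite subr0 in er.
set N := (u * 2 ^ s)%N in sN er *.
have Nr : 0 < N%:R :> R by rewrite ltr0n; exact: leq_ltn_trans sN.
have [b1 b2 b3] := hsplit F Kf N hF (leq_trans a2 (ltnW sN)).
have t1 := hD _ b1; rewrite (sum_omphi _ _ _ b1) in t1.
set M := ifloor h N in b1 b2 b3 t1 er *.
set S0 := \sum_(1 <= n < N.+1) _ in b2 *; set S1 := \sum_(m0 <= m < M) _ in b2 t1; set S2 := \sum_(m0 <= m < M) _ in b2 er.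
have p1 : phi m0%:R <= phi M%:R.
{ apply: (phi_le _ _ _ _ _ _ _ _ reg phi hphi); first exact: ltW hm0.
  by rewrite ler_nat. }
have pm0 : 0 < phi m0%:R by have [_ _ p0 _ _] := phi_facts _ _ _ _ _ _ _ _ reg phi hphi _ (ltW hm0).
have [b4 b5] := andP b3.
have -> : (N%:R)^-1 * S0 - L = (N%:R)^-1 * ((S0 - S1 - S2) + (S1 - L * (phi M%:R - phi m0%:R)) - L * (N%:R - phi M%:R + phi m0%:R)) + (N%:R)^-1 * S2.
{ field; exact: lt0r_neq0. }
apply: le_trans (ler_normD _ _) _.
have q1 : `|(N%:R)^-1 * ((S0 - S1 - S2) + (S1 - L * (phi M%:R - phi m0%:R)) - L * (N%:R - phi M%:R + phi m0%:R))| <= e / 4 + e / 4.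
{ rewrite normrM normfV normr_nat ler_pdivrMl //.
  apply: le_trans (ler_normB _ _) _; apply: le_trans (lerD (ler_normD _ _) (lexx _)) _.
  have u1 : `|L * (N%:R - phi M%:R + phi m0%:R)| <= `|L| * (C + `|phi m0%:R|).
  { rewrite normrM ler_wpM2l // (gtr0_norm pm0) ger0_norm; last by move: b4 pm0; lra.
    by rewrite lerD2r. }
  have u2 : e / 4 * (phi M%:R - phi m0%:R) <= e / 4 * N%:R by rewrite ler_pM2l //; move: b4 pm0; lra.
  have u3 : K <= N%:R * (e / 4).
  { rewrite -ler_pdivrMr //; apply: le_trans hN1 _; rewrite ler_nat; apply: leq_trans (ltnW sN); exact: ltnW a3. }
  move: b2 t1 u1 u2 u3; rewrite /K; lra. }
by move: q1 er; lra.
Qed.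

End ErrorTerm.

(** The averages sample whole orbits, so [f] and its bounded version must agree at every iterate;
    preimages of a null set are null. *)
Lemma ae_orbit (R : realType) (d : measure_display) (X : measurableType d) (mu : probability X R)
  (T : X -> X) (P : X -> Prop) : measure_preserving mu T -> {ae mu, forall x, P x} ->
  {ae mu, forall x, forall n, P (iter n T x)}.
Proof.
move=> hT [A [mA muA hA]]; apply: ae_foralln => n.
have [mn pn] := mp_iter mu T n hT.
exists (iter n T @^-1` A); split.
- by rewrite -[X in measurable X]setTI; exact: mn.
- exact: etrans (pn _ mA) muA.
- by move=> x hx; exact: hA.
Qed.

Lemma pop_errpoly (R : realType) (d : measure_display) (X : measurableType d) (T : X -> X)
  (h phi : R -> R) (m0 N : nat) (f : X -> R) (x : X) :
  pop T (errpoly h phi m0 N) f x =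
  (N%:R)^-1 * \sum_(m0 <= m < ifloor h N) f (iter (m ^ 2) T x) * dphi phi m.
Proof.
rewrite /errpoly popZ pop_sum; congr (_ * _).
by apply: eq_bigr => m _; rewrite popZ popXn mulrC.
Qed.

(** Truncation at [|M|] instead of [M] keeps the interval nonempty whatever the sign of [M]. *)
Lemma Linfty_bounded_version (R : realType) (d : measure_display) (X : measurableType d)
  (mu : probability X R) (f : X -> R) : Linfty mu f -> exists2 g, bm g & {ae mu, forall x, f x = g x}.
Proof.
move=> [mf [M hM]].
have m1 : measurable_fun setT (fun x => Num.min (f x) `|M|) by apply: measurable_minr => //; exact: measurable_cst.
exists (fun x => Num.max (- `|M|) (Num.min (f x) `|M|)).
  split; first by apply: measurable_maxr => //; exact: measurable_cst.
  exists `|M| => x; have M0 := normr_ge0 M.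
  rewrite ler_norml le_max lexx ge_max ge_min lexx orbT andbT /=; lra.
apply: filterS hM => x hx; have : `|f x| <= `|M| by apply: le_trans hx _; exact: ler_norm.
by rewrite ler_norml => /andP[h1 h2]; rewrite (min_idPl h2) (max_idPr h1).
Qed.

Theorem theorem1p7 (R : realType) (c : R) (h : R -> R)
  (hc : 1 <= c < 23 / 22) (hRc : in_Rc c h)
  (d : measure_display) (X : measurableType d) (mu : probability X R)
  (T : X -> X) (hT : measure_preserving mu T)
  (f : X -> R) (hf : Linfty mu f) :
  {ae mu, forall x : X, exists l : R,
     ergavg f T (floor_sq h) x @ \oo --> l /\
     ergavg f T (fun n => (n ^ 2)%N) x @ \oo --> l}.
Proof.
have [A [A1 [A2 [y1 [c' [K0 [ka reg]]]]]]] := in_Rc_regular c h hc hRc.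
have [phi hphi] := inverse_exists _ _ _ _ _ _ _ _ reg.
have [m0 hm0'] := archi_nat (h y1).
(* Strict inequality, because [phi] is differentiated only to the right of [h y1]. *)
have hm0 : h y1 < m0.+1%:R by apply: le_lt_trans hm0' _; rewrite ltr_nat.
have [g hg efg] := Linfty_bounded_version _ _ _ mu f hf.
have orb := ae_orbit _ _ _ mu T _ hT efg.
have sq := bourgain_squares mu T hT g hg.
have er := errpoly_ae _ _ _ _ _ _ _ _ reg phi hphi m0.+1 hm0 mu T hT g hg.
have [_ [Kg hKg]] := hg.
apply: filterS3 orb sq er => x ox [l sx] ex; exists l.
have e a : ergavg f T a x = (fun N => (N%:R)^-1 * \sum_(1 <= n < N.+1) g (iter (a n) T x)).
  by apply/funext => N; rewrite /ergavg; congr (_ * _); apply: eq_bigr => n _.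
rewrite !e; split; last exact/tendsP.
apply/tendsP.
apply: (weighted_tends _ _ _ _ _ _ _ _ reg phi hphi m0.+1 hm0 (fun m => g (iter (m ^ 2) T x)) Kg l) => //.
move=> u u0; apply: eq_tends (ex u u0) => s.
exact: pop_errpoly.
Qed.
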